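(* For a complex number $\nu$ with $\operatorname{Re}(\nu)>-1$ and $0<\theta<\pi/2$ let $$\psi_\nu(\theta)=P_\nu(\cos\theta)-\frac{2}{\pi}\,i\,Q_\nu(\cos\theta),\qquad \sigma_\nu(\theta)=\int_0^\infty\frac{dx}{\sqrt{x^2-2ix}\,\left(1+\sin(\theta)\exp(i\theta)x\right)^{\nu+1}},$$ where $P_\nu$ and $Q_\nu$ are the Legendre functions of the first and second kinds of degree $\nu$. Then $$\psi_\nu(\theta)=-\frac{2}{\pi}\,i\,\exp(i(\nu+1)\theta)\,\sigma_\nu(\theta),$$ which expresses $\psi_\nu$ as the product of an oscillating exponential function and an integral involving only nonoscillatory elementary functions, and the following hold. (1) For every $\theta\in(0,\pi/2)$ with $\psi_\nu(\theta)\neq0$, $$\frac{\psi_\nu'(\theta)}{\psi_\nu(\theta)}=i(\nu+1)+\frac{\sigma_\nu'(\theta)}{\sigma_\nu(\theta)}=i(\nu+1)-(\nu+1)\exp(2i\theta)\left(\int_0^\infty\frac{x\,dx}{\sqrt{x^2-2ix}\,\left(1+\sin(\theta)\exp(i\theta)x\right)^{\nu+2}}\right)\left(\int_0^\infty\frac{dx}{\sqrt{x^2-2ix}\,\left(1+\sin(\theta)\exp(i\theta)x\right)^{\nu+1}}\right)^{-1}.$$ (2) If $\nu$ is real (and $\nu>-1$), then Legendre's differential equation $$\psi''(\theta)+\cot(\theta)\,\psi'(\theta)+\nu(\nu+1)\,\psi(\theta)=0\qquad(0<\theta<\pi/2)$$ admits a nonoscillatory phase function: $\psi_\nu$ does not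 vanish on $(0,\pi/2)$, the function $\operatorname{Im}\left(\psi_\nu'(\theta)/\psi_\nu(\theta)\right)$, that is, the imaginary part of the right-hand side of the formula in (1), is the derivative $\alpha_\nu'$ of a phase function $\alpha_\nu$ for this equation on $(0,\pi/2)$, and both $\alpha_\nu$ and $\alpha_\nu'$ are nonoscillatory functions.
   Context: Principal branches of the square root and of complex powers are used throughout. The word ''nonoscillatory'' is used informally, without a quantitative definition. The assertion that $\alpha_\nu$ and $\alpha_\nu'$ are nonoscillatory is drawn directly from the formula in (1): the oscillatory exponential factor $\exp(i(\nu+1)\theta)$ of $\psi_\nu$ cancels in the logarithmic derivative, contributing only the constant $i(\nu+1)$, and what remains involves only integrals of nonoscillatory elementary functions. Gauss' hypergeometric function is ${}_2F_1(a,b;c;z)=\sum_{n=0}^\infty\frac{(a)_n(b)_n}{(c)_n}\frac{z^n}{n!}$ for $|z|<1$, where $c\neq 0,-1,-2,\ldots$ and $(z)_n=z(z+1)\cdots(z+n-1)$. The Legendre function of the first kind of degree $\nu$ is $P_\nu(z)={}_2F_1\left(-\nu,\nu+1;1;\frac{1-z}{2}\right)$ near $z=1$, analytically continued to $\mathbb{C}\setminus(-\infty,-1]$. The Legendre function of the second kind of degree $\nu$ is $$Q_\nu(z)=(2z)^{-\nu-1}\sqrt{\pi}\,\frac{\Gamma(\nu+1)}{\Gamma(\nu+3/2)}\;{}_2F_1\left(\frac{\nu}{2}+1,\frac{\nu}{2}+\frac12;\nu+\frac32;\frac{1}{z^2}\right)$$ for $|z|>1$, analytically continued to $\mathbb{C}\setminus(-\infty,1]$.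 For $x\in(-1,1)$, $Q_\nu(x)$ is defined by $$Q_\nu(x)=\lim_{y\to0^+}\frac{Q_\nu(x+iy)+Q_\nu(x-iy)}{2}.$$ Phase functions. Let $q$ be smooth and positive on $(a,b)$. A smooth function $\alpha:(a,b)\to\mathbb{R}$ is a phase function for $y''(x)+q(x)y(x)=0$ on $(a,b)$ if $\alpha'$ does not vanish on $(a,b)$ and the functions $\cos(\alpha(x))/\sqrt{|\alpha'(x)|}$ and $\sin(\alpha(x))/\sqrt{|\alpha'(x)|}$ form a basis of the space of solutions of this equation. For an equation $\eta''(x)+p_0(x)\eta'(x)+q_0(x)\eta(x)=0$ on $(a,b)$ with $p_0,q_0$ real-valued and smooth, such that $q(x)=q_0(x)-\frac14(p_0(x))^2-\frac12p_0'(x)$ is positive on $(a,b)$, a function $\alpha$ is called a phase function for this equation if it is a phase function for $y''(x)+q(x)y(x)=0$. *)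

(* Defs.v *)
From Stdlib Require Import Reals Factorial.
From Coquelicot Require Import Coquelicot.

Open Scope R_scope.

(** * Elementary functions of a complex variable, principal branches *)

Definition Cexp (z : C) : C :=
  (exp (Re z) * cos (Im z), exp (Re z) * sin (Im z)).

(** Principal argument, in [(-PI, PI]]; meaningful for [z <> 0]. *)
Definition Carg (z : C) : R :=
  if Rle_dec 0 (Im z) then acos (Re z / Cmod z) else - acos (Re z / Cmod z).

Definition Clog (z : C) : C := (ln (Cmod z), Carg z).

(** [z] to the complex power [w]; meaningful for [z <> 0].  (Coquelicot's [Cpow]
    is the power with exponent in [nat].) *)
Definition Cpower (z w : C) : C := Cexp (w * Clog z)%C.

Definition Csqrt (z : C) : C :=
  (RtoC (sqrt (Cmod z)) * Cexp (Ci * RtoC (Carg z / 2)))%C.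

(** * Calculus of functions from [R] to [C]

    [C] is used as a normed module over [R]. *)

Definition ex_CDerive (f : R -> C) (x : R) : Prop :=
  ex_derive (K := R_AbsRing) (V := C_R_NormedModule) f x.

Definition CDerive (f : R -> C) (x : R) : C :=
  (Derive (fun t => Re (f t)) x, Derive (fun t => Im (f t)) x).

(** Improper integral over [(0, +oo)], improper at both ends. *)
Definition ex_CRInt_0_infty (f : R -> C) : Prop :=
  ex_RInt_gen (V := C_R_NormedModule) f (at_right 0) (Rbar_locally p_infty).

Definition CRInt_0_infty (f : R -> C) : C :=
  RInt_gen (V := C_R_CompleteNormedModule) f (at_right 0) (Rbar_locally p_infty).

(** * Special functions *)

(** Euler's integral, convergent for [0 < Re z]. *)
Definition CGamma (z : C) : C :=
  CRInt_0_infty (fun t => Cpower (RtoC t) (z - 1) * RtoC (exp (- t)))%C.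

Fixpoint Cpochhammer (z : C) (n : nat) : C :=
  match n with
  | O => RtoC 1
  | S m => (Cpochhammer z m * (z + RtoC (INR m)))%C
  end.

(** The sum of the Gauss series, meaningful for [Cmod z < 1] and
    [c] not a nonpositive integer. *)
Definition hyp2F1 (a b c z : C) : C :=
  iota (T := C_CompleteNormedModule)
    (is_pseries (K := C_AbsRing) (V := C_NormedModule)
      (fun n => Cpochhammer a n * Cpochhammer b n
                / (Cpochhammer c n * RtoC (INR (fact n))))%C z).

Definition analytic_on (D : C -> Prop) (f : C -> C) : Prop :=
  forall z0 : C, D z0 ->
  exists (a : nat -> C) (r : R), 0 < r /\
    forall z : C, Cmod (z - z0) < r ->
      is_pseries (K := C_AbsRing) (V := C_NormedModule) a (z - z0)%C (f z).

(** The complex plane cut along [(-oo, c]]. *)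
Definition cut_plane (c : R) (z : C) : Prop := ~ (Im z = 0 /\ Re z <= c).

(** [P] is the Legendre function of the first kind of degree [nu].  Its values
    on the cut are left free. *)
Definition is_legendreP (nu : C) (P : C -> C) : Prop :=
  analytic_on (cut_plane (-1)) P /\
  forall z : C, Cmod (1 - z) < 2 ->
    P z = (hyp2F1 (- nu) (nu + 1) 1 ((1 - z) / 2))%C.

(** [Q] is the Legendre function of the second kind of degree [nu] off the cut
    [(-oo, 1]].  The factor [(2 z)^(-nu-1)] has a jump along the negative axis,
    so the formula is imposed for [|z| > 1] off the cut only. *)
Definition is_legendreQ (nu : C) (Q : C -> C) : Prop :=
  analytic_on (cut_plane 1) Q /\
  forall z : C, 1 < Cmod z -> cut_plane 1 z ->
    Q z = (Cpower (2 * z) (- nu - 1) * RtoC (sqrt PI)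
           * (CGamma (nu + 1) / CGamma (nu + 3 / 2))
           * hyp2F1 (nu / 2 + 1) (nu / 2 + 1 / 2) (nu + 3 / 2) (1 / (z * z)))%C.

(** The values on [(-1, 1)] of the Legendre function of the second kind given
    by [Q] off the cut. *)
Definition legendreQ_cut (Q : C -> C) (x : R) : C :=
  lim (T := C_CompleteNormedModule)
    (filtermap (fun y : R => ((Q (x, y) + Q (x, (- y)%R)) / 2)%C) (at_right 0)).

Definition psi_nu (P Q : C -> C) (theta : R) : C :=
  (P (RtoC (cos theta))
   - RtoC (2 / PI) * Ci * legendreQ_cut Q (cos theta))%C.

(** The base [1 + sin(theta) exp(i theta) x] of the powers in the integrals. *)
Definition kernel_base (theta x : R) : C :=
  (1 + RtoC (sin theta) * Cexp (Ci * RtoC theta) * RtoC x)%C.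

Definition sigma_integrand (nu : C) (theta x : R) : C :=
  (1 / (Csqrt (RtoC x * RtoC x - 2 * Ci * RtoC x)
        * Cpower (kernel_base theta x) (nu + 1)))%C.

Definition sigma_nu (nu : C) (theta : R) : C :=
  CRInt_0_infty (sigma_integrand nu theta).

Definition tau_integrand (nu : C) (theta x : R) : C :=
  (RtoC x / (Csqrt (RtoC x * RtoC x - 2 * Ci * RtoC x)
             * Cpower (kernel_base theta x) (nu + 2)))%C.

Definition tau_nu (nu : C) (theta : R) : C :=
  CRInt_0_infty (tau_integrand nu theta).

(** * Phase functions *)

Definition smooth_on (a b : R) (f : R -> R) : Prop :=
  forall (n : nat) (x : R), a < x < b -> ex_derive_n f n x.

Definition is_solution (q : R -> R) (a b : R) (y : R -> R) : Prop :=
  forall x : R, a < x < b ->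
    ex_derive y x /\ ex_derive (Derive y) x /\
    Derive (Derive y) x + q x * y x = 0.

(** [u], [v] is a basis of the space of real solutions on [(a, b)]; functions
    are compared on [(a, b)] only. *)
Definition is_solution_basis (q : R -> R) (a b : R) (u v : R -> R) : Prop :=
  is_solution q a b u /\ is_solution q a b v /\
  (forall c d : R,
      (forall x : R, a < x < b -> c * u x + d * v x = 0) -> c = 0 /\ d = 0) /\
  (forall y : R -> R, is_solution q a b y ->
      exists c d : R, forall x : R, a < x < b -> y x = c * u x + d * v x).

(** Phase function for [y'' + q y = 0] on [(a, b)]. *)
Definition is_phase_function (q : R -> R) (a b : R) (alpha : R -> R) : Prop :=
  smooth_on a b q /\ (forall x : R, a < x < b -> 0 < q x) /\
  smooth_on a b alpha /\
  (forall x : R, a < x < b -> Derive alpha x <> 0) /\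
  is_solution_basis q a b
    (fun x => cos (alpha x) / sqrt (Rabs (Derive alpha x)))
    (fun x => sin (alpha x) / sqrt (Rabs (Derive alpha x))).

(** Phase function for [eta'' + p0 eta' + q0 eta = 0] on [(a, b)]. *)
Definition is_phase_function_ode
    (p0 q0 : R -> R) (a b : R) (alpha : R -> R) : Prop :=
  smooth_on a b p0 /\ smooth_on a b q0 /\
  is_phase_function
    (fun x => q0 x - 1 / 4 * (p0 x) ^ 2 - 1 / 2 * Derive p0 x) a b alpha.

(* Main.v *)
Require Import Defs.
From Stdlib Require Import Reals ZArith Factorial Lra Lia.
From Coquelicot Require Import Coquelicot.
Open Scope R_scope.

(** Write [a = nu + 1], let [j] be [i] or [-i], and let [E_j(theta)] be
    [exp (j a theta)] times the integral over [(0, oo)] of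
    [(x^2 - 2 j x)^(-1/2) (1 + sin theta exp (j theta) x)^(-a)]. The main point is that
    [psi_nu] is [- (2 / pi) i E_i].

    An integration by parts ([fam_parts]) gives a differential equation of second order
    for the integral as a function of [c = sin theta exp (j theta)] ([Mint_ode]), and
    multiplication by the exponential turns it into Legendre's equation ([Efun_leg]).
    The function [E_j] extends to complex [h = j theta] in a half-strip, where
    [Q_nu (cosh h) = E_j] ([secondkind_eq]). Indeed, [Q_nu] solves the same equation, near
    infinity by its series ([gauss_ode]) and elsewhere by the identity theorem
    ([identity_curve]); as [Re h -> -oo] both functions are [exp (a h)] times quantities
    with a common limit, so that their Wronskian vanishes and their quotient is one. That
    the limits agree is the evaluation of a Beta integral by Gamma functions
    ([beta_gamma]), after the path of integration has been rotated ([rotation]).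

    On the cut, [Q_nu] is therefore the mean of [E_i] and [E_(-i)] ([legendreQ_cut_eq]),
    while [P_nu = - (i / pi) (E_i - E_(-i))] ([Pser_Ecut]): as the angle tends to zero the
    logarithmic singularities cancel and the right side tends to one ([Ecut_diff_tends]),
    so the difference [y] of the two sides satisfies [y -> 0] and [sin y' -> 0], which
    among the solutions only zero does. The combination of the two formulas is [psi_Ecut],
    and differentiation under the integral sign ([famint_cdiff]) yields the logarithmic
    derivative.

    For real [nu] the functions [E_i] and [E_(-i)] are conjugate, so [P_nu] is the real part
    of [psi_nu]. By Abel's identity [sin * Im (conj psi_nu * psi_nu')] is constant, and its
    limit at zero is [2 / pi] ([psi_wronskian]). Hence [psi_nu] has no zero, and
    [Im (psi_nu' / psi_nu) = (2 / pi) / (sin * |psi_nu|^2)] is positive. A primitive of it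
    differs from the argument of [psi_nu] by a constant, so Liouville's substitution
    [y = sqrt (sin) psi] shows that it is a phase function ([phase_function]). *)

(** * Derivatives of curves and complex derivatives *)

(** The derivative of a curve, by components and together with its value, so that the
    rules for real functions apply; [cderiv_ex] returns to the normed module [C]. *)
Definition cderiv (f : R -> C) (t : R) (l : C) : Prop :=
  is_derive (fun s => Re (f s)) t (Re l) /\ is_derive (fun s => Im (f s)) t (Im l).

Definition cdiff (f : C -> C) (z l : C) : Prop :=
  forall eps, 0 < eps -> exists d, 0 < d /\ forall w, Cmod (w - z) < d ->
    Cmod (f w - f z - l * (w - z)) <= eps * Cmod (w - z).

Lemma C_eq (z w : C) : Re z = Re w -> Im z = Im w -> z = w.
Proof. destruct z, w; unfold Re, Im; simpl; intros; subst; reflexivity. Qed.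

Lemma Im_le_Cmod (z : C) : Rabs (Im z) <= Cmod z.
Proof. eapply Rle_trans; [apply Rmax_r | apply Rmax_Cmod]. Qed.

Lemma Cmod_le_ReIm (z : C) : Cmod z <= Rabs (Re z) + Rabs (Im z).
Proof.
  replace z with (RtoC (Re z) + Ci * RtoC (Im z))%C at 1
    by (apply C_eq; unfold Re, Im, Ci; simpl; ring).
  eapply Rle_trans; [apply Cmod_triangle|].
  rewrite Cmod_mult, Cmod_Ci, !Cmod_R; lra.
Qed.

Lemma is_derive_eps (f : R -> R) (t l : R) :
  is_derive f t l <->
  forall eps, 0 < eps -> exists d, 0 < d /\ forall s, Rabs (s - t) < d ->
    Rabs (f s - f t - l * (s - t)) <= eps * Rabs (s - t).
Proof.
  split.
  - intros [_ H] eps He.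
    destruct (H t (fun P HP => HP) (mkposreal eps He)) as [d Hd].
    exists d; split; [apply cond_pos|]; intros s Hs.
    specialize (Hd s Hs); unfold norm, minus, plus, opp, scal in Hd; simpl in Hd.
    unfold abs, mult in Hd; simpl in Hd.
    unfold mult in Hd; simpl in Hd.
    replace (f s - f t - l * (s - t)) with (f s + - f t + - ((s + - t) * l)) by ring.
    exact Hd.
  - intros H; split; [apply is_linear_scal_l|].
    intros x Hx eps.
    apply (is_filter_lim_locally_unique (V:=R_NormedModule)) in Hx; subst x.
    destruct (H eps (cond_pos eps)) as [d [Hd1 Hd]].
    exists (mkposreal d Hd1); intros s Hs.
    specialize (Hd s Hs).
    unfold norm, minus, plus, opp, scal; simpl; unfold abs, mult; simpl.
    unfold mult; simpl.
    replace (f s + - f t + - ((s + - t) * l)) with (f s - f t - l * (s - t)) by ring.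
    exact Hd.
Qed.

Lemma cderiv_eps (f : R -> C) (t : R) (l : C) :
  cderiv f t l <->
  forall eps, 0 < eps -> exists d, 0 < d /\ forall s, Rabs (s - t) < d ->
    Cmod (f s - f t - l * RtoC (s - t)) <= eps * Rabs (s - t).
Proof.
  unfold cderiv; rewrite !is_derive_eps; split.
  - intros [H1 H2] eps He.
    destruct (H1 (eps/2)) as [d1 [D1 H1']]; [lra|].
    destruct (H2 (eps/2)) as [d2 [D2 H2']]; [lra|].
    exists (Rmin d1 d2); split; [apply Rmin_glb_lt; assumption|].
    intros s Hs.
    specialize (H1' s (Rlt_le_trans _ _ _ Hs (Rmin_l _ _))).
    specialize (H2' s (Rlt_le_trans _ _ _ Hs (Rmin_r _ _))).
    eapply Rle_trans; [apply Cmod_le_ReIm|].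
    replace (Re (f s - f t - l * RtoC (s - t))) with (Re (f s) - Re (f t) - Re l * (s - t))
      by (unfold Re; simpl; ring).
    replace (Im (f s - f t - l * RtoC (s - t))) with (Im (f s) - Im (f t) - Im l * (s - t))
      by (unfold Im; simpl; ring).
    lra.
  - intros H; split; intros eps He; destruct (H eps He) as [d [D Hd]];
      exists d; (split; [exact D|]); intros s Hs; eapply Rle_trans; try apply (Hd s Hs).
    + eapply Rle_trans; [|apply re_le_Cmod]. right; f_equal; unfold Re; simpl; ring.
    + eapply Rle_trans; [|apply Im_le_Cmod]. right; f_equal; unfold Im; simpl; ring.
Qed.

Lemma cderiv_unique f t l1 l2 : cderiv f t l1 -> cderiv f t l2 -> l1 = l2.
Proof.
  intros [A B] [A' B']; apply C_eq.
  - rewrite <- (is_derive_unique _ _ _ A); exact (is_derive_unique _ _ _ A').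
  - rewrite <- (is_derive_unique _ _ _ B); exact (is_derive_unique _ _ _ B').
Qed.

Lemma CDerive_eq f t l : cderiv f t l -> CDerive f t = l.
Proof.
  intros [A B]; unfold CDerive; apply is_derive_unique in A; apply is_derive_unique in B.
  apply C_eq; assumption.
Qed.

Lemma cderiv_ex f t l : cderiv f t l -> ex_CDerive f t.
Proof.
  intros H; exists l.
  rewrite cderiv_eps in H.
  split; [apply is_linear_scal_l|].
  intros x Hx eps; apply (is_filter_lim_locally_unique (V:=R_NormedModule)) in Hx; subst x.
  destruct (H eps (cond_pos eps)) as [d [Hd1 Hd]].
  exists (mkposreal d Hd1); intros s Hs; specialize (Hd s Hs).
  rewrite <- Cmod_norm.
  match goal with |- Cmod ?u <= _ =>
    replace u with (f s - f t - l * RtoC (s - t))%C end.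
  - exact Hd.
  - destruct (f s), (f t), l; apply C_eq; cbv -[Rplus Rmult Ropp]; ring.
Qed.

Lemma cderiv_ext_loc f g t l :
  locally t (fun s => f s = g s) -> cderiv f t l -> cderiv g t l.
Proof.
  intros H [A B]; split; (eapply is_derive_ext_loc; [|eassumption]);
    (eapply filter_imp; [|exact H]); intros s Hs; simpl; rewrite Hs; reflexivity.
Qed.

Lemma cderiv_eq f t l l' : cderiv f t l -> l = l' -> cderiv f t l'.
Proof. intros H <-; exact H. Qed.

Lemma is_derive_extR (f g : R -> R) (t l : R) :
  (forall s : R, f s = g s) -> is_derive f t l -> is_derive g t l.
Proof. intros H; apply is_derive_ext; exact H. Qed.

Lemma is_derive_cst (c t : R) : is_derive (fun _ : R => c) t 0.
Proof. apply (is_derive_const (K := R_AbsRing) (V := R_NormedModule)). Qed.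

Lemma cderiv_const c t : cderiv (fun _ => c) t (RtoC 0).
Proof. split; [apply (is_derive_cst (Re c))|apply (is_derive_cst (Im c))]. Qed.

Lemma cderiv_RtoC f t l : is_derive f t l -> cderiv (fun s => RtoC (f s)) t (RtoC l).
Proof. intros H; split; [exact H|apply (is_derive_cst 0)]. Qed.

Lemma cderiv_id t : cderiv RtoC t (RtoC 1).
Proof. apply (cderiv_RtoC (fun s => s)), (is_derive_id (K := R_AbsRing)). Qed.

Lemma cderiv_plus f g t l m :
  cderiv f t l -> cderiv g t m -> cderiv (fun s => f s + g s)%C t (l + m)%C.
Proof. intros [A B] [A' B']; split; apply @is_derive_plus; assumption. Qed.

Lemma cderiv_opp f t l : cderiv f t l -> cderiv (fun s => - f s)%C t (- l)%C.
Proof. intros [A B]; split; apply @is_derive_opp; assumption. Qed.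

Lemma cderiv_minus f g t l m :
  cderiv f t l -> cderiv g t m -> cderiv (fun s => f s - g s)%C t (l - m)%C.
Proof. intros; apply cderiv_plus; [|apply cderiv_opp]; assumption. Qed.

Lemma is_derive_mult' (f g : R -> R) x l m :
  is_derive f x l -> is_derive g x m -> is_derive (fun s => f s * g s) x (l * g x + f x * m).
Proof. intros; apply (is_derive_mult f g); try assumption. intros; apply Rmult_comm. Qed.

Lemma cderiv_mult f g t l m :
  cderiv f t l -> cderiv g t m ->
  cderiv (fun s => f s * g s)%C t (l * g t + f t * m)%C.
Proof.
  intros [A B] [A' B']; split.
  - apply (is_derive_ext (fun s => Re (f s) * Re (g s) - Im (f s) * Im (g s)));
      [reflexivity|].
    replace (Re (l * g t + f t * m)) with
      ((Re l * Re (g t) + Re (f t) * Re m) - (Im l * Im (g t) + Im (f t) * Im m))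
      by (unfold Re, Im; simpl; ring).
    apply @is_derive_minus; apply is_derive_mult'; assumption.
  - apply (is_derive_ext (fun s => Re (f s) * Im (g s) + Im (f s) * Re (g s)));
      [reflexivity|].
    replace (Im (l * g t + f t * m)) with
      ((Re l * Im (g t) + Re (f t) * Im m) + (Im l * Re (g t) + Im (f t) * Re m))
      by (unfold Re, Im; simpl; ring).
    apply @is_derive_plus; apply is_derive_mult'; assumption.
Qed.

Lemma cderiv_scal c f t l : cderiv f t l -> cderiv (fun s => c * f s)%C t (c * l)%C.
Proof.
  intros H; eapply cderiv_eq; [apply cderiv_mult; [apply cderiv_const|exact H]|]; cbn beta; ring.
Qed.

Lemma Csqnorm_neq0 (z : C) : z <> RtoC 0 -> Re z ^ 2 + Im z ^ 2 <> 0.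
Proof.
  intros H E; apply H; apply C_eq; simpl; nra.
Qed.

Lemma cderiv_inv f t l : cderiv f t l -> f t <> RtoC 0 ->
  cderiv (fun s => / f s)%C t (- l / (f t * f t))%C.
Proof.
  intros [A B] H; pose proof (Csqnorm_neq0 _ H) as N.
  assert (D : is_derive (fun s => Re (f s) ^ 2 + Im (f s) ^ 2) t
                (2 * Re (f t) * Re l + 2 * Im (f t) * Im l)).
  { replace (2 * Re (f t) * Re l + 2 * Im (f t) * Im l) with
      ((Re l * Re (f t) + Re (f t) * Re l) + (Im l * Im (f t) + Im (f t) * Im l)) by ring.
    apply (is_derive_extR (fun s => Re (f s) * Re (f s) + Im (f s) * Im (f s)));
      [intros; ring|].
    apply @is_derive_plus; apply is_derive_mult'; assumption. }
  apply (is_derive_inv (fun s => Re (f s) ^ 2 + Im (f s) ^ 2)) in D; [|exact N].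
  split.
  - apply (is_derive_ext (fun s => Re (f s) * / (Re (f s) ^ 2 + Im (f s) ^ 2)));
      [reflexivity|].
    replace (Re (- l / (f t * f t))) with
      (Re l * / (Re (f t) ^ 2 + Im (f t) ^ 2) +
       Re (f t) * (- (2 * Re (f t) * Re l + 2 * Im (f t) * Im l)
                   / (Re (f t) ^ 2 + Im (f t) ^ 2) ^ 2)).
    + exact (is_derive_mult' (fun s => Re (f s)) _ _ _ _ A D).
    + destruct (f t) as [x y]; destruct l as [u v]; unfold Re, Im in *; simpl in *.
      field. split; [intro E; apply N; nra|].
      intro E; apply N. assert (E' : (x*x+y*y)*(x*x+y*y) = 0) by nra.
      apply Rmult_integral in E'; nra.
  - apply (is_derive_ext (fun s => - Im (f s) * / (Re (f s) ^ 2 + Im (f s) ^ 2)));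
      [reflexivity|].
    replace (Im (- l / (f t * f t))) with
      (- Im l * / (Re (f t) ^ 2 + Im (f t) ^ 2) +
       - Im (f t) * (- (2 * Re (f t) * Re l + 2 * Im (f t) * Im l)
                   / (Re (f t) ^ 2 + Im (f t) ^ 2) ^ 2)).
    + exact (is_derive_mult' (fun s => - Im (f s)) _ _ _ _ (is_derive_opp _ _ _ B) D).
    + destruct (f t) as [x y]; destruct l as [u v]; unfold Re, Im in *; simpl in *.
      field. split; [intro E; apply N; nra|].
      intro E; apply N. assert (E' : (x*x+y*y)*(x*x+y*y) = 0) by nra.
      apply Rmult_integral in E'; nra.
Qed.

Lemma cderiv_div f g t l m : cderiv f t l -> cderiv g t m -> g t <> RtoC 0 ->
  cderiv (fun s => f s / g s)%C t ((l * g t - f t * m) / (g t * g t))%C.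
Proof.
  intros A B H; eapply cderiv_eq;
    [apply cderiv_mult; [exact A|apply cderiv_inv; [exact B|exact H]]|].
  cbn beta; field; exact H.
Qed.

Lemma cderiv_lip f t l : cderiv f t l ->
  exists d, 0 < d /\ forall s, Rabs (s - t) < d ->
    Cmod (f s - f t) <= (Cmod l + 1) * Rabs (s - t).
Proof.
  intros H; rewrite cderiv_eps in H; destruct (H 1) as [d [D Hd]]; [lra|].
  exists d; split; [exact D|]; intros s Hs.
  replace (f s - f t)%C with ((f s - f t - l * RtoC (s - t)) + l * RtoC (s - t))%C by ring.
  eapply Rle_trans; [apply Cmod_triangle|].
  rewrite Cmod_mult, Cmod_R. specialize (Hd s Hs). lra.
Qed.

Lemma cderiv_comp (f : C -> C) (g : R -> C) t l m :
  cdiff f (g t) l -> cderiv g t m -> cderiv (fun s => f (g s)) t (l * m)%C.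
Proof.
  intros Hf Hg; destruct (cderiv_lip _ _ _ Hg) as [d1 [D1 H1]].
  rewrite cderiv_eps in *; intros eps He.
  pose proof (Cmod_ge_0 l) as Ll; pose proof (Cmod_ge_0 m) as Lm.
  destruct (Hf (eps / 2 / (Cmod m + 1))) as [d2 [D2 H2]];
    [apply Rdiv_lt_0_compat; lra|].
  destruct (Hg (eps / 2 / (Cmod l + 1))) as [d3 [D3 H3]];
    [apply Rdiv_lt_0_compat; lra|].
  exists (Rmin d1 (Rmin d3 (d2 / (Cmod m + 1)))); split.
  { repeat apply Rmin_glb_lt; try assumption; apply Rdiv_lt_0_compat; lra. }
  intros s Hs.
  assert (S1 : Rabs (s - t) < d1) by (eapply Rlt_le_trans; [exact Hs|apply Rmin_l]).
  assert (S23 : Rabs (s - t) < Rmin d3 (d2 / (Cmod m + 1)))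
    by (eapply Rlt_le_trans; [exact Hs|apply Rmin_r]).
  assert (S3 : Rabs (s - t) < d3) by (eapply Rlt_le_trans; [exact S23|apply Rmin_l]).
  assert (S2 : Rabs (s - t) < d2 / (Cmod m + 1))
    by (eapply Rlt_le_trans; [exact S23|apply Rmin_r]).
  specialize (H1 s S1); specialize (H3 s S3).
  assert (G : Cmod (g s - g t) < d2).
  { eapply Rle_lt_trans; [exact H1|].
    apply (Rmult_lt_compat_l (Cmod m + 1)) in S2; [|lra].
    replace ((Cmod m + 1) * (d2 / (Cmod m + 1))) with d2 in S2 by (field; lra). exact S2. }
  specialize (H2 (g s) G).
  replace (f (g s) - f (g t) - l * m * RtoC (s - t))%C with
    ((f (g s) - f (g t) - l * (g s - g t)) + l * (g s - g t - m * RtoC (s - t)))%C by ring.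
  eapply Rle_trans; [apply Cmod_triangle|]; rewrite Cmod_mult.
  assert (A1 : eps / 2 / (Cmod m + 1) * Cmod (g s - g t) <= eps / 2 * Rabs (s - t)).
  { replace (eps / 2 * Rabs (s - t)) with
      (eps / 2 / (Cmod m + 1) * ((Cmod m + 1) * Rabs (s - t))) by (field; lra).
    apply Rmult_le_compat_l; [|exact H1].
    apply Rlt_le, Rdiv_lt_0_compat; lra. }
  assert (A2 : Cmod l * Cmod (g s - g t - m * RtoC (s - t)) <= eps / 2 * Rabs (s - t)).
  { eapply Rle_trans; [apply Rmult_le_compat_l; [exact Ll|exact H3]|].
    replace (eps / 2 * Rabs (s - t)) with
      ((Cmod l + 1) * (eps / 2 / (Cmod l + 1) * Rabs (s - t))) by (field; lra).
    apply Rmult_le_compat_r; [|lra].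
    apply Rmult_le_pos; [|apply Rabs_pos].
    apply Rlt_le, Rdiv_lt_0_compat; lra. }
  lra.
Qed.

Lemma cdiff_cont f z l : cdiff f z l ->
  forall eps, 0 < eps -> exists d, 0 < d /\ forall w, Cmod (w - z) < d ->
    Cmod (f w - f z) < eps.
Proof.
  intros H eps He; destruct (H 1) as [d [D Hd]]; [lra|].
  pose proof (Cmod_ge_0 l).
  exists (Rmin d (eps / (Cmod l + 1))); split.
  { apply Rmin_glb_lt; [assumption|apply Rdiv_lt_0_compat; lra]. }
  intros w Hw.
  assert (W1 : Cmod (w - z) < d) by (eapply Rlt_le_trans; [exact Hw|apply Rmin_l]).
  assert (W2 : Cmod (w - z) < eps / (Cmod l + 1))
    by (eapply Rlt_le_trans; [exact Hw|apply Rmin_r]).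
  replace (f w - f z)%C with ((f w - f z - l * (w - z)) + l * (w - z))%C by ring.
  eapply Rle_lt_trans; [apply Cmod_triangle|]. rewrite Cmod_mult.
  specialize (Hd w W1).
  apply (Rmult_lt_compat_l (Cmod l + 1)) in W2; [|lra].
  replace ((Cmod l + 1) * (eps / (Cmod l + 1))) with eps in W2 by (field; lra).
  lra.
Qed.

Lemma cderiv_0_const f (a b : R) :
  (forall t, a < t < b -> cderiv f t (RtoC 0)) ->
  forall s t, a < s < b -> a < t < b -> f s = f t.
Proof.
  intros H.
  assert (K : forall g : R -> R, (forall t, a < t < b -> is_derive g t 0) ->
    forall s t, a < s < b -> a < t < b -> g s = g t).
  { intros g Hg s t Hs Ht.
    destruct (MVT_gen g s t (fun _ => 0)) as [c [_ Hc]].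
    - intros x Hx; apply Hg.
      unfold Rmin, Rmax in Hx; destruct (Rle_dec s t); lra.
    - intros x Hx. apply continuity_pt_filterlim.
      apply (ex_derive_continuous g). exists 0; apply Hg.
      unfold Rmin, Rmax in Hx; destruct (Rle_dec s t); lra.
    - lra. }
  intros s t Hs Ht; apply C_eq.
  - apply (K (fun u => Re (f u))); try assumption; intros u Hu; apply (H u Hu).
  - apply (K (fun u => Im (f u))); try assumption; intros u Hu; apply (H u Hu).
Qed.

(** The mean value inequality, from the mean value theorem applied to the
    component of the curve along the chord. *)
Lemma cderiv_mvt f g (M a b : R) : a <= b ->
  (forall t, a <= t <= b -> cderiv f t (g t)) ->
  (forall t, a <= t <= b -> Cmod (g t) <= M) ->
  Cmod (f b - f a) <= M * (b - a).
Proof.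
  intros Hab Hf HM.
  set (d := (f b - f a)%C).
  set (h := fun t => Re d * Re (f t) + Im d * Im (f t)).
  assert (Hh : forall t, a <= t <= b -> is_derive h t (Re d * Re (g t) + Im d * Im (g t))).
  { intros t Ht; destruct (Hf t Ht) as [A B].
    apply @is_derive_plus; apply is_derive_scal; assumption. }
  destruct (MVT_gen h a b (fun t => Re d * Re (g t) + Im d * Im (g t))) as [c [Hc E]].
  - intros x Hx; apply Hh; rewrite Rmin_left, Rmax_right in Hx; lra.
  - intros x Hx; apply continuity_pt_filterlim, (ex_derive_continuous h).
    eexists; apply Hh; rewrite Rmin_left, Rmax_right in Hx; lra.
  - rewrite Rmin_left, Rmax_right in Hc by lra.
    assert (E1 : h b - h a = Cmod d ^ 2).
    { rewrite Cmod2_alt; unfold h, d, Re, Im; simpl; ring. }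
    assert (E2 : Re d * Re (g c) + Im d * Im (g c) <= Cmod d * Cmod (g c)).
    { replace (Re d * Re (g c) + Im d * Im (g c)) with (Re (Cconj d * g c))
        by (unfold Re, Im; simpl; ring).
      rewrite <- (Cmod_conj d), <- Cmod_mult.
      eapply Rle_trans; [apply Rle_abs|apply re_le_Cmod]. }
    specialize (HM c Hc).
    pose proof (Cmod_ge_0 d) as P. destruct P as [P|P]; [|rewrite <- P].
    + apply (Rmult_le_reg_l (Cmod d)); [exact P|].
      assert (Cmod d * Cmod (g c) <= Cmod d * M) by (apply Rmult_le_compat_l; lra).
      rewrite E1 in E. nra.
    + pose proof (Cmod_ge_0 (g c)). apply Rmult_le_pos; lra.
Qed.

(** Taylor's inequality of order two along a segment. *)
Lemma cderiv_taylor f f1 f2 (M a b : R) : a <= b ->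
  (forall t, a <= t <= b -> cderiv f t (f1 t)) ->
  (forall t, a <= t <= b -> cderiv f1 t (f2 t)) ->
  (forall t, a <= t <= b -> Cmod (f2 t) <= M) ->
  Cmod (f b - f a - RtoC (b - a) * f1 a) <= M * (b - a) ^ 2.
Proof.
  intros Hab H1 H2 HM.
  assert (M0 : 0 <= M) by (eapply Rle_trans; [apply Cmod_ge_0|apply (HM a); lra]).
  set (g := fun t => (f t - RtoC (t - a) * f1 a)%C).
  assert (D : Cmod (g b - g a) <= (M * (b - a)) * (b - a)).
  { apply (cderiv_mvt g (fun t => (f1 t - f1 a)%C)); [exact Hab| |].
    - intros t Ht; eapply cderiv_eq.
      + apply cderiv_minus; [apply H1; exact Ht|].
        apply cderiv_mult; [|apply cderiv_const].
        apply (cderiv_RtoC (fun t => t - a) t 1).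
        auto_derive; [trivial|ring].
      + cbn beta; ring.
    - intros t Ht.
      eapply Rle_trans; [apply (cderiv_mvt f1 f2 M a t); [lra| |]|].
      + intros s Hs; apply H2; lra.
      + intros s Hs; apply HM; lra.
      + apply Rmult_le_compat_l; lra. }
  unfold g in D.
  replace (f b - f a - RtoC (b - a) * f1 a)%C with
    (f b - RtoC (b - a) * f1 a - (f a - RtoC (a - a) * f1 a))%C.
  - simpl. rewrite Rmult_1_r. lra.
  - replace (a - a) with 0 by ring. ring.
Qed.

(** * Exponential, logarithm and powers in the right half-plane *)

Lemma Re_plus z w : Re (z + w)%C = Re z + Re w. Proof. reflexivity. Qed.
Lemma Im_plus z w : Im (z + w)%C = Im z + Im w. Proof. reflexivity. Qed.
Lemma Re_opp z : Re (- z)%C = - Re z. Proof. reflexivity. Qed.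
Lemma Im_opp z : Im (- z)%C = - Im z. Proof. reflexivity. Qed.
Lemma Re_minus z w : Re (z - w)%C = Re z - Re w. Proof. reflexivity. Qed.
Lemma Im_minus z w : Im (z - w)%C = Im z - Im w. Proof. reflexivity. Qed.
Lemma Re_mult z w : Re (z * w)%C = Re z * Re w - Im z * Im w. Proof. reflexivity. Qed.
Lemma Im_mult z w : Im (z * w)%C = Re z * Im w + Im z * Re w. Proof. reflexivity. Qed.
Lemma Re_RtoC x : Re (RtoC x) = x. Proof. reflexivity. Qed.
Lemma Im_RtoC x : Im (RtoC x) = 0. Proof. reflexivity. Qed.
Lemma Re_pair x y : Re (x, y) = x. Proof. reflexivity. Qed.
Lemma Im_pair x y : Im (x, y) = y. Proof. reflexivity. Qed.
Lemma Re_Ci : Re Ci = 0. Proof. reflexivity. Qed.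
Lemma Im_Ci : Im Ci = 1. Proof. reflexivity. Qed.
Hint Rewrite Re_plus Im_plus Re_opp Im_opp Re_minus Im_minus Re_mult Im_mult
  Re_RtoC Im_RtoC Re_pair Im_pair Re_Ci Im_Ci : reim.

Lemma Re_pos_neq0 z : 0 < Re z -> z <> RtoC 0.
Proof. intros H E; rewrite E in H; simpl in H; lra. Qed.

Lemma Cexp_plus z w : Cexp (z + w) = (Cexp z * Cexp w)%C.
Proof.
  apply C_eq; unfold Cexp; autorewrite with reim;
    rewrite exp_plus, ?cos_plus, ?sin_plus; ring.
Qed.

Lemma Cexp_0 : Cexp 0 = RtoC 1.
Proof. apply C_eq; unfold Cexp; autorewrite with reim; rewrite exp_0, ?cos_0, ?sin_0; ring. Qed.

Lemma Cmod_Cexp z : Cmod (Cexp z) = exp (Re z).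
Proof.
  assert (H : Cmod (Cexp z) ^ 2 = exp (Re z) ^ 2).
  { rewrite Cmod2_alt; unfold Cexp; autorewrite with reim.
    pose proof (sin2_cos2 (Im z)) as S; unfold Rsqr in S.
    transitivity (exp (Re z) ^ 2 * (sin (Im z) * sin (Im z) + cos (Im z) * cos (Im z)));
      [ring|rewrite S; ring]. }
  pose proof (Cmod_ge_0 (Cexp z)); pose proof (exp_pos (Re z)); nra.
Qed.

Lemma Cexp_neq0 z : Cexp z <> RtoC 0.
Proof. apply Cmod_gt_0; rewrite Cmod_Cexp; apply exp_pos. Qed.

Lemma Cexp_opp z : Cexp (- z) = (/ Cexp z)%C.
Proof.
  assert (H : (Cexp (- z) * Cexp z)%C = RtoC 1)
    by (rewrite <- Cexp_plus, <- Cexp_0; f_equal; ring).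
  pose proof (Cexp_neq0 z).
  transitivity (Cexp (- z) * Cexp z * / Cexp z)%C; [field; assumption|rewrite H; ring].
Qed.

Lemma Cexp_RtoC x : Cexp (RtoC x) = RtoC (exp x).
Proof. apply C_eq; unfold Cexp; autorewrite with reim; rewrite ?cos_0, ?sin_0; ring. Qed.

Lemma cderiv_Cexp f t l : cderiv f t l ->
  cderiv (fun s => Cexp (f s)) t (Cexp (f t) * l)%C.
Proof.
  intros [A B].
  assert (E : is_derive (fun s => exp (Re (f s))) t (exp (Re (f t)) * Re l)).
  { rewrite Rmult_comm; apply (is_derive_comp exp (fun s => Re (f s)));
      [apply is_derive_exp|exact A]. }
  split.
  - replace (Re (Cexp (f t) * l)) with
      (exp (Re (f t)) * Re l * cos (Im (f t)) + exp (Re (f t)) * (Im l * - sin (Im (f t))))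
      by (unfold Cexp; autorewrite with reim; ring).
    apply (is_derive_mult' (fun s => exp (Re (f s))) (fun s => cos (Im (f s)))); [exact E|].
    apply (is_derive_comp cos (fun s => Im (f s))); [apply is_derive_cos|exact B].
  - replace (Im (Cexp (f t) * l)) with
      (exp (Re (f t)) * Re l * sin (Im (f t)) + exp (Re (f t)) * (Im l * cos (Im (f t))))
      by (unfold Cexp; autorewrite with reim; ring).
    apply (is_derive_mult' (fun s => exp (Re (f s))) (fun s => sin (Im (f s)))); [exact E|].
    apply (is_derive_comp sin (fun s => Im (f s))); [apply is_derive_sin|exact B].
Qed.

Lemma Cmod_pos_Re z : 0 < Re z -> 0 < Cmod z.
Proof. intros; apply Cmod_gt_0, Re_pos_neq0; assumption. Qed.

Lemma cos_atan_div x y : 0 < x -> cos (atan (y / x)) = x / sqrt (x ^ 2 + y ^ 2).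
Proof.
  intros H; rewrite cos_atan.
  replace (1 + (y / x)²) with ((x ^ 2 + y ^ 2) / x ^ 2) by (unfold Rsqr; field; lra).
  rewrite sqrt_div_alt by nra.
  rewrite sqrt_pow2 by lra. field.
  split; [|lra]. apply Rgt_not_eq, sqrt_lt_R0; nra.
Qed.

(** In the right half-plane the argument, defined through [acos], is the arc tangent
    of a smooth quotient. *)
Lemma Carg_atan z : 0 < Re z -> Carg z = atan (Im z / Re z).
Proof.
  intros H; unfold Carg.
  assert (E : Re z / Cmod z = cos (atan (Im z / Re z)))
    by (rewrite cos_atan_div by assumption; reflexivity).
  rewrite E.
  pose proof (atan_bound (Im z / Re z)) as B.
  destruct (Rle_dec 0 (Im z)) as [P|P].
  - apply acos_cos; split; [|pose proof PI_RGT_0; lra].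
    rewrite <- atan_0. destruct P as [P|P].
    + apply Rlt_le, atan_increasing, Rdiv_lt_0_compat; assumption.
    + rewrite <- P; unfold Rdiv; rewrite Rmult_0_l; lra.
  - rewrite <- (cos_neg (atan _)), acos_cos; [ring|].
    assert (atan (Im z / Re z) < 0).
    { rewrite <- atan_0; apply atan_increasing.
      apply Rmult_neg_pos; [lra|apply Rinv_0_lt_compat; assumption]. }
    pose proof PI_RGT_0; lra.
Qed.

Lemma Carg_bound z : 0 < Re z -> - (PI / 2) < Carg z < PI / 2.
Proof. intros H; rewrite Carg_atan by assumption; pose proof (atan_bound (Im z / Re z)); lra. Qed.

Lemma sin_atan_div x y : 0 < x -> sin (atan (y / x)) = y / sqrt (x ^ 2 + y ^ 2).
Proof.
  intros H; rewrite sin_atan.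
  replace (1 + (y / x)²) with ((x ^ 2 + y ^ 2) / x ^ 2) by (unfold Rsqr; field; lra).
  rewrite sqrt_div_alt by nra.
  rewrite sqrt_pow2 by lra. field.
  split; [|lra]. apply Rgt_not_eq, sqrt_lt_R0; nra.
Qed.

Lemma Cexp_Clog z : 0 < Re z -> Cexp (Clog z) = z.
Proof.
  intros H; pose proof (Cmod_pos_Re _ H) as M.
  unfold Cexp, Clog; autorewrite with reim.
  rewrite exp_ln by assumption.
  rewrite Carg_atan, cos_atan_div, sin_atan_div by assumption.
  fold (Re z) (Im z).
  change (sqrt (Re z ^ 2 + Im z ^ 2)) with (Cmod z).
  apply C_eq; autorewrite with reim; field; lra.
Qed.

(** The imaginary part of a logarithm of a point of the right half-plane is
    determined by its cosine being positive, once it lies in [(-PI, PI)]. *)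
Lemma Clog_Cexp w : 0 < Re (Cexp w) -> - PI < Im w < PI -> Clog (Cexp w) = w.
Proof.
  intros H B.
  unfold Clog; rewrite Cmod_Cexp, ln_exp, Carg_atan by assumption.
  assert (K : 0 < cos (Im w)).
  { unfold Cexp in H; autorewrite with reim in H; pose proof (exp_pos (Re w)); nra. }
  assert (B' : - PI / 2 < Im w < PI / 2).
  { split.
    - destruct (Rlt_dec (- PI / 2) (Im w)) as [P|P]; [exact P|exfalso].
      assert (cos (- Im w) <= 0) by (apply cos_le_0; lra). rewrite cos_neg in *; lra.
    - destruct (Rlt_dec (Im w) (PI / 2)) as [P|P]; [exact P|exfalso].
      assert (cos (Im w) <= 0) by (apply cos_le_0; lra). lra. }
  replace (Im (Cexp w) / Re (Cexp w)) with (tan (Im w)).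
  - rewrite atan_tan by lra. destruct w; reflexivity.
  - unfold Cexp, tan; autorewrite with reim; pose proof (exp_pos (Re w)); field; lra.
Qed.

Lemma Clog_unique z w : 0 < Re z -> Cexp w = z -> - PI < Im w < PI -> Clog z = w.
Proof. intros H <- B; apply Clog_Cexp; assumption. Qed.

Lemma cderiv_pos_loc f t l : cderiv f t l -> 0 < Re (f t) -> locally t (fun s => 0 < Re (f s)).
Proof.
  intros [A _] H.
  assert (K : continuous (fun s => Re (f s)) t)
    by (apply (ex_derive_continuous (fun s => Re (f s))); eexists; exact A).
  exact (K (fun u => 0 < u) (open_gt 0 _ H)).
Qed.

Lemma cderiv_Clog f t l : cderiv f t l -> 0 < Re (f t) ->
  cderiv (fun s => Clog (f s)) t (l / f t)%C.
Proof.
  intros D H; pose proof (cderiv_pos_loc _ _ _ D H) as L; destruct D as [A B].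
  assert (N : Re (f t) ^ 2 + Im (f t) ^ 2 <> 0) by nra.
  set (x := fun s => Re (f s)) in *; set (y := fun s => Im (f s)) in *.
  assert (Ex : x t = Re (f t)) by reflexivity.
  assert (Ey : y t = Im (f t)) by reflexivity.
  split.
  - apply is_derive_ext_loc with (fun s => / 2 * ln (x s * x s + y s * y s)).
    + eapply filter_imp; [|exact L]; intros s Hs; unfold Clog; simpl.
      change (Re (ln (Cmod (f s)), Carg (f s))) with (ln (Cmod (f s))).
      assert (P : 0 < Cmod (f s)) by (apply Cmod_pos_Re; exact Hs).
      replace (x s * x s + y s * y s) with (Cmod (f s) * Cmod (f s)).
      * rewrite ln_mult by assumption. apply Rmult_eq_reg_l with 2; [|lra].
        unfold mult; simpl; field.
      * transitivity (Cmod (f s) ^ 2); [ring|rewrite Cmod2_alt; unfold x, y; ring].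
    + replace (Re (l / f t)) with
        (/ 2 * (((Re l * x t + x t * Re l) + (Im l * y t + y t * Im l))
                * / (x t * x t + y t * y t))).
      * apply is_derive_scal.
        apply (is_derive_comp ln (fun s => x s * x s + y s * y s)).
        { apply is_derive_ln. rewrite Ex; nra. }
        apply @is_derive_plus; apply is_derive_mult'; assumption.
      * rewrite Ex, Ey; destruct (f t) as [u v], l as [p q];
          unfold Re, Im in *; simpl in *; field; nra.
  - apply is_derive_ext_loc with (fun s => atan (y s * / x s)).
    + eapply filter_imp; [|exact L]; intros s Hs; unfold Clog; simpl.
      change (Im (ln (Cmod (f s)), Carg (f s))) with (Carg (f s)).
      rewrite Carg_atan by exact Hs; reflexivity.
    + replace (Im (l / f t)) with
        ((Im l * / x t + y t * (- Re l / x t ^ 2)) * / (1 + (y t * / x t)²)).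
      * apply (is_derive_comp atan (fun s => y s * / x s)).
        { replace (/ (1 + (y t * / x t)²)) with (/ (1 + (y t * / x t) ^ 2))
            by (unfold Rsqr; f_equal; ring).
          apply is_derive_Reals, derivable_pt_lim_atan. }
        apply (is_derive_mult' y (fun s => / x s)); [exact B|].
        apply (is_derive_inv x); [exact A|rewrite Ex; lra].
      * rewrite Ex, Ey; destruct (f t) as [u v], l as [p q];
          unfold Re, Im, Rsqr in *; simpl in *; field; split; nra.
Qed.

Lemma Cpower_neq0 z w : Cpower z w <> RtoC 0.
Proof. apply Cexp_neq0. Qed.

Lemma Cpower_plus z a b : Cpower z (a + b) = (Cpower z a * Cpower z b)%C.
Proof. unfold Cpower; rewrite <- Cexp_plus; f_equal; ring. Qed.

Lemma Cpower_opp z a : Cpower z (- a) = (/ Cpower z a)%C.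
Proof. unfold Cpower; rewrite <- Cexp_opp; f_equal; ring. Qed.

Lemma Cpower_0 z : Cpower z 0 = RtoC 1.
Proof. unfold Cpower; rewrite <- Cexp_0; f_equal; ring. Qed.

Lemma Cpower_1 z : 0 < Re z -> Cpower z 1 = z.
Proof.
  intros H; unfold Cpower; replace (1 * Clog z)%C with (Clog z) by ring.
  apply Cexp_Clog; assumption.
Qed.

Lemma Cpower_S z a : 0 < Re z -> Cpower z (a + 1) = (z * Cpower z a)%C.
Proof. intros H; rewrite Cpower_plus, Cpower_1 by assumption; ring. Qed.

Lemma cderiv_Cpower f t l a : cderiv f t l -> 0 < Re (f t) ->
  cderiv (fun s => Cpower (f s) a) t (a * Cpower (f t) a * l / f t)%C.
Proof.
  intros D H; eapply cderiv_eq.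
  - apply cderiv_Cexp, cderiv_scal, cderiv_Clog; [exact D|exact H].
  - unfold Cpower; field; apply Re_pos_neq0, H.
Qed.

Lemma Cmod_Cpower z a : Cmod (Cpower z a) = exp (Re a * ln (Cmod z) - Im a * Carg z).
Proof. unfold Cpower; rewrite Cmod_Cexp; autorewrite with reim; reflexivity. Qed.

Definition Kexp (a : C) : R := exp (2 * Rabs (Im a)).

Lemma Kexp_pos a : 0 < Kexp a. Proof. apply exp_pos. Qed.

Lemma exp_le x y : x <= y -> exp x <= exp y.
Proof. intros [H|H]; [left; apply exp_increasing; exact H|subst; lra]. Qed.

(** In the right half-plane the argument is bounded by [PI / 2], so a complex
    power is comparable with the real power of the modulus. *)
Lemma Cmod_Cpower_le z a : 0 < Re z -> Cmod (Cpower z a) <= Kexp a * Rpower (Cmod z) (Re a).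
Proof.
  intros H; rewrite Cmod_Cpower; unfold Kexp, Rpower; rewrite <- exp_plus.
  apply exp_le.
  pose proof (Carg_bound _ H) as B.
  assert (PI <= 4) by apply PI_4.
  assert (Rabs (Carg z) <= 2) by (apply Rabs_le; lra).
  assert (- (Im a * Carg z) <= Rabs (Im a) * Rabs (Carg z)).
  { rewrite <- Rabs_mult, <- (Rabs_Ropp (Im a * Carg z)); apply Rle_abs. }
  pose proof (Rabs_pos (Im a)); pose proof (Rabs_pos (Carg z)); nra.
Qed.

Lemma Clog_scal r z : 0 < r -> 0 < Re z -> Clog (RtoC r * z) = (RtoC (ln r) + Clog z)%C.
Proof.
  intros R H.
  apply Clog_unique.
  - autorewrite with reim; rewrite Rmult_0_l, Rminus_0_r; apply Rmult_lt_0_compat; assumption.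
  - rewrite Cexp_plus, Cexp_Clog, Cexp_RtoC, exp_ln by assumption; reflexivity.
  - pose proof (Carg_bound _ H); pose proof PI_RGT_0; unfold Clog; autorewrite with reim; lra.
Qed.

Lemma Cpower_scal r z a : 0 < r -> 0 < Re z ->
  Cpower (RtoC r * z) a = (Cpower (RtoC r) a * Cpower z a)%C.
Proof.
  intros R H; unfold Cpower; rewrite Clog_scal by assumption.
  assert (E : Clog (RtoC r) = RtoC (ln r)).
  { replace (RtoC r) with (RtoC r * RtoC 1)%C by ring.
    rewrite Clog_scal; [|exact R|simpl; lra].
    rewrite (Clog_unique (RtoC 1) (RtoC 0)); [ring|simpl; lra|apply Cexp_0|].
    pose proof PI_RGT_0; simpl; lra. }
  rewrite E, <- Cexp_plus; f_equal; ring.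
Qed.

Lemma Clog_RtoC r : 0 < r -> Clog (RtoC r) = RtoC (ln r).
Proof.
  intros R; apply Clog_unique; [exact R|rewrite Cexp_RtoC, exp_ln; trivial|].
  pose proof PI_RGT_0; simpl; lra.
Qed.

Lemma Cpower_RtoC r x : 0 < r -> Cpower (RtoC r) (RtoC x) = RtoC (Rpower r x).
Proof.
  intros R; unfold Cpower, Rpower; rewrite Clog_RtoC, <- RtoC_mult, Cexp_RtoC by assumption.
  reflexivity.
Qed.

Lemma Cmod_Cpower_RtoC r a : 0 < r -> Cmod (Cpower (RtoC r) a) = Rpower r (Re a).
Proof.
  intros R; rewrite Cmod_Cpower. unfold Rpower; f_equal.
  rewrite Cmod_R, Rabs_pos_eq by lra.
  rewrite Carg_atan by exact R; simpl; unfold Rdiv; rewrite Rmult_0_l, atan_0; ring.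
Qed.

Lemma Csqrt_Cpower z : 0 < Re z -> Csqrt z = Cpower z (1 / 2).
Proof.
  intros H; pose proof (Cmod_pos_Re _ H) as M.
  unfold Csqrt, Cpower, Clog.
  replace (sqrt (Cmod z)) with (exp (/ 2 * ln (Cmod z))) by
    (rewrite <- Rpower_sqrt by assumption; reflexivity).
  rewrite <- Cexp_RtoC, <- Cexp_plus; f_equal.
  apply C_eq; unfold Re, Im, Ci; simpl; field.
Qed.

(** * Improper integrals over the half-line *)

Section HalfLine.
Context {V : CompleteNormedModule R_AbsRing}.

Definition is_halfline_int (f : R -> V) (l : V) : Prop :=
  is_RInt_gen f (at_right 0) (Rbar_locally p_infty) l.

Lemma halfline_eps (f : R -> V) (l : V) :
  (forall a b, 0 < a -> 0 < b -> ex_RInt f a b) ->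
  (is_halfline_int f l <->
   forall eps, 0 < eps -> exists d, 0 < d /\ forall a b, 0 < a < d -> / d < b ->
     norm (minus (RInt f a b) l) < eps).
Proof.
  intros Hf; split.
  - intros H eps He.
    assert (L : locally l (fun y => norm (minus y l) < eps)).
    { apply (locally_le_locally_norm (K := R_AbsRing) (V := V)).
      exists (mkposreal eps He); intros y Hy; exact Hy. }
    destruct (H _ L) as [P Q [d Hd] [M HM] HPQ].
    assert (Q0 : 0 < Rmin d (/ (1 + Rabs M))).
    { apply Rmin_glb_lt; [apply cond_pos|].
      apply Rinv_0_lt_compat; pose proof (Rabs_pos M); lra. }
    exists (Rmin d (/ (1 + Rabs M))); split; [exact Q0|].
    intros a b [Ha1 Ha2] Hb.
    destruct (HPQ a b) as [y [Hy1 Hy2]].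
    + apply Hd; [|exact Ha1].
      change (Rabs (a - 0) < d); rewrite Rminus_0_r, Rabs_pos_eq by lra.
      eapply Rlt_le_trans; [exact Ha2|apply Rmin_l].
    + apply HM.
      assert (1 + Rabs M <= / Rmin d (/ (1 + Rabs M))).
      { rewrite <- (Rinv_inv (1 + Rabs M)) at 1.
        apply Rinv_le_contravar; [exact Q0|apply Rmin_r]. }
      pose proof (Rle_abs M); lra.
    + simpl in Hy1, Hy2. rewrite (is_RInt_unique _ _ _ _ Hy1). exact Hy2.
  - intros H P HP.
    apply (locally_norm_le_locally (K := R_AbsRing) (V := V)) in HP.
    destruct HP as [eps HP].
    destruct (H eps (cond_pos eps)) as [d [D Hd]].
    apply (Filter_prod _ _ _ (fun a => 0 < a < d) (fun b => / d < b)).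
    + exists (mkposreal d D); intros y Hy Hy0; split; [exact Hy0|].
      change (Rabs (y - 0) < d) in Hy; rewrite Rminus_0_r in Hy.
      eapply Rle_lt_trans; [apply Rle_abs|exact Hy].
    + exists (/ d); trivial.
    + intros a b Ha Hb; simpl.
      assert (0 < / d) by (apply Rinv_0_lt_compat; exact D).
      exists (RInt f a b); split.
      * apply RInt_correct, Hf; lra.
      * apply HP, Hd; assumption.
Qed.

Lemma halfline_unique (f : R -> V) (l m : V) :
  is_halfline_int f l -> is_halfline_int f m -> l = m.
Proof.
  intros H1 H2.
  rewrite <- (is_RInt_gen_unique (V := V) f l H1).
  apply is_RInt_gen_unique; exact H2.
Qed.

Lemma filter_prod_pos (P : R -> Prop) : (forall x, 0 < x -> P x) ->
  filter_prod (at_right 0) (Rbar_locally p_infty)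
    (fun ab : R * R => fst ab <= snd ab /\ forall x, fst ab <= x <= snd ab -> P x).
Proof.
  intros H.
  apply (Filter_prod _ _ _ (fun a => 0 < a < 1) (fun b => 1 < b)).
  - exists (mkposreal 1 Rlt_0_1); intros y Hy Hy0; split; [exact Hy0|].
    change (Rabs (y - 0) < 1) in Hy; rewrite Rminus_0_r in Hy.
    eapply Rle_lt_trans; [apply Rle_abs|exact Hy].
  - exists 1; trivial.
  - intros a b Ha Hb; simpl; split; [lra|]; intros x Hx; apply H; lra.
Qed.

Lemma halfline_ext (f g : R -> V) (l : V) :
  (forall x, 0 < x -> f x = g x) -> is_halfline_int f l -> is_halfline_int g l.
Proof.
  intros E; apply is_RInt_gen_ext.
  eapply filter_imp; [|apply (filter_prod_pos (fun x => f x = g x) E)].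
  intros [a b] [Hab H] x Hx; simpl in *; apply H.
  rewrite Rmin_left, Rmax_right in Hx; lra.
Qed.

Lemma halfline_le (f : R -> V) (g : R -> R) (l : V) (m : R) :
  (forall x, 0 < x -> norm (f x) <= g x) ->
  is_halfline_int f l ->
  is_RInt_gen (V := R_NormedModule) g (at_right 0) (Rbar_locally p_infty) m ->
  norm l <= m.
Proof.
  intros H Hf Hg; pose proof (filter_prod_pos _ H) as F.
  eapply (RInt_gen_norm (V := V) (Fa := at_right 0) (Fb := Rbar_locally p_infty) f g l m);
    [| |exact Hf|exact Hg].
  - eapply filter_imp; [|exact F]; intros [a b] [A _]; exact A.
  - eapply filter_imp; [|exact F]; intros [a b] [_ B]; exact B.
Qed.

End HalfLine.

Definition RI (g : R -> R) (m : R) : Prop :=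
  is_halfline_int (V := R_CompleteNormedModule) g m.

Definition CI (f : R -> C) (l : C) : Prop :=
  is_halfline_int (V := C_R_CompleteNormedModule) f l.

Definition ccont (f : R -> C) (x : R) : Prop :=
  continuous (fun s => Re (f s)) x /\ continuous (fun s => Im (f s)) x.

Lemma CI_correct f l : CI f l -> ex_CRInt_0_infty f /\ CRInt_0_infty f = l.
Proof.
  intros H; split; [exists l; exact H|].
  exact (is_RInt_gen_unique (V := C_R_CompleteNormedModule) (Fa := at_right 0)
           (Fb := Rbar_locally p_infty) f l H).
Qed.

Lemma ccont_continuous f x : ccont f x -> continuous (U := C_R_NormedModule) f x.
Proof.
  intros [A B] P [eps HP].
  assert (LA : locally x (fun s => ball (Re (f x)) eps (Re (f s))))
    by exact (A _ (locally_ball (Re (f x)) eps)).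
  assert (LB : locally x (fun s => ball (Im (f x)) eps (Im (f s))))
    by exact (B _ (locally_ball (Im (f x)) eps)).
  change (locally x (fun s => P (f s))).
  generalize (filter_and _ _ LA LB).
  apply filter_imp; intros s [H1 H2]; apply HP; split; assumption.
Qed.

Lemma cderiv_ccont f t l : cderiv f t l -> ccont f t.
Proof.
  intros [A B]; split.
  - apply (ex_derive_continuous (fun s => Re (f s))); eexists; exact A.
  - apply (ex_derive_continuous (fun s => Im (f s))); eexists; exact B.
Qed.

Lemma ccont_ex_RInt f a b : (forall x, 0 < x -> ccont f x) -> 0 < a -> 0 < b ->
  ex_RInt (V := C_R_CompleteNormedModule) f a b.
Proof.
  intros H A B; apply (ex_RInt_continuous (V := C_R_CompleteNormedModule)).
  intros z Hz; apply ccont_continuous, H.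
  eapply Rlt_le_trans; [|apply Hz]; apply Rmin_glb_lt; assumption.
Qed.

Lemma RI_ex_RInt g m a b : RI g m -> 0 < a -> 0 < b -> ex_RInt g a b.
Proof.
  intros H A B.
  destruct (H (fun _ => True)) as [P Q [d Hd] [M HM] HPQ]; [apply filter_true|].
  assert (D : forall u, 0 < u -> exists p, 0 < p /\ p <= u /\ P p).
  { intros u U; exists (Rmin (d / 2) u).
    assert (0 < Rmin (d / 2) u) by (apply Rmin_glb_lt; [pose proof (cond_pos d); lra|exact U]).
    split; [assumption|split; [apply Rmin_r|]].
    apply Hd; [|assumption].
    change (Rabs (Rmin (d / 2) u - 0) < d); rewrite Rminus_0_r, Rabs_pos_eq by lra.
    eapply Rle_lt_trans; [apply Rmin_l|]; pose proof (cond_pos d); lra. }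
  assert (K : forall u v, 0 < u -> u <= v -> ex_RInt g u v).
  { intros u v U UV; destruct (D u U) as [p [P1 [P2 P3]]].
    destruct (HPQ p (Rmax v (M + 1))) as [y [Hy _]]; [exact P3| |].
    - apply HM; eapply Rlt_le_trans; [|apply Rmax_r]; lra.
    - simpl in Hy.
      assert (E : ex_RInt g p (Rmax v (M + 1))) by (exists y; exact Hy).
      pose proof (Rmax_l v (M + 1)).
      apply (ex_RInt_Chasles_2 (V := R_CompleteNormedModule) g p); [lra|].
      apply (ex_RInt_Chasles_1 (V := R_CompleteNormedModule) g p v (Rmax v (M + 1))); [lra|exact E]. }
  destruct (Rle_dec a b); [apply K; lra|].
  apply ex_RInt_swap, K; lra.
Qed.

Lemma Cmod_norm_CR (z : C) : norm (V := C_R_CompleteNormedModule) z = Cmod z.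
Proof. symmetry; apply Cmod_norm. Qed.

Lemma RInt_le_dom f g m a b : (forall x, 0 < x -> ccont f x) -> RI g m ->
  (forall x, 0 < x -> Cmod (f x) <= g x) -> 0 < a -> a <= b ->
  Cmod (RInt (V := C_R_CompleteNormedModule) f a b) <= RInt g a b.
Proof.
  intros Hf Hg H A AB.
  rewrite <- Cmod_norm_CR.
  apply (norm_RInt_le (V := C_R_CompleteNormedModule) f g a b); [exact AB| | |].
  - intros x Hx; rewrite Cmod_norm_CR; apply H; lra.
  - apply (RInt_correct (V := C_R_CompleteNormedModule)), ccont_ex_RInt; trivial; lra.
  - apply (RInt_correct (V := R_CompleteNormedModule)), (RI_ex_RInt _ m); trivial; lra.
Qed.

(** Domination: convergence follows from the Cauchy criterion, because the
    contribution of the two end pieces is controlled by that of the majorant. *)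
Lemma CI_dom f g m : (forall x, 0 < x -> ccont f x) -> RI g m ->
  (forall x, 0 < x -> Cmod (f x) <= g x) -> exists l, CI f l /\ Cmod l <= m.
Proof.
  intros Hf Hg H.
  pose proof (fun a b => RI_ex_RInt g m a b Hg) as Eg.
  pose proof (fun a b => ccont_ex_RInt f a b Hf) as Ef.
  pose proof (proj1 (halfline_eps (V := R_CompleteNormedModule) g m Eg) Hg) as Hg'.
  assert (piece : forall a b u v, 0 < a -> 0 < b -> 0 < u -> 0 < v ->
    Cmod (RInt (V := C_R_CompleteNormedModule) f a b - RInt (V := C_R_CompleteNormedModule) f u v)
    <= Rabs (RInt g a u) + Rabs (RInt g b v)).
  { assert (one : forall a u, 0 < a -> 0 < u ->
      Cmod (RInt (V := C_R_CompleteNormedModule) f a u) <= Rabs (RInt g a u)).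
    { intros a u A U; destruct (Rle_dec a u).
      - eapply Rle_trans; [apply (RInt_le_dom f g m); assumption|apply Rle_abs].
      - rewrite <- (opp_RInt_swap (V := C_R_CompleteNormedModule)) by (apply Ef; assumption).
        rewrite <- (opp_RInt_swap (V := R_CompleteNormedModule) g) by (apply Eg; assumption).
        change (Cmod (- RInt (V := C_R_CompleteNormedModule) f u a) <= Rabs (- RInt g u a)).
        rewrite Cmod_opp, Rabs_Ropp.
        eapply Rle_trans; [apply (RInt_le_dom f g m); trivial; lra|apply Rle_abs]. }
    intros a b u v A B U W.
    assert (E1 := RInt_Chasles (V := C_R_CompleteNormedModule) f a u b (Ef _ _ A U) (Ef _ _ U B)).
    assert (E2 := RInt_Chasles (V := C_R_CompleteNormedModule) f u b v (Ef _ _ U B) (Ef _ _ B W)).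
    rewrite <- E1, <- E2.
    change plus with Cplus.
    match goal with |- Cmod (Cplus ?p ?q - Cplus ?q ?r) <= _ =>
      replace (Cplus p q - Cplus q r)%C with (p - r)%C by ring end.
    eapply Rle_trans; [apply Cmod_triangle|]; rewrite Cmod_opp.
    apply Rplus_le_compat; apply one; assumption. }
  assert (ends : forall eps, 0 < eps -> exists d, 0 < d /\
    forall a b u v, 0 < a < d -> / d < b -> 0 < u < d -> / d < v ->
    Cmod (RInt (V := C_R_CompleteNormedModule) f a b
          - RInt (V := C_R_CompleteNormedModule) f u v) < eps).
  { intros eps He; destruct (Hg' (eps / 4)) as [d [D Hd]]; [lra|].
    exists d; split; [exact D|]; intros a b u v A B U W.
    assert (0 < / d) by (apply Rinv_0_lt_compat; exact D).
    eapply Rle_lt_trans; [apply piece; lra|].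
    assert (K : forall a b, 0 < a < d -> / d < b -> Rabs (RInt g a b - m) < eps / 4).
    { intros a' b' A' B'; exact (Hd a' b' A' B'). }
    assert (E1 : RInt g a u + RInt g u b = RInt g a b).
    { apply (RInt_Chasles (V := R_CompleteNormedModule)); apply Eg; lra. }
    assert (E2 : RInt g u b + RInt g b v = RInt g u v).
    { apply (RInt_Chasles (V := R_CompleteNormedModule)); apply Eg; lra. }
    pose proof (K a b A B) as K1; pose proof (K u b U B) as K2; pose proof (K u v U W) as K3.
    apply Rabs_def2 in K1; apply Rabs_def2 in K2; apply Rabs_def2 in K3.
    assert (Rabs (RInt g a u) < eps / 2) by (apply Rabs_def1; lra).
    assert (Rabs (RInt g b v) < eps / 2) by (apply Rabs_def1; lra).
    lra. }
  assert (ex : exists l, CI f l).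
  { apply (filterlimi_locally_cauchy (U := C_R_CompleteNormedModule)
      (F := filter_prod (at_right 0) (Rbar_locally p_infty))
      (fun ab : R * R => is_RInt (V := C_R_CompleteNormedModule) f (fst ab) (snd ab))).
    { eapply filter_imp; [|apply (filter_prod_pos (fun x => 0 < x) (fun x h => h))].
      intros [a b] [AB P]; simpl in *.
      assert (A : 0 < a) by (apply P; lra). assert (B : 0 < b) by (apply P; lra).
      split.
      - eexists; apply (RInt_correct (V := C_R_CompleteNormedModule)), Ef; assumption.
      - intros y1 y2 H1 H2.
        rewrite <- (is_RInt_unique (V := C_R_CompleteNormedModule) _ _ _ _ H1).
        exact (is_RInt_unique (V := C_R_CompleteNormedModule) _ _ _ _ H2). }
    intros eps; destruct (ends eps (cond_pos eps)) as [d [D Hd]].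
    exists (fun ab => (0 < fst ab < d) /\ / d < snd ab); split.
    - apply (Filter_prod _ _ _ (fun a => 0 < a < d) (fun b => / d < b)).
      + exists (mkposreal d D); intros y Hy Hy0; split; [exact Hy0|].
        change (Rabs (y - 0) < d) in Hy; rewrite Rminus_0_r in Hy.
        eapply Rle_lt_trans; [apply Rle_abs|exact Hy].
      + exists (/ d); trivial.
      + intros a b Ha Hb; split; assumption.
    - intros [a b] [u v] [A B] [U W] p q Hp Hq; simpl in *.
      rewrite <- (is_RInt_unique _ _ _ _ Hp), <- (is_RInt_unique _ _ _ _ Hq).
      apply (norm_compat1 (V := C_R_CompleteNormedModule)).
      rewrite Cmod_norm_CR; apply Hd; assumption. }
  destruct ex as [l Hl]; exists l; split; [exact Hl|].
  rewrite <- Cmod_norm_CR.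
  apply (halfline_le (V := C_R_CompleteNormedModule) f g l m); [|exact Hl|exact Hg].
  intros x Hx; rewrite Cmod_norm_CR; apply H, Hx.
Qed.

Lemma CI_le f g l m : CI f l -> RI g m -> (forall x, 0 < x -> Cmod (f x) <= g x) -> Cmod l <= m.
Proof.
  intros Hf Hg H; rewrite <- Cmod_norm_CR.
  apply (halfline_le (V := C_R_CompleteNormedModule) f g l m); [|exact Hf|exact Hg].
  intros x Hx; rewrite Cmod_norm_CR; apply H, Hx.
Qed.

Lemma CI_unique f l m : CI f l -> CI f m -> l = m.
Proof. exact (halfline_unique (V := C_R_CompleteNormedModule) f l m). Qed.

Lemma CI_ext f g l : (forall x, 0 < x -> f x = g x) -> CI f l -> CI g l.
Proof. exact (halfline_ext (V := C_R_CompleteNormedModule) f g l). Qed.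

Lemma CI_plus f g l m : CI f l -> CI g m -> CI (fun x => f x + g x)%C (l + m)%C.
Proof. intros A B; exact (is_RInt_gen_plus (V := C_R_NormedModule) f g l m A B). Qed.

Lemma CI_opp f l : CI f l -> CI (fun x => - f x)%C (- l)%C.
Proof. intros A; exact (is_RInt_gen_opp (V := C_R_NormedModule) f l A). Qed.

Lemma CI_minus f g l m : CI f l -> CI g m -> CI (fun x => f x - g x)%C (l - m)%C.
Proof. intros A B; apply CI_plus, CI_opp; assumption. Qed.

Lemma CI_RI f l : CI f l <-> RI (fun x => Re (f x)) (Re l) /\ RI (fun x => Im (f x)) (Im l).
Proof.
  split.
  - intros H; split; intros P [eps HP].
    + destruct (H (fun z => ball (Re l) eps (Re z))) as [A B HA HB HAB].
      { exists eps; intros y [Hy _]; exact Hy. }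
      apply (Filter_prod _ _ _ A B HA HB); intros a b Ha Hb.
      destruct (HAB a b Ha Hb) as [y [Hy1 Hy2]]; exists (Re y); split; [|apply HP, Hy2].
      exact (is_RInt_fct_extend_fst (U := R_NormedModule) (V := R_NormedModule) f _ _ y Hy1).
    + destruct (H (fun z => ball (Im l) eps (Im z))) as [A B HA HB HAB].
      { exists eps; intros y [_ Hy]; exact Hy. }
      apply (Filter_prod _ _ _ A B HA HB); intros a b Ha Hb.
      destruct (HAB a b Ha Hb) as [y [Hy1 Hy2]]; exists (Im y); split; [|apply HP, Hy2].
      exact (is_RInt_fct_extend_snd (U := R_NormedModule) (V := R_NormedModule) f _ _ y Hy1).
  - intros [H1 H2] P [eps HP].
    specialize (H1 _ (locally_ball (Re l) eps)); specialize (H2 _ (locally_ball (Im l) eps)).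
    unfold filtermapi in *.
    generalize (filter_and _ _ H1 H2).
    apply filter_imp; intros [a b] [[u [Hu1 Hu2]] [v [Hv1 Hv2]]].
    exists (u, v); split; [|apply HP; split; assumption].
    exact (is_RInt_fct_extend_pair (U := R_NormedModule) (V := R_NormedModule) f _ _ u v Hu1 Hv1).
Qed.

Lemma RI_plus f g l m : RI f l -> RI g m -> RI (fun x => f x + g x) (l + m).
Proof. intros A B; exact (is_RInt_gen_plus (V := R_NormedModule) f g l m A B). Qed.

Lemma RI_scal k f l : RI f l -> RI (fun x => k * f x) (k * l).
Proof. intros A; exact (is_RInt_gen_scal (V := R_NormedModule) f k l A). Qed.

Lemma RI_ext f g l : (forall x, 0 < x -> f x = g x) -> RI f l -> RI g l.
Proof. exact (halfline_ext (V := R_CompleteNormedModule) f g l). Qed.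

Lemma RI_unique f l m : RI f l -> RI f m -> l = m.
Proof. exact (halfline_unique (V := R_CompleteNormedModule) f l m). Qed.

Lemma RI_le f g l m : RI f l -> RI g m -> (forall x, 0 < x -> f x <= g x) -> l <= m.
Proof.
  intros Hf Hg H.
  assert (K : 0 <= m + -1 * l).
  { assert (D := RI_plus _ _ _ _ Hg (RI_scal (-1) _ _ Hf)).
    eapply Rle_trans; [apply (norm_ge_0 (V := R_CompleteNormedModule) (m + -1 * l))|].
    apply (halfline_le (V := R_CompleteNormedModule) (fun x => g x + -1 * f x)
             (fun x => g x + -1 * f x) _ _); [|exact D|exact D].
    intros x Hx; specialize (H x Hx).
    change (Rabs (g x + -1 * f x) <= g x + -1 * f x); rewrite Rabs_pos_eq; lra. }
  lra.
Qed.

Lemma CI_scal c f l : CI f l -> CI (fun x => c * f x)%C (c * l)%C.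
Proof.
  rewrite !CI_RI; intros [A B]; split.
  - eapply RI_ext; [|replace (Re (c * l)%C) with (Re c * Re l + - Im c * Im l)
      by (autorewrite with reim; ring); apply RI_plus; apply RI_scal; [exact A|exact B]].
    intros x _; cbn beta; autorewrite with reim; ring.
  - eapply RI_ext; [|replace (Im (c * l)%C) with (Re c * Im l + Im c * Re l)
      by (autorewrite with reim; ring); apply RI_plus; apply RI_scal; [exact B|exact A]].
    intros x _; cbn beta; autorewrite with reim; ring.
Qed.

Lemma CI_RtoC g m : RI g m -> CI (fun x => RtoC (g x)) (RtoC m).
Proof.
  intros H; apply CI_RI; split; [exact H|].
  eapply RI_ext; [|replace (Im (RtoC m)) with (0 * m) by (simpl; ring); apply RI_scal, H].
  intros; simpl; ring.
Qed.

Lemma RI_FTC G g A B : (forall x, 0 < x -> is_derive G x (g x)) ->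
  (forall x, 0 < x -> continuous g x) ->
  filterlim G (at_right 0) (locally A) -> filterlim G (Rbar_locally p_infty) (locally B) ->
  RI g (B - A).
Proof.
  intros HG Hg HA HB.
  assert (D : forall x, 0 < x -> Derive G x = g x)
    by (intros x Hx; apply is_derive_unique, HG, Hx).
  apply RI_ext with (Derive G); [exact D|].
  apply (is_RInt_gen_Derive (Fa := at_right 0) (Fb := Rbar_locally p_infty) G A B);
    [| |exact HA|exact HB].
  - eapply filter_imp; [|apply (filter_prod_pos (fun x => 0 < x) (fun x h => h))].
    intros [a b] [AB H] x Hx; simpl in *; rewrite Rmin_left, Rmax_right in Hx by lra.
    eexists; apply HG, H, Hx.
  - eapply filter_imp; [|apply (filter_prod_pos (fun x => 0 < x) (fun x h => h))].
    intros [a b] [AB H] x Hx; simpl in *; rewrite Rmin_left, Rmax_right in Hx by lra.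
    assert (X : 0 < x) by (apply H, Hx).
    apply (continuous_ext_loc _ g); [|apply Hg, X].
    generalize (open_gt 0 x X); apply filter_imp; intros y Hy; symmetry; apply D, Hy.
Qed.

Definition tends0 (F : (R -> Prop) -> Prop) (f : R -> C) : Prop :=
  forall eps, 0 < eps -> F (fun x => Cmod (f x) < eps).

Lemma tends0_Re F f : Filter F -> tends0 F f -> filterlim (fun x => Re (f x)) F (locally 0).
Proof.
  intros HF H; apply filterlim_locally; intros eps.
  eapply filter_imp; [|apply (H eps (cond_pos eps))]; intros x Hx.
  change (Rabs (Re (f x) - 0) < eps); rewrite Rminus_0_r.
  eapply Rle_lt_trans; [apply re_le_Cmod|exact Hx].
Qed.

Lemma tends0_Im F f : Filter F -> tends0 F f -> filterlim (fun x => Im (f x)) F (locally 0).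
Proof.
  intros HF H; apply filterlim_locally; intros eps.
  eapply filter_imp; [|apply (H eps (cond_pos eps))]; intros x Hx.
  change (Rabs (Im (f x) - 0) < eps); rewrite Rminus_0_r.
  eapply Rle_lt_trans; [apply Im_le_Cmod|exact Hx].
Qed.

Lemma CI_FTC0 G g : (forall x, 0 < x -> cderiv G x (g x)) ->
  (forall x, 0 < x -> ccont g x) ->
  tends0 (at_right 0) G -> tends0 (Rbar_locally p_infty) G -> CI g (RtoC 0).
Proof.
  intros HG Hg HA HB; apply CI_RI; split.
  - replace (Re (RtoC 0)) with (0 - 0) by (simpl; ring).
    apply (RI_FTC (fun x => Re (G x))).
    + intros x Hx; apply (HG x Hx).
    + intros x Hx; apply (Hg x Hx).
    + apply tends0_Re; [typeclasses eauto|exact HA].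
    + apply tends0_Re; [typeclasses eauto|exact HB].
  - replace (Im (RtoC 0)) with (0 - 0) by (simpl; ring).
    apply (RI_FTC (fun x => Im (G x))).
    + intros x Hx; apply (HG x Hx).
    + intros x Hx; apply (Hg x Hx).
    + apply tends0_Im; [typeclasses eauto|exact HA].
    + apply tends0_Im; [typeclasses eauto|exact HB].
Qed.

(** * The majorants of the integrals *)

Lemma sqrt_pos_lt x : 0 < x -> 0 < sqrt x.
Proof. apply sqrt_lt_R0. Qed.

Lemma Rpower_pos x y : 0 < Rpower x y.
Proof. apply exp_pos. Qed.

(** A majorant of order [x^(-1/2)] at zero and [x^(-1 - p/2)] at infinity, with the
    primitive [- (2 / p) (1 + sqrt x)^(-p)]. *)
Definition maj (p x : R) : R := / sqrt x * Rpower (1 + sqrt x) (- 1 - p).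

Lemma Rpower_1sqrt_infty p : 0 < p ->
  filterlim (fun x => Rpower (1 + sqrt x) (- p)) (Rbar_locally p_infty) (locally 0).
Proof.
  intros P.
  assert (L : filterlim (fun x => ln (1 + sqrt x)) (Rbar_locally p_infty) (Rbar_locally p_infty)).
  { apply (filterlim_comp _ _ _ (fun x => 1 + sqrt x) ln _ (Rbar_locally p_infty));
      [|apply is_lim_ln_p].
    intros Q [M HM]; destruct (filterlim_sqrt_p (fun y => M < y)) as [N HN]; [exists M; trivial|].
    exists N; intros x Hx; apply HM; specialize (HN x Hx); lra. }
  apply (filterlim_comp _ _ _ (fun x => - p * ln (1 + sqrt x)) exp _ (Rbar_locally m_infty));
    [|apply is_lim_exp_m].
  intros Q [M HM].
  destruct (L (fun y => - M / p < y)) as [N HN]; [exists (- M / p); trivial|].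
  exists N; intros x Hx; apply HM; specialize (HN x Hx).
  apply (Rmult_lt_compat_l p) in HN; [|exact P].
  replace (p * (- M / p)) with (- M) in HN by (field; lra). lra.
Qed.

Lemma Rpower_1sqrt_0 p :
  filterlim (fun x => Rpower (1 + sqrt x) p) (at_right 0) (locally 1).
Proof.
  assert (C : continuous (fun x => Rpower (1 + sqrt x) p) 0).
  { apply (continuous_comp (fun x => 1 + sqrt x) (fun y => Rpower y p)).
    - apply (continuous_plus (V := R_NormedModule) (fun _ => 1) sqrt);
        [apply continuous_const|apply continuous_sqrt].
    - rewrite sqrt_0; apply (ex_derive_continuous (fun y => Rpower y p)).
      unfold Rpower; auto_derive; lra. }
  eapply filterlim_filter_le_1; [apply filter_le_within|].
  unfold continuous in C; rewrite sqrt_0, Rplus_0_r in C.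
  replace (Rpower 1 p) with 1 in C; [exact C|].
  unfold Rpower; rewrite ln_1, Rmult_0_r, exp_0; reflexivity.
Qed.

Lemma RI_maj p : 0 < p -> RI (maj p) (2 / p).
Proof.
  intros P.
  replace (2 / p) with (- (2 / p) * 0 - - (2 / p) * 1) by ring.
  apply (RI_FTC (fun x => - (2 / p) * Rpower (1 + sqrt x) (- p))).
  - intros x X; pose proof (sqrt_pos_lt x X).
    unfold maj, Rpower; auto_derive; [repeat split; lra|].
    replace (-1 - p) with (- p + - (1)) by ring.
    rewrite Rmult_plus_distr_r, exp_plus.
    replace (- (1) * ln (1 + sqrt x)) with (- ln (1 + sqrt x)) by ring.
    rewrite exp_Ropp, exp_ln by lra. field; lra.
  - intros x X; pose proof (sqrt_pos_lt x X).
    apply (ex_derive_continuous (maj p)); unfold maj, Rpower; auto_derive; repeat split; lra.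
  - apply (filterlim_comp _ _ _ (fun x => Rpower (1 + sqrt x) (- p)) (fun y => - (2 / p) * y) _ (locally 1));
      [apply Rpower_1sqrt_0|].
    apply (filterlim_scal_r (V := R_NormedModule)).
  - apply (filterlim_comp _ _ _ (fun x => Rpower (1 + sqrt x) (- p)) (fun y => - (2 / p) * y) _ (locally 0));
      [apply Rpower_1sqrt_infty, P|].
    apply (filterlim_scal_r (V := R_NormedModule)).
Qed.

Lemma Rpower_le_1 x y : 1 <= x -> y <= 0 -> Rpower x y <= 1.
Proof.
  intros X Y; unfold Rpower; rewrite <- exp_0; apply exp_le.
  assert (0 <= ln x) by (rewrite <- ln_1; destruct X as [X|X];
    [left; apply ln_increasing; lra|rewrite <- X; lra]).
  nra.
Qed.

Lemma tends0_ends G K q : 0 < q ->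
  (forall x, 0 < x -> Cmod (G x) <= K * (sqrt x * Rpower (1 + sqrt x) (- 1 - q))) ->
  tends0 (at_right 0) G /\ tends0 (Rbar_locally p_infty) G.
Proof.
  intros Q H.
  assert (K0 : 0 <= K).
  { specialize (H 1 Rlt_0_1); rewrite sqrt_1 in H.
    pose proof (Cmod_ge_0 (G 1)); pose proof (Rpower_pos (1 + 1) (-1 - q)); nra. }
  split; intros eps He.
  - assert (E : 0 < eps / (K + 1)) by (apply Rdiv_lt_0_compat; lra).
    exists (mkposreal ((eps / (K + 1)) ^ 2) ltac:(nra)); intros x Hx X.
    change (Rabs (x - 0) < (eps / (K + 1)) ^ 2) in Hx.
    rewrite Rminus_0_r, Rabs_pos_eq in Hx by lra.
    pose proof (sqrt_pos_lt x X) as S.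
    assert (sqrt x < eps / (K + 1)).
    { rewrite <- (sqrt_pow2 (eps / (K + 1))) by lra; apply sqrt_lt_1; nra. }
    assert (Rpower (1 + sqrt x) (-1 - q) <= 1) by (apply Rpower_le_1; lra).
    pose proof (Rpower_pos (1 + sqrt x) (-1 - q)).
    eapply Rle_lt_trans; [apply H, X|].
    apply Rle_lt_trans with (K * sqrt x); [apply Rmult_le_compat_l; nra|].
    assert ((K + 1) * sqrt x < eps).
    { apply (Rmult_lt_compat_l (K + 1)) in H0; [|lra].
      replace ((K + 1) * (eps / (K + 1))) with eps in H0 by (field; lra); exact H0. }
    nra.
  - assert (L := Rpower_1sqrt_infty q Q).
    assert (E : 0 < eps / (K + 1)) by (apply Rdiv_lt_0_compat; lra).
    assert (L' := proj1 (filterlim_locally _ _) L (mkposreal _ E)).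
    generalize (filter_and _ _ L' (ex_intro (fun M => forall x, M < x -> 0 < x) 0 (fun x h => h))).
    apply filter_imp; intros x [Hx X].
    change (Rabs (Rpower (1 + sqrt x) (- q) - 0) < eps / (K + 1)) in Hx.
    rewrite Rminus_0_r, Rabs_pos_eq in Hx by (left; apply Rpower_pos).
    pose proof (sqrt_pos_lt x X) as S.
    eapply Rle_lt_trans; [apply H, X|].
    assert (B : sqrt x * Rpower (1 + sqrt x) (-1 - q) <= Rpower (1 + sqrt x) (- q)).
    { replace (- q) with (1 + (-1 - q)) by ring; rewrite Rpower_plus, Rpower_1 by lra.
      apply Rmult_le_compat_r; [left; apply Rpower_pos|lra]. }
    apply Rle_lt_trans with (K * Rpower (1 + sqrt x) (- q)); [apply Rmult_le_compat_l; assumption|].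
    apply (Rmult_lt_compat_l (K + 1)) in Hx; [|lra].
    replace ((K + 1) * (eps / (K + 1))) with eps in Hx by (field; lra).
    pose proof (Rpower_pos (1 + sqrt x) (- q)); nra.
Qed.

Lemma Rpower_neg_le x y p : 0 < x -> x <= y -> 0 <= p -> Rpower y (- p) <= Rpower x (- p).
Proof.
  intros X XY P; unfold Rpower; apply exp_le.
  assert (ln x <= ln y) by (destruct XY as [XY|XY]; [left; apply ln_increasing; lra|subst; lra]).
  nra.
Qed.

Lemma Rpower_neg_exp x p q : 1 <= x -> q <= p -> Rpower x (- p) <= Rpower x (- q).
Proof.
  intros X PQ; unfold Rpower; apply exp_le.
  assert (0 <= ln x) by (rewrite <- ln_1; destruct X as [X|X];
    [left; apply ln_increasing; lra|rewrite <- X; lra]).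
  nra.
Qed.

Lemma Rpower_sqr x p : 0 < x -> Rpower (x ^ 2) p = Rpower x (2 * p).
Proof.
  intros X; unfold Rpower; f_equal; replace (x ^ 2) with (x * x) by ring.
  rewrite ln_mult by assumption; ring.
Qed.

(** * The kernel and the family of integrals *)

Lemma base_ge1 c x : 0 <= Re c -> 0 < x -> 1 <= Re (1 + c * RtoC x).
Proof. intros; autorewrite with reim; nra. Qed.

Lemma base_Cmod_ge c x : 0 <= Re c -> 0 < x -> Cmod c * x <= Cmod (1 + c * RtoC x).
Proof.
  intros C X; apply Rsqr_incr_0; try apply Cmod_ge_0;
    [|pose proof (Cmod_ge_0 c); nra].
  unfold Rsqr.
  assert (E1 := Cmod2_alt (1 + c * RtoC x)); assert (E2 := Cmod2_alt c).
  autorewrite with reim in E1.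
  assert (x * x * (Cmod c ^ 2) = x * x * (Re c ^ 2 + Im c ^ 2)) by (rewrite E2; reflexivity).
  nra.
Qed.

Lemma sqr_1sqrt x : 0 < x -> (1 + sqrt x) ^ 2 <= 2 * (1 + x).
Proof.
  intros X; pose proof (sqrt_sqrt x (Rlt_le _ _ X)); pose proof (Rle_0_sqr (1 - sqrt x)).
  unfold Rsqr in *; nra.
Qed.

(** One of the lower bounds [1] and [Cmod c * x] is always of the order of [1 + x],
    uniformly in [Cmod c >= r]. *)
Lemma base_Cmod_ge' c x r : 0 <= Re c -> 0 < r <= 1 -> r <= Cmod c -> 0 < x ->
  r / 4 * (1 + sqrt x) ^ 2 <= Cmod (1 + c * RtoC x).
Proof.
  intros C R RC X.
  pose proof (sqr_1sqrt x X) as S.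
  pose proof (base_ge1 c x C X) as B1; pose proof (base_Cmod_ge c x C X) as B2.
  pose proof (re_le_Cmod (1 + c * RtoC x)) as B3; pose proof (Rle_abs (Re (1 + c * RtoC x))).
  nra.
Qed.

Lemma pow_dom c b m r x p :
  0 <= Re c -> 0 < r <= 1 -> r <= Cmod c -> 0 < x -> 0 <= p <= Re b - INR m ->
  x ^ m * Cmod (Cpower (1 + c * RtoC x) (- b))
  <= Kexp b * / r ^ m * Rpower (r / 4) (- p) * Rpower (1 + sqrt x) (- (2 * p)).
Proof.
  intros C R RC X P.
  set (w := (1 + c * RtoC x)%C).
  pose proof (base_ge1 c x C X) as B1; fold w in B1.
  assert (W1 : 1 <= Cmod w)
    by (pose proof (re_le_Cmod w); pose proof (Rle_abs (Re w)); lra).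
  assert (W2 : r * x <= Cmod w).
  { pose proof (base_Cmod_ge c x C X); fold w in H; nra. }
  assert (W3 := base_Cmod_ge' c x r C R RC X); fold w in W3.
  assert (H1 := Cmod_Cpower_le w (- b) ltac:(lra)).
  assert (Kb : Kexp (- b) = Kexp b)
    by (unfold Kexp; autorewrite with reim; rewrite Rabs_Ropp; reflexivity).
  rewrite Kb in H1; rewrite Re_opp in H1.
  pose proof (Kexp_pos b) as K0.
  assert (S : 0 < sqrt x) by (apply sqrt_pos_lt, X).
  assert (rm : 0 < r ^ m) by (apply pow_lt; lra).
  assert (xm : x ^ m <= / r ^ m * Cmod w ^ m).
  { apply Rmult_le_reg_l with (r ^ m); [exact rm|].
    rewrite <- Rmult_assoc, Rinv_r, Rmult_1_l by lra.
    rewrite <- Rpow_mult_distr; apply pow_incr; split; [nra|exact W2]. }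
  assert (Q : Cmod w ^ m * Rpower (Cmod w) (- Re b) <= Rpower (Cmod w) (- p)).
  { rewrite <- Rpower_pow, <- Rpower_plus by lra.
    replace (INR m + - Re b) with (- (Re b - INR m)) by ring.
    apply Rpower_neg_exp; [exact W1|lra]. }
  assert (Q' : Rpower (Cmod w) (- p) <= Rpower (r / 4) (- p) * Rpower (1 + sqrt x) (- (2 * p))).
  { replace (- (2 * p)) with (2 * - p) by ring.
    rewrite <- Rpower_sqr by lra.
    rewrite Rpower_mult_distr by nra.
    apply Rpower_neg_le; nra. }
  apply Rle_trans with ((/ r ^ m * Cmod w ^ m) * (Kexp b * Rpower (Cmod w) (- Re b))).
  - apply Rmult_le_compat; [apply pow_le; lra|apply Cmod_ge_0|exact xm|exact H1].
  - replace (/ r ^ m * Cmod w ^ m * (Kexp b * Rpower (Cmod w) (- Re b)))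
      with (Kexp b * / r ^ m * (Cmod w ^ m * Rpower (Cmod w) (- Re b))) by ring.
    rewrite (Rmult_assoc (Kexp b * / r ^ m)).
    apply Rmult_le_compat_l; [|lra].
    apply Rlt_le, Rmult_lt_0_compat; [exact K0|apply Rinv_0_lt_compat, rm].
Qed.

(** [(x^2 + 2 om x)^(-1/2)]: the Legendre functions need [om = i] and [om = -i], the
    Beta integral [om = 1], and the rotation of the path the arcs between them. *)
Definition kern (om : C) (x : R) : C :=
  Cpower (RtoC x * RtoC x + 2 * om * RtoC x) (RtoC (- / 2)).

Lemma kern_base om x : 0 <= Re om -> 0 < x ->
  0 < Re (RtoC x * RtoC x + 2 * om * RtoC x).
Proof. intros; autorewrite with reim; nra. Qed.

Lemma kern_bound om x : 0 <= Re om -> Cmod om = 1 -> 0 < x ->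
  Cmod (kern om x) <= 2 * (/ sqrt x * / (1 + sqrt x)).
Proof.
  intros O O1 X.
  pose proof (kern_base om x O X) as B.
  set (w := (RtoC x * RtoC x + 2 * om * RtoC x)%C) in *.
  unfold kern; fold w.
  rewrite Cmod_Cpower; rewrite Re_RtoC, Im_RtoC, Rmult_0_l, Rminus_0_r.
  assert (M : 0 < Cmod w) by (apply Cmod_pos_Re, B).
  pose proof (sqrt_pos_lt x X) as S.
  assert (E : exp (- / 2 * ln (Cmod w)) = / sqrt (Cmod w)).
  { replace (- / 2 * ln (Cmod w)) with (- (/ 2 * ln (Cmod w))) by ring.
    rewrite exp_Ropp; f_equal; exact (Rpower_sqrt _ M). }
  rewrite E.
  replace (2 * (/ sqrt x * / (1 + sqrt x))) with (/ (sqrt x * (1 + sqrt x) / 2))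
    by (field; split; lra).
  apply Rinv_le_contravar; [apply Rdiv_lt_0_compat; nra|].
  assert (E2 : Cmod w = x * Cmod (RtoC x + 2 * om)).
  { unfold w; replace (RtoC x * RtoC x + 2 * om * RtoC x)%C
      with (RtoC x * (RtoC x + 2 * om))%C by ring.
    rewrite Cmod_mult, Cmod_R, Rabs_pos_eq by lra; reflexivity. }
  assert (E3 : (1 + sqrt x) ^ 2 / 4 <= Cmod (RtoC x + 2 * om)).
  { pose proof (sqr_1sqrt x X).
    assert (D := Cmod2_alt (RtoC x + 2 * om)); assert (D1 := Cmod2_alt om).
    rewrite O1 in D1; autorewrite with reim in D.
    pose proof (Cmod_ge_0 (RtoC x + 2 * om)); nra. }
  rewrite E2, sqrt_mult_alt by lra.
  replace (sqrt x * (1 + sqrt x) / 2) with (sqrt x * ((1 + sqrt x) / 2)) by field.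
  apply Rmult_le_compat_l; [lra|].
  rewrite <- (sqrt_pow2 ((1 + sqrt x) / 2)) by lra.
  apply sqrt_le_1_alt; nra.
Qed.

Lemma cderiv_kern om x : 0 <= Re om -> 0 < x ->
  cderiv (kern om) x (- (RtoC x + om) * kern om x / (RtoC x * RtoC x + 2 * om * RtoC x))%C.
Proof.
  intros O X; pose proof (kern_base om x O X) as B.
  eapply cderiv_eq.
  - apply (cderiv_Cpower (fun s => RtoC s * RtoC s + 2 * om * RtoC s)%C); [|exact B].
    apply cderiv_plus; [apply cderiv_mult; apply cderiv_id|].
    apply cderiv_scal, cderiv_id.
  - fold (kern om x).
    replace (RtoC (- / 2)) with (- (1 / 2))%C
      by (apply C_eq; unfold Re, Im; simpl; field).
    field; apply Re_pos_neq0, B.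
Qed.

(** Differentiation in [c] raises [m] and [b] by one, up to the factor [-b], so these
    integrands form a family closed under it. *)
Definition fam (om : C) (m : nat) (b c : C) (x : R) : C :=
  (kern om x * RtoC (x ^ m) * Cpower (1 + c * RtoC x) (- b))%C.

Definition famint (om : C) (m : nat) (b c : C) : C := CRInt_0_infty (fam om m b c).

Lemma cderiv_base c x : cderiv (fun s => 1 + c * RtoC s)%C x c.
Proof.
  eapply cderiv_eq; [apply cderiv_plus; [apply cderiv_const|apply cderiv_scal, cderiv_id]|]; ring.
Qed.

Lemma fam_ccont om m b c x : 0 <= Re om -> 0 <= Re c -> 0 < x -> ccont (fam om m b c) x.
Proof.
  intros O C X; eapply cderiv_ccont.
  apply cderiv_mult; [apply cderiv_mult|].
  - apply cderiv_kern; assumption.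
  - apply cderiv_RtoC with (f := fun x => x ^ m). apply is_derive_pow, is_derive_Reals, derivable_pt_lim_id.
  - apply (cderiv_Cpower (fun s => 1 + c * RtoC s)%C); [apply cderiv_base|].
    pose proof (base_ge1 c x C X); lra.
Qed.

Definition famK (m : nat) (b : C) (r p : R) : R :=
  2 * (Kexp b * / r ^ m * Rpower (r / 4) (- p)).

Lemma fam_bound om m b c x r p : 0 <= Re om -> Cmod om = 1 ->
  0 <= Re c -> 0 < r <= 1 -> r <= Cmod c -> 0 < x -> 0 <= p <= Re b - INR m ->
  Cmod (fam om m b c x) <= famK m b r p * maj (2 * p) x.
Proof.
  intros O O1 C R RC X P; unfold fam, famK.
  rewrite !Cmod_mult, Cmod_R, (Rabs_pos_eq (x ^ m)) by (apply pow_le; lra).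
  rewrite Rmult_assoc.
  pose proof (kern_bound om x O O1 X) as B1.
  pose proof (pow_dom c b m r x p C R RC X P) as B2.
  pose proof (sqrt_pos_lt x X).
  eapply Rle_trans.
  { apply Rmult_le_compat; [apply Cmod_ge_0| |exact B1|exact B2].
    apply Rmult_le_pos; [apply pow_le; lra|apply Cmod_ge_0]. }
  right; unfold maj.
  replace (- 1 - 2 * p) with (- (2 * p) + - (1)) by ring.
  rewrite (Rpower_plus (- (2 * p)) (- (1))), (Rpower_Ropp _ 1), Rpower_1 by lra; ring.
Qed.

Lemma fam_CI om m b c : 0 <= Re om -> Cmod om = 1 -> 0 <= Re c -> c <> 0%C -> INR m < Re b ->
  CI (fam om m b c) (famint om m b c).
Proof.
  intros O O1 C N P.
  set (r := Rmin 1 (Cmod c)).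
  assert (R1 : 0 < r) by (apply Rmin_glb_lt; [lra|apply Cmod_gt_0, N]).
  assert (R2 : r <= 1) by apply Rmin_l.
  assert (R3 : r <= Cmod c) by apply Rmin_r.
  destruct (CI_dom (fam om m b c) (fun x => famK m b r (Re b - INR m) * maj (2 * (Re b - INR m)) x)
    (famK m b r (Re b - INR m) * (2 / (2 * (Re b - INR m))))) as [l [Hl _]].
  - intros x X; apply fam_ccont; lra.
  - apply RI_scal, RI_maj; lra.
  - intros x X; apply fam_bound; lra.
  - unfold famint; rewrite (proj2 (CI_correct _ _ Hl)); exact Hl.
Qed.

Lemma famint_bound om m b c r p : 0 <= Re om -> Cmod om = 1 -> 0 <= Re c ->
  0 < r <= 1 -> r <= Cmod c -> 0 < p <= Re b - INR m ->
  Cmod (famint om m b c) <= famK m b r p / p.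
Proof.
  intros O O1 C R RC P.
  replace (famK m b r p / p) with (famK m b r p * (2 / (2 * p))) by (field; lra).
  apply (CI_le (fam om m b c) (fun x => famK m b r p * maj (2 * p) x)).
  - apply fam_CI; try assumption; [|lra]. apply Cmod_gt_0; lra.
  - apply RI_scal, RI_maj; lra.
  - intros x X; apply fam_bound; lra.
Qed.

Lemma cderiv_fam om m b (c : R -> C) c' x t : cderiv c t c' -> 0 <= Re (c t) -> 0 < x ->
  cderiv (fun s => fam om m b (c s) x) t (- b * c' * fam om (S m) (b + 1) (c t) x)%C.
Proof.
  intros D C X; pose proof (base_ge1 _ x C X) as B.
  eapply cderiv_eq.
  - unfold fam; apply cderiv_scal.
    apply (cderiv_Cpower (fun s => 1 + c s * RtoC x)%C); [|lra].
    apply cderiv_plus; [apply cderiv_const|].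
    apply cderiv_mult; [exact D|apply cderiv_const].
  - unfold fam.
    replace (- (b + 1))%C with (- b + - (1))%C by ring.
    rewrite (Cpower_plus _ (- b) (- (1))), (Cpower_opp _ 1), Cpower_1 by lra.
    simpl pow; rewrite RtoC_mult. field. apply Re_pos_neq0; lra.
Qed.

(** Differentiation under the integral sign, by Taylor's inequality on the
    segment from [c] to [w]. *)
Lemma famint_cdiff om m b c : 0 <= Re om -> Cmod om = 1 -> 0 < Re c -> INR m < Re b ->
  cdiff (famint om m b) c (- b * famint om (S m) (b + 1) c)%C.
Proof.
  intros O O1 C P.
  set (r := Rmin 1 (Re c / 2)).
  assert (R1 : 0 < r) by (apply Rmin_glb_lt; lra).
  assert (R2 : r <= 1) by apply Rmin_l.
  assert (R3 : r <= Re c / 2) by apply Rmin_r.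
  set (p := Re b - INR m).
  set (K := Cmod (b * (b + 1)) * famK (S (S m)) (b + 1 + 1) r p).
  assert (main : forall w, Cmod (w - c) < Re c / 2 ->
    Cmod (famint om m b w - famint om m b c - (- b * famint om (S m) (b + 1) c) * (w - c))
    <= (K * / p) * Cmod (w - c) ^ 2).
  { intros w Hw.
    assert (W : 0 < Re w).
    { pose proof (re_le_Cmod (w - c)) as H; autorewrite with reim in H.
      apply Rabs_le_between in H; lra. }
    set (cs := fun s : R => (c + RtoC s * (w - c))%C).
    assert (Dcs : forall s, cderiv cs s (w - c)).
    { intros s; eapply cderiv_eq;
        [apply cderiv_plus; [apply cderiv_const|apply cderiv_mult; [apply cderiv_id|apply cderiv_const]]|].
      cbn beta; ring. }
    assert (Bcs : forall s, 0 <= s <= 1 -> Re c / 2 <= Re (cs s)).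
    { intros s Hs; unfold cs; autorewrite with reim.
      pose proof (re_le_Cmod (w - c)) as H; autorewrite with reim in H.
      apply Rabs_le_between in H; nra. }
    assert (Nw := Re_pos_neq0 w W); assert (Nc := Re_pos_neq0 c C).
    apply (CI_le (fun x => fam om m b w x - fam om m b c x
                   - (- b * (w - c)) * fam om (S m) (b + 1) c x)%C
                 (fun x => (K * Cmod (w - c) ^ 2) * maj (2 * p) x)).
    - replace (famint om m b w - famint om m b c - - b * famint om (S m) (b + 1) c * (w - c))%C
        with (famint om m b w - famint om m b c - (- b * (w - c)) * famint om (S m) (b + 1) c)%C by ring.
      apply CI_minus; [apply CI_minus; apply fam_CI; try assumption; lra|].
      apply CI_scal, fam_CI; try assumption; [lra|].
      rewrite S_INR; autorewrite with reim; simpl; lra.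
    - replace (K * / p * Cmod (w - c) ^ 2) with (K * Cmod (w - c) ^ 2 * (2 / (2 * p)))
        by (field; unfold p; lra).
      apply RI_scal, RI_maj; unfold p; lra.
    - intros x X.
      assert (T := cderiv_taylor (fun s => fam om m b (cs s) x)
        (fun s => - b * (w - c) * fam om (S m) (b + 1) (cs s) x)%C
        (fun s => - b * (w - c) * (- (b + 1) * (w - c) * fam om (S (S m)) (b + 1 + 1) (cs s) x))%C
        (K * Cmod (w - c) ^ 2 * maj (2 * p) x) 0 1 ltac:(lra)).
      cbv beta in T.
      replace (cs 1) with w in T by (unfold cs; ring).
      replace (cs 0) with c in T by (unfold cs; ring).
      rewrite Rminus_0_r in T.
      replace (K * Cmod (w - c) ^ 2 * maj (2 * p) x) with
        (K * Cmod (w - c) ^ 2 * maj (2 * p) x * 1 ^ 2) by ring.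
      replace (- b * (w - c) * fam om (S m) (b + 1) c x)%C with
        (RtoC 1 * (- b * (w - c) * fam om (S m) (b + 1) c x))%C by ring.
      apply T.
      + intros t Ht; apply cderiv_fam; [apply Dcs|specialize (Bcs t Ht); lra|exact X].
      + intros t Ht; apply cderiv_scal, cderiv_fam;
          [apply Dcs|specialize (Bcs t Ht); lra|exact X].
      + intros t Ht; specialize (Bcs t Ht).
        replace (- b * (w - c) * (- (b + 1) * (w - c) * fam om (S (S m)) (b + 1 + 1) (cs t) x))%C
          with ((b * (b + 1)) * ((w - c) * (w - c)) * fam om (S (S m)) (b + 1 + 1) (cs t) x)%C by ring.
        rewrite Cmod_mult, (Cmod_mult (b * (b + 1))), (Cmod_mult (w - c)).
        assert (F := fam_bound om (S (S m)) (b + 1 + 1) (cs t) x r p O O1).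
        assert (Hp : 0 <= p <= Re (b + 1 + 1) - INR (S (S m)))
          by (unfold p; rewrite !S_INR; autorewrite with reim; simpl; lra).
        specialize (F ltac:(lra) ltac:(lra)).
        assert (Hr : r <= Cmod (cs t)).
        { eapply Rle_trans; [|apply re_le_Cmod]; eapply Rle_trans; [|apply Rle_abs]; lra. }
        specialize (F Hr X Hp).
        unfold K.
        replace (Cmod (b * (b + 1)) * famK (S (S m)) (b + 1 + 1) r p * Cmod (w - c) ^ 2 * maj (2 * p) x)
          with (Cmod (b * (b + 1)) * (Cmod (w - c) * Cmod (w - c)) *
                 (famK (S (S m)) (b + 1 + 1) r p * maj (2 * p) x)) by ring.
        apply Rmult_le_compat_l; [|exact F].
        apply Rmult_le_pos; [apply Cmod_ge_0|apply Rmult_le_pos; apply Cmod_ge_0]. }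
  intros eps He.
  assert (K0 : 0 <= K * / p).
  { unfold K, famK; apply Rmult_le_pos; [apply Rmult_le_pos; [apply Cmod_ge_0|]|].
    - apply Rmult_le_pos; [lra|]. apply Rmult_le_pos; [|left; apply Rpower_pos].
      apply Rmult_le_pos; [left; apply Kexp_pos|left; apply Rinv_0_lt_compat, pow_lt, R1].
    - left; apply Rinv_0_lt_compat; unfold p; lra. }
  revert main K0; generalize (K * / p); clear K; intros K main K0.
  exists (Rmin (Re c / 2) (eps / (K + 1))); split.
  { apply Rmin_glb_lt; [lra|apply Rdiv_lt_0_compat; lra]. }
  intros w Hw.
  assert (W1 : Cmod (w - c) < Re c / 2) by (eapply Rlt_le_trans; [exact Hw|apply Rmin_l]).
  assert (W2 : Cmod (w - c) < eps / (K + 1)) by (eapply Rlt_le_trans; [exact Hw|apply Rmin_r]).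
  eapply Rle_trans; [apply main, W1|].
  apply (Rmult_lt_compat_l (K + 1)) in W2; [|lra].
  replace ((K + 1) * (eps / (K + 1))) with eps in W2 by (field; lra).
  pose proof (Cmod_ge_0 (w - c)).
  replace (K * Cmod (w - c) ^ 2) with (K * Cmod (w - c) * Cmod (w - c)) by ring.
  apply Rmult_le_compat_r; [assumption|]; nra.
Qed.

(** The mean value inequality on the segment from [c] to [w], on which the modulus
    of the parameter stays at least [r]. *)
Lemma famint_lip om m b c w r p : 0 <= Re om -> Cmod om = 1 ->
  0 <= Re c -> 0 <= Re w -> 0 < r <= 1 -> 2 * r <= Cmod c -> Cmod (w - c) <= r ->
  0 < p <= Re b - INR m ->
  Cmod (famint om m b w - famint om m b c)
  <= Cmod b * famK (S m) (b + 1) r p / p * Cmod (w - c).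
Proof.
  intros O O1 C W R RC WC P.
  assert (Bcs : forall s, 0 <= s <= 1 -> r <= Cmod (c + RtoC s * (w - c))).
  { intros s Hs.
    assert (Cmod c <= Cmod (c + RtoC s * (w - c)) + Cmod (RtoC s * (w - c))).
    { replace c with ((c + RtoC s * (w - c)) + - (RtoC s * (w - c)))%C at 1 by ring.
      eapply Rle_trans; [apply Cmod_triangle|]; rewrite Cmod_opp; lra. }
    rewrite Cmod_mult, Cmod_R, Rabs_pos_eq in H by lra.
    pose proof (Cmod_ge_0 (w - c)); nra. }
  assert (Nc : c <> 0%C) by (apply Cmod_gt_0; lra).
  assert (Nw : w <> 0%C).
  { apply Cmod_gt_0; specialize (Bcs 1 ltac:(lra)).
    replace (c + 1 * (w - c))%C with w in Bcs by ring; lra. }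
  replace (Cmod b * famK (S m) (b + 1) r p / p * Cmod (w - c)) with
    (Cmod b * Cmod (w - c) * famK (S m) (b + 1) r p * (2 / (2 * p))) by (field; lra).
  apply (CI_le (fun x => fam om m b w x - fam om m b c x)%C
    (fun x => Cmod b * Cmod (w - c) * famK (S m) (b + 1) r p * maj (2 * p) x)).
  - apply CI_minus; apply fam_CI; try assumption; lra.
  - apply RI_scal, RI_maj; lra.
  - intros x X.
    assert (T := cderiv_mvt (fun s => fam om m b (c + RtoC s * (w - c)) x)
      (fun s => - b * (w - c) * fam om (S m) (b + 1) (c + RtoC s * (w - c)) x)%C
      (Cmod b * Cmod (w - c) * famK (S m) (b + 1) r p * maj (2 * p) x) 0 1 ltac:(lra)).
    cbv beta in T.
    replace (c + RtoC 1 * (w - c))%C with w in T by ring.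
    replace (c + RtoC 0 * (w - c))%C with c in T by ring.
    rewrite Rminus_0_r, Rmult_1_r in T.
    assert (Rs : forall s, 0 <= s <= 1 -> 0 <= Re (c + RtoC s * (w - c))).
    { intros s Hs; autorewrite with reim; nra. }
    apply T.
    + intros t Ht; apply (cderiv_fam om m b (fun s => c + RtoC s * (w - c))%C);
        [|apply Rs, Ht|exact X].
      eapply cderiv_eq;
        [apply cderiv_plus; [apply cderiv_const|apply cderiv_mult; [apply cderiv_id|apply cderiv_const]]|].
      cbn beta; ring.
    + intros t Ht; rewrite !Cmod_mult, Cmod_opp, (Rmult_assoc (Cmod b * Cmod (w - c))).
      apply Rmult_le_compat_l; [apply Rmult_le_pos; apply Cmod_ge_0|].
      apply fam_bound; try assumption; [apply Rs, Ht|apply Bcs, Ht|].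
      rewrite S_INR; autorewrite with reim; lra.
Qed.

(** Integration by parts: the derivative of
    [(x^2 + 2 om x)^(1/2) (1 + c x)^(-a-1)] has integral zero. *)
Lemma fam_parts om a c : 0 <= Re om -> Cmod om = 1 -> 0 < Re c -> 0 < Re a ->
  CI (fun x => kern om x * ((RtoC x + om) * (1 + c * RtoC x)
         - (a + 1) * c * (RtoC x * RtoC x + 2 * om * RtoC x))
       * Cpower (1 + c * RtoC x) (- (a + 1 + 1)))%C (RtoC 0).
Proof.
  intros O O1 C A.
  set (q := fun x : R => (RtoC x * RtoC x + 2 * om * RtoC x)%C).
  set (G := fun x : R => (q x * kern om x * Cpower (1 + c * RtoC x) (- (a + 1)))%C).
  assert (Dq : forall x, cderiv q x (2 * (RtoC x + om))%C).
  { intros x; eapply cderiv_eq.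
    - apply cderiv_plus; [apply cderiv_mult; apply cderiv_id|].
      apply cderiv_scal, cderiv_id.
    - ring. }
  assert (D : forall x, 0 < x -> cderiv G x
     (kern om x * ((RtoC x + om) * (1 + c * RtoC x)
         - (a + 1) * c * (RtoC x * RtoC x + 2 * om * RtoC x))
       * Cpower (1 + c * RtoC x) (- (a + 1 + 1)))%C).
  { intros x X.
    pose proof (base_ge1 c x (Rlt_le _ _ C) X) as B.
    pose proof (kern_base om x O X) as Bk.
    eapply cderiv_eq.
    - apply cderiv_mult; [apply cderiv_mult; [apply Dq|apply cderiv_kern; assumption]|].
      apply (cderiv_Cpower (fun s => 1 + c * RtoC s)%C); [apply cderiv_base|lra].
    - replace (- (a + 1 + 1))%C with (- (a + 1) + - (1))%C by ring.
      rewrite (Cpower_plus _ (- (a + 1)) (- (1))), (Cpower_opp _ 1), Cpower_1 by lra.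
      unfold q; field; split; apply Re_pos_neq0; lra. }
  set (r := Rmin 1 (Re c)).
  assert (R1 : 0 < r) by (apply Rmin_glb_lt; lra).
  assert (R2 : r <= 1) by apply Rmin_l.
  assert (R3 : r <= Cmod c).
  { eapply Rle_trans; [apply Rmin_r|]; eapply Rle_trans; [apply Rle_abs|apply re_le_Cmod]. }
  set (Kp := Kexp (a + 1) * / r ^ 0 * Rpower (r / 4) (- (Re a + 1))).
  assert (T := tends0_ends G (4 * Kp) (2 * Re a) ltac:(lra)).
  destruct T as [T0 T1].
  { intros x X; unfold G; rewrite !Cmod_mult.
    assert (P := pow_dom c (a + 1) 0 r x (Re a + 1) ltac:(lra) ltac:(lra) R3 X).
    assert (Hp : 0 <= Re a + 1 <= Re (a + 1) - INR 0) by (autorewrite with reim; simpl; lra).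
    specialize (P Hp); fold Kp in P; rewrite pow_O, Rmult_1_l in P.
    assert (Bk := kern_bound om x O O1 X).
    pose proof (sqrt_pos_lt x X) as S; pose proof (sqrt_sqrt x (Rlt_le _ _ X)) as SS.
    assert (Bq : Cmod (q x) <= 2 * (sqrt x * sqrt x * (1 + sqrt x) ^ 2)).
    { unfold q; replace (RtoC x * RtoC x + 2 * om * RtoC x)%C
        with (RtoC x * (RtoC x + 2 * om))%C by ring.
      rewrite Cmod_mult, Cmod_R, Rabs_pos_eq by lra.
      assert (Cmod (RtoC x + 2 * om) <= x + 2).
      { eapply Rle_trans; [apply Cmod_triangle|].
        rewrite Cmod_mult, O1, !Cmod_R, !Rabs_pos_eq by lra; lra. }
      rewrite SS, (Rmult_comm 2), Rmult_assoc; apply Rmult_le_compat_l; [lra|].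
      nra. }
    apply Rle_trans with
      (2 * (sqrt x * sqrt x * (1 + sqrt x) ^ 2) * (2 * (/ sqrt x * / (1 + sqrt x)))
        * (Kp * Rpower (1 + sqrt x) (- (2 * (Re a + 1))))).
    - apply Rmult_le_compat; [apply Rmult_le_pos; apply Cmod_ge_0|apply Cmod_ge_0| |exact P].
      apply Rmult_le_compat; try apply Cmod_ge_0; assumption.
    - right.
      replace (-1 - 2 * Re a) with (1 + - (2 * (Re a + 1))) by ring.
      rewrite (Rpower_plus 1), Rpower_1 by lra. field; lra. }
  apply (CI_FTC0 G); [exact D| |exact T0|exact T1].
  intros x X; eapply cderiv_ccont.
  apply cderiv_mult; [apply cderiv_mult; [apply cderiv_kern; assumption|]|].
  - apply cderiv_minus; apply cderiv_mult.
    + apply cderiv_plus; [apply cderiv_id|apply cderiv_const].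
    + apply cderiv_base.
    + apply cderiv_const.
    + apply Dq.
  - apply (cderiv_Cpower (fun s => 1 + c * RtoC s)%C); [apply cderiv_base|].
    pose proof (base_ge1 c x (Rlt_le _ _ C) X); lra.
Qed.

(** * Legendre's equation in the variable [h], with [cosh h] in place of [cos theta] *)

(** The unit [i] or [-i], for [e = 1] or [e = -1]: the two signs belong to the two sides
    of the cut and are treated at once. *)
Definition jj (e : R) : C := (0, e).

Lemma jj_sqr e : e * e = 1 -> (jj e * jj e)%C = (- (1))%C.
Proof. intros H; apply C_eq; unfold jj; autorewrite with reim; simpl; nra. Qed.

Definition Csinh (h : C) : C := ((Cexp h - Cexp (- h)) / 2)%C.
Definition Ccosh (h : C) : C := ((Cexp h + Cexp (- h)) / 2)%C.

(** [sin theta * exp (j theta)] at [h = j theta], for [j = jj e]: the only way in which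
    the integrals depend on the angle. *)
Definition cc (e : R) (h : C) : C := (jj e * (1 - Cexp (2 * h)) / 2)%C.

(** A half-strip on which [cc e h] has positive real part. Its interior is mapped by
    [cosh] onto an open quadrant, and its side [Re h = 0] onto a part of the cut. *)
Definition strip (e : R) (h : C) : Prop := 0 < e * Im h < PI / 2 /\ Re h <= 0.

Lemma Cexp_double h : Cexp (2 * h) = (Cexp h * Cexp h)%C.
Proof. rewrite <- Cexp_plus; f_equal; ring. Qed.

Lemma Cmult_eq_reg_l' (c x y : C) : c <> 0%C -> (c * x)%C = (c * y)%C -> x = y.
Proof.
  intros H E; transitivity (/ c * (c * x))%C; [field; exact H|].
  rewrite E; field; exact H.
Qed.

Lemma C2_neq0 : RtoC 2 <> RtoC 0.
Proof. apply Re_pos_neq0; simpl; lra. Qed.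

Lemma Re_half z : Re (z / 2)%C = Re z / 2.
Proof. destruct z as [x y]; unfold Re; simpl; field. Qed.

Lemma Im_half z : Im (z / 2)%C = Im z / 2.
Proof. destruct z as [x y]; unfold Im; simpl; field. Qed.

Lemma Re_cc e h : Re (cc e h) = e * exp (2 * Re h) * sin (2 * Im h) / 2.
Proof.
  unfold cc, jj; rewrite Re_half; autorewrite with reim; unfold Cexp; autorewrite with reim.
  replace (2 * Re h - 0 * Im h) with (2 * Re h) by ring.
  replace (2 * Im h + 0 * Re h) with (2 * Im h) by ring. field.
Qed.

Lemma e_cases e : e * e = 1 -> e = 1 \/ e = -1.
Proof. intros H; destruct (Req_dec e 1); [left; assumption|right]; nra. Qed.

Lemma Re_cc_pos e h : e * e = 1 -> strip e h -> 0 < Re (cc e h).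
Proof.
  intros E [[A B] C]; rewrite Re_cc.
  assert (0 < e * sin (2 * Im h)).
  { destruct (e_cases e E) as [-> | ->].
    - rewrite Rmult_1_l in *; apply sin_gt_0; lra.
    - replace (-1 * sin (2 * Im h)) with (sin (- (2 * Im h))) by (rewrite sin_neg; ring).
      apply sin_gt_0; lra. }
  pose proof (exp_pos (2 * Re h)).
  replace (e * exp (2 * Re h) * sin (2 * Im h) / 2) with
    (exp (2 * Re h) * (e * sin (2 * Im h)) / 2) by field.
  apply Rdiv_lt_0_compat; [apply Rmult_lt_0_compat; assumption|lra].
Qed.

Lemma strip_neq1 e h : e * e = 1 -> strip e h -> (1 - Cexp (2 * h) <> 0)%C.
Proof.
  intros E S H; pose proof (Re_cc_pos e h E S) as P; unfold cc in P.
  rewrite H in P; replace (jj e * 0 / 2)%C with (RtoC 0) in P by field.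
  simpl in P; lra.
Qed.

Lemma Csinh_neq0 e h : e * e = 1 -> strip e h -> Csinh h <> 0%C.
Proof.
  intros E S H; apply (strip_neq1 e h E S); rewrite Cexp_double.
  assert (K : (Cexp h * Cexp (- h))%C = 1%C)
    by (rewrite <- Cexp_plus, <- Cexp_0; f_equal; ring).
  replace (1 - Cexp h * Cexp h)%C with (- (2) * Cexp h * Csinh h + (1 - Cexp h * Cexp (- h)))%C
    by (unfold Csinh; field).
  rewrite H, K; ring.
Qed.

Definition Ccoth (h : C) : C := (Ccosh h / Csinh h)%C.

Lemma Ccoth_zeta e h : e * e = 1 -> strip e h ->
  Ccoth h = ((1 + Cexp (2 * h)) / (Cexp (2 * h) - 1))%C.
Proof.
  intros E S; pose proof (strip_neq1 e h E S) as N.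
  unfold Ccoth, Ccosh, Csinh; rewrite Cexp_opp, Cexp_double in *.
  pose proof (Cexp_neq0 h) as N0.
  field; repeat split; try assumption.
  intros H; apply N; replace (1 - Cexp h * Cexp h)%C with (- (Cexp h * Cexp h - 1))%C by ring;
    rewrite H; ring.
Qed.

Lemma cderiv_Csinh h d t : cderiv h t d -> cderiv (fun s => Csinh (h s)) t (Ccosh (h t) * d)%C.
Proof.
  intros H; eapply cderiv_eq.
  - unfold Csinh, Cdiv; apply cderiv_mult; [|apply cderiv_const].
    apply cderiv_minus; apply cderiv_Cexp; [exact H|apply cderiv_opp, H].
  - unfold Ccosh; field.
Qed.

Lemma cderiv_Ccosh h d t : cderiv h t d -> cderiv (fun s => Ccosh (h s)) t (Csinh (h t) * d)%C.
Proof.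
  intros H; eapply cderiv_eq.
  - unfold Ccosh, Cdiv; apply cderiv_mult; [|apply cderiv_const].
    apply cderiv_plus; apply cderiv_Cexp; [exact H|apply cderiv_opp, H].
  - unfold Csinh; field.
Qed.

Lemma cderiv_cc e h d t : cderiv h t d ->
  cderiv (fun s => cc e (h s)) t (- (jj e) * Cexp (2 * h t) * d)%C.
Proof.
  intros H; eapply cderiv_eq.
  - unfold cc, Cdiv; apply cderiv_mult; [|apply cderiv_const].
    apply cderiv_scal, cderiv_minus; [apply cderiv_const|].
    apply cderiv_Cexp, cderiv_scal, H.
  - cbn beta; field.
Qed.

(** [leg a h d y y1 t]: along the curve [h] of constant velocity [d], the pair
    [(y, y1)] satisfies the first-order form of
    [y'' + coth h y' = a (a - 1) y], the primes being derivatives in [h]. *)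
Definition leg (a : C) (h : R -> C) (d : C) (y y1 : R -> C) (t : R) : Prop :=
  cderiv y t (y1 t * d)%C /\
  cderiv y1 t ((a * (a - 1) * y t - Ccoth (h t) * y1 t) * d)%C.

Definition Mint (e : R) (m : nat) (b c : C) : C := famint (- jj e) m b c.

(** The boundary value [exp (j a theta) sigma] continued to complex [h = j theta];
    [E1fun] is its derivative in [h]. *)
Definition Efun (e : R) (a h : C) : C := (Cexp (a * h) * Mint e 0 a (cc e h))%C.

Definition E1fun (e : R) (a h : C) : C :=
  (Cexp (a * h) * (a * Mint e 0 a (cc e h)
     + a * jj e * Cexp (2 * h) * Mint e 1 (a + 1) (cc e h)))%C.

Lemma jj_om e : e * e = 1 -> 0 <= Re (- jj e) /\ Cmod (- jj e) = 1.
Proof.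
  intros E; split; [unfold jj; simpl; lra|].
  rewrite Cmod_opp; unfold Cmod, jj; simpl.
  replace (0 * (0 * 1) + e * (e * 1)) with 1 by nra. apply sqrt_1.
Qed.

(** The hypergeometric equation of the integrals, from integration by parts. *)
Lemma Mint_ode e a c : e * e = 1 -> 0 < Re a -> 0 < Re c ->
  ((2 * c - jj e) * c * (a * (a + 1) * Mint e 2 (a + 1 + 1) c)
   - ((2 * a + 3) * c - jj e) * (a * Mint e 1 (a + 1) c) + a * Mint e 0 a c = 0)%C.
Proof.
  intros E A C; destruct (jj_om e E) as [O O1].
  assert (J := jj_sqr e E).
  assert (R1 : INR 0 < Re a) by (simpl; lra).
  assert (R2 : INR 1 < Re (a + 1)) by (autorewrite with reim; simpl; lra).
  assert (R3 : INR 2 < Re (a + 1 + 1)) by (autorewrite with reim; simpl; lra).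
  assert (I0 := fam_CI _ 0 a c O O1 (Rlt_le _ _ C) (Re_pos_neq0 _ C) R1).
  assert (I1 := fam_CI _ 1 (a + 1)%C c O O1 (Rlt_le _ _ C) (Re_pos_neq0 _ C) R2).
  assert (I2 := fam_CI _ 2 (a + 1 + 1)%C c O O1 (Rlt_le _ _ C) (Re_pos_neq0 _ C) R3).
  assert (Ip := fam_parts _ a c O O1 C A).
  apply (CI_scal (a * jj e)) in Ip.
  apply (CI_unique _ _ _ (CI_plus _ _ _ _ (CI_minus _ _ _ _
    (CI_scal ((2 * c - jj e) * c) _ _ (CI_scal (a * (a + 1)) _ _ I2))
    (CI_scal ((2 * a + 3) * c - jj e) _ _ (CI_scal a _ _ I1))) (CI_scal a _ _ I0))).
  replace (RtoC 0) with (a * jj e * 0)%C by ring.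
  eapply CI_ext; [|exact Ip].
  intros x X; cbn beta; unfold fam.
  assert (B := base_ge1 c x (Rlt_le _ _ C) X).
  set (w := (1 + c * RtoC x)%C) in *.
  assert (W : w <> 0%C) by (apply Re_pos_neq0; lra).
  set (p := Cpower w (- (a + 1 + 1))).
  assert (P1 : Cpower w (- (a + 1)) = (w * p)%C).
  { unfold p; rewrite <- Cpower_S by lra; f_equal; ring. }
  assert (P0 : Cpower w (- a) = (w * (w * p))%C).
  { rewrite <- P1, <- Cpower_S by lra; f_equal; ring. }
  rewrite P0, P1; simpl pow; rewrite !RtoC_mult.
  unfold w; generalize (kern (- jj e) x); intros k.
  set (j := jj e) in *.
  transitivity (k * p * (a * (RtoC x * (1 + c * RtoC x) - (a + 1) * c * RtoC x * RtoC x) * j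
     + a * (j * j) * (- (1 + c * RtoC x) + 2 * (a + 1) * c * RtoC x)))%C;
    [ring|rewrite J; ring].
Qed.

Lemma Mint_cderiv e m b h d t : e * e = 1 -> INR m < Re b -> strip e (h t) -> cderiv h t d ->
  cderiv (fun s => Mint e m b (cc e (h s))) t
    (b * jj e * Cexp (2 * h t) * Mint e (S m) (b + 1) (cc e (h t)) * d)%C.
Proof.
  intros E B S D; destruct (jj_om e E) as [O O1].
  eapply cderiv_eq.
  - apply (cderiv_comp (Mint e m b) (fun s => cc e (h s))).
    + apply famint_cdiff; try assumption; apply Re_cc_pos; assumption.
    + apply cderiv_cc, D.
  - unfold Mint; ring.
Qed.

Lemma Efun_cderiv e a h d t : e * e = 1 -> 0 < Re a -> strip e (h t) -> cderiv h t d ->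
  cderiv (fun s => Efun e a (h s)) t (E1fun e a (h t) * d)%C.
Proof.
  intros E A S D; eapply cderiv_eq.
  - unfold Efun; apply cderiv_mult; [apply cderiv_Cexp, cderiv_scal, D|].
    apply (Mint_cderiv e 0 a h d t); try assumption; simpl; lra.
  - unfold E1fun; ring.
Qed.

(** The equation [Mint_ode] of the integral becomes Legendre's equation after
    multiplication by the exponential. *)
Lemma Efun_leg e a h d t : e * e = 1 -> 0 < Re a -> strip e (h t) -> cderiv h t d ->
  leg a h d (fun s => Efun e a (h s)) (fun s => E1fun e a (h s)) t.
Proof.
  intros E A S D; split; [apply Efun_cderiv; assumption|].
  assert (R1 : INR 1 < Re (a + 1)) by (autorewrite with reim; simpl; lra).
  eapply cderiv_eq.
  - unfold E1fun; apply cderiv_mult; [apply cderiv_Cexp, cderiv_scal, D|].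
    apply cderiv_plus.
    + apply cderiv_scal, (Mint_cderiv e 0 a h d t); try assumption; simpl; lra.
    + apply cderiv_mult.
      * apply cderiv_scal, cderiv_Cexp, cderiv_scal, D.
      * apply (Mint_cderiv e 1 (a + 1)%C h d t); assumption.
  - rewrite (Ccoth_zeta e) by assumption.
    unfold Efun, E1fun.
    assert (N := strip_neq1 e (h t) E S).
    assert (H := Mint_ode e a (cc e (h t)) E A (Re_cc_pos e (h t) E S)).
    assert (J := jj_sqr e E).
    set (X := Mint e 0 a (cc e (h t))) in *.
    set (Y := Mint e 1 (a + 1) (cc e (h t))) in *.
    set (Z := Mint e 2 (a + 1 + 1) (cc e (h t))) in *.
    unfold cc in H.
    set (ze := Cexp (2 * h t)) in *; set (j := jj e) in *.
    set (x := Cexp (a * h t)).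
    assert (H' : ((1 - ze) * ze * (a * (a + 1) * Z)
       = j * ((2 * a + 3) * (1 - ze) - 2) * (a * Y) - 2 * (a * X))%C).
    { assert (Q : ((2 * (j * (1 - ze) / 2) - j) * (j * (1 - ze) / 2) * (a * (a + 1) * Z)
         = (j * j) * (- ((1 - ze) * ze / 2) * (a * (a + 1) * Z)))%C) by field.
      rewrite Q, J in H.
      replace ((1 - ze) * ze * (a * (a + 1) * Z))%C with
        (2 * (- (1) * (- ((1 - ze) * ze / 2) * (a * (a + 1) * Z))
         - ((2 * a + 3) * (j * (1 - ze) / 2) - j) * (a * Y) + a * X)
         + (j * ((2 * a + 3) * (1 - ze) - 2) * (a * Y) - 2 * (a * X)))%C by field.
      rewrite H; ring. }
    apply (Cmult_eq_reg_l' (1 - ze)%C); [exact N|].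
    transitivity (x * d * ((1 - ze) * (a * a * X + 2 * a * (a + 1) * j * ze * Y)
       + (j * j) * ze * ((1 - ze) * ze * (a * (a + 1) * Z))))%C; [ring|].
    rewrite J, H'.
    field; intros K; apply N; replace (1 - ze)%C with (- (ze - 1))%C by ring; rewrite K; ring.
Qed.

(** * Uniqueness of solutions *)

Lemma is_derive_Cmod2 f l t : cderiv f t l ->
  is_derive (fun s => Cmod (f s) ^ 2) t (2 * (Re (f t) * Re l + Im (f t) * Im l)).
Proof.
  intros [A B].
  apply (is_derive_extR (fun s => Re (f s) * Re (f s) + Im (f s) * Im (f s)));
    [intros s; rewrite Cmod2_alt; ring|].
  replace (2 * (Re (f t) * Re l + Im (f t) * Im l)) with
    ((Re l * Re (f t) + Re (f t) * Re l) + (Im l * Im (f t) + Im (f t) * Im l)) by ring.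
  apply @is_derive_plus; apply is_derive_mult'; assumption.
Qed.

Lemma Cdot_le z w : Rabs (Re z * Re w + Im z * Im w) <= Cmod z * Cmod w.
Proof.
  replace (Re z * Re w + Im z * Im w) with (Re (Cconj z * w))
    by (unfold Re, Im; simpl; ring).
  rewrite <- (Cmod_conj z), <- Cmod_mult; apply re_le_Cmod.
Qed.

(** Gronwall's argument: [N exp(-K t)] decreases and [N exp(K t)] increases, for
    [N] the squared norm of the pair. *)
Lemma pair_zero u u1 v v1 (l r t0 K : R) : 0 <= K ->
  (forall t, l <= t <= r -> cderiv u t (v t) /\ cderiv u1 t (v1 t) /\
     Cmod (v t) <= K * (Cmod (u t) + Cmod (u1 t)) /\
     Cmod (v1 t) <= K * (Cmod (u t) + Cmod (u1 t))) ->
  l <= t0 <= r -> u t0 = 0%C -> u1 t0 = 0%C ->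
  forall t, l <= t <= r -> u t = 0%C /\ u1 t = 0%C.
Proof.
  intros K0 H T0 U0 U1 t T.
  set (N := fun s => Cmod (u s) ^ 2 + Cmod (u1 s) ^ 2).
  set (N' := fun s => 2 * (Re (u s) * Re (v s) + Im (u s) * Im (v s))
                      + 2 * (Re (u1 s) * Re (v1 s) + Im (u1 s) * Im (v1 s))).
  assert (DN : forall s, l <= s <= r -> is_derive N s (N' s)).
  { intros s Hs; destruct (H s Hs) as [A [B _]].
    apply @is_derive_plus; apply is_derive_Cmod2; assumption. }
  assert (BN : forall s, l <= s <= r -> Rabs (N' s) <= 4 * K * N s).
  { intros s Hs; destruct (H s Hs) as [_ [_ [A B]]]; unfold N', N.
    eapply Rle_trans; [apply Rabs_triang|]; rewrite !Rabs_mult, (Rabs_pos_eq 2) by lra.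
    pose proof (Cdot_le (u s) (v s)); pose proof (Cdot_le (u1 s) (v1 s)).
    pose proof (Cmod_ge_0 (u s)); pose proof (Cmod_ge_0 (u1 s)).
    assert (Cmod (u s) * Cmod (v s) <= Cmod (u s) * (K * (Cmod (u s) + Cmod (u1 s))))
      by (apply Rmult_le_compat_l; assumption).
    assert (Cmod (u1 s) * Cmod (v1 s) <= Cmod (u1 s) * (K * (Cmod (u s) + Cmod (u1 s))))
      by (apply Rmult_le_compat_l; assumption).
    assert (K * (Cmod (u s) + Cmod (u1 s)) ^ 2 <= K * (2 * (Cmod (u s) ^ 2 + Cmod (u1 s) ^ 2)))
      by (apply Rmult_le_compat_l; [exact K0|pose proof (pow2_ge_0 (Cmod (u s) - Cmod (u1 s))); lra]).
    lra. }
  assert (N0 : N t0 = 0) by (unfold N; rewrite U0, U1, Cmod_0; ring).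
  assert (Npos : forall s, 0 <= N s)
    by (intros s; unfold N; pose proof (pow2_ge_0 (Cmod (u s))); pose proof (pow2_ge_0 (Cmod (u1 s))); lra).
  assert (De : forall k s, is_derive (fun s => exp (k * s)) s (k * exp (k * s)))
    by (intros k s; auto_derive; [trivial|ring]).
  assert (Nt : N t <= 0).
  { assert (mono : forall k x y, l <= x -> x <= y -> y <= r -> (k = 4 * K \/ k = - (4 * K)) ->
       k * (N y * exp (k * y) - N x * exp (k * x)) >= 0).
    { intros k x y X XY Y Hk.
      destruct (MVT_gen (fun s => N s * exp (k * s)) x y
        (fun s => N' s * exp (k * s) + N s * (k * exp (k * s)))) as [c [Hc E]].
      - intros s Hs; rewrite Rmin_left, Rmax_right in Hs by lra.
        apply (is_derive_mult' N (fun s => exp (k * s))); [apply DN; lra|apply De].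
      - intros s Hs; rewrite Rmin_left, Rmax_right in Hs by lra.
        apply continuity_pt_filterlim, (ex_derive_continuous (fun s => N s * exp (k * s))).
        eexists; apply (is_derive_mult' N (fun s => exp (k * s))); [apply DN; lra|apply De].
      - rewrite Rmin_left, Rmax_right in Hc by lra.
        rewrite E.
        assert (Bc := BN c ltac:(lra)); apply Rabs_le_between in Bc.
        pose proof (Npos c); pose proof (exp_pos (k * c)).
        apply Rle_ge.
        replace (k * ((N' c * exp (k * c) + N c * (k * exp (k * c))) * (y - x)))
          with (exp (k * c) * (y - x) * (k * (N' c + k * N c))) by ring.
        apply Rmult_le_pos; [apply Rmult_le_pos; lra|].
        destruct Hk; subst k; nra. }
    destruct (Req_dec K 0) as [Z|Z].
    - assert (forall s, l <= s <= r -> N s = N t0) as C.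
      { intros s Hs.
        destruct (MVT_gen N s t0 N') as [c [Hc E]].
        + intros x Hx; apply DN; unfold Rmin, Rmax in Hx; destruct (Rle_dec s t0); lra.
        + intros x Hx; apply continuity_pt_filterlim, (ex_derive_continuous N).
          eexists; apply DN; unfold Rmin, Rmax in Hx; destruct (Rle_dec s t0); lra.
        + assert (Bc : Rabs (N' c) <= 4 * K * N c)
            by (apply BN; unfold Rmin, Rmax in Hc; destruct (Rle_dec s t0); lra).
          rewrite Z in Bc; apply Rabs_le_between in Bc.
          replace (N' c) with 0 in E by lra; lra. }
      rewrite (C t T), N0; lra.
    - assert (KP : 0 < 4 * K) by lra.
      destruct (Rle_dec t t0) as [L|L].
      + pose proof (mono (4 * K) t t0 ltac:(lra) L ltac:(lra) (or_introl eq_refl)) as M.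
        rewrite N0 in M; pose proof (exp_pos (4 * K * t)); pose proof (Npos t).
        destruct (Rle_dec (N t) 0) as [Q|Q]; [exact Q|exfalso].
        assert (0 < N t * exp (4 * K * t)) by (apply Rmult_lt_0_compat; lra). nra.
      + pose proof (mono (- (4 * K)) t0 t ltac:(lra) ltac:(lra) ltac:(lra) (or_intror eq_refl)) as M.
        rewrite N0 in M; pose proof (exp_pos (- (4 * K) * t)); pose proof (Npos t).
        destruct (Rle_dec (N t) 0) as [Q|Q]; [exact Q|exfalso].
        assert (0 < N t * exp (- (4 * K) * t)) by (apply Rmult_lt_0_compat; lra). nra. }
  pose proof (pow2_ge_0 (Cmod (u t))); pose proof (pow2_ge_0 (Cmod (u1 t))).
  unfold N in Nt; split; apply Cmod_eq_0; nra.
Qed.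

Lemma ccont_bounded f a b : a <= b -> (forall t, a <= t <= b -> ccont f t) ->
  exists K, 0 <= K /\ forall t, a <= t <= b -> Cmod (f t) <= K.
Proof.
  intros AB H.
  destruct (continuity_ab_maj (fun t => Rabs (Re (f t)) + Rabs (Im (f t))) a b AB) as [m [Hm _]].
  { intros c Hc; apply continuity_pt_filterlim; destruct (H c Hc) as [A B].
    apply (continuous_plus (V := R_NormedModule) (fun t => Rabs (Re (f t))) (fun t => Rabs (Im (f t)))).
    - apply (continuous_comp (fun t => Re (f t)) Rabs); [exact A|apply continuous_Rabs].
    - apply (continuous_comp (fun t => Im (f t)) Rabs); [exact B|apply continuous_Rabs]. }
  exists (Rabs (Re (f m)) + Rabs (Im (f m))); split.
  - pose proof (Rabs_pos (Re (f m))); pose proof (Rabs_pos (Im (f m))); lra.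
  - intros t Ht; eapply Rle_trans; [apply Cmod_le_ReIm|apply Hm, Ht].
Qed.

Lemma leg_minus a h d y y1 v v1 t : leg a h d y y1 t -> leg a h d v v1 t ->
  leg a h d (fun s => y s - v s)%C (fun s => y1 s - v1 s)%C t.
Proof.
  intros [A B] [A' B']; split;
    (eapply cderiv_eq; [apply cderiv_minus; eassumption|]); cbn beta; ring.
Qed.

Lemma leg_plus a h d y y1 v v1 t : leg a h d y y1 t -> leg a h d v v1 t ->
  leg a h d (fun s => y s + v s)%C (fun s => y1 s + v1 s)%C t.
Proof.
  intros [A B] [A' B']; split;
    (eapply cderiv_eq; [apply cderiv_plus; eassumption|]); cbn beta; ring.
Qed.

Lemma leg_scal a h d y y1 k t : leg a h d y y1 t ->
  leg a h d (fun s => k * y s)%C (fun s => k * y1 s)%C t.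
Proof.
  intros [A B]; split; (eapply cderiv_eq; [apply cderiv_scal; eassumption|]); cbn beta; ring.
Qed.

(** Away from the zeros of [sinh] the coefficients are bounded on compact intervals,
    so that [pair_zero] applies. *)
Lemma leg_zero a h d y y1 (l r t0 : R) :
  (forall t, l < t < r -> cderiv h t d /\ Csinh (h t) <> 0%C /\ leg a h d y y1 t) ->
  l < t0 < r -> y t0 = 0%C -> y1 t0 = 0%C ->
  forall t, l < t < r -> y t = 0%C.
Proof.
  intros H T0 Y0 Y1 t T.
  set (p := Rmin t t0); set (q := Rmax t t0).
  assert (PQ : p <= q /\ l < p /\ q < r /\ p <= t <= q /\ p <= t0 <= q).
  { unfold p, q, Rmin, Rmax; destruct (Rle_dec t t0); lra. }
  destruct PQ as [PQ [LP [QR [PT PT0]]]].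
  destruct (ccont_bounded (fun s => Ccoth (h s)) p q PQ) as [K [K0 HK]].
  { intros s Hs; destruct (H s ltac:(lra)) as [D [S _]].
    eapply cderiv_ccont, cderiv_div;
      [apply cderiv_Ccosh, D|apply cderiv_Csinh, D|exact S]. }
  set (B := (1 + Cmod (a * (a - 1)) + K) * Cmod d).
  apply (pair_zero y y1 (fun s => y1 s * d)%C
    (fun s => (a * (a - 1) * y s - Ccoth (h s) * y1 s) * d)%C p q t0 B); try assumption.
  - unfold B; pose proof (Cmod_ge_0 (a * (a - 1))); pose proof (Cmod_ge_0 d); nra.
  - intros s Hs; destruct (H s ltac:(lra)) as [_ [_ [D1 D2]]].
    split; [exact D1|split; [exact D2|split]].
    + rewrite Cmod_mult; unfold B.
      pose proof (Cmod_ge_0 (a * (a - 1))); pose proof (Cmod_ge_0 d);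
      pose proof (Cmod_ge_0 (y s)); pose proof (Cmod_ge_0 (y1 s)).
      replace ((1 + Cmod (a * (a - 1)) + K) * Cmod d * (Cmod (y s) + Cmod (y1 s))) with
        (((1 + Cmod (a * (a - 1)) + K) * (Cmod (y s) + Cmod (y1 s))) * Cmod d) by ring.
      apply Rmult_le_compat_r; [assumption|nra].
    + rewrite Cmod_mult; unfold B.
      pose proof (Cmod_ge_0 (a * (a - 1))); pose proof (Cmod_ge_0 d);
      pose proof (Cmod_ge_0 (y s)); pose proof (Cmod_ge_0 (y1 s)).
      replace ((1 + Cmod (a * (a - 1)) + K) * Cmod d * (Cmod (y s) + Cmod (y1 s))) with
        (((1 + Cmod (a * (a - 1)) + K) * (Cmod (y s) + Cmod (y1 s))) * Cmod d) by ring.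
      apply Rmult_le_compat_r; [assumption|].
      eapply Rle_trans; [apply Cmod_triangle|]; rewrite Cmod_opp, (Cmod_mult _ (y s)), (Cmod_mult _ (y1 s)).
      specialize (HK s Hs); pose proof (Cmod_ge_0 (Ccoth (h s))); nra.
Qed.

(** Abel's identity. *)
Lemma leg_wronskian a h d y y1 v v1 (l r : R) :
  (forall t, l < t < r -> cderiv h t d /\ Csinh (h t) <> 0%C /\
     leg a h d y y1 t /\ leg a h d v v1 t) ->
  forall s t, l < s < r -> l < t < r ->
  (Csinh (h s) * (y s * v1 s - y1 s * v s) = Csinh (h t) * (y t * v1 t - y1 t * v t))%C.
Proof.
  intros H.
  apply (cderiv_0_const (fun s => Csinh (h s) * (y s * v1 s - y1 s * v s))%C l r).
  intros t T; destruct (H t T) as [D [S [[A B] [A' B']]]].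
  eapply cderiv_eq.
  - apply cderiv_mult; [apply cderiv_Csinh, D|].
    apply cderiv_minus; apply cderiv_mult; eassumption.
  - cbn beta; unfold Ccoth; field; exact S.
Qed.

(** The multiple of [v] with the value of [y] at [t0] also has its derivative there, so
    [leg_zero] applies to the difference. *)
Lemma leg_proportional a h d y y1 v v1 (l r t0 : R) :
  (forall t, l < t < r -> cderiv h t d /\ Csinh (h t) <> 0%C /\
     leg a h d y y1 t /\ leg a h d v v1 t) ->
  l < t0 < r -> v t0 <> 0%C -> (y t0 * v1 t0 - y1 t0 * v t0 = 0)%C ->
  forall t, l < t < r -> y t = (y t0 / v t0 * v t)%C.
Proof.
  intros H T0 V W t T.
  set (k := (y t0 / v t0)%C).
  assert (Z : (y t - k * v t = 0)%C).
  { apply (leg_zero a h d (fun s => y s - k * v s)%C (fun s => y1 s - k * v1 s)%C l r t0).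
    - intros s Hs; destruct (H s Hs) as [D [S [A B]]]; split; [exact D|split; [exact S|]].
      apply leg_minus; [exact A|apply leg_scal, B].
    - exact T0.
    - unfold k; field; exact V.
    - unfold k; replace (y1 t0 - y t0 / v t0 * v1 t0)%C with
        (- (y t0 * v1 t0 - y1 t0 * v t0) / v t0)%C by (field; exact V).
      rewrite W; field; exact V.
    - exact T. }
  replace (y t) with ((y t - k * v t) + k * v t)%C by ring; rewrite Z; ring.
Qed.

Lemma tends0_const (F : (R -> Prop) -> Prop) (f : R -> C) (c : C) :
  ProperFilter F -> F (fun t => f t = c) -> tends0 F f -> c = 0%C.
Proof.
  intros PF H T; apply Cmod_eq_0.
  destruct (Rle_lt_or_eq_dec 0 (Cmod c) (Cmod_ge_0 c)) as [L|L]; [exfalso|symmetry; exact L].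
  destruct (filter_ex _ (filter_and _ _ H (T _ L))) as [t [A B]].
  rewrite A in B; lra.
Qed.

(** * Complex power series *)

Definition Cser (a : nat -> C) (l : C) : Prop :=
  is_series (K := C_AbsRing) (V := C_NormedModule) a l.

Lemma Cser_unique a l m : Cser a l -> Cser a m -> l = m.
Proof.
  intros A B.
  exact (filterlim_locally_unique (V := C_NormedModule) (F := eventually) _ _ _ A B).
Qed.

Lemma Cser_ext a b l : (forall n, a n = b n) -> Cser a l -> Cser b l.
Proof. intros H; apply (is_series_ext (V := C_NormedModule)); exact H. Qed.

Lemma Cser_plus a b l m : Cser a l -> Cser b m -> Cser (fun n => a n + b n)%C (l + m)%C.
Proof. intros A B; exact (is_series_plus (V := C_NormedModule) a b l m A B). Qed.

Lemma Cser_scal c a l : Cser a l -> Cser (fun n => c * a n)%C (c * l)%C.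
Proof. intros A; exact (is_series_scal (V := C_NormedModule) c a l A). Qed.

Lemma Cser_0 : Cser (fun _ => RtoC 0) (RtoC 0).
Proof.
  intros P HP; exists 0%nat; intros n _.
  assert (E : sum_n (G := C_NormedModule) (fun _ => RtoC 0) n = RtoC 0).
  { induction n as [|n IH]; [apply sum_O|].
    rewrite sum_Sn, IH; apply C_eq; unfold plus; simpl; ring. }
  rewrite E; apply locally_singleton; exact HP.
Qed.

Lemma Cser_decr a l : Cser (fun n => a (S n)) l -> Cser a (a 0%nat + l)%C.
Proof.
  intros H; apply (is_series_decr_1 (V := C_NormedModule)).
  assert (E : plus (G := C_NormedModule) (a 0%nat + l)%C (opp (a 0%nat)) = l).
  { change ((a 0%nat + l) + - a 0%nat = l)%C; ring. }
  exact (eq_ind_r (Cser (fun k => a (S k))) H E).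
Qed.

Lemma Cser_lim a l : Cser a l <->
  forall eps, 0 < eps -> exists N, forall n, (N <= n)%nat ->
    Cmod (sum_n (G := C_NormedModule) a n - l) < eps.
Proof.
  split.
  - intros H eps He.
    assert (L : locally (T := C_NormedModule) l (fun y => Cmod (y - l) < eps)).
    { apply (locally_le_locally_norm (V := C_NormedModule)).
      exists (mkposreal eps He); intros y Hy; exact Hy. }
    exact (H _ L).
  - intros H P HP.
    apply (locally_norm_le_locally (V := C_NormedModule)) in HP; destruct HP as [eps HP].
    destruct (H eps (cond_pos eps)) as [N HN].
    exists N; intros n Hn; apply HP; exact (HN n Hn).
Qed.

Lemma Cser_dom a M q : 0 <= q < 1 -> (forall n, Cmod (a n) <= M * q ^ n) ->
  exists l, Cser a l /\ Cmod l <= M / (1 - q).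
Proof.
  intros Q H.
  assert (M0 : 0 <= M) by (specialize (H 0%nat); simpl in H; pose proof (Cmod_ge_0 (a 0%nat)); lra).
  destruct (ex_series_le (K := C_AbsRing) (V := C_CompleteNormedModule) a (fun n => M * q ^ n))
    as [l Hl].
  - exact H.
  - apply (ex_series_scal (V := R_NormedModule) M (fun n => q ^ n)), ex_series_geom.
    rewrite Rabs_pos_eq; lra.
  - exists l; split; [exact Hl|].
    assert (S : forall n, Cmod (sum_n (G := C_NormedModule) a n) <= M / (1 - q)).
    { assert (S : forall n, Cmod (sum_n (G := C_NormedModule) a n) <= M * (1 - q ^ (S n)) / (1 - q)).
      { induction n as [|n IH].
        - rewrite sum_O; eapply Rle_trans; [apply H|]; simpl; right; field; lra.
        - rewrite sum_Sn; change plus with Cplus.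
          eapply Rle_trans; [apply Cmod_triangle|].
          eapply Rle_trans; [apply Rplus_le_compat; [exact IH|apply H]|].
          right; simpl; field; lra. }
      intros n; eapply Rle_trans; [apply S|].
      unfold Rdiv; apply Rmult_le_compat_r; [left; apply Rinv_0_lt_compat; lra|].
      assert (0 <= q ^ (Datatypes.S n)) by (apply pow_le; lra). nra. }
    destruct (Rle_dec (Cmod l) (M / (1 - q))) as [L|L]; [exact L|exfalso].
    destruct (proj1 (Cser_lim a l) Hl (Cmod l - M / (1 - q))) as [N HN]; [lra|].
    specialize (HN N (le_n N)); specialize (S N).
    assert (Cmod l <= Cmod (sum_n (G := C_NormedModule) a N - l) + Cmod (sum_n (G := C_NormedModule) a N)).
    { replace l with (- (sum_n (G := C_NormedModule) a N - l) + sum_n (G := C_NormedModule) a N)%C at 1 by ring.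
      eapply Rle_trans; [apply Cmod_triangle|]; rewrite Cmod_opp; lra. }
    lra.
Qed.

Lemma Cser_terms a l : Cser a l -> exists M, forall n, Cmod (a n) <= M.
Proof.
  intros H; destruct (proj1 (Cser_lim a l) H 1 Rlt_0_1) as [N HN].
  assert (T : forall n, (N <= n)%nat -> Cmod (a (S n)) <= 2).
  { intros n Hn.
    pose proof (HN n Hn) as A; pose proof (HN (S n) ltac:(lia)) as B.
    rewrite sum_Sn in B; change plus with Cplus in B.
    replace (a (S n)) with ((sum_n (G := C_NormedModule) a n + a (S n) - l)
      + - (sum_n (G := C_NormedModule) a n - l))%C by ring.
    eapply Rle_trans; [apply Cmod_triangle|]; rewrite Cmod_opp; lra. }
  assert (F : forall k, exists M, forall n, (n <= k)%nat -> Cmod (a n) <= M).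
  { induction k as [|k [M IH]].
    - exists (Cmod (a 0%nat)); intros n Hn; replace n with 0%nat by lia; lra.
    - exists (Rmax M (Cmod (a (S k)))); intros n Hn.
      destruct (Nat.eq_dec n (S k)) as [->|E]; [apply Rmax_r|].
      eapply Rle_trans; [apply IH; lia|apply Rmax_l]. }
  destruct (F N) as [M HM]; exists (Rmax M 2); intros n.
  destruct (Compare_dec.le_lt_dec n N) as [L|L].
  - eapply Rle_trans; [apply HM, L|apply Rmax_l].
  - destruct n as [|n]; [lia|]; eapply Rle_trans; [apply T; lia|apply Rmax_r].
Qed.

Lemma pseries_Cser a w l :
  is_pseries (K := C_AbsRing) (V := C_NormedModule) a w l <-> Cser (fun n => w ^ n * a n)%C l.
Proof.
  unfold is_pseries, Cser; split; apply (is_series_ext (V := C_NormedModule)); intros n; reflexivity.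
Qed.

(** The sum, selected as in the definition of [hyp2F1]. *)
Definition CPS (a : nat -> C) (w : C) : C :=
  iota (T := C_CompleteNormedModule)
    (is_pseries (K := C_AbsRing) (V := C_NormedModule) a w).

Lemma CPS_unique a w l : Cser (fun n => w ^ n * a n)%C l -> CPS a w = l.
Proof.
  intros H; apply pseries_Cser in H.
  assert (I : is_pseries (K := C_AbsRing) (V := C_NormedModule) a w (CPS a w)).
  { apply (iota_correct (V := C_CompleteNormedModule)
      (is_pseries (K := C_AbsRing) (V := C_NormedModule) a w)).
    exists l; split; [exact H|]; intros m Hm; exact (Cser_unique _ _ _ H Hm). }
  exact (Cser_unique _ _ _ I H).
Qed.

(** Coefficients dominated by a geometric sequence. *)
Definition bnd (a : nat -> C) (r : R) : Prop := exists M, forall n, Cmod (a n) * r ^ n <= M.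

Lemma Cmod_Cpow (w : C) n : Cmod (w ^ n)%C = Cmod w ^ n.
Proof. apply Cmod_pow. Qed.

Lemma bnd_geom a r s : 0 < r -> 0 <= s -> bnd a r ->
  exists M, 0 <= M /\ forall n, Cmod (a n) * s ^ n <= M * (s / r) ^ n.
Proof.
  intros R0 S0 [M H]; exists M; split.
  - eapply Rle_trans; [|apply (H 0%nat)]; simpl; pose proof (Cmod_ge_0 (a 0%nat)); lra.
  - intros n.
    replace (Cmod (a n) * s ^ n) with (Cmod (a n) * r ^ n * (s / r) ^ n).
    + apply Rmult_le_compat_r; [apply pow_le, Rmult_le_pos; [exact S0|left; apply Rinv_0_lt_compat, R0]|apply H].
    + rewrite Rmult_assoc, <- Rpow_mult_distr; do 2 f_equal; field; lra.
Qed.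

Lemma CPS_Cser a r w : bnd a r -> Cmod w < r -> Cser (fun n => w ^ n * a n)%C (CPS a w).
Proof.
  intros B W; pose proof (Cmod_ge_0 w) as W0.
  destruct (bnd_geom a r (Cmod w) ltac:(lra) W0 B) as [M [M0 H]].
  destruct (Cser_dom (fun n => w ^ n * a n)%C M (Cmod w / r)) as [l [Hl _]].
  - split; [apply Rmult_le_pos; [exact W0|left; apply Rinv_0_lt_compat; lra]|].
    apply Rmult_lt_reg_r with r; [lra|]; unfold Rdiv; rewrite Rmult_assoc, Rinv_l; lra.
  - intros n; rewrite Cmod_mult, Cmod_Cpow, Rmult_comm; apply H.
  - rewrite (CPS_unique _ _ _ Hl); exact Hl.
Qed.

Lemma bnd_scaln a r s : 0 < s < r -> bnd a r -> bnd (fun n => RtoC (INR n) * a n)%C s.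
Proof.
  intros S B; destruct (bnd_geom a r s ltac:(lra) ltac:(lra) B) as [M [M0 H]].
  set (d := r / s - 1).
  assert (D : 0 < d).
  { unfold d; assert (1 < r / s); [|lra].
    apply Rmult_lt_reg_r with s; [lra|]; unfold Rdiv; rewrite Rmult_assoc, Rinv_l; lra. }
  assert (Q : s / r = / (1 + d)) by (unfold d; field; lra).
  exists (M * / d); intros n.
  rewrite Cmod_mult, Cmod_R, Rabs_pos_eq, Rmult_assoc by apply pos_INR.
  pose proof (pos_INR n) as N.
  eapply Rle_trans; [apply Rmult_le_compat_l; [exact N|apply H]|].
  rewrite Q, pow_inv.
  assert (P : 1 + INR n * d <= (1 + d) ^ n) by (apply poly; lra).
  assert (P0 : 0 < (1 + d) ^ n) by (apply pow_lt; lra).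
  apply Rmult_le_reg_r with ((1 + d) ^ n); [exact P0|].
  replace (INR n * (M * / (1 + d) ^ n) * (1 + d) ^ n) with (M * INR n) by (field; lra).
  apply Rmult_le_reg_r with d; [exact D|].
  replace (M * / d * (1 + d) ^ n * d) with (M * (1 + d) ^ n) by (field; lra).
  rewrite Rmult_assoc; apply Rmult_le_compat_l; lra.
Qed.

Definition dcoef (a : nat -> C) (n : nat) : C := (RtoC (INR (S n)) * a (S n))%C.

Lemma bnd_shift a r : 0 < r -> bnd a r -> bnd (fun n => a (S n)) r.
Proof.
  intros R0 [M H]; exists (M / r); intros n.
  apply Rmult_le_reg_r with r; [exact R0|].
  unfold Rdiv; rewrite (Rmult_assoc M), Rinv_l, Rmult_1_r by lra.
  eapply Rle_trans; [|apply (H (S n))]; simpl; right; ring.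
Qed.

Lemma bnd_dcoef a r s : 0 < s < r -> bnd a r -> bnd (dcoef a) s.
Proof.
  intros S B; exact (bnd_shift _ s ltac:(lra) (bnd_scaln a r s S B)).
Qed.

Lemma Cpow_diff_bound (w h : C) (s : R) n : 0 < s -> Cmod w <= s -> Cmod (w + h) <= s ->
  s ^ 2 * Cmod ((w + h) ^ n - w ^ n - RtoC (INR n) * h * w ^ (pred n))%C
  <= INR n ^ 2 * Cmod h ^ 2 * s ^ n.
Proof.
  intros Sp W WH; induction n as [|n IH].
  - simpl pred; simpl Cpow; simpl INR.
    replace (1 - 1 - 0 * h * 1)%C with (RtoC 0) by ring.
    rewrite Cmod_0; lra.
  - assert (E : ((w + h) ^ (S n) - w ^ (S n) - RtoC (INR (S n)) * h * w ^ (pred (S n)))%C =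
      ((w + h) * ((w + h) ^ n - w ^ n - RtoC (INR n) * h * w ^ (pred n))
       + RtoC (INR n) * (h * h) * w ^ (pred n))%C).
    { rewrite S_INR, RtoC_plus; simpl pred.
      destruct n as [|m]; [simpl; ring|].
      simpl pred; simpl Cpow; ring. }
    rewrite E.
    apply Rle_trans with (s * (s ^ 2 * Cmod ((w + h) ^ n - w ^ n - RtoC (INR n) * h * w ^ (pred n))%C)
      + INR n * Cmod h ^ 2 * s ^ S n).
    + assert (T : s ^ 2 * Cmod (RtoC (INR n) * (h * h) * w ^ (pred n))%C <= INR n * Cmod h ^ 2 * s ^ S n).
      { rewrite !Cmod_mult, Cmod_R, Rabs_pos_eq, Cmod_Cpow by apply pos_INR.
        destruct n as [|m]; [simpl; lra|]; simpl pred.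
        assert (Cmod w ^ m <= s ^ m) by (apply pow_incr; split; [apply Cmod_ge_0|exact W]).
        pose proof (pos_INR (S m)).
        replace (INR (S m) * Cmod h ^ 2 * s ^ S (S m)) with
          (INR (S m) * Cmod h ^ 2 * s ^ 2 * s ^ m) by (simpl; ring).
        replace (s ^ 2 * (INR (S m) * (Cmod h * Cmod h) * Cmod w ^ m)) with
          (INR (S m) * Cmod h ^ 2 * s ^ 2 * Cmod w ^ m) by ring.
        apply Rmult_le_compat_l; [|assumption].
        pose proof (pow2_ge_0 (Cmod h)); pose proof (pow2_ge_0 s).
        apply Rmult_le_pos; [apply Rmult_le_pos|]; assumption. }
      assert (T2 := Cmod_triangle ((w + h) * ((w + h) ^ n - w ^ n - RtoC (INR n) * h * w ^ (pred n)))
        (RtoC (INR n) * (h * h) * w ^ (pred n))).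
      rewrite (Cmod_mult (w + h)) in T2.
      set (x := Cmod ((w + h) ^ n - w ^ n - RtoC (INR n) * h * w ^ (pred n))%C) in *.
      assert (0 <= x) by apply Cmod_ge_0.
      assert (Cmod (w + h) * x <= s * x) by (apply Rmult_le_compat_r; assumption).
      pose proof (pow2_ge_0 s). nra.
    + assert (s * (s ^ 2 * Cmod ((w + h) ^ n - w ^ n - RtoC (INR n) * h * w ^ (pred n))%C)
        <= s * (INR n ^ 2 * Cmod h ^ 2 * s ^ n)) by (apply Rmult_le_compat_l; lra).
      rewrite S_INR.
      assert (0 <= Cmod h ^ 2 * s ^ S n)
        by (apply Rmult_le_pos; [apply pow2_ge_0|left; apply pow_lt, Sp]).
      pose proof (pos_INR n).
      replace (s * (INR n ^ 2 * Cmod h ^ 2 * s ^ n)) with (INR n ^ 2 * (Cmod h ^ 2 * s ^ S n)) in *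
        by (simpl; ring).
      nra.
Qed.

(** Termwise differentiation: the second-order remainders of the powers, bounded by
    [Cpow_diff_bound], have a convergent sum. *)
Lemma CPS_cdiff a r w : bnd a r -> Cmod w < r -> cdiff (CPS a) w (CPS (dcoef a) w).
Proof.
  intros B W; pose proof (Cmod_ge_0 w) as W0.
  set (s := (Cmod w + r) / 2).
  set (s1 := (s + r) / 2); set (s2 := (s + s1) / 2).
  assert (Ss : 0 < s /\ Cmod w < s /\ s < s2 /\ s2 < s1 /\ s1 < r) by (unfold s2, s1, s; lra).
  destruct Ss as [S0 [WS [S12 [S21 S1r]]]].
  assert (B1 := bnd_scaln a r s1 ltac:(lra) B).
  assert (B2 := bnd_scaln _ s1 s2 ltac:(lra) B1).
  destruct (bnd_geom _ s2 s ltac:(lra) ltac:(lra) B2) as [M [M0 HM]].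
  assert (Q : 0 <= s / s2 < 1).
  { split; [apply Rmult_le_pos; [lra|left; apply Rinv_0_lt_compat; lra]|].
    apply Rmult_lt_reg_r with s2; [lra|]; unfold Rdiv; rewrite Rmult_assoc, Rinv_l; lra. }
  set (K := M / (1 - s / s2) / s ^ 2).
  assert (main : forall v, Cmod (v - w) < s - Cmod w ->
    Cmod (CPS a v - CPS a w - CPS (dcoef a) w * (v - w)) <= K * Cmod (v - w) ^ 2).
  { intros v Hv.
    set (h := (v - w)%C) in *.
    assert (V : v = (w + h)%C) by (unfold h; ring).
    assert (VS : Cmod (w + h) <= s)
      by (eapply Rle_trans; [apply Cmod_triangle|]; lra).
    assert (I1 := CPS_Cser a r v B ltac:(rewrite V; lra)).
    assert (I2 := CPS_Cser a r w B ltac:(lra)).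
    assert (I3 := CPS_Cser (dcoef a) s1 w (bnd_dcoef a r s1 ltac:(lra) B) ltac:(lra)).
    assert (I4 : Cser (fun n => RtoC (INR n) * h * w ^ (pred n) * a n)%C (h * CPS (dcoef a) w)%C).
    { replace (h * CPS (dcoef a) w)%C with
        ((fun n => RtoC (INR n) * h * w ^ (pred n) * a n)%C 0%nat + h * CPS (dcoef a) w)%C
        by (simpl; ring).
      apply (Cser_decr (fun n => RtoC (INR n) * h * w ^ (pred n) * a n)%C).
      eapply Cser_ext; [|apply (Cser_scal h), I3].
      intros n; unfold dcoef; simpl pred; cbn beta; ring. }
    assert (I5 := Cser_plus _ _ _ _ (Cser_plus _ _ _ _ I1 (Cser_scal (- (1)) _ _ I2))
                    (Cser_scal (- (1)) _ _ I4)).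
    destruct (Cser_dom (fun n => ((w + h) ^ n - w ^ n - RtoC (INR n) * h * w ^ (pred n)) * a n)%C
      (Cmod h ^ 2 / s ^ 2 * M) (s / s2) Q) as [l [Hl Bl]].
    - intros n; rewrite Cmod_mult.
      assert (P := Cpow_diff_bound w h s n S0 ltac:(lra) VS).
      specialize (HM n); rewrite !Cmod_mult, Cmod_R, (Rabs_pos_eq (INR n)) in HM by apply pos_INR.
      assert (s2p : 0 < s ^ 2) by (apply pow_lt, S0).
      apply Rmult_le_reg_l with (s ^ 2); [exact s2p|].
      rewrite <- Rmult_assoc.
      replace (s ^ 2 * (Cmod h ^ 2 / s ^ 2 * M * (s / s2) ^ n)) with
        (Cmod h ^ 2 * (M * (s / s2) ^ n)) by (field; lra).
      eapply Rle_trans; [apply Rmult_le_compat_r; [apply Cmod_ge_0|exact P]|].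
      replace (INR n ^ 2 * Cmod h ^ 2 * s ^ n * Cmod (a n)) with
        (Cmod h ^ 2 * (INR n * (INR n * Cmod (a n)) * s ^ n)) by ring.
      apply Rmult_le_compat_l; [apply pow2_ge_0|exact HM].
    - replace (CPS a v - CPS a w - CPS (dcoef a) w * h)%C with l.
      + eapply Rle_trans; [exact Bl|]; unfold K; right; field.
        split; [lra|]. split; [|lra]. intros E; apply (f_equal (fun x => x / s2)) in E.
        assert (1 - s / s2 = 0); [|lra].
        replace (1 - s / s2) with ((s2 - s) / s2) by (field; lra). unfold Rdiv in *; lra.
      + apply (Cser_unique _ _ _ Hl).
        replace (CPS a v - CPS a w - CPS (dcoef a) w * h)%C with
          (CPS a v + - (1) * CPS a w + - (1) * (h * CPS (dcoef a) w))%C by ring.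
        eapply Cser_ext; [|exact I5].
        intros n; cbn beta; rewrite V; ring. }
  intros eps He.
  assert (K0 : 0 <= K).
  { unfold K; apply Rmult_le_pos; [apply Rmult_le_pos; [exact M0|]|];
      left; apply Rinv_0_lt_compat; [lra|apply pow_lt, S0]. }
  exists (Rmin (s - Cmod w) (eps / (K + 1))); split.
  { apply Rmin_glb_lt; [lra|apply Rdiv_lt_0_compat; lra]. }
  intros v Hv.
  assert (V1 : Cmod (v - w) < s - Cmod w) by (eapply Rlt_le_trans; [exact Hv|apply Rmin_l]).
  assert (V2 : Cmod (v - w) < eps / (K + 1)) by (eapply Rlt_le_trans; [exact Hv|apply Rmin_r]).
  eapply Rle_trans; [apply main, V1|].
  apply (Rmult_lt_compat_l (K + 1)) in V2; [|lra].
  replace ((K + 1) * (eps / (K + 1))) with eps in V2 by (field; lra).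
  pose proof (Cmod_ge_0 (v - w)).
  replace (K * Cmod (v - w) ^ 2) with (K * Cmod (v - w) * Cmod (v - w)) by ring.
  apply Rmult_le_compat_r; [assumption|]; nra.
Qed.

Lemma CPS_0 a : CPS a 0 = a 0%nat.
Proof.
  apply CPS_unique.
  assert (E : a 0%nat = ((fun n => 0 ^ n * a n) 0%nat + 0)%C) by (simpl; ring).
  rewrite E.
  apply (Cser_decr (fun n => 0 ^ n * a n)%C).
  eapply Cser_ext; [|apply Cser_0]; intros n; simpl; ring.
Qed.

Lemma CPS_step a r w : 0 < r -> bnd a r -> Cmod w < r ->
  CPS a w = (a 0%nat + w * CPS (fun n => a (S n)) w)%C.
Proof.
  intros R0 B W; apply CPS_unique.
  assert (E : (a 0%nat + w * CPS (fun n => a (S n)) w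
               = (fun n => w ^ n * a n) 0%nat + w * CPS (fun n => a (S n)) w)%C)
    by (simpl; ring).
  rewrite E; apply (Cser_decr (fun n => w ^ n * a n)%C).
  eapply Cser_ext; [|apply (Cser_scal w), (CPS_Cser _ r w (bnd_shift a r R0 B) W)].
  intros n; simpl; ring.
Qed.

(** The constant term vanishes by continuity, and division by the variable keeps the
    accumulation of zeros. *)
Lemma CPS_zeros a r : 0 < r -> bnd a r ->
  (forall d, 0 < d -> exists w : C, w <> 0%C /\ Cmod w < d /\ CPS a w = 0%C) ->
  forall n, a n = 0%C.
Proof.
  intros R0 B Z n; revert a B Z; induction n as [|n IH]; intros a B Z.
  - apply Cmod_eq_0; destruct (Rle_lt_or_eq_dec 0 _ (Cmod_ge_0 (a 0%nat))) as [L|L]; [exfalso|auto].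
    assert (D := CPS_cdiff a r 0 B ltac:(rewrite Cmod_0; exact R0)).
    destruct (cdiff_cont _ _ _ D _ L) as [d [D0 Hd]].
    destruct (Z d D0) as [w [W0 [W1 W2]]].
    specialize (Hd w); replace (w - 0)%C with w in Hd by ring.
    specialize (Hd W1); rewrite W2, CPS_0 in Hd.
    replace (0 - a 0%nat)%C with (- a 0%nat)%C in Hd by ring; rewrite Cmod_opp in Hd; lra.
  - assert (A0 : a 0%nat = 0%C).
    { clear IH; apply Cmod_eq_0; destruct (Rle_lt_or_eq_dec 0 _ (Cmod_ge_0 (a 0%nat))) as [L|L]; [exfalso|auto].
      assert (D := CPS_cdiff a r 0 B ltac:(rewrite Cmod_0; exact R0)).
      destruct (cdiff_cont _ _ _ D _ L) as [d [D0 Hd]].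
      destruct (Z d D0) as [w [W0 [W1 W2]]].
      specialize (Hd w); replace (w - 0)%C with w in Hd by ring.
      specialize (Hd W1); rewrite W2, CPS_0 in Hd.
      replace (0 - a 0%nat)%C with (- a 0%nat)%C in Hd by ring; rewrite Cmod_opp in Hd; lra. }
    apply (IH (fun n => a (S n)) (bnd_shift a r R0 B)).
    intros d D0; destruct (Z (Rmin d r)) as [w [W0 [W1 W2]]]; [apply Rmin_glb_lt; assumption|].
    exists w; split; [exact W0|split; [eapply Rlt_le_trans; [exact W1|apply Rmin_l]|]].
    rewrite (CPS_step a r w R0 B) in W2 by (eapply Rlt_le_trans; [exact W1|apply Rmin_r]).
    rewrite A0 in W2.
    transitivity (/ w * (0 + w * CPS (fun n => a (S n)) w))%C; [field; exact W0|rewrite W2; ring].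
Qed.

(** * Analytic functions and the identity theorem *)

Definition local_series (f : C -> C) (z0 : C) (a : nat -> C) (r : R) : Prop :=
  0 < r /\ (forall s, 0 < s < r -> bnd a s) /\
  forall z, Cmod (z - z0) < r -> f z = CPS a (z - z0).

Lemma local_series_of f z0 a r : 0 < r ->
  (forall z, Cmod (z - z0) < r ->
     is_pseries (K := C_AbsRing) (V := C_NormedModule) a (z - z0)%C (f z)) ->
  local_series f z0 a r.
Proof.
  intros R0 H; split; [exact R0|split].
  - intros s S.
    assert (E : (z0 + RtoC s - z0)%C = RtoC s) by ring.
    specialize (H (z0 + RtoC s)%C); rewrite E in H.
    rewrite Cmod_R, Rabs_pos_eq in H by lra; specialize (H ltac:(lra)).
    apply pseries_Cser in H; destruct (Cser_terms _ _ H) as [M HM].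
    exists M; intros n; eapply Rle_trans; [|apply (HM n)].
    rewrite Cmod_mult, Cmod_Cpow, Cmod_R, Rabs_pos_eq by lra; lra.
  - intros z Hz; symmetry; apply CPS_unique, pseries_Cser, H, Hz.
Qed.

Lemma analytic_local D f z : analytic_on D f -> D z -> exists a r, local_series f z a r.
Proof.
  intros A Z; destruct (A z Z) as [a [r [R0 H]]]; exists a, r.
  apply local_series_of; assumption.
Qed.

Lemma cdiff_ext_loc f g z l r : 0 < r -> (forall w, Cmod (w - z) < r -> f w = g w) ->
  cdiff g z l -> cdiff f z l.
Proof.
  intros R0 E H eps He; destruct (H eps He) as [d [D Hd]].
  exists (Rmin d r); split; [apply Rmin_glb_lt; assumption|].
  intros w Hw; rewrite !E.
  - apply Hd; eapply Rlt_le_trans; [exact Hw|apply Rmin_l].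
  - replace (z - z)%C with (RtoC 0) by ring; rewrite Cmod_0; exact R0.
  - eapply Rlt_le_trans; [exact Hw|apply Rmin_r].
Qed.

Lemma cdiff_shift f z0 z l : cdiff f (z - z0) l -> cdiff (fun w => f (w - z0)%C) z l.
Proof.
  intros H eps He; destruct (H eps He) as [d [D Hd]]; exists d; split; [exact D|].
  intros w Hw; specialize (Hd (w - z0)%C).
  replace (w - z0 - (z - z0))%C with (w - z)%C in Hd by ring; apply Hd, Hw.
Qed.

Lemma local_series_cdiff f z0 a r z : local_series f z0 a r -> Cmod (z - z0) < r ->
  cdiff f z (CPS (dcoef a) (z - z0)).
Proof.
  intros [R0 [B H]] Hz.
  apply (cdiff_ext_loc f (fun w => CPS a (w - z0)) z _ (r - Cmod (z - z0))); [lra| |].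
  - intros w Hw; apply H.
    replace (w - z0)%C with ((w - z) + (z - z0))%C by ring.
    eapply Rle_lt_trans; [apply Cmod_triangle|]; lra.
  - apply (cdiff_shift (CPS a)), (CPS_cdiff a ((Cmod (z - z0) + r) / 2)); [|lra].
    pose proof (Cmod_ge_0 (z - z0)); apply B; lra.
Qed.

(** The complex derivative as a total function, read off along the real direction. *)
Definition deriv (f : C -> C) (z : C) : C := CDerive (fun t => f (z + RtoC t)%C) 0.

Lemma deriv_eq f z l : cdiff f z l -> deriv f z = l.
Proof.
  intros H; apply CDerive_eq; eapply cderiv_eq.
  - apply (cderiv_comp f (fun t => z + RtoC t)%C).
    + replace (z + RtoC 0)%C with z by ring; exact H.
    + apply cderiv_plus; [apply cderiv_const|apply cderiv_id].
  - ring.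
Qed.

Lemma analytic_cdiff D f z : analytic_on D f -> D z -> cdiff f z (deriv f z).
Proof.
  intros A Z; destruct (analytic_local D f z A Z) as [a [r H]].
  assert (K := local_series_cdiff f z a r z H).
  replace (z - z)%C with (RtoC 0) in K by ring; rewrite Cmod_0 in K.
  specialize (K (proj1 H)); rewrite (deriv_eq f z _ K); exact K.
Qed.

Lemma analytic_deriv D f : analytic_on D f -> analytic_on D (deriv f).
Proof.
  intros A z Z; destruct (analytic_local D f z A Z) as [a [r H]].
  exists (dcoef a), r; split; [apply H|]; intros w Hw.
  rewrite (deriv_eq f w _ (local_series_cdiff f z a r w H Hw)).
  apply pseries_Cser; destruct H as [R0 [B _]].
  pose proof (Cmod_ge_0 (w - z)).
  apply (CPS_Cser _ ((2 * Cmod (w - z) + r) / 3)); [|lra].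
  apply (bnd_dcoef a ((Cmod (w - z) + 2 * r) / 3)); [lra|apply B; lra].
Qed.

Lemma analytic_plus D f g : analytic_on D f -> analytic_on D g ->
  analytic_on D (fun z => f z + g z)%C.
Proof.
  intros A B z Z; destruct (A z Z) as [a [r [R0 Ha]]]; destruct (B z Z) as [b [s [S0 Hb]]].
  exists (fun n => a n + b n)%C, (Rmin r s); split; [apply Rmin_glb_lt; assumption|].
  intros w Hw.
  assert (W1 : Cmod (w - z) < r) by (eapply Rlt_le_trans; [exact Hw|apply Rmin_l]).
  assert (W2 : Cmod (w - z) < s) by (eapply Rlt_le_trans; [exact Hw|apply Rmin_r]).
  specialize (Ha w W1); specialize (Hb w W2); rewrite !pseries_Cser in *.
  eapply Cser_ext; [|apply (Cser_plus _ _ _ _ Ha Hb)]; intros n; cbn beta; ring.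
Qed.

Lemma analytic_scal D k f : analytic_on D f -> analytic_on D (fun z => k * f z)%C.
Proof.
  intros A z Z; destruct (A z Z) as [a [r [R0 Ha]]].
  exists (fun n => k * a n)%C, r; split; [exact R0|]; intros w Hw.
  specialize (Ha w Hw); rewrite !pseries_Cser in *.
  eapply Cser_ext; [|apply (Cser_scal k _ _ Ha)]; intros n; cbn beta; ring.
Qed.

Lemma analytic_mul_id D f : analytic_on D f -> analytic_on D (fun z => z * f z)%C.
Proof.
  intros A z Z; destruct (A z Z) as [a [r [R0 Ha]]].
  exists (fun n => z * a n + match n with O => 0 | S m => a m end)%C, r; split; [exact R0|].
  intros w Hw; specialize (Ha w Hw); rewrite !pseries_Cser in *.
  assert (I : Cser (fun n => (w - z) ^ n * match n with O => 0 | S m => a m end)%C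
                   ((w - z) * f w)%C).
  { replace ((w - z) * f w)%C with
      ((fun n => (w - z) ^ n * match n with O => 0 | S m => a m end) 0%nat + (w - z) * f w)%C
      by (simpl; ring).
    apply (Cser_decr (fun n => (w - z) ^ n * match n with O => 0 | S m => a m end)%C).
    eapply Cser_ext; [|apply (Cser_scal (w - z)), Ha]; intros n; simpl; ring. }
  replace (w * f w)%C with (z * f w + (w - z) * f w)%C by ring.
  eapply Cser_ext; [|apply (Cser_plus _ _ _ _ (Cser_scal z _ _ Ha) I)]; intros n; cbn beta; ring.
Qed.

(** At the supremum of the parameters with [f (Z t) <> 0] the zeros of the local power
    series accumulate, so that [CPS_zeros] applies to it. *)
Lemma identity_curve D f (Z Z' : R -> C) (T : R) :
  analytic_on D f ->
  (forall t, 0 < t -> D (Z t) /\ cderiv Z t (Z' t) /\ Z' t <> 0%C) ->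
  (forall t, T < t -> f (Z t) = 0%C) -> forall t, 0 < t -> f (Z t) = 0%C.
Proof.
  intros A HZ HT t1 T1.
  apply Cmod_eq_0; destruct (Rle_lt_or_eq_dec 0 _ (Cmod_ge_0 (f (Z t1)))) as [L|L]; [exfalso|auto].
  set (Ex := fun t => 0 < t /\ f (Z t) <> 0%C).
  destruct (completeness Ex) as [s [Sub Slub]].
  { exists T; intros t [_ Ht]; destruct (Rle_dec t T) as [Q|Q]; [exact Q|].
    exfalso; apply Ht, HT; lra. }
  { exists t1; split; [exact T1|apply Cmod_gt_0, L]. }
  assert (S1 : t1 <= s) by (apply Sub; split; [exact T1|apply Cmod_gt_0, L]).
  assert (S0 : 0 < s) by lra.
  assert (after : forall t, s < t -> f (Z t) = 0%C).
  { intros t Ht; apply Cmod_eq_0.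
    destruct (Rle_lt_or_eq_dec 0 _ (Cmod_ge_0 (f (Z t)))) as [Q|Q]; [exfalso|auto].
    assert (t <= s) by (apply Sub; split; [lra|apply Cmod_gt_0, Q]); lra. }
  destruct (HZ s S0) as [Ds [dZ nZ]].
  destruct (analytic_local D f (Z s) A Ds) as [a [r [R0 [B H]]]].
  apply Cmod_gt_0 in nZ.
  destruct (cderiv_lip _ _ _ dZ) as [d1 [D1 Hd1]].
  rewrite cderiv_eps in dZ; destruct (dZ (Cmod (Z' s) / 2)) as [d2 [D2 Hd2]]; [lra|].
  set (m := Cmod (Z' s)) in *.
  assert (near : forall eps, 0 < eps -> exists d, 0 < d /\ forall t, Rabs (t - s) < d ->
    Cmod (Z t - Z s) < eps /\ (t <> s -> Z t - Z s <> 0)%C).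
  { intros eps He.
    exists (Rmin d1 (Rmin d2 (eps / (m + 1)))); split.
    { repeat apply Rmin_glb_lt; try assumption; apply Rdiv_lt_0_compat; lra. }
    intros t Ht.
    assert (T1' : Rabs (t - s) < d1) by (eapply Rlt_le_trans; [exact Ht|apply Rmin_l]).
    assert (T23 : Rabs (t - s) < Rmin d2 (eps / (m + 1)))
      by (eapply Rlt_le_trans; [exact Ht|apply Rmin_r]).
    assert (T2 : Rabs (t - s) < d2) by (eapply Rlt_le_trans; [exact T23|apply Rmin_l]).
    assert (T3 : Rabs (t - s) < eps / (m + 1)) by (eapply Rlt_le_trans; [exact T23|apply Rmin_r]).
    split.
    - eapply Rle_lt_trans; [apply Hd1, T1'|].
      apply (Rmult_lt_compat_l (m + 1)) in T3; [|lra].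
      replace ((m + 1) * (eps / (m + 1))) with eps in T3 by (field; lra). exact T3.
    - intros N E; specialize (Hd2 t T2); rewrite E in Hd2.
      replace (0 - Z' s * RtoC (t - s))%C with (- (Z' s * RtoC (t - s)))%C in Hd2 by ring.
      rewrite Cmod_opp, Cmod_mult, Cmod_R in Hd2; fold m in Hd2.
      assert (0 < Rabs (t - s)) by (apply Rabs_pos_lt; lra). nra. }
  assert (a0 : forall n, a n = 0%C).
  { apply (CPS_zeros a (r / 2)); [lra|apply B; lra|].
    intros d Dp; destruct (near (Rmin d r)) as [d' [D' Hd']]; [apply Rmin_glb_lt; assumption|].
    destruct (Hd' (s + d' / 2)) as [N1 N2].
    { replace (s + d' / 2 - s) with (d' / 2) by ring; rewrite Rabs_pos_eq; lra. }
    exists (Z (s + d' / 2)%R - Z s)%C; split; [apply N2; lra|split].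
    - eapply Rlt_le_trans; [exact N1|apply Rmin_l].
    - rewrite <- H by (eapply Rlt_le_trans; [exact N1|apply Rmin_r]).
      apply after; lra. }
  assert (f0 : forall z, Cmod (z - Z s) < r -> f z = 0%C).
  { intros z Hz; rewrite H by exact Hz; apply CPS_unique.
    eapply Cser_ext; [|apply Cser_0]; intros n; cbn beta; rewrite a0; ring. }
  destruct (near r R0) as [d' [D' Hd']].
  assert (s <= s - d' / 2); [|lra].
  apply Slub; intros t [Ht1 Ht2].
  destruct (Rle_dec t (s - d' / 2)) as [Q|Q]; [exact Q|exfalso; apply Ht2].
  destruct (Rle_dec t s) as [Q'|Q'].
  - apply f0, Hd'; apply Rabs_def1; lra.
  - apply after; lra.
Qed.

(** * The Gauss series *)

Definition hcoef (a b c : C) (n : nat) : C :=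
  (Cpochhammer a n * Cpochhammer b n / (Cpochhammer c n * RtoC (INR (fact n))))%C.

Lemma hyp2F1_CPS a b c z : hyp2F1 a b c z = CPS (hcoef a b c) z.
Proof. reflexivity. Qed.

Lemma shift_neq0 c n : 0 < Re c -> (c + RtoC (INR n) <> 0)%C.
Proof. intros H; apply Re_pos_neq0; autorewrite with reim; pose proof (pos_INR n); lra. Qed.

Lemma Cpochhammer_neq0 c n : 0 < Re c -> Cpochhammer c n <> 0%C.
Proof.
  intros H; induction n as [|n IH]; simpl.
  - apply Re_pos_neq0; simpl; lra.
  - apply Cmult_neq_0; [exact IH|apply shift_neq0, H].
Qed.

Lemma INR_S_neq0 n : RtoC (INR (S n)) <> 0%C.
Proof. apply Re_pos_neq0; rewrite Re_RtoC; apply lt_0_INR; lia. Qed.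

Lemma hcoef_S a b c n : 0 < Re c ->
  (RtoC (INR (S n)) * (c + RtoC (INR n)) * hcoef a b c (S n)
   = (a + RtoC (INR n)) * (b + RtoC (INR n)) * hcoef a b c n)%C.
Proof.
  intros H; unfold hcoef.
  rewrite fact_simpl, mult_INR, RtoC_mult.
  change (Cpochhammer a (S n)) with (Cpochhammer a n * (a + RtoC (INR n)))%C.
  change (Cpochhammer b (S n)) with (Cpochhammer b n * (b + RtoC (INR n)))%C.
  change (Cpochhammer c (S n)) with (Cpochhammer c n * (c + RtoC (INR n)))%C.
  field; repeat split.
  - intros E; apply (INR_fact_neq_0 n); apply (f_equal Re) in E; exact E.
  - apply Cpochhammer_neq0, H.
  - apply INR_S_neq0.
  - apply shift_neq0, H.
Qed.

(** The quotient of consecutive coefficients tends to one, so that beyond some rank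
    [Cmod (hcoef a b c n) * r ^ n] decreases. *)
Lemma hcoef_bnd a b c r : 0 < Re c -> 0 < r < 1 -> bnd (hcoef a b c) r.
Proof.
  intros Hc Hr.
  set (A := Cmod a + Cmod b + Cmod c).
  pose proof (Cmod_ge_0 a); pose proof (Cmod_ge_0 b); pose proof (Cmod_ge_0 c).
  assert (A0 : 0 <= A) by (unfold A; lra).
  set (q := (1 + r) / 2).
  assert (Q : r < q ^ 2 /\ 0 < q < 1) by (unfold q; nra).
  destruct (archimed (2 * A / (1 - q))) as [N1 _].
  set (N := Z.to_nat (up (2 * A / (1 - q)))).
  assert (HN : 2 * A / (1 - q) <= INR N).
  { unfold N; rewrite INR_IZR_INZ, Z2Nat.id; [lra|].
    apply le_IZR; apply Rle_trans with (2 * A / (1 - q)); [|lra].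
    apply Rmult_le_pos; [lra|left; apply Rinv_0_lt_compat; lra]. }
  assert (step : forall n, (N <= n)%nat ->
    Cmod (hcoef a b c (S n)) * r ^ S n <= Cmod (hcoef a b c n) * r ^ n).
  { intros n Hn.
    assert (Hn' : INR N <= INR n) by (apply le_INR; exact Hn).
    pose proof (pos_INR n) as n0.
    assert (E := f_equal Cmod (hcoef_S a b c n Hc)).
    rewrite !Cmod_mult, Cmod_R, Rabs_pos_eq in E by apply pos_INR.
    assert (Ba : Cmod (a + RtoC (INR n)) <= INR n + A).
    { eapply Rle_trans; [apply Cmod_triangle|]; rewrite Cmod_R, Rabs_pos_eq by exact n0; unfold A; lra. }
    assert (Bb : Cmod (b + RtoC (INR n)) <= INR n + A).
    { eapply Rle_trans; [apply Cmod_triangle|]; rewrite Cmod_R, Rabs_pos_eq by exact n0; unfold A; lra. }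
    assert (Bc : INR n - A <= Cmod (c + RtoC (INR n))).
    { assert (Cmod (RtoC (INR n)) <= Cmod (c + RtoC (INR n)) + Cmod c).
      { replace (RtoC (INR n)) with ((c + RtoC (INR n)) + - c)%C at 1 by ring.
        eapply Rle_trans; [apply Cmod_triangle|]; rewrite Cmod_opp; lra. }
      rewrite Cmod_R, Rabs_pos_eq in H2 by exact n0; unfold A; lra. }
    assert (K : q * (INR n + A) <= INR n - A).
    { assert (2 * A <= (1 - q) * INR n).
      { apply Rmult_le_reg_r with (/ (1 - q)); [apply Rinv_0_lt_compat; lra|].
        replace ((1 - q) * INR n * / (1 - q)) with (INR n) by (field; lra).
        unfold Rdiv in HN; lra. }
      nra. }
    assert (P0 : 0 < INR (S n) * Cmod (c + RtoC (INR n))).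
    { apply Rmult_lt_0_compat; [apply lt_0_INR; lia|apply Cmod_gt_0, shift_neq0, Hc]. }
    assert (rn : 0 < r ^ n) by (apply pow_lt; lra).
    simpl pow.
    apply Rmult_le_reg_l with (INR (S n) * Cmod (c + RtoC (INR n))); [exact P0|].
    replace (INR (S n) * Cmod (c + RtoC (INR n)) * (Cmod (hcoef a b c (S n)) * (r * r ^ n))) with
      (INR (S n) * Cmod (c + RtoC (INR n)) * Cmod (hcoef a b c (S n)) * r * r ^ n) by ring.
    rewrite E.
    pose proof (Cmod_ge_0 (hcoef a b c n)) as h0.
    assert (Bab : Cmod (a + RtoC (INR n)) * Cmod (b + RtoC (INR n)) <= (INR n + A) * (INR n + A))
      by (apply Rmult_le_compat; try assumption; apply Cmod_ge_0).
    assert (M : Cmod (a + RtoC (INR n)) * Cmod (b + RtoC (INR n)) * r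
       <= INR (S n) * Cmod (c + RtoC (INR n))).
    { assert (X1 : (INR n + A) * (INR n + A) * r <= (INR n - A) * (INR n - A)).
      { assert (0 <= q * (INR n + A)) by (apply Rmult_le_pos; lra).
        assert ((q * (INR n + A)) * (q * (INR n + A)) <= (INR n - A) * (INR n - A))
          by (apply Rmult_le_compat; assumption).
        assert (0 <= (INR n + A) * (INR n + A)) by (apply Rmult_le_pos; lra).
        assert (r * ((INR n + A) * (INR n + A)) <= q ^ 2 * ((INR n + A) * (INR n + A)))
          by (apply Rmult_le_compat_r; lra).
        nra. }
      assert (X2 : (INR n - A) * (INR n - A) <= INR (S n) * Cmod (c + RtoC (INR n))).
      { assert (0 <= INR n - A)
          by (eapply Rle_trans; [|exact K]; apply Rmult_le_pos; lra).
        apply Rmult_le_compat; try assumption; rewrite S_INR; lra. }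
      assert (Cmod (a + RtoC (INR n)) * Cmod (b + RtoC (INR n)) * r
        <= (INR n + A) * (INR n + A) * r) by (apply Rmult_le_compat_r; lra).
      lra. }
    replace (Cmod (a + RtoC (INR n)) * Cmod (b + RtoC (INR n)) * Cmod (hcoef a b c n) * r * r ^ n)
      with (Cmod (a + RtoC (INR n)) * Cmod (b + RtoC (INR n)) * r * (Cmod (hcoef a b c n) * r ^ n)) by ring.
    apply Rmult_le_compat_r; [apply Rmult_le_pos; lra|exact M]. }
  assert (F : forall k, exists M, forall n, (n <= k)%nat -> Cmod (hcoef a b c n) * r ^ n <= M).
  { induction k as [|k [M IH]].
    - exists (Cmod (hcoef a b c 0) * r ^ 0); intros n Hn; replace n with 0%nat by lia; lra.
    - exists (Rmax M (Cmod (hcoef a b c (S k)) * r ^ S k)); intros n Hn.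
      destruct (Nat.eq_dec n (S k)) as [->|E]; [apply Rmax_r|].
      eapply Rle_trans; [apply IH; lia|apply Rmax_l]. }
  destruct (F N) as [M HM]; exists M; intros n.
  induction n as [|n IH]; [apply HM; lia|].
  destruct (Compare_dec.le_lt_dec N n) as [L|L].
  - eapply Rle_trans; [apply step, L|exact IH].
  - apply HM; lia.
Qed.

(** Gauss's differential equation, coefficient by coefficient. *)
Lemma gauss_ode a b c w : 0 < Re c -> Cmod w < 1 ->
  (w * (1 - w) * CPS (dcoef (dcoef (hcoef a b c))) w
   + (c - (a + b + 1) * w) * CPS (dcoef (hcoef a b c)) w
   - a * b * CPS (hcoef a b c) w = 0)%C.
Proof.
  intros Hc Hw; set (A := hcoef a b c).
  pose proof (Cmod_ge_0 w) as W0.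
  set (r3 := (3 * Cmod w + 1) / 4); set (r2 := (2 * Cmod w + 2) / 4); set (r1 := (Cmod w + 3) / 4).
  assert (B1 : bnd A r1) by (apply hcoef_bnd; unfold r1; [exact Hc|lra]).
  assert (B2 : bnd (dcoef A) r2) by (apply (bnd_dcoef A r1); [unfold r1, r2; lra|exact B1]).
  assert (B3 : bnd (dcoef (dcoef A)) r3)
    by (apply (bnd_dcoef _ r2); [unfold r3, r2; lra|exact B2]).
  assert (I0 := CPS_Cser A r1 w B1 ltac:(unfold r1; lra)).
  assert (I1 := CPS_Cser (dcoef A) r2 w B2 ltac:(unfold r2; lra)).
  assert (I2 := CPS_Cser (dcoef (dcoef A)) r3 w B3 ltac:(unfold r3; lra)).
  set (f := CPS A w) in *; set (f1 := CPS (dcoef A) w) in *; set (f2 := CPS (dcoef (dcoef A)) w) in *.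
  assert (J1 : Cser (fun n => w ^ n * (RtoC (INR n) * A n))%C (w * f1)%C).
  { replace (w * f1)%C with ((fun n => w ^ n * (RtoC (INR n) * A n)) 0%nat + w * f1)%C
      by (simpl; ring).
    apply (Cser_decr (fun n => w ^ n * (RtoC (INR n) * A n))%C).
    eapply Cser_ext; [|apply (Cser_scal w), I1]; intros n; unfold dcoef; simpl Cpow; ring. }
  assert (J2 : Cser (fun n => w ^ n * (RtoC (INR n) * dcoef A n))%C (w * f2)%C).
  { replace (w * f2)%C with ((fun n => w ^ n * (RtoC (INR n) * dcoef A n)) 0%nat + w * f2)%C
      by (simpl; ring).
    apply (Cser_decr (fun n => w ^ n * (RtoC (INR n) * dcoef A n))%C).
    eapply Cser_ext; [|apply (Cser_scal w), I2]; intros n; unfold dcoef; simpl Cpow; ring. }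
  assert (J3 : Cser (fun n => w ^ n * (RtoC (INR n) * (RtoC (INR n) - 1) * A n))%C (w * (w * f2))%C).
  { replace (w * (w * f2))%C with
      ((fun n => w ^ n * (RtoC (INR n) * (RtoC (INR n) - 1) * A n)) 0%nat + w * (w * f2))%C
      by (simpl; ring).
    apply (Cser_decr (fun n => w ^ n * (RtoC (INR n) * (RtoC (INR n) - 1) * A n))%C).
    eapply Cser_ext; [|apply (Cser_scal w), J2]; intros n; unfold dcoef; simpl Cpow.
    rewrite S_INR, RtoC_plus; ring. }
  assert (Z := Cser_plus _ _ _ _ (Cser_plus _ _ _ _ (Cser_plus _ _ _ _ (Cser_plus _ _ _ _
     J2 (Cser_scal (- (1)) _ _ J3)) (Cser_scal c _ _ I1)) (Cser_scal (- (a + b + 1)) _ _ J1))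
     (Cser_scal (- (a * b)) _ _ I0)).
  transitivity (w * f2 + - (1) * (w * (w * f2)) + c * f1 + - (a + b + 1) * (w * f1)
    + - (a * b) * f)%C; [ring|].
  apply (Cser_unique _ _ _ Z).
  eapply Cser_ext; [|apply Cser_0]; intros n; cbn beta.
  assert (E := hcoef_S a b c n Hc); fold A in E.
  unfold dcoef.
  transitivity (w ^ n * (RtoC (INR (S n)) * (c + RtoC (INR n)) * A (S n)
     - (a + RtoC (INR n)) * (b + RtoC (INR n)) * A n))%C; [rewrite E; ring|ring].
Qed.

(** * Rotation of the path of integration *)

(** Over a subdivision into [n] equal pieces the increments add up to [O(1/n)]. *)
Lemma quad_const (f : R -> C) (p q K : R) : p <= q ->
  (forall s t, p <= s -> s <= t -> t <= q -> Cmod (f t - f s) <= K * (t - s) ^ 2) -> f p = f q.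
Proof.
  intros PQ H.
  assert (K0 : 0 <= K * (q - p) ^ 2) by (eapply Rle_trans; [apply Cmod_ge_0|apply (H p q); lra]).
  assert (N : forall n, (0 < n)%nat -> Cmod (f q - f p) * INR n <= K * (q - p) ^ 2).
  { intros n Hn; assert (n0 : 0 < INR n) by (apply lt_0_INR, Hn).
    set (d := (q - p) / INR n).
    assert (d0 : 0 <= d) by (unfold d; apply Rmult_le_pos; [lra|left; apply Rinv_0_lt_compat, n0]).
    assert (S : forall k, (k <= n)%nat -> Cmod (f (p + INR k * d) - f p) <= INR k * (K * d ^ 2)).
    { induction k as [|k IH]; intros Hk.
      - simpl INR; rewrite Rmult_0_l, Rplus_0_r, Rmult_0_l.
        replace (f p - f p)%C with (RtoC 0) by ring; rewrite Cmod_0; lra.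
      - replace (f (p + INR (S k) * d)%R - f p)%C with
          ((f (p + INR (S k) * d)%R - f (p + INR k * d)%R) + (f (p + INR k * d)%R - f p))%C by ring.
        eapply Rle_trans; [apply Cmod_triangle|].
        specialize (IH ltac:(lia)).
        assert (INR (S k) <= INR n) by (apply le_INR; lia).
        assert (INR (S k) * d <= q - p).
        { replace (q - p) with (INR n * d) by (unfold d; field; lra).
          apply Rmult_le_compat_r; assumption. }
        pose proof (pos_INR k); rewrite S_INR in *.
        assert (A : Cmod (f (p + (INR k + 1) * d)%R - f (p + INR k * d)%R)
          <= K * (p + (INR k + 1) * d - (p + INR k * d)) ^ 2).
        { apply H; nra. }
        replace (p + (INR k + 1) * d - (p + INR k * d)) with d in A by ring.
        lra. }
    specialize (S n (le_n n)).
    replace (p + INR n * d) with q in S by (unfold d; field; lra).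
    apply Rmult_le_reg_r with (/ INR n); [apply Rinv_0_lt_compat, n0|].
    rewrite Rmult_assoc, Rinv_r, Rmult_1_r by lra.
    eapply Rle_trans; [exact S|]; unfold d; right; field; lra. }
  assert (Z : Cmod (f q - f p) = 0).
  { destruct (Rle_lt_or_eq_dec 0 _ (Cmod_ge_0 (f q - f p))) as [L|L]; [exfalso|auto].
    destruct (archimed (K * (q - p) ^ 2 / Cmod (f q - f p))) as [A _].
    set (n := S (Z.to_nat (up (K * (q - p) ^ 2 / Cmod (f q - f p))))).
    specialize (N n ltac:(unfold n; lia)).
    assert (B : K * (q - p) ^ 2 / Cmod (f q - f p) < INR n).
    { unfold n; rewrite S_INR, INR_IZR_INZ, Z2Nat.id; [lra|].
      apply le_IZR; apply Rle_trans with (K * (q - p) ^ 2 / Cmod (f q - f p)); [|lra].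
      apply Rmult_le_pos; [lra|left; apply Rinv_0_lt_compat, L]. }
    apply (Rmult_lt_compat_l (Cmod (f q - f p))) in B; [|exact L].
    replace (Cmod (f q - f p) * (K * (q - p) ^ 2 / Cmod (f q - f p))) with (K * (q - p) ^ 2) in B
      by (field; lra). lra. }
  apply Cmod_eq_0 in Z.
  replace (f q) with ((f q - f p) + f p)%C by ring; rewrite Z; ring.
Qed.

(** The substitution [x -> exp (j phi) x], carried out as a homotopy. The angle [phi]
    joins the integrand of the Beta integral, at [phi = 0], to the one of the Legendre
    functions, at [phi = PI / 2]; [rho] and [eta] are the logarithmic derivatives in
    [phi] of its two factors. *)
Section Rotation.
Context (e : R) (a : C).
Context (E : e * e = 1) (A : 0 < Re a).

Let om (phi : R) : C := Cexp (- (jj e * RtoC phi)).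
Let cr (phi : R) : C := (Cexp (jj e * RtoC phi) / 2)%C.
Let rho (phi x : R) : C := (jj e * om phi / (RtoC x + 2 * om phi))%C.
Let eta (phi x : R) : C := (- a * jj e * cr phi * RtoC x / (1 + cr phi * RtoC x))%C.

Lemma rot_om phi : 0 <= phi <= PI / 2 -> 0 <= Re (om phi) /\ Cmod (om phi) = 1.
Proof.
  intros P; unfold om, jj; split.
  - unfold Cexp; autorewrite with reim.
    replace (- (0 * phi - e * 0)) with 0 by ring; rewrite exp_0.
    destruct (e_cases e E) as [-> | ->]; rewrite Rmult_1_l.
    + rewrite cos_neg; apply cos_ge_0; autorewrite with reim; lra.
    + apply cos_ge_0; autorewrite with reim; lra.
  - rewrite Cmod_Cexp; autorewrite with reim.
    replace (- (0 * phi - e * 0)) with 0 by ring; apply exp_0.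
Qed.

Lemma rot_cr phi : 0 <= phi <= PI / 2 -> 0 <= Re (cr phi) /\ Cmod (cr phi) = 1 / 2.
Proof.
  intros P; unfold cr, jj; split.
  - rewrite Re_half; unfold Cexp; autorewrite with reim.
    replace (0 * phi - e * 0) with 0 by ring; rewrite exp_0, Rmult_1_l.
    assert (0 <= cos (0 * 0 + e * phi)); [|lra].
    destruct (e_cases e E) as [-> | ->]; apply cos_ge_0; lra.
  - rewrite Cmod_div, Cmod_Cexp by apply C2_neq0; autorewrite with reim.
    replace (0 * phi - e * 0) with 0 by ring; rewrite exp_0, Cmod_R, Rabs_pos_eq; lra.
Qed.

Lemma cderiv_om t : cderiv om t (- (jj e) * om t)%C.
Proof.
  unfold om; eapply cderiv_eq.
  - apply cderiv_Cexp, cderiv_opp, cderiv_scal, cderiv_id.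
  - cbn beta; ring.
Qed.

Lemma cderiv_cr t : cderiv cr t (jj e * cr t)%C.
Proof.
  unfold cr, Cdiv; eapply cderiv_eq.
  - apply cderiv_mult; [apply cderiv_Cexp, cderiv_scal, cderiv_id|apply cderiv_const].
  - cbn beta; ring.
Qed.

Lemma om_base phi x : 0 <= phi <= PI / 2 -> 0 < x -> 2 <= Cmod (RtoC x + 2 * om phi).
Proof.
  intros P X; destruct (rot_om phi P) as [O O1].
  assert (D := Cmod2_alt (RtoC x + 2 * om phi)); assert (D1 := Cmod2_alt (om phi)).
  rewrite O1 in D1; autorewrite with reim in D.
  pose proof (Cmod_ge_0 (RtoC x + 2 * om phi)); nra.
Qed.

Lemma om_base_x phi x : 0 <= phi <= PI / 2 -> 0 < x -> x <= Cmod (RtoC x + 2 * om phi).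
Proof.
  intros P X; destruct (rot_om phi P) as [O O1].
  eapply Rle_trans; [|apply re_le_Cmod]; eapply Rle_trans; [|apply Rle_abs].
  autorewrite with reim; lra.
Qed.

Let F (phi x : R) : C := fam (om phi) 0 a (cr phi) x.

Lemma cderiv_F x t : 0 <= t <= PI / 2 -> 0 < x ->
  cderiv (fun s => F s x) t (F t x * (rho t x + eta t x))%C.
Proof.
  intros T X; destruct (rot_om t T) as [O O1]; destruct (rot_cr t T) as [C C1].
  pose proof (base_ge1 _ x C X) as B; pose proof (kern_base _ x O X) as Bk.
  assert (N := om_base t x T X).
  assert (N' : (RtoC x + 2 * om t <> 0)%C) by (apply Cmod_gt_0; lra).
  assert (Nx : RtoC x <> 0%C) by (apply Re_pos_neq0; exact X).
  unfold F, fam, kern; eapply cderiv_eq.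
  - apply cderiv_mult; [apply cderiv_mult; [|apply cderiv_const]|].
    + apply (cderiv_Cpower (fun s => RtoC x * RtoC x + 2 * om s * RtoC x)%C); [|exact Bk].
      apply cderiv_plus; [apply cderiv_const|].
      apply cderiv_mult; [apply cderiv_scal, cderiv_om|apply cderiv_const].
    + apply (cderiv_Cpower (fun s => 1 + cr s * RtoC x)%C); [|lra].
      apply cderiv_plus; [apply cderiv_const|].
      apply cderiv_mult; [apply cderiv_cr|apply cderiv_const].
  - cbn beta; unfold rho, eta.
    replace (RtoC (- / 2)) with (- (1 / 2))%C by (apply C_eq; unfold Re, Im; simpl; field).
    set (k := Cpower (RtoC x * RtoC x + 2 * om t * RtoC x) (- (1 / 2))).
    replace (RtoC x * RtoC x + 2 * om t * RtoC x)%C with (RtoC x * (RtoC x + 2 * om t))%C by ring.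
    field; repeat split; try assumption; apply Re_pos_neq0; lra.
Qed.

Lemma cderiv_F2 x t : 0 <= t <= PI / 2 -> 0 < x ->
  cderiv (fun s => F s x * (rho s x + eta s x))%C t
    (F t x * ((rho t x + eta t x) * (rho t x + eta t x)
       + om t * RtoC x / ((RtoC x + 2 * om t) * (RtoC x + 2 * om t))
       + a * cr t * RtoC x / ((1 + cr t * RtoC x) * (1 + cr t * RtoC x))))%C.
Proof.
  intros T X; destruct (rot_om t T) as [O O1]; destruct (rot_cr t T) as [C C1].
  pose proof (base_ge1 _ x C X) as B.
  assert (N := om_base t x T X).
  assert (N' : (RtoC x + 2 * om t <> 0)%C) by (apply Cmod_gt_0; lra).
  assert (Nb : (1 + cr t * RtoC x <> 0)%C) by (apply Re_pos_neq0; lra).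
  assert (J := jj_sqr e E).
  eapply cderiv_eq.
  - apply cderiv_mult; [apply cderiv_F; assumption|].
    unfold rho, eta; apply cderiv_plus; apply cderiv_div; try assumption.
    + apply cderiv_scal, cderiv_om.
    + apply cderiv_plus; [apply cderiv_const|apply cderiv_scal, cderiv_om].
    + apply cderiv_mult; [apply cderiv_scal, cderiv_cr|apply cderiv_const].
    + apply cderiv_plus; [apply cderiv_const|].
      apply cderiv_mult; [apply cderiv_cr|apply cderiv_const].
  - fold (rho t x) (eta t x).
    transitivity (F t x * ((rho t x + eta t x) * (rho t x + eta t x)
       - (jj e * jj e) * om t * RtoC x / ((RtoC x + 2 * om t) * (RtoC x + 2 * om t))
       - (jj e * jj e) * a * cr t * RtoC x / ((1 + cr t * RtoC x) * (1 + cr t * RtoC x))))%C.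
    + unfold rho, eta; field; split; assumption.
    + rewrite J; field; split; assumption.
Qed.

(** The derivative in the angle is [j] times the derivative of [x F], whose
    integral over the half-line is zero. *)
Lemma rot_int0 t : 0 <= t <= PI / 2 -> CI (fun x => F t x * (rho t x + eta t x))%C 0%C.
Proof.
  intros T; destruct (rot_om t T) as [O O1]; destruct (rot_cr t T) as [C C1].
  assert (DF : forall x, 0 < x -> cderiv (fun s => RtoC s * F t s)%C x
     (F t x * (om t / (RtoC x + 2 * om t) - a * cr t * RtoC x / (1 + cr t * RtoC x)))%C).
  { intros x X; pose proof (base_ge1 _ x C X) as B; pose proof (kern_base _ x O X) as Bk.
    assert (N := om_base t x T X).
    assert (N' : (RtoC x + 2 * om t <> 0)%C) by (apply Cmod_gt_0; lra).
    assert (Nb : (1 + cr t * RtoC x <> 0)%C) by (apply Re_pos_neq0; lra).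
    assert (Nx : RtoC x <> 0%C) by (apply Re_pos_neq0; exact X).
    eapply cderiv_eq.
    - apply cderiv_mult; [apply cderiv_id|].
      unfold F, fam; apply cderiv_mult; [apply cderiv_mult|].
      + apply cderiv_kern; assumption.
      + exact (cderiv_const (RtoC 1) x).
      + apply (cderiv_Cpower (fun s => 1 + cr t * RtoC s)%C); [apply cderiv_base|lra].
    - unfold F, fam; simpl pow.
      replace (RtoC x * RtoC x + 2 * om t * RtoC x)%C with (RtoC x * (RtoC x + 2 * om t))%C by ring.
      field; repeat split; assumption. }
  destruct (tends0_ends (fun x => RtoC x * F t x)%C (famK 0 a (1 / 2) (Re a)) (2 * Re a)) as [T0 T1].
  - lra.
  - intros x X; rewrite Cmod_mult, Cmod_R, Rabs_pos_eq by lra.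
    assert (Bd := fam_bound (om t) 0 a (cr t) x (1 / 2) (Re a) O O1 C ltac:(lra) ltac:(lra) X).
    specialize (Bd ltac:(simpl; lra)).
    pose proof (sqrt_pos_lt x X) as S; pose proof (sqrt_sqrt x (Rlt_le _ _ X)) as SS.
    eapply Rle_trans; [apply Rmult_le_compat_l; [lra|exact Bd]|].
    right; unfold maj; rewrite <- SS at 1; field; lra.
  - replace (RtoC 0) with (jj e * 0)%C by ring.
    eapply CI_ext; [|apply CI_scal].
    2:{ apply (CI_FTC0 (fun x => RtoC x * F t x)%C
          (fun x => F t x * (om t / (RtoC x + 2 * om t) - a * cr t * RtoC x / (1 + cr t * RtoC x)))%C);
        [exact DF| |exact T0|exact T1].
        intros x X; pose proof (base_ge1 _ x C X) as B.
        assert (N := om_base t x T X).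
        assert (N' : (RtoC x + 2 * om t <> 0)%C) by (apply Cmod_gt_0; lra).
        assert (Nb : (1 + cr t * RtoC x <> 0)%C) by (apply Re_pos_neq0; lra).
        eapply cderiv_ccont, cderiv_mult.
        - unfold F, fam; apply cderiv_mult; [apply cderiv_mult|].
          + apply cderiv_kern; assumption.
          + exact (cderiv_const (RtoC 1) x).
          + apply (cderiv_Cpower (fun s => 1 + cr t * RtoC s)%C); [apply cderiv_base|lra].
        - apply cderiv_minus; apply cderiv_div; try assumption.
          + apply cderiv_const.
          + apply cderiv_plus; [apply cderiv_id|apply cderiv_const].
          + apply cderiv_scal, cderiv_id.
          + apply cderiv_base. }
    intros x X; cbn beta; unfold rho, eta.
    pose proof (base_ge1 _ x C X) as B.
    assert (N := om_base t x T X).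
    field; split; [apply Re_pos_neq0; lra|apply Cmod_gt_0; lra].
Qed.

(** The first-order increment in the angle integrates to zero, and the second-order
    remainder has a uniform integrable majorant. *)
Lemma rotation : famint (- jj e) 0 a (jj e / 2) = famint 1 0 a (1 / 2).
Proof.
  set (Kf := famK 0 a (1 / 2) (Re a)).
  set (Kc := ((1 + Cmod a) * (1 + Cmod a) + 1 + Cmod a)).
  assert (Q : famint (om 0) 0 a (cr 0) = famint (om (PI / 2)) 0 a (cr (PI / 2))).
  { apply (quad_const (fun t => famint (om t) 0 a (cr t)) 0 (PI / 2) (Kf * Kc * / Re a)).
    { pose proof PI_RGT_0; lra. }
    intros s t S ST T.
    destruct (rot_om s ltac:(lra)) as [O O1]; destruct (rot_cr s ltac:(lra)) as [C C1].
    destruct (rot_om t ltac:(lra)) as [O' O1']; destruct (rot_cr t ltac:(lra)) as [C' C1'].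
    assert (R1 : INR 0 < Re a) by (simpl; lra).
    assert (Nc : cr s <> 0%C) by (apply Cmod_gt_0; lra).
    assert (Nc' : cr t <> 0%C) by (apply Cmod_gt_0; lra).
    assert (I1 := fam_CI _ 0 a _ O O1 C Nc R1); assert (I2 := fam_CI _ 0 a _ O' O1' C' Nc' R1).
    replace (famint (om t) 0 a (cr t) - famint (om s) 0 a (cr s))%C with
      (famint (om t) 0 a (cr t) - famint (om s) 0 a (cr s) - RtoC (t - s) * 0)%C by ring.
    replace (Kf * Kc * / Re a * (t - s) ^ 2) with (Kf * Kc * (t - s) ^ 2 * (2 / (2 * Re a)))
      by (field; lra).
    apply (CI_le (fun x => F t x - F s x - RtoC (t - s) * (F s x * (rho s x + eta s x)))%C
                 (fun x => Kf * Kc * (t - s) ^ 2 * maj (2 * Re a) x)).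
    - apply CI_minus; [exact (CI_minus _ _ _ _ I2 I1)|].
      exact (CI_scal _ _ _ (rot_int0 s ltac:(lra))).
    - apply RI_scal, RI_maj; lra.
    - intros x X.
      replace (Kf * Kc * (t - s) ^ 2 * maj (2 * Re a) x) with
        (Kf * Kc * maj (2 * Re a) x * (t - s) ^ 2) by ring.
      apply (cderiv_taylor (fun u => F u x) (fun u => F u x * (rho u x + eta u x))%C
        (fun u => F u x * ((rho u x + eta u x) * (rho u x + eta u x)
           + om u * RtoC x / ((RtoC x + 2 * om u) * (RtoC x + 2 * om u))
           + a * cr u * RtoC x / ((1 + cr u * RtoC x) * (1 + cr u * RtoC x))))%C); [exact ST| | |].
      + intros u U; apply cderiv_F; [lra|exact X].
      + intros u U; apply cderiv_F2; [lra|exact X].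
      + intros u U.
        assert (U' : 0 <= u <= PI / 2) by lra.
        destruct (rot_om u U') as [Ou Ou1]; destruct (rot_cr u U') as [Cu Cu1].
        assert (Bd := fam_bound (om u) 0 a (cr u) x (1 / 2) (Re a) Ou Ou1 Cu ltac:(lra) ltac:(lra) X).
        specialize (Bd ltac:(simpl; lra)); fold Kf in Bd.
        assert (N2 := om_base u x U' X); assert (Nx := om_base_x u x U' X).
        pose proof (base_ge1 _ x Cu X) as B1; pose proof (base_Cmod_ge _ x Cu X) as B2.
        set (w := (1 + cr u * RtoC x)%C) in *; set (v := (RtoC x + 2 * om u)%C) in *.
        assert (W1 : 1 <= Cmod w)
          by (pose proof (re_le_Cmod w); pose proof (Rle_abs (Re w)); lra).
        assert (Nw : w <> 0%C) by (apply Cmod_gt_0; lra).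
        assert (Nv : v <> 0%C) by (apply Cmod_gt_0; lra).
        assert (Jm : Cmod (jj e) = 1) by (rewrite <- (Cmod_opp (jj e)); apply jj_om, E).
        assert (E1 : Cmod (rho u x) <= 1).
        { unfold rho; fold v; rewrite Cmod_div, Cmod_mult, Jm, Ou1 by exact Nv.
          apply Rmult_le_reg_r with (Cmod v); [lra|]; unfold Rdiv; rewrite Rmult_assoc, Rinv_l; lra. }
        assert (E2 : Cmod (eta u x) <= Cmod a).
        { unfold eta; fold w; rewrite Cmod_div, !Cmod_mult, Jm, Cmod_opp, Cmod_R, (Rabs_pos_eq x) by (exact Nw || lra).
          apply Rmult_le_reg_r with (Cmod w); [lra|]; unfold Rdiv; rewrite (Rmult_assoc _ (/ Cmod w)), Rinv_l by lra.
          pose proof (Cmod_ge_0 a); nra. }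
        assert (E3 : Cmod (om u * RtoC x / (v * v)) <= 1).
        { rewrite Cmod_div, !Cmod_mult, Ou1, Cmod_R, (Rabs_pos_eq x) by (lra || apply Cmult_neq_0; exact Nv).
          apply Rmult_le_reg_r with (Cmod v * Cmod v); [nra|]; unfold Rdiv.
          rewrite (Rmult_assoc _ (/ (Cmod v * Cmod v))), Rinv_l by nra. nra. }
        assert (E4 : Cmod (a * cr u * RtoC x / (w * w)) <= Cmod a).
        { rewrite Cmod_div, !Cmod_mult, Cmod_R, (Rabs_pos_eq x) by (lra || apply Cmult_neq_0; exact Nw).
          apply Rmult_le_reg_r with (Cmod w * Cmod w); [nra|]; unfold Rdiv.
          rewrite (Rmult_assoc _ (/ (Cmod w * Cmod w))), Rinv_l by nra.
          pose proof (Cmod_ge_0 a).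
          assert (Cmod (cr u) * x <= Cmod w * Cmod w) by nra. nra. }
        rewrite Cmod_mult.
        replace (Kf * Kc * maj (2 * Re a) x) with (Kf * maj (2 * Re a) x * Kc) by ring.
        apply Rmult_le_compat; [apply Cmod_ge_0|apply Cmod_ge_0|exact Bd|].
        eapply Rle_trans; [apply Cmod_triangle|].
        eapply Rle_trans; [apply Rplus_le_compat_r, Cmod_triangle|].
        unfold Kc; apply Rplus_le_compat; [apply Rplus_le_compat|]; try assumption.
        rewrite Cmod_mult.
        assert (Cmod (rho u x + eta u x) <= 1 + Cmod a)
          by (eapply Rle_trans; [apply Cmod_triangle|]; lra).
        apply Rmult_le_compat; try apply Cmod_ge_0; assumption. }
  assert (om0 : om 0 = 1%C).
  { unfold om; rewrite <- Cexp_0; f_equal; ring. }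
  assert (cr0 : cr 0 = (1 / 2)%C).
  { unfold cr; rewrite <- Cexp_0; do 2 f_equal; ring. }
  assert (ej : Cexp (jj e * RtoC (PI / 2)) = jj e).
  { unfold Cexp, jj; autorewrite with reim.
    replace (0 * (PI / 2) - e * 0) with 0 by ring; rewrite exp_0.
    destruct (e_cases e E) as [-> | ->].
    - replace (0 * 0 + 1 * (PI / 2)) with (PI / 2) by ring; rewrite cos_PI2, sin_PI2.
      apply C_eq; simpl; ring.
    - replace (0 * 0 + -1 * (PI / 2)) with (- (PI / 2)) by ring; rewrite cos_neg, sin_neg, cos_PI2, sin_PI2.
      apply C_eq; simpl; ring. }
  assert (om1 : om (PI / 2) = (- jj e)%C).
  { unfold om; rewrite Cexp_opp, ej.
    apply (Cmult_eq_reg_l' (jj e)); [apply Cmod_gt_0; rewrite <- (Cmod_opp (jj e)), (proj2 (jj_om e E)); lra|].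
    replace (jj e * - jj e)%C with (- (jj e * jj e))%C by ring; rewrite (jj_sqr e E).
    rewrite Cinv_r; [ring|].
    apply Cmod_gt_0; rewrite <- (Cmod_opp (jj e)), (proj2 (jj_om e E)); lra. }
  assert (cr1 : cr (PI / 2) = (jj e / 2)%C) by (unfold cr; rewrite ej; reflexivity).
  rewrite om0, cr0, om1, cr1 in Q; symmetry; exact Q.
Qed.

End Rotation.

(** * A Beta integral *)

(** Euler's integral [B(a, 1/2)], in the variable [x / 2]. *)
Definition beta (a : C) : C := famint 1 0 a (1 / 2).

Lemma half_data : 0 <= Re (RtoC 1) /\ Cmod (RtoC 1) = 1 /\ 0 < Re (1 / 2)%C.
Proof.
  split; [simpl; lra|split; [apply Cmod_1|]]; rewrite Re_half; simpl; lra.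
Qed.

Lemma half_RtoC : (1 / 2)%C = RtoC (/ 2).
Proof. apply C_eq; [rewrite Re_half|rewrite Im_half]; simpl; lra. Qed.

Lemma beta_CI a : 0 < Re a -> CI (fam 1 0 a (1 / 2)) (beta a).
Proof.
  intros A; destruct half_data as [O [O1 C]].
  apply fam_CI; try assumption; [lra|apply Re_pos_neq0, C].
Qed.

(** The integration by parts [fam_parts] at [om = 1] and [c = 1/2]. *)
Lemma beta_S a : 0 < Re a -> ((2 * a + 1) * beta (a + 1) = 2 * a * beta a)%C.
Proof.
  intros A; destruct half_data as [O [O1 C]].
  assert (P := fam_parts 1 a (1 / 2) O O1 C A).
  assert (I0 := beta_CI a A).
  assert (I1 := beta_CI (a + 1) ltac:(autorewrite with reim; lra)).
  assert (D : ((2 * a + 1) * beta (a + 1) - 2 * a * beta a = 0)%C).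
  { apply (CI_unique _ _ _ (CI_minus _ _ _ _ (CI_scal (2 * a + 1) _ _ I1) (CI_scal (2 * a) _ _ I0))).
    eapply CI_ext; [|exact P]; intros x X; cbn beta; unfold fam.
    assert (B := base_ge1 (1 / 2) x (Rlt_le _ _ C) X).
    set (w := (1 + 1 / 2 * RtoC x)%C) in *.
    set (p := Cpower w (- (a + 1 + 1))).
    assert (P1 : Cpower w (- (a + 1)) = (w * p)%C).
    { unfold p; rewrite <- Cpower_S by lra; f_equal; ring. }
    assert (P0 : Cpower w (- a) = (w * (w * p))%C).
    { rewrite <- P1, <- Cpower_S by lra; f_equal; ring. }
    rewrite P0, P1; simpl pow; unfold w; field. }
  replace (2 * a * beta a)%C with
    ((2 * a + 1) * beta (a + 1) - ((2 * a + 1) * beta (a + 1) - 2 * a * beta a))%C by ring.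
  rewrite D; ring.
Qed.

Definition fam1 (y x : R) : R := Rpower (x * x + 2 * x) (- / 2) * Rpower (1 + x / 2) (- y).

Lemma fam1_eq y x : 0 < x -> fam 1 0 (RtoC y) (1 / 2) x = RtoC (fam1 y x).
Proof.
  intros X; unfold fam, kern, fam1; simpl pow.
  replace (RtoC x * RtoC x + 2 * 1 * RtoC x)%C with (RtoC (x * x + 2 * x))
    by (rewrite RtoC_plus, !RtoC_mult; ring).
  replace (1 + 1 / 2 * RtoC x)%C with (RtoC (1 + x / 2))
    by (rewrite half_RtoC, RtoC_plus; unfold Rdiv; rewrite RtoC_mult; ring).
  rewrite <- RtoC_opp, !Cpower_RtoC, RtoC_mult by nra; ring.
Qed.

Lemma sqrt_Rpower x : 0 < x -> Rpower x (- / 2) = / sqrt x.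
Proof. intros X; rewrite Rpower_Ropp, Rpower_sqrt by exact X; reflexivity. Qed.

Lemma continuous_fam1 y x : 0 < x -> continuous (fam1 y) x.
Proof.
  intros X; apply (ex_derive_continuous (fam1 y)); unfold fam1, Rpower; auto_derive.
  repeat split; nra.
Qed.

Lemma filterlim_at_right_cont (G : R -> R) : continuous G 0 ->
  filterlim G (at_right 0) (locally (G 0)).
Proof. intros H; eapply filterlim_filter_le_1; [apply filter_le_within|exact H]. Qed.

Lemma filterlim_atan_p : filterlim atan (Rbar_locally p_infty) (locally (PI / 2)).
Proof.
  apply filterlim_locally; intros eps; pose proof PI_RGT_0.
  set (d := Rmin (eps / 2) (PI / 2)).
  assert (D : 0 < d) by (apply Rmin_glb_lt; [pose proof (cond_pos eps)|]; lra).
  assert (D1 : d <= eps / 2) by apply Rmin_l.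
  assert (D2 : d <= PI / 2) by apply Rmin_r.
  exists (tan (PI / 2 - d)); intros x Hx.
  change (Rabs (atan x - PI / 2) < eps).
  pose proof (atan_increasing _ _ Hx) as I; rewrite atan_tan in I by lra.
  pose proof (atan_bound x); pose proof (cond_pos eps); apply Rabs_def1; lra.
Qed.

Lemma beta_half : beta (RtoC (/ 2)) = RtoC PI.
Proof.
  apply (CI_unique _ _ _ (beta_CI (RtoC (/ 2)) ltac:(rewrite Re_RtoC; lra))).
  apply CI_ext with (fun x => RtoC (fam1 (/ 2) x)).
  { intros x X; symmetry; apply fam1_eq, X. }
  apply CI_RtoC.
  replace PI with (2 * (PI / 2) - 2 * atan (sqrt (0 / 2)))
    by (unfold Rdiv; rewrite Rmult_0_l, sqrt_0, atan_0; field).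
  apply (RI_FTC (fun x => 2 * atan (sqrt (x / 2)))).
  - intros x X.
    assert (S : 0 < sqrt (x / 2)) by (apply sqrt_lt_R0; lra).
    assert (SS : sqrt (x / 2) * sqrt (x / 2) = x / 2) by (apply sqrt_sqrt; lra).
    auto_derive; [lra|].
    unfold fam1.
    assert (P1 : 0 < x * x + 2 * x) by nra.
    rewrite !sqrt_Rpower by lra.
    rewrite <- Rinv_mult, <- sqrt_mult by lra.
    replace ((x * x + 2 * x) * (1 + x / 2)) with ((x + 2) ^ 2 * (x / 2)) by field.
    rewrite (sqrt_mult ((x + 2) ^ 2)), sqrt_pow2 by (try lra; apply pow2_ge_0).
    unfold Rdiv in *; set (s := sqrt (x * / 2)) in *.
    replace (1 + s * (s * 1)) with ((x + 2) / 2) by lra. field; lra.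
  - intros x X; apply continuous_fam1, X.
  - apply (filterlim_at_right_cont (fun x => 2 * atan (sqrt (x / 2)))).
    apply (continuous_mult (K := R_AbsRing) (fun _ => 2)); [apply continuous_const|].
    apply (continuous_comp (fun x => sqrt (x / 2)) atan).
    + apply (continuous_comp (fun x => x / 2) sqrt); [|apply continuous_sqrt].
      apply (ex_derive_continuous (fun x => x / 2)); auto_derive; trivial.
    + apply continuous_atan.
  - apply (filterlim_comp _ _ _ (fun x => atan (sqrt (x / 2))) (fun y => 2 * y) _ (locally (PI / 2)));
      [|apply (filterlim_scal_r (V := R_NormedModule))].
    apply (filterlim_comp _ _ _ (fun x => sqrt (x / 2)) atan _ (Rbar_locally p_infty)).
    + apply (filterlim_comp _ _ _ (fun x => x / 2) sqrt _ (Rbar_locally p_infty));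
        [|apply filterlim_sqrt_p].
      intros P [M HM]; exists (2 * M); intros x Hx; apply HM; lra.
    + apply filterlim_atan_p.
Qed.

Lemma beta_1 : beta (RtoC 1) = RtoC 2.
Proof.
  apply (CI_unique _ _ _ (beta_CI (RtoC 1) ltac:(rewrite Re_RtoC; lra))).
  apply CI_ext with (fun x => RtoC (fam1 1 x)).
  { intros x X; symmetry; apply fam1_eq, X. }
  apply CI_RtoC.
  replace 2 with (2 * sqrt (1 - 0) - 2 * sqrt (0 / (0 + 2)))
    by (unfold Rdiv; rewrite Rmult_0_l, sqrt_0, Rminus_0_r, sqrt_1; field).
  apply (RI_FTC (fun x => 2 * sqrt (x / (x + 2)))).
  - intros x X.
    assert (P : 0 < x / (x + 2)) by (apply Rdiv_lt_0_compat; lra).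
    assert (S : 0 < sqrt (x / (x + 2))) by (apply sqrt_lt_R0, P).
    assert (SS : sqrt (x / (x + 2)) * sqrt (x / (x + 2)) = x / (x + 2)) by (apply sqrt_sqrt; lra).
    auto_derive; [repeat split; lra|].
    unfold fam1.
    rewrite sqrt_Rpower by nra; rewrite Rpower_Ropp, Rpower_1 by lra.
    replace (x * x + 2 * x) with ((x + 2) ^ 2 * (x / (x + 2))) by (field; lra).
    rewrite (sqrt_mult ((x + 2) ^ 2)), sqrt_pow2 by (try lra; apply pow2_ge_0).
    unfold Rdiv in *; set (s := sqrt (x * / (x + 2))) in *. field; lra.
  - intros x X; apply continuous_fam1, X.
  - apply (filterlim_at_right_cont (fun x => 2 * sqrt (x / (x + 2)))).
    apply (continuous_mult (K := R_AbsRing) (fun _ => 2)); [apply continuous_const|].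
    apply (continuous_comp (fun x => x / (x + 2)) sqrt); [|apply continuous_sqrt].
    apply (ex_derive_continuous (fun x => x / (x + 2))); auto_derive; lra.
  - apply (filterlim_comp _ _ _ (fun x => sqrt (x / (x + 2))) (fun y => 2 * y) _ (locally (sqrt (1 - 0))));
      [|apply (filterlim_scal_r (V := R_NormedModule))].
    apply (filterlim_comp _ _ _ (fun x => x / (x + 2)) sqrt _ (locally (1 - 0)));
      [|apply continuous_sqrt].
    apply filterlim_locally; intros eps.
    exists (2 / eps); intros x Hx.
    assert (E0 := cond_pos eps).
    assert (0 < 2 / eps) by (apply Rdiv_lt_0_compat; lra).
    change (Rabs (x / (x + 2) - (1 - 0)) < eps).
    replace (x / (x + 2) - (1 - 0)) with (- (2 / (x + 2))) by (field; lra).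
    rewrite Rabs_Ropp, Rabs_pos_eq by (left; apply Rdiv_lt_0_compat; lra).
    apply Rmult_lt_reg_r with (x + 2); [lra|].
    replace (2 / (x + 2) * (x + 2)) with 2 by (field; lra).
    apply (Rmult_lt_compat_l eps) in Hx; [|exact E0].
    replace (eps * (2 / eps)) with 2 in Hx by (field; lra). nra.
Qed.

(** The values of [beta] at the positive integers; [bseq n] belongs to [n + 1]. *)
Fixpoint bseq (n : nat) : R :=
  match n with O => 2 | S m => 2 * INR (S m) / (2 * INR (S m) + 1) * bseq m end.

Lemma bseq_pos n : 0 < bseq n.
Proof.
  induction n as [|n IH]; [simpl; lra|].
  change (0 < 2 * INR (S n) / (2 * INR (S n) + 1) * bseq n).
  assert (0 < INR (S n)) by (apply lt_0_INR; lia).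
  apply Rmult_lt_0_compat; [apply Rdiv_lt_0_compat; lra|exact IH].
Qed.

Lemma beta_INR n : beta (RtoC (INR (S n))) = RtoC (bseq n).
Proof.
  induction n as [|n IH]; [exact beta_1|].
  assert (P : 0 < INR (S n)) by (apply lt_0_INR; lia).
  assert (E := beta_S (RtoC (INR (S n))) P).
  rewrite IH in E.
  rewrite (S_INR (S n)), RtoC_plus.
  assert (N : (2 * RtoC (INR (S n)) + 1 <> 0)%C)
    by (apply Re_pos_neq0; autorewrite with reim; lra).
  apply (Cmult_eq_reg_l' (2 * RtoC (INR (S n)) + 1)); [exact N|]; rewrite E.
  change (bseq (S n)) with (2 * INR (S n) / (2 * INR (S n) + 1) * bseq n).
  unfold Rdiv; rewrite !RtoC_mult, RtoC_inv, RtoC_plus, RtoC_mult by lra.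
  field; exact N.
Qed.

Lemma Cexp_near1 a s : 0 <= Re a -> 0 <= s -> Cmod (Cexp (- a * RtoC s) - 1) <= Cmod a * s.
Proof.
  intros A S.
  assert (T := cderiv_mvt (fun t => Cexp (- a * RtoC t)) (fun t => Cexp (- a * RtoC t) * - a)%C
    (Cmod a) 0 s S).
  cbv beta in T.
  assert (E : Cexp (- a * RtoC 0) = 1%C) by (rewrite <- Cexp_0; f_equal; ring).
  rewrite E, Rminus_0_r in T; apply T.
  - intros t Ht; eapply cderiv_eq; [apply cderiv_Cexp, cderiv_scal, cderiv_id|]; cbn beta; ring.
  - intros t Ht; rewrite Cmod_mult, Cmod_Cexp, Cmod_opp; autorewrite with reim.
    assert (exp (- Re a * t - - Im a * 0) <= 1) by (rewrite <- exp_0; apply exp_le; nra).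
    pose proof (Cmod_ge_0 a); nra.
Qed.

Lemma ln_le_minus1 x : 0 < x -> ln x <= x - 1.
Proof.
  intros X; destruct (Req_dec x 1) as [->|N]; [rewrite ln_1; lra|].
  assert (ln x <> 0) by (intros H; apply N; rewrite <- (exp_ln x X), H; apply exp_0).
  pose proof (exp_ineq1 (ln x) H) as K; rewrite exp_ln in K by exact X; lra.
Qed.

(** The factor [(1 + x / 2)^(-a)] differs from one by at most [Cmod a * (x / 2)], and
    [x / 2] times an integrand is the difference of two consecutive ones. *)
Lemma beta_shift a n : 0 < Re a ->
  Cmod (beta (a + RtoC (INR (S (S n)))) - RtoC (bseq (S n)))
  <= Cmod a * (bseq n - bseq (S n)).
Proof.
  intros A; set (N := INR (S (S n))).
  assert (N0 : 0 < N) by (apply lt_0_INR; lia).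
  assert (N1 : 0 < INR (S n)) by (apply lt_0_INR; lia).
  assert (I0 := beta_CI (a + RtoC N) ltac:(autorewrite with reim; lra)).
  assert (I1 := beta_CI (RtoC N) N0).
  assert (I2 := beta_CI (RtoC (INR (S n))) N1).
  unfold N in I1 at 2; rewrite beta_INR in I1, I2.
  assert (J1 : RI (fam1 N) (bseq (S n))).
  { apply (RI_ext (fun x => Re (fam 1 0 (RtoC N) (1 / 2) x))).
    - intros x X; rewrite fam1_eq by exact X; reflexivity.
    - exact (proj1 (proj1 (CI_RI _ _) I1)). }
  assert (J2 : RI (fam1 (INR (S n))) (bseq n)).
  { apply (RI_ext (fun x => Re (fam 1 0 (RtoC (INR (S n))) (1 / 2) x))).
    - intros x X; rewrite fam1_eq by exact X; reflexivity.
    - exact (proj1 (proj1 (CI_RI _ _) I2)). }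
  replace (Cmod a * (bseq n - bseq (S n))) with (Cmod a * (bseq n + -1 * bseq (S n))) by ring.
  apply (CI_le (fun x => fam 1 0 (a + RtoC N) (1 / 2) x - fam 1 0 (RtoC N) (1 / 2) x)%C
    (fun x => Cmod a * (fam1 (INR (S n)) x + -1 * fam1 N x))).
  - apply CI_minus; assumption.
  - apply RI_scal, RI_plus; [exact J2|apply RI_scal, J1].
  - intros x X.
    assert (E : fam 1 0 (a + RtoC N) (1 / 2) x =
      (fam 1 0 (RtoC N) (1 / 2) x * Cexp (- a * RtoC (ln (1 + x / 2))))%C).
    { unfold fam.
      replace (- (a + RtoC N))%C with (- RtoC N + - a)%C by ring; rewrite Cpower_plus.
      replace (1 + 1 / 2 * RtoC x)%C with (RtoC (1 + x / 2))
        by (rewrite half_RtoC, RtoC_plus; unfold Rdiv; rewrite RtoC_mult; ring).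
      unfold Cpower at 2; rewrite Clog_RtoC by lra; ring. }
    rewrite E, fam1_eq by exact X.
    replace (RtoC (fam1 N x) * Cexp (- a * RtoC (ln (1 + x / 2))) - RtoC (fam1 N x))%C with
      (RtoC (fam1 N x) * (Cexp (- a * RtoC (ln (1 + x / 2))) - 1))%C by ring.
    assert (L0 : 0 <= ln (1 + x / 2)) by (rewrite <- ln_1; left; apply ln_increasing; lra).
    assert (L1 : ln (1 + x / 2) <= x / 2) by (pose proof (ln_le_minus1 (1 + x / 2) ltac:(lra)); lra).
    assert (B := Cexp_near1 a _ (Rlt_le _ _ A) L0).
    assert (F0 : 0 < fam1 N x) by (apply Rmult_lt_0_compat; apply Rpower_pos).
    assert (F1 : fam1 (INR (S n)) x = (1 + x / 2) * fam1 N x).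
    { unfold fam1, N; rewrite (S_INR (S n)).
      replace (- INR (S n)) with (1 + - (INR (S n) + 1)) by ring.
      rewrite Rpower_plus, Rpower_1 by lra; ring. }
    rewrite F1, Cmod_mult, Cmod_R, Rabs_pos_eq by lra.
    replace (Cmod a * ((1 + x / 2) * fam1 N x + -1 * fam1 N x)) with (fam1 N x * (Cmod a * (x / 2))) by field.
    apply Rmult_le_compat_l; [lra|].
    eapply Rle_trans; [exact B|]; apply Rmult_le_compat_l; [apply Cmod_ge_0|exact L1].
Qed.

(** * The Gamma function *)

Definition gint (a : C) (t : R) : C := (Cpower (RtoC t) (a - 1) * RtoC (exp (- t)))%C.

Lemma gint_Cmod a t : 0 < t -> Cmod (gint a t) = Rpower t (Re a - 1) * exp (- t).
Proof.
  intros T; unfold gint; rewrite Cmod_mult, Cmod_Cpower_RtoC, Cmod_R, Rabs_pos_eq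
    by (exact T || left; apply exp_pos); autorewrite with reim; reflexivity.
Qed.

Lemma cderiv_powexp b t : 0 < t ->
  cderiv (fun s => Cpower (RtoC s) b * RtoC (exp (- s)))%C t
    (b * (Cpower (RtoC t) (b - 1) * RtoC (exp (- t))) - Cpower (RtoC t) b * RtoC (exp (- t)))%C.
Proof.
  intros T; eapply cderiv_eq.
  - apply cderiv_mult; [apply (cderiv_Cpower RtoC); [apply cderiv_id|exact T]|].
    apply (cderiv_RtoC (fun s => exp (- s)) t (- exp (- t))); auto_derive; [trivial|ring].
  - cbn beta; replace (b - 1)%C with (b + - (1))%C by ring.
    rewrite Cpower_plus, (Cpower_opp _ 1), Cpower_1, RtoC_opp by exact T.
    field; apply Re_pos_neq0, T.
Qed.

Lemma gint_ccont a t : 0 < t -> ccont (gint a) t.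
Proof. intros T; eapply cderiv_ccont, cderiv_powexp, T. Qed.

Lemma exp_dominates m t : (0 < m)%nat -> 0 <= t -> (1 + t) ^ m * exp (- t) <= INR m ^ m.
Proof.
  intros M T.
  assert (m1 : 1 <= INR m) by (apply (le_INR 1); lia).
  assert (E : (1 + t) ^ m <= INR m ^ m * exp t).
  { assert (e1 : exp t = exp (t / INR m) ^ m).
    { rewrite <- Rpower_pow by apply exp_pos; unfold Rpower; rewrite ln_exp; f_equal; field; lra. }
    rewrite e1, <- Rpow_mult_distr; apply pow_incr; split; [lra|].
    assert (1 + t / INR m <= exp (t / INR m)) by apply exp_ineq1_le.
    assert (INR m * (1 + t / INR m) <= INR m * exp (t / INR m)) by (apply Rmult_le_compat_l; lra).
    replace (INR m * (1 + t / INR m)) with (INR m + t) in H0 by (field; lra). lra. }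
  apply Rmult_le_reg_r with (exp t); [apply exp_pos|].
  rewrite Rmult_assoc, <- exp_plus, Rplus_opp_l, exp_0, Rmult_1_r; exact E.
Qed.

(** A majorant of the Gamma integrand up to a constant, with the primitive
    [(t / (1 + t))^al / al]. *)
Definition gmaj (al t : R) : R := Rpower t (al - 1) * Rpower (1 + t) (- al - 1).

Lemma tends_gmaj_0 al : 0 < al ->
  filterlim (fun t => Rpower t al * Rpower (1 + t) (- al)) (at_right 0) (locally 0).
Proof.
  intros Al; apply filterlim_locally; intros eps.
  exists (mkposreal (Rpower eps (/ al)) (Rpower_pos _ _)); intros t Ht T.
  change (Rabs (t - 0) < Rpower eps (/ al)) in Ht.
  rewrite Rminus_0_r, Rabs_pos_eq in Ht by lra.
  change (Rabs (Rpower t al * Rpower (1 + t) (- al) - 0) < eps).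
  rewrite Rminus_0_r, Rabs_pos_eq
    by (left; apply Rmult_lt_0_compat; apply Rpower_pos).
  assert (K : Rpower t al < eps).
  { apply Rlt_le_trans with (Rpower (Rpower eps (/ al)) al).
    - unfold Rpower at 1 2; apply exp_increasing, Rmult_lt_compat_l; [exact Al|].
      apply ln_increasing; assumption.
    - rewrite Rpower_mult, Rinv_l, Rpower_1 by (apply cond_pos || lra); lra. }
  pose proof (Rpower_le_1 (1 + t) (- al) ltac:(lra) ltac:(lra)).
  pose proof (Rpower_pos t al); pose proof (Rpower_pos (1 + t) (- al)); nra.
Qed.

Lemma RI_gmaj al : 0 < al -> RI (gmaj al) (/ al).
Proof.
  intros Al.
  replace (/ al) with (/ al * 1 - / al * 0) by ring.
  apply (RI_FTC (fun t => / al * (Rpower t al * Rpower (1 + t) (- al)))).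
  - intros t T; unfold gmaj, Rpower; auto_derive; [repeat split; lra|].
    replace ((al - 1) * ln t) with (al * ln t + - ln t) by ring.
    replace ((- al - 1) * ln (1 + t)) with (- al * ln (1 + t) + - ln (1 + t)) by ring.
    rewrite !exp_plus, !exp_Ropp, !exp_ln by lra. field; lra.
  - intros t T; apply (ex_derive_continuous (gmaj al)); unfold gmaj, Rpower; auto_derive; lra.
  - apply (filterlim_comp _ _ _ (fun t => Rpower t al * Rpower (1 + t) (- al)) (fun y => / al * y) _ (locally 0));
      [apply tends_gmaj_0, Al|apply (filterlim_scal_r (V := R_NormedModule))].
  - apply (filterlim_comp _ _ _ (fun t => Rpower t al * Rpower (1 + t) (- al)) (fun y => / al * y) _ (locally 1));
      [|apply (filterlim_scal_r (V := R_NormedModule))].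
    assert (L : filterlim (fun t => al * ln (1 - / (1 + t))) (Rbar_locally p_infty) (locally 0)).
    { replace 0 with (al * ln 1) by (rewrite ln_1; ring).
      apply (filterlim_comp _ _ _ (fun t => 1 - / (1 + t)) (fun y => al * ln y) _ (locally 1)).
      - apply filterlim_locally; intros eps; assert (E0 := cond_pos eps).
        exists (/ eps); intros t Ht.
        assert (0 < / eps) by (apply Rinv_0_lt_compat, E0).
        change (Rabs (1 - / (1 + t) - 1) < eps).
        replace (1 - / (1 + t) - 1) with (- / (1 + t)) by ring.
        rewrite Rabs_Ropp, Rabs_pos_eq by (left; apply Rinv_0_lt_compat; lra).
        rewrite <- (Rinv_inv eps); apply Rinv_lt_contravar; nra.
      - apply (ex_derive_continuous (fun y => al * ln y)); auto_derive; lra. }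
    apply (filterlim_ext_loc (fun t => exp (al * ln (1 - / (1 + t))))).
    + exists 0; intros t T; unfold Rpower; rewrite <- exp_plus; f_equal.
      replace (1 - / (1 + t)) with (t * / (1 + t)) by (field; lra).
      rewrite ln_mult, ln_Rinv by (lra || apply Rinv_0_lt_compat; lra); ring.
    + assert (L2 : filterlim (fun t => exp (al * ln (1 - / (1 + t)))) (Rbar_locally p_infty) (locally (exp 0))).
      { apply (filterlim_comp _ _ _ (fun t => al * ln (1 - / (1 + t))) exp _ (locally 0));
          [exact L|apply (ex_derive_continuous exp); auto_derive; trivial]. }
      rewrite exp_0 in L2; exact L2.
Qed.

Lemma nat_above x : exists m : nat, (0 < m)%nat /\ x <= INR m.
Proof.
  destruct (archimed (Rabs x)) as [A _].
  exists (S (Z.to_nat (up (Rabs x)))); split; [lia|].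
  rewrite S_INR, INR_IZR_INZ, Z2Nat.id.
  - pose proof (Rle_abs x); lra.
  - apply le_IZR; pose proof (Rabs_pos x); lra.
Qed.

Lemma gint_dom a : 0 < Re a -> exists K, 0 < K /\ forall t, 0 < t ->
  Cmod (gint a t) <= K * gmaj (Re a) t /\ Rpower (1 + t) (Re a + 1) * exp (- t) <= K.
Proof.
  intros A; destruct (nat_above (Re a + 1)) as [m [M Hm]].
  assert (m1 : 1 <= INR m) by (apply (le_INR 1); lia).
  exists (INR m ^ m); split; [apply pow_lt; lra|]; intros t T.
  assert (B : Rpower (1 + t) (Re a + 1) * exp (- t) <= INR m ^ m).
  { eapply Rle_trans; [|apply (exp_dominates m t M); lra].
    apply Rmult_le_compat_r; [left; apply exp_pos|].
    rewrite <- Rpower_pow by lra; apply Rle_Rpower; lra. }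
  split; [|exact B].
  rewrite gint_Cmod by exact T; unfold gmaj.
  replace (exp (- t)) with
    (Rpower (1 + t) (- Re a - 1) * (Rpower (1 + t) (Re a + 1) * exp (- t))).
  - rewrite (Rmult_comm (INR m ^ m)), <- Rmult_assoc.
    apply Rmult_le_compat_l; [|exact B].
    left; apply Rmult_lt_0_compat; apply Rpower_pos.
  - rewrite <- Rmult_assoc, <- Rpower_plus.
    replace (- Re a - 1 + (Re a + 1)) with 0 by ring; rewrite Rpower_O by lra; ring.
Qed.

Lemma gamma_CI a : 0 < Re a -> CI (gint a) (CGamma a).
Proof.
  intros A; destruct (gint_dom a A) as [K [K0 HK]].
  destruct (CI_dom (gint a) (fun t => K * gmaj (Re a) t) (K * / Re a)) as [l [Hl _]].
  - intros; apply gint_ccont; assumption.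
  - apply RI_scal, RI_gmaj, A.
  - intros t T; apply HK, T.
  - unfold CGamma; fold (gint a); rewrite (proj2 (CI_correct _ _ Hl)); exact Hl.
Qed.

Lemma gamma_S a : 0 < Re a -> CGamma (a + 1) = (a * CGamma a)%C.
Proof.
  intros A; destruct (gint_dom a A) as [K [K0 HK]].
  assert (I0 := gamma_CI a A).
  assert (I1 := gamma_CI (a + 1) ltac:(autorewrite with reim; lra)).
  assert (Z : (a * CGamma a - CGamma (a + 1) = 0)%C).
  { apply (CI_unique _ _ _ (CI_minus _ _ _ _ (CI_scal a _ _ I0) I1)).
    assert (EqG : forall t, gint (a + 1) t = (Cpower (RtoC t) a * RtoC (exp (- t)))%C)
      by (intros t; unfold gint; do 2 f_equal; ring).
    assert (Bd : forall t, 0 < t ->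
      Cmod (Cpower (RtoC t) a * RtoC (exp (- t))) <= K * (Rpower t (Re a) * Rpower (1 + t) (- Re a))
      /\ Cmod (Cpower (RtoC t) a * RtoC (exp (- t))) <= K * / (1 + t)).
    { intros t T; rewrite Cmod_mult, Cmod_Cpower_RtoC, Cmod_R, Rabs_pos_eq by (exact T || left; apply exp_pos).
      destruct (HK t T) as [_ H2].
      assert (P1 := Rpower_pos t (Re a)); assert (P2 := Rpower_pos (1 + t) (Re a)).
      rewrite Rpower_plus, Rpower_1 in H2 by lra.
      pose proof (exp_pos (- t)) as e0.
      split.
      - rewrite Rpower_Ropp.
        apply Rmult_le_reg_r with (Rpower (1 + t) (Re a)); [exact P2|].
        replace (K * (Rpower t (Re a) * / Rpower (1 + t) (Re a)) * Rpower (1 + t) (Re a))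
          with (Rpower t (Re a) * K) by (field; lra).
        replace (Rpower t (Re a) * exp (- t) * Rpower (1 + t) (Re a)) with
          (Rpower t (Re a) * (Rpower (1 + t) (Re a) * exp (- t))) by ring.
        apply Rmult_le_compat_l; [lra|].
        assert (0 < Rpower (1 + t) (Re a) * exp (- t)) by (apply Rmult_lt_0_compat; lra). nra.
      - assert (Rpower t (Re a) <= Rpower (1 + t) (Re a)) by (apply Rle_Rpower_l; lra).
        apply Rmult_le_reg_r with (1 + t); [lra|].
        replace (K * / (1 + t) * (1 + t)) with K by (field; lra).
        eapply Rle_trans; [|exact H2].
        rewrite (Rmult_assoc _ (1 + t)), (Rmult_comm (1 + t)), <- Rmult_assoc.
        apply Rmult_le_compat_r; [lra|apply Rmult_le_compat_r; lra]. }
    apply (CI_FTC0 (fun t => Cpower (RtoC t) a * RtoC (exp (- t)))%C).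
    - intros t T; rewrite EqG; apply cderiv_powexp, T.
    - intros t T; destruct (gint_ccont a t T) as [C1 C2].
      destruct (gint_ccont (a + 1) t T) as [C3 C4].
      split.
      + apply (continuous_ext (fun t => (Re a * Re (gint a t) - Im a * Im (gint a t)) - Re (gint (a + 1) t)));
          [reflexivity|].
        apply (continuous_minus (V := R_NormedModule)); [|exact C3].
        apply (continuous_minus (V := R_NormedModule));
          apply (continuous_scal_r (V := R_NormedModule)); assumption.
      + apply (continuous_ext (fun t => (Re a * Im (gint a t) + Im a * Re (gint a t)) - Im (gint (a + 1) t)));
          [reflexivity|].
        apply (continuous_minus (V := R_NormedModule)); [|exact C4].
        apply (continuous_plus (V := R_NormedModule));
          apply (continuous_scal_r (V := R_NormedModule)); assumption.
    - intros eps He.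
      assert (E1 : 0 < eps / K) by (apply Rdiv_lt_0_compat; assumption).
      assert (L := proj1 (filterlim_locally _ _) (tends_gmaj_0 (Re a) A) (mkposreal _ E1)).
      destruct L as [d Hd]; exists d; intros t Ht T; specialize (Hd t Ht T).
      change (Rabs (Rpower t (Re a) * Rpower (1 + t) (- Re a) - 0) < eps / K) in Hd.
      rewrite Rminus_0_r, Rabs_pos_eq in Hd by (left; apply Rmult_lt_0_compat; apply Rpower_pos).
      eapply Rle_lt_trans; [exact (proj1 (Bd t T))|].
      apply (Rmult_lt_compat_l K) in Hd; [|exact K0].
      replace (K * (eps / K)) with eps in Hd by (field; lra); exact Hd.
    - intros eps He; exists (K / eps); intros t Ht.
      assert (0 < K / eps) by (apply Rdiv_lt_0_compat; assumption).
      eapply Rle_lt_trans; [exact (proj2 (Bd t ltac:(lra)))|].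
      apply Rmult_lt_reg_r with (1 + t); [lra|].
      rewrite Rmult_assoc, Rinv_l, Rmult_1_r by lra.
      apply (Rmult_lt_compat_l eps) in Ht; [|exact He].
      replace (eps * (K / eps)) with K in Ht by (field; lra). nra. }
  replace (a * CGamma a)%C with ((a * CGamma a - CGamma (a + 1)) + CGamma (a + 1))%C by ring.
  rewrite Z; ring.
Qed.

Lemma gamma_1 : CGamma 1 = 1%C.
Proof.
  apply (CI_unique _ _ _ (gamma_CI 1 ltac:(simpl; lra))).
  apply (CI_ext (fun t => RtoC (exp (- t)))).
  { intros t T; unfold gint; replace (1 - 1)%C with (RtoC 0) by ring; rewrite Cpower_0; ring. }
  apply CI_RtoC.
  replace 1 with (- 0 - - exp (- 0)) by (rewrite Ropp_0, exp_0; ring).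
  apply (RI_FTC (fun t => - exp (- t))).
  - intros t _; auto_derive; [trivial|ring].
  - intros t _; apply (ex_derive_continuous (fun t => exp (- t))); auto_derive; trivial.
  - apply (filterlim_at_right_cont (fun t => - exp (- t))).
    apply (ex_derive_continuous (fun t => - exp (- t))); auto_derive; trivial.
  - apply (filterlim_comp _ _ _ (fun t => exp (- t)) Ropp _ (locally 0)).
    + apply (filterlim_comp _ _ _ Ropp exp _ (Rbar_locally m_infty)); [|apply is_lim_exp_m].
      intros P [M HM]; exists (- M); intros x Hx; apply HM; lra.
    + apply (filterlim_opp (V := R_NormedModule)).
Qed.

Lemma gamma_fact n : CGamma (RtoC (INR (S n))) = RtoC (INR (fact n)).
Proof.
  induction n as [|n IH]; [exact gamma_1|].
  rewrite (S_INR (S n)), RtoC_plus, gamma_S, IH by (apply lt_0_INR; lia).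
  rewrite fact_simpl, mult_INR, RtoC_mult; reflexivity.
Qed.

(** * The ratio of Gamma functions *)

Definition Clim (x : nat -> C) (l : C) : Prop :=
  forall eps, 0 < eps -> exists N, forall n, (N <= n)%nat -> Cmod (x n - l) < eps.

Lemma Clim_unique x l m : Clim x l -> Clim x m -> l = m.
Proof.
  intros A B.
  assert (Z : (l - m = 0)%C).
  { apply Cmod_eq_0; destruct (Rle_lt_or_eq_dec 0 _ (Cmod_ge_0 (l - m))) as [L|L]; [exfalso|auto].
    destruct (A (Cmod (l - m) / 2)) as [N1 H1]; [lra|].
    destruct (B (Cmod (l - m) / 2)) as [N2 H2]; [lra|].
    specialize (H1 (Nat.max N1 N2) ltac:(lia)); specialize (H2 (Nat.max N1 N2) ltac:(lia)).
    set (y := x (Nat.max N1 N2)) in *.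
    assert (Cmod (l - m) <= Cmod (y - l) + Cmod (y - m)); [|lra].
    replace (l - m)%C with (- (y - l) + (y - m))%C by ring.
    eapply Rle_trans; [apply Cmod_triangle|]; rewrite Cmod_opp; lra. }
  replace l with ((l - m) + m)%C by ring; rewrite Z; ring.
Qed.

Lemma Clim_const c : Clim (fun _ => c) c.
Proof.
  intros eps He; exists O; intros n _; replace (c - c)%C with (RtoC 0) by ring.
  rewrite Cmod_0; exact He.
Qed.

Lemma Clim_ext x y l : (forall n, x n = y n) -> Clim x l -> Clim y l.
Proof.
  intros H A eps He; destruct (A eps He) as [N HN]; exists N; intros n Hn; rewrite <- H; apply HN, Hn.
Qed.

Lemma Clim_mult x y l m : Clim x l -> Clim y m -> Clim (fun n => x n * y n)%C (l * m)%C.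
Proof.
  intros A B eps He.
  pose proof (Cmod_ge_0 l); pose proof (Cmod_ge_0 m).
  destruct (A (eps / 2 / (Cmod m + 1))) as [N1 H1]; [apply Rdiv_lt_0_compat; lra|].
  destruct (B (Rmin 1 (eps / 2 / (Cmod l + 1)))) as [N2 H2].
  { apply Rmin_glb_lt; [lra|apply Rdiv_lt_0_compat; lra]. }
  exists (Nat.max N1 N2); intros n Hn.
  specialize (H1 n ltac:(lia)); specialize (H2 n ltac:(lia)).
  assert (H2' : Cmod (y n - m) < 1) by (eapply Rlt_le_trans; [exact H2|apply Rmin_l]).
  assert (H2'' : Cmod (y n - m) < eps / 2 / (Cmod l + 1))
    by (eapply Rlt_le_trans; [exact H2|apply Rmin_r]).
  replace (x n * y n - l * m)%C with ((x n - l) * y n + l * (y n - m))%C by ring.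
  eapply Rle_lt_trans; [apply Cmod_triangle|]; rewrite !Cmod_mult.
  assert (Y : Cmod (y n) <= Cmod m + 1).
  { replace (y n) with ((y n - m) + m)%C by ring.
    eapply Rle_trans; [apply Cmod_triangle|]; lra. }
  apply (Rmult_lt_compat_l (Cmod m + 1)) in H1; [|lra].
  replace ((Cmod m + 1) * (eps / 2 / (Cmod m + 1))) with (eps / 2) in H1 by (field; lra).
  apply (Rmult_lt_compat_l (Cmod l + 1)) in H2''; [|lra].
  replace ((Cmod l + 1) * (eps / 2 / (Cmod l + 1))) with (eps / 2) in H2'' by (field; lra).
  pose proof (Cmod_ge_0 (x n - l)); pose proof (Cmod_ge_0 (y n - m)); pose proof (Cmod_ge_0 (y n)).
  assert (Cmod (x n - l) * Cmod (y n) <= (Cmod m + 1) * Cmod (x n - l)) by nra.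
  nra.
Qed.

(** Moments of the Gamma density of parameter [n + 1], rescaled to mean one. *)
Fixpoint mom (n k : nat) : R :=
  match k with O => 1 | S i => mom n i * (INR (S (n + i)) / INR (S n)) end.

Definition gdens (n : nat) (t : R) : R := t ^ n * exp (- t) / INR (fact n).

Lemma mom_fact n k : mom n k = INR (fact (n + k)) / (INR (fact n) * INR (S n) ^ k).
Proof.
  assert (F : INR (fact n) <> 0) by apply INR_fact_neq_0.
  assert (P : INR (S n) <> 0) by (apply not_0_INR; lia).
  induction k as [|k IH].
  - simpl mom; rewrite Nat.add_0_r; simpl pow; field; exact F.
  - change (mom n (S k)) with (mom n k * (INR (S (n + k)) / INR (S n))); rewrite IH, Nat.add_succ_r, (fact_simpl (n + k)), mult_INR.
    change (INR (S n) ^ S k) with (INR (S n) * INR (S n) ^ k).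
    field; repeat split; try assumption. apply pow_nonzero, P.
Qed.

Lemma mom_lim k : is_lim_seq (fun n => mom n k) 1.
Proof.
  induction k as [|k IH]; [apply is_lim_seq_const|].
  apply (is_lim_seq_ext (fun n => mom n k * (1 + INR k * / INR (S n)))).
  { intros n; change (mom n (S k)) with (mom n k * (INR (S (n + k)) / INR (S n))); f_equal.
    assert (INR (S n) <> 0) by (apply not_0_INR; lia).
    replace (S (n + k)) with (S n + k)%nat by lia; rewrite plus_INR; field; assumption. }
  assert (L : is_lim_seq (fun n => mom n k * (1 + INR k * / INR (S n))) (1 * (1 + INR k * 0))).
  { apply is_lim_seq_mult'; [exact IH|].
    apply is_lim_seq_plus'; [apply is_lim_seq_const|].
    apply (is_lim_seq_scal_l (fun n => / INR (S n)) (INR k) 0).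
    apply (is_lim_seq_incr_1 (fun n => / INR n)).
    apply (is_lim_seq_inv INR p_infty); [apply is_lim_seq_INR|discriminate]. }
  rewrite Rmult_0_r, Rplus_0_r, Rmult_1_r in L; exact L.
Qed.

Lemma gint_INR n t : 0 < t -> gint (RtoC (INR (S n))) t = RtoC (t ^ n * exp (- t)).
Proof.
  intros T; unfold gint.
  replace (RtoC (INR (S n)) - 1)%C with (RtoC (INR n)) by (rewrite S_INR, RtoC_plus; ring).
  rewrite Cpower_RtoC, Rpower_pow, RtoC_mult by exact T; reflexivity.
Qed.

Lemma mom_RI n k : RI (fun t => gdens n t * (t / INR (S n)) ^ k) (mom n k).
Proof.
  assert (F : INR (fact n) <> 0) by apply INR_fact_neq_0.
  assert (P : INR (S n) <> 0) by (apply not_0_INR; lia).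
  assert (I := gamma_CI (RtoC (INR (S (n + k)))) ltac:(rewrite Re_RtoC; apply lt_0_INR; lia)).
  rewrite gamma_fact in I; apply CI_RI in I; destruct I as [I _].
  apply (RI_scal (/ (INR (fact n) * INR (S n) ^ k))) in I.
  rewrite mom_fact; unfold Rdiv at 2; rewrite Rmult_comm.
  eapply RI_ext; [|exact I].
  intros t T; cbn beta; rewrite gint_INR, Re_RtoC by exact T.
  unfold gdens, Rdiv; rewrite Rpow_mult_distr, pow_inv, pow_add.
  field; split; [apply pow_nonzero, P|exact F].
Qed.

(** Three ranges of [u] are distinguished: above one, between one half and one, and
    below one half, where the left side is at most two. *)
Lemma Cpower_near1 a m u : 0 < Re a -> (0 < m)%nat -> Re a <= INR m -> 0 < u ->
  Cmod (Cpower (RtoC u) a - 1) <= (2 * Cmod a + 4) * (Rabs (u - 1) * (1 + u ^ m)).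
Proof.
  intros A M Hm U.
  pose proof (Cmod_ge_0 a) as a0.
  assert (um : 0 < u ^ m) by (apply pow_lt, U).
  destruct (Rle_dec 1 u) as [L|L].
  - rewrite Rabs_pos_eq by lra.
    assert (L0 : 0 <= ln u) by (rewrite <- ln_1; destruct L as [L|L];
      [left; apply ln_increasing; lra|rewrite L; lra]).
    assert (E : (Cpower (RtoC u) a - 1 = - (Cpower (RtoC u) a * (Cexp (- a * RtoC (ln u)) - 1)))%C).
    { unfold Cpower; rewrite Clog_RtoC by exact U.
      replace (- a * RtoC (ln u))%C with (- (a * RtoC (ln u)))%C by ring.
      rewrite Cexp_opp; field; apply Cexp_neq0. }
    rewrite E, Cmod_opp, Cmod_mult, Cmod_Cpower_RtoC by exact U.
    assert (B := Cexp_near1 a (ln u) (Rlt_le _ _ A) L0).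
    assert (B2 := ln_le_minus1 u U).
    assert (B3 : Rpower u (Re a) <= u ^ m) by (rewrite <- Rpower_pow by exact U; apply Rle_Rpower; lra).
    pose proof (Rpower_pos u (Re a)); pose proof (Cmod_ge_0 (Cexp (- a * RtoC (ln u)) - 1)).
    assert (q1 : 0 <= (u - 1) * u ^ m) by (apply Rmult_le_pos; lra).
    assert (q2 : 0 <= Cmod a * ((u - 1) * u ^ m)) by (apply Rmult_le_pos; lra).
    assert (q3 : 0 <= Cmod a * (u - 1)) by (apply Rmult_le_pos; lra).
    apply Rle_trans with (u ^ m * (Cmod a * (u - 1))); [|lra].
    apply Rmult_le_compat; try lra.
    eapply Rle_trans; [exact B|]; apply Rmult_le_compat_l; lra.
  - assert (Ru : Rpower u (Re a) <= 1).
    { unfold Rpower; rewrite <- exp_0; apply exp_le.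
      assert (ln u < 0) by (rewrite <- ln_1; apply ln_increasing; lra). nra. }
    rewrite Rabs_left by lra.
    destruct (Rle_dec (/ 2) u) as [L2|L2].
    + assert (E : Cpower (RtoC u) a = Cexp (- a * RtoC (- ln u))).
      { unfold Cpower; rewrite Clog_RtoC by exact U; f_equal; rewrite RtoC_opp; ring. }
      assert (L0 : ln u < 0) by (rewrite <- ln_1; apply ln_increasing; lra).
      rewrite E; eapply Rle_trans; [apply Cexp_near1; lra|].
      assert (B2 : - ln u <= 2 * (1 - u)).
      { rewrite <- ln_Rinv by exact U.
        eapply Rle_trans; [apply ln_le_minus1, Rinv_0_lt_compat, U|].
        apply Rmult_le_reg_r with u; [exact U|].
        rewrite Rmult_minus_distr_r, Rinv_l by lra; nra. }
      assert (q1 : 0 <= (1 - u) * u ^ m) by (apply Rmult_le_pos; lra).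
      assert (q2 : 0 <= Cmod a * ((1 - u) * u ^ m)) by (apply Rmult_le_pos; lra).
      assert (q3 : Cmod a * - ln u <= Cmod a * (2 * (1 - u))) by (apply Rmult_le_compat_l; lra).
      lra.
    + assert (q1 : 0 <= (1 - u) * u ^ m) by (apply Rmult_le_pos; lra).
      assert (q2 : 0 <= Cmod a * ((1 - u) * u ^ m)) by (apply Rmult_le_pos; lra).
      assert (q3 : 0 <= Cmod a * (1 - u)) by (apply Rmult_le_pos; lra).
      apply Rle_trans with 2; [|lra].
      eapply Rle_trans; [apply Cmod_triangle|].
      rewrite Cmod_opp, Cmod_1, Cmod_Cpower_RtoC by exact U; lra.
Qed.

(** [Gamma (a + N) / (N^a Gamma N)]: the Gamma density of parameter [N] concentrates
    around its mean, so the quotient, which is the average of [(t / N)^a], tends to one. *)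
Definition gratio (a : C) (n : nat) : C :=
  (CGamma (a + RtoC (INR (S n))) / (Cpower (RtoC (INR (S n))) a * RtoC (INR (fact n))))%C.

(** By [Cpower_near1] and the inequality of the two means, the deviation from one is
    bounded by [d] times bounded moments plus [1 / d] times central moments of order two,
    which tend to zero. *)
Lemma gratio_lim a : 0 < Re a -> Clim (gratio a) 1.
Proof.
  intros A; destruct (nat_above (Re a)) as [m [M Hm]].
  set (K := 2 * Cmod a + 4).
  assert (K0 : 0 < K) by (unfold K; pose proof (Cmod_ge_0 a); lra).
  assert (bound : forall n d, 0 < d -> Cmod (gratio a n - 1) <=
    K / 2 * (d * (mom n 0 + mom n m) + / d * (mom n 2 + -2 * mom n 1 + mom n 0
      + (mom n (m + 2) + -2 * mom n (m + 1) + mom n m)))).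
  { intros n d D; set (N := INR (S n)).
    assert (N0 : 0 < N) by (apply lt_0_INR; lia).
    assert (F : 0 < INR (fact n)) by (apply lt_0_INR, lt_O_fact).
    apply (CI_le (fun t => RtoC (gdens n t) * Cpower (RtoC (t / N)) a - RtoC (gdens n t * (t / N) ^ 0))%C
      (fun t => K / 2 * (d * (gdens n t * (t / N) ^ 0 + gdens n t * (t / N) ^ m)
         + / d * (gdens n t * (t / N) ^ 2 + -2 * (gdens n t * (t / N) ^ 1) + gdens n t * (t / N) ^ 0
          + (gdens n t * (t / N) ^ (m + 2) + -2 * (gdens n t * (t / N) ^ (m + 1)) + gdens n t * (t / N) ^ m))))).
    - apply CI_minus; [|apply (CI_RtoC _ 1), (mom_RI n 0)].
      assert (I := gamma_CI (a + RtoC N) ltac:(autorewrite with reim; lra)).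
      apply (CI_scal (/ (Cpower (RtoC N) a * RtoC (INR (fact n))))) in I.
      unfold gratio; fold N; unfold Cdiv; rewrite Cmult_comm.
      eapply CI_ext; [|exact I]; intros t T; cbn beta; unfold gint.
      assert (tN : 0 < t / N) by (apply Rdiv_lt_0_compat; assumption).
      assert (E1 : Cpower (RtoC t) a = (Cpower (RtoC N) a * Cpower (RtoC (t / N)) a)%C).
      { rewrite <- Cpower_scal by (exact N0 || exact tN).
        rewrite <- RtoC_mult; do 2 f_equal; field; lra. }
      replace (a + RtoC N - 1)%C with (a + RtoC (INR n))%C
        by (unfold N; rewrite S_INR, RtoC_plus; ring).
      rewrite Cpower_plus, E1, Cpower_RtoC, Rpower_pow by exact T.
      generalize (Cpower (RtoC (t / N)) a); intros q.
      unfold gdens, Rdiv; rewrite !RtoC_mult, RtoC_inv by lra.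
      field; split; [|apply Cpower_neq0].
      apply Re_pos_neq0; exact F.
    - apply RI_scal, RI_plus; apply RI_scal.
      + exact (RI_plus _ _ _ _ (mom_RI n 0) (mom_RI n m)).
      + exact (RI_plus _ _ _ _
          (RI_plus _ _ _ _ (RI_plus _ _ _ _ (mom_RI n 2) (RI_scal (-2) _ _ (mom_RI n 1))) (mom_RI n 0))
          (RI_plus _ _ _ _ (RI_plus _ _ _ _ (mom_RI n (m + 2)) (RI_scal (-2) _ _ (mom_RI n (m + 1))))
             (mom_RI n m))).
    - intros t T; set (u := t / N); assert (U : 0 < u) by (apply Rdiv_lt_0_compat; assumption).
      assert (G0 : 0 < gdens n t).
      { unfold gdens; apply Rdiv_lt_0_compat; [|exact F].
        apply Rmult_lt_0_compat; [apply pow_lt, T|apply exp_pos]. }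
      replace (RtoC (gdens n t) * Cpower (RtoC u) a - RtoC (gdens n t * u ^ 0))%C with
        (RtoC (gdens n t) * (Cpower (RtoC u) a - 1))%C by (simpl pow; rewrite RtoC_mult; ring).
      rewrite Cmod_mult, Cmod_R, Rabs_pos_eq by lra.
      assert (B := Cpower_near1 a m u A M Hm U); fold K in B.
      eapply Rle_trans; [apply Rmult_le_compat_l; [lra|exact B]|].
      rewrite !pow_add; simpl (u ^ 2); simpl (u ^ 1); simpl (u ^ 0).
      assert (um : 0 < u ^ m) by (apply pow_lt, U).
      assert (Y : Rabs (u - 1) <= / 2 * (d + / d * (u - 1) ^ 2)).
      { apply Rmult_le_reg_r with (2 * d); [lra|].
        replace (/ 2 * (d + / d * (u - 1) ^ 2) * (2 * d)) with (d ^ 2 + (u - 1) ^ 2) by (field; lra).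
        rewrite <- (pow2_abs (u - 1)); pose proof (pow2_ge_0 (d - Rabs (u - 1))); nra. }
      apply Rle_trans with (gdens n t * (K * ((/ 2 * (d + / d * (u - 1) ^ 2)) * (1 + u ^ m)))).
      + apply Rmult_le_compat_l; [lra|]; apply Rmult_le_compat_l; [lra|].
        apply Rmult_le_compat_r; lra.
      + right; field; lra. }
  intros eps He.
  set (d := eps / (2 * K)).
  assert (D : 0 < d) by (apply Rdiv_lt_0_compat; lra).
  assert (L : is_lim_seq (fun n => K / 2 * (d * (mom n 0 + mom n m) + / d * (mom n 2 + -2 * mom n 1 + mom n 0
      + (mom n (m + 2) + -2 * mom n (m + 1) + mom n m)))) (eps / 2)).
  { replace (eps / 2) with (K / 2 * (d * (1 + 1) + / d * (1 + -2 * 1 + 1 + (1 + -2 * 1 + 1))))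
      by (unfold d; field; lra).
    apply (is_lim_seq_scal_l _ (K / 2) (Finite _)).
    apply is_lim_seq_plus'.
    - apply (is_lim_seq_scal_l _ d (Finite _)); apply is_lim_seq_plus'; apply mom_lim.
    - apply (is_lim_seq_scal_l _ (/ d) (Finite _)).
      pose proof (fun k => is_lim_seq_scal_l _ (-2) (Finite 1) (mom_lim k)) as L2.
      exact (is_lim_seq_plus' _ _ _ _
        (is_lim_seq_plus' _ _ _ _ (is_lim_seq_plus' _ _ _ _ (mom_lim 2) (L2 1%nat)) (mom_lim 0))
        (is_lim_seq_plus' _ _ _ _ (is_lim_seq_plus' _ _ _ _ (mom_lim (m + 2)) (L2 (m + 1)%nat)) (mom_lim m))). }
  apply is_lim_seq_spec in L; destruct (L (mkposreal (eps / 2) ltac:(lra))) as [N HN].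
  exists N; intros n Hn; specialize (HN n Hn); cbn [pos] in HN; apply Rabs_def2 in HN.
  eapply Rle_lt_trans; [apply (bound n d D)|]; lra.
Qed.

Lemma gamma_shift_0 a n : 0 < Re a -> CGamma a = 0%C -> CGamma (a + RtoC (INR n)) = 0%C.
Proof.
  intros A H; induction n as [|n IH].
  - simpl INR; replace (a + 0)%C with a by ring; exact H.
  - rewrite S_INR, RtoC_plus, Cplus_assoc, gamma_S, IH; [ring|].
    autorewrite with reim; pose proof (pos_INR n); lra.
Qed.

(** A zero would propagate to all integer shifts and make [gratio] vanish. *)
Lemma gamma_neq0 a : 0 < Re a -> CGamma a <> 0%C.
Proof.
  intros A H; destruct (gratio_lim a A 1 Rlt_0_1) as [N HN].
  specialize (HN N (le_n N)); unfold gratio in HN.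
  rewrite gamma_shift_0 in HN by assumption.
  replace (0 / (Cpower (RtoC (INR (S N))) a * RtoC (INR (fact N))) - 1)%C with (- (1))%C in HN.
  - rewrite Cmod_opp, Cmod_1 in HN; lra.
  - field; split; [intros Z; apply (INR_fact_neq_0 N); apply (f_equal Re) in Z; exact Z
      |apply Cpower_neq0].
Qed.

Lemma beta_ratio_lim a : 0 < Re a ->
  Clim (fun n => beta (a + RtoC (INR (S n))) / RtoC (bseq n))%C 1.
Proof.
  intros A eps He.
  pose proof (Cmod_ge_0 a).
  destruct (nat_above (Cmod a / eps)) as [N [_ HN]].
  exists (S N); intros n Hn; destruct n as [|n]; [lia|].
  assert (B := beta_shift a n A).
  pose proof (bseq_pos (S n)) as P.
  assert (Nn : INR N <= INR n) by (apply le_INR; lia).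
  assert (E : bseq n - bseq (S n) = bseq (S n) / (2 * INR (S n))).
  { change (bseq (S n)) with (2 * INR (S n) / (2 * INR (S n) + 1) * bseq n).
    assert (0 < INR (S n)) by (apply lt_0_INR; lia). field; lra. }
  rewrite E in B.
  assert (nz : RtoC (bseq (S n)) <> 0%C) by (apply Re_pos_neq0; exact P).
  replace (beta (a + RtoC (INR (S (S n)))) / RtoC (bseq (S n)) - 1)%C with
    ((beta (a + RtoC (INR (S (S n)))) - RtoC (bseq (S n))) / RtoC (bseq (S n)))%C by (field; exact nz).
  rewrite Cmod_div, Cmod_R, Rabs_pos_eq by (exact nz || lra).
  assert (n1 : 0 < INR (S n)) by (apply lt_0_INR; lia).
  apply Rle_lt_trans with (Cmod a / (2 * INR (S n))).
  - apply Rmult_le_reg_r with (bseq (S n)); [exact P|].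
    unfold Rdiv at 1; rewrite Rmult_assoc, Rinv_l, Rmult_1_r by lra.
    eapply Rle_trans; [exact B|]; right; field; lra.
  - apply Rmult_lt_reg_r with (2 * INR (S n)); [lra|].
    replace (Cmod a / (2 * INR (S n)) * (2 * INR (S n))) with (Cmod a) by (field; lra).
    assert (Cmod a <= eps * INR N).
    { apply (Rmult_le_compat_l eps) in HN; [|lra].
      replace (eps * (Cmod a / eps)) with (Cmod a) in HN by (field; lra); exact HN. }
    rewrite S_INR; nra.
Qed.

(** The quantity that is shown to be the constant [sqrt PI]. *)
Definition xratio (a : C) : C := (beta a * CGamma (a + RtoC (/ 2)) / CGamma a)%C.

Lemma xratio_S a : 0 < Re a -> xratio (a + 1) = xratio a.
Proof.
  intros A; unfold xratio.
  replace (a + 1 + RtoC (/ 2))%C with (a + RtoC (/ 2) + 1)%C by ring.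
  rewrite !gamma_S by (autorewrite with reim; lra).
  assert (B := beta_S a A).
  assert (N1 : (2 * a + 1 <> 0)%C) by (apply Re_pos_neq0; autorewrite with reim; lra).
  assert (N2 : a <> 0%C) by (apply Re_pos_neq0, A).
  assert (N3 := gamma_neq0 a A).
  assert (E : beta (a + 1) = (2 * a * beta a / (2 * a + 1))%C).
  { apply (Cmult_eq_reg_l' (2 * a + 1)); [exact N1|]; rewrite B; field; exact N1. }
  rewrite E; replace (RtoC (/ 2)) with (1 / 2)%C by apply half_RtoC.
  field; repeat split; assumption.
Qed.

Lemma xratio_n a n : 0 < Re a -> xratio (a + RtoC (INR n)) = xratio a.
Proof.
  intros A; induction n as [|n IH].
  - simpl INR; f_equal; ring.
  - rewrite S_INR, RtoC_plus, Cplus_assoc, xratio_S, IH; [reflexivity|].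
    autorewrite with reim; pose proof (pos_INR n); lra.
Qed.

(** The middle factor on the right does not depend on [a], and cancels when two
    points are compared. *)
Lemma xratio_seq a n : 0 < Re a ->
  (xratio a * gratio a n = (beta (a + RtoC (INR (S n))) / RtoC (bseq n))
     * (RtoC (bseq n) * Cpower (RtoC (INR (S n))) (RtoC (/ 2))) * gratio (a + RtoC (/ 2)) n)%C.
Proof.
  intros A; rewrite <- (xratio_n a (S n) A); unfold xratio, gratio.
  replace (a + RtoC (INR (S n)) + RtoC (/ 2))%C with (a + RtoC (/ 2) + RtoC (INR (S n)))%C by ring.
  rewrite Cpower_plus.
  assert (N1 : CGamma (a + RtoC (INR (S n))) <> 0%C).
  { apply gamma_neq0; autorewrite with reim; pose proof (pos_INR (S n)); lra. }
  field; repeat split; try apply Cpower_neq0; try exact N1.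
  - intros Z; apply (INR_fact_neq_0 n); apply (f_equal Re) in Z; exact Z.
  - apply Re_pos_neq0; apply bseq_pos.
Qed.

(** [xratio] is periodic of period one, and its values at two points have quotient
    tending to one under integer shifts; so it is constant. *)
Lemma xratio_const a b : 0 < Re a -> 0 < Re b -> xratio a = xratio b.
Proof.
  intros A B.
  assert (Ah : 0 < Re (a + RtoC (/ 2))) by (autorewrite with reim; lra).
  assert (Bh : 0 < Re (b + RtoC (/ 2))) by (autorewrite with reim; lra).
  set (ba := fun n => (beta (a + RtoC (INR (S n))) / RtoC (bseq n))%C).
  set (bb := fun n => (beta (b + RtoC (INR (S n))) / RtoC (bseq n))%C).
  assert (L1 : Clim (fun n => xratio a * gratio a n * (bb n * gratio (b + RtoC (/ 2)) n))%C
                    (xratio a * 1 * (1 * 1))%C).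
  { exact (Clim_mult _ _ _ _
      (Clim_mult _ _ _ _ (Clim_const (xratio a)) (gratio_lim a A))
      (Clim_mult _ _ _ _ (beta_ratio_lim b B) (gratio_lim _ Bh))). }
  assert (L2 : Clim (fun n => xratio b * gratio b n * (ba n * gratio (a + RtoC (/ 2)) n))%C
                    (xratio b * 1 * (1 * 1))%C).
  { exact (Clim_mult _ _ _ _
      (Clim_mult _ _ _ _ (Clim_const (xratio b)) (gratio_lim b B))
      (Clim_mult _ _ _ _ (beta_ratio_lim a A) (gratio_lim _ Ah))). }
  assert (E : (xratio a * 1 * (1 * 1) = xratio b * 1 * (1 * 1))%C).
  { apply (Clim_unique _ _ _ L1); eapply Clim_ext; [|exact L2].
    intros n; cbn beta; rewrite !xratio_seq by assumption; unfold ba, bb; ring. }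
  replace (xratio a) with (xratio a * 1 * (1 * 1))%C by ring; rewrite E; ring.
Qed.

Lemma gamma_half_real : exists g, 0 <= g /\ CGamma (RtoC (/ 2)) = RtoC g.
Proof.
  assert (P : 0 < Re (RtoC (/ 2))) by (rewrite Re_RtoC; lra).
  assert (I := gamma_CI (RtoC (/ 2)) P).
  assert (Q : forall t, 0 < t -> gint (RtoC (/ 2)) t = RtoC (Rpower t (/ 2 - 1) * exp (- t))).
  { intros t T; unfold gint; rewrite <- RtoC_minus, Cpower_RtoC, RtoC_mult by exact T; reflexivity. }
  apply CI_RI in I; destruct I as [I1 I2].
  assert (Z := RI_scal 0 _ _ I1); rewrite Rmult_0_l in Z.
  exists (Re (CGamma (RtoC (/ 2)))); split.
  - apply (RI_le _ _ _ _ Z I1).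
    intros t T; rewrite Q, Re_RtoC, Rmult_0_l by exact T.
    apply Rmult_le_pos; [left; apply Rpower_pos|left; apply exp_pos].
  - apply C_eq; [reflexivity|]; rewrite Im_RtoC.
    apply (RI_unique _ _ _ I2).
    refine (RI_ext _ _ _ _ Z).
    intros t T; rewrite Q, Im_RtoC by exact T; ring.
Qed.

(** The constant equals [Gamma (1/2)] at [1] and [PI / Gamma (1/2)] at [1/2], so that
    its square is [PI]. *)
Lemma xratio_value a : 0 < Re a -> xratio a = RtoC (sqrt PI).
Proof.
  intros A.
  destruct gamma_half_real as [g [g0 Hg]].
  assert (Hh : 0 < Re (RtoC (/ 2))) by (rewrite Re_RtoC; lra).
  assert (H1 : 0 < Re (RtoC 1)) by (rewrite Re_RtoC; lra).
  assert (gn := gamma_neq0 _ Hh); rewrite Hg in gn.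
  assert (gp : g <> 0) by (intros Z; apply gn; rewrite Z; reflexivity).
  assert (X1 : xratio (RtoC 1) = RtoC g).
  { unfold xratio; rewrite beta_1, gamma_1.
    replace (1 + RtoC (/ 2))%C with (RtoC (/ 2) + 1)%C by ring.
    rewrite gamma_S, Hg by exact Hh; rewrite <- half_RtoC; field. }
  assert (X2 : xratio (RtoC (/ 2)) = (RtoC PI / RtoC g)%C).
  { unfold xratio; rewrite beta_half, Hg.
    replace (RtoC (/ 2) + RtoC (/ 2))%C with (RtoC 1) by (rewrite <- RtoC_plus; f_equal; field).
    rewrite gamma_1; field; exact gn. }
  assert (E := xratio_const _ _ H1 Hh); rewrite X1, X2, <- RtoC_div in E by exact gp.
  apply (f_equal Re) in E; rewrite !Re_RtoC in E.
  assert (G2 : g * g = PI) by (rewrite E at 1; field; exact gp).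
  rewrite (xratio_const a _ A H1), X1; f_equal.
  symmetry; rewrite <- G2; apply sqrt_square, g0.
Qed.

Lemma beta_gamma a : 0 < Re a ->
  beta a = (RtoC (sqrt PI) * (CGamma a / CGamma (a + 1 / 2)))%C.
Proof.
  intros A; assert (X := xratio_value a A); unfold xratio in X.
  rewrite <- half_RtoC in X.
  assert (N1 := gamma_neq0 a A).
  assert (N2 : CGamma (a + 1 / 2) <> 0%C)
    by (apply gamma_neq0; rewrite half_RtoC; autorewrite with reim; lra).
  rewrite <- X; field; split; assumption.
Qed.

(** * The hyperbolic cosine on the half-strip *)

Lemma Ccosh_sqr h : (Ccosh h * Ccosh h - Csinh h * Csinh h = 1)%C.
Proof.
  unfold Ccosh, Csinh.
  assert (K : (Cexp h * Cexp (- h))%C = 1%C)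
    by (rewrite <- Cexp_plus, <- Cexp_0; f_equal; ring).
  transitivity (Cexp h * Cexp (- h))%C; [field|exact K].
Qed.

Lemma Re_Ccosh h : Re (Ccosh h) = cosh (Re h) * cos (Im h).
Proof.
  unfold Ccosh, Cexp; rewrite Re_half; autorewrite with reim; rewrite cos_neg; unfold cosh; field.
Qed.

Lemma Im_Ccosh h : Im (Ccosh h) = sinh (Re h) * sin (Im h).
Proof.
  unfold Ccosh, Cexp; rewrite Im_half; autorewrite with reim; rewrite sin_neg; unfold sinh; field.
Qed.

Lemma strip_cos e h : e * e = 1 -> strip e h -> 0 < cos (Im h) /\ 0 < e * sin (Im h).
Proof.
  intros E [[A B] _]; destruct (e_cases e E) as [-> | ->].
  - rewrite Rmult_1_l in *; split; [apply cos_gt_0; lra|apply sin_gt_0; lra].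
  - split; [apply cos_gt_0; lra|].
    replace (-1 * sin (Im h)) with (sin (- Im h)) by (rewrite sin_neg; ring); apply sin_gt_0; lra.
Qed.

Lemma cosh_pos x : 0 < cosh x.
Proof. unfold cosh; pose proof (exp_pos x); pose proof (exp_pos (- x)); lra. Qed.

Lemma Ccosh_Re_pos e h : e * e = 1 -> strip e h -> 0 < Re (Ccosh h).
Proof.
  intros E S; rewrite Re_Ccosh; destruct (strip_cos e h E S) as [A _].
  apply Rmult_lt_0_compat; [apply cosh_pos|exact A].
Qed.

Lemma Ccosh_Im_neq0 e h : e * e = 1 -> strip e h -> Re h < 0 -> Im (Ccosh h) <> 0.
Proof.
  intros E S H; rewrite Im_Ccosh; destruct (strip_cos e h E S) as [_ A].
  apply Rmult_integral_contrapositive_currified; [|nra].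
  unfold sinh; assert (exp (Re h) < exp (- Re h)) by (apply exp_increasing; lra); lra.
Qed.

Lemma Ccosh_cut e h : e * e = 1 -> strip e h -> Re h < 0 -> cut_plane 1 (Ccosh h).
Proof. intros E S H [A _]; exact (Ccosh_Im_neq0 e h E S H A). Qed.

Lemma zeta_lt1 h : Re h < 0 -> Cmod (Cexp (2 * h)) < 1.
Proof.
  intros H; rewrite Cmod_Cexp; autorewrite with reim.
  rewrite <- exp_0; apply exp_increasing; lra.
Qed.

Lemma one_plus_zeta h : Re h < 0 -> 0 < Re (1 + Cexp (2 * h)).
Proof.
  intros H; pose proof (zeta_lt1 h H) as Z; pose proof (re_le_Cmod (Cexp (2 * h))) as R.
  apply Rabs_le_between in R; rewrite Re_plus, Re_RtoC; lra.
Qed.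

Lemma Ccosh_zeta h : (2 * Ccosh h = Cexp (- h) * (1 + Cexp (2 * h)))%C.
Proof.
  rewrite Cexp_double, Cexp_opp; unfold Ccosh; rewrite Cexp_opp; field; apply Cexp_neq0.
Qed.

Lemma Cpower_Ccosh e a h : e * e = 1 -> strip e h -> Re h < 0 ->
  Cpower (2 * Ccosh h) (- a) = (Cexp (a * h) * Cpower (1 + Cexp (2 * h)) (- a))%C.
Proof.
  intros E S H.
  pose proof (one_plus_zeta h H) as P; pose proof (Carg_bound _ P) as B.
  assert (L : Clog (2 * Ccosh h) = (- h + Clog (1 + Cexp (2 * h)))%C).
  { apply Clog_unique.
    - pose proof (Ccosh_Re_pos e h E S); autorewrite with reim; lra.
    - rewrite Cexp_plus, Cexp_Clog, Ccosh_zeta by exact P; reflexivity.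
    - destruct S as [[S1 S2] _]; rewrite Im_plus, Im_opp.
      unfold Clog; rewrite Im_pair.
      destruct (e_cases e E) as [-> | ->]; lra. }
  unfold Cpower; rewrite L, <- Cexp_plus; f_equal; ring.
Qed.

(** * Limits of complex functions of a real variable *)

Definition tends (F : (R -> Prop) -> Prop) (x : R -> C) (l : C) : Prop :=
  tends0 F (fun t => x t - l)%C.

Lemma tends_const F c : Filter F -> tends F (fun _ => c) c.
Proof.
  intros HF eps He; apply filter_forall; intros _.
  replace (c - c)%C with (RtoC 0) by ring; rewrite Cmod_0; exact He.
Qed.

Lemma tends_ext F x y l : Filter F -> F (fun t => x t = y t) -> tends F x l -> tends F y l.
Proof.
  intros HF H A eps He; generalize (filter_and (F := F) _ _ H (A eps He)).
  apply filter_imp; intros t [E1 E2]; rewrite <- E1; exact E2.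
Qed.

Lemma tends_plus F x y l m : Filter F -> tends F x l -> tends F y m ->
  tends F (fun t => x t + y t)%C (l + m)%C.
Proof.
  intros HF A B eps He.
  generalize (filter_and (F := F) _ _ (A (eps / 2) ltac:(lra)) (B (eps / 2) ltac:(lra))).
  apply filter_imp; intros t [E1 E2].
  replace (x t + y t - (l + m))%C with ((x t - l) + (y t - m))%C by ring.
  eapply Rle_lt_trans; [apply Cmod_triangle|]; lra.
Qed.

Lemma tends_mult F x y l m : Filter F -> tends F x l -> tends F y m ->
  tends F (fun t => x t * y t)%C (l * m)%C.
Proof.
  intros HF A B eps He.
  pose proof (Cmod_ge_0 l); pose proof (Cmod_ge_0 m).
  assert (E1 : 0 < eps / 2 / (Cmod m + 1)) by (apply Rdiv_lt_0_compat; lra).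
  assert (E2 : 0 < eps / 2 / (Cmod l + 1)) by (apply Rdiv_lt_0_compat; lra).
  generalize (filter_and (F := F) _ _ (A _ E1) (filter_and (F := F) _ _ (B _ E2) (B 1 Rlt_0_1))).
  apply filter_imp; intros t [H1 [H2 H3]].
  replace (x t * y t - l * m)%C with ((x t - l) * y t + l * (y t - m))%C by ring.
  eapply Rle_lt_trans; [apply Cmod_triangle|]; rewrite !Cmod_mult.
  assert (Y : Cmod (y t) <= Cmod m + 1).
  { replace (y t) with ((y t - m) + m)%C by ring.
    eapply Rle_trans; [apply Cmod_triangle|]; lra. }
  apply (Rmult_lt_compat_l (Cmod m + 1)) in H1; [|lra].
  replace ((Cmod m + 1) * (eps / 2 / (Cmod m + 1))) with (eps / 2) in H1 by (field; lra).
  apply (Rmult_lt_compat_l (Cmod l + 1)) in H2; [|lra].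
  replace ((Cmod l + 1) * (eps / 2 / (Cmod l + 1))) with (eps / 2) in H2 by (field; lra).
  pose proof (Cmod_ge_0 (x t - l)); pose proof (Cmod_ge_0 (y t - m)); pose proof (Cmod_ge_0 (y t)).
  assert (Cmod (x t - l) * Cmod (y t) <= (Cmod m + 1) * Cmod (x t - l)) by nra.
  nra.
Qed.

Lemma tends_scal F k x l : Filter F -> tends F x l -> tends F (fun t => k * x t)%C (k * l)%C.
Proof. intros HF A; exact (tends_mult F _ _ _ _ HF (tends_const F k HF) A). Qed.

Lemma tends_opp F x l : Filter F -> tends F x l -> tends F (fun t => - x t)%C (- l)%C.
Proof.
  intros HF A eps He; generalize (A eps He); apply filter_imp; intros t H.
  replace (- x t - - l)%C with (- (x t - l))%C by ring; rewrite Cmod_opp; exact H.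
Qed.

Lemma tends_minus F x y l m : Filter F -> tends F x l -> tends F y m ->
  tends F (fun t => x t - y t)%C (l - m)%C.
Proof. intros HF A B; exact (tends_plus F _ _ _ _ HF A (tends_opp F _ _ HF B)). Qed.

Lemma tends_unique F x l m : ProperFilter F -> tends F x l -> tends F x m -> l = m.
Proof.
  intros PF A B.
  assert (D := tends_minus F _ _ _ _ _ A B).
  assert (Z : (0 - (l - m) = 0)%C).
  { apply (tends0_const F (fun t => x t - x t - (l - m))%C (0 - (l - m))%C PF); [|exact D].
    apply filter_forall; intros t; ring. }
  replace l with (m - (0 - (l - m)))%C by ring; rewrite Z; ring.
Qed.

Lemma tends_bound F x l (b : R -> R) : Filter F ->
  F (fun t => Cmod (x t - l) <= b t) -> filterlim b F (locally 0) -> tends F x l.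
Proof.
  intros HF H B eps He.
  assert (L := proj1 (filterlim_locally _ _) B (mkposreal eps He)).
  generalize (filter_and (F := F) _ _ H L); apply filter_imp; intros t [H1 H2].
  change (Rabs (b t - 0) < eps) in H2; rewrite Rminus_0_r in H2; apply Rabs_def2 in H2; lra.
Qed.

Lemma tends_comp F g l0 d x : Filter F -> cdiff g l0 d -> tends F x l0 ->
  tends F (fun t => g (x t)) (g l0).
Proof.
  intros HF D A eps He; destruct (cdiff_cont _ _ _ D eps He) as [del [D0 Hd]].
  generalize (A del D0); apply filter_imp; intros t Ht; apply Hd, Ht.
Qed.

Lemma Cpower_lip1 b : exists K, 0 <= K /\ forall w, Cmod (w - 1) <= 1 / 2 ->
  Cmod (Cpower w b - 1) <= K * Cmod (w - 1).
Proof.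
  set (K := Cmod b * (Kexp b * exp (Rabs (Re b))) * 2).
  assert (K0 : 0 <= K).
  { unfold K; pose proof (Cmod_ge_0 b); pose proof (Kexp_pos b); pose proof (exp_pos (Rabs (Re b))).
    apply Rmult_le_pos; [|lra]; apply Rmult_le_pos; [lra|]; apply Rmult_le_pos; lra. }
  exists K; split; [exact K0|]; intros w Hw.
  set (g := fun s : R => (1 + RtoC s * (w - 1))%C).
  assert (Dg : forall s, cderiv g s (w - 1)%C).
  { intros s; eapply cderiv_eq;
      [apply cderiv_plus; [apply cderiv_const|apply cderiv_mult; [apply cderiv_id|apply cderiv_const]]|].
    cbn beta; ring. }
  assert (Rg : forall s, 0 <= s <= 1 -> 1 / 2 <= Re (g s) /\ Cmod (g s) <= 3 / 2).
  { intros s Hs; split.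
    - pose proof (re_le_Cmod (w - 1)) as R1; apply Rabs_le_between in R1.
      unfold g; autorewrite with reim in *; nra.
    - unfold g; eapply Rle_trans; [apply Cmod_triangle|].
      rewrite Cmod_1, Cmod_mult, Cmod_R, Rabs_pos_eq by lra; pose proof (Cmod_ge_0 (w - 1)); nra. }
  assert (T := cderiv_mvt (fun s => Cpower (g s) b) (fun s => b * Cpower (g s) b * (w - 1) / g s)%C
    (K * Cmod (w - 1)) 0 1 ltac:(lra)).
  cbv beta in T.
  replace (g 1) with w in T by (unfold g; ring).
  replace (g 0) with (RtoC 1) in T by (unfold g; ring).
  assert (E1 : Cpower 1 b = 1%C).
  { unfold Cpower; rewrite (Clog_unique 1 0); [rewrite <- Cexp_0; f_equal; ring|simpl; lra|apply Cexp_0|].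
    pose proof PI_RGT_0; simpl; lra. }
  rewrite E1, Rminus_0_r, Rmult_1_r in T; apply T.
  - intros s Hs; apply cderiv_Cpower; [apply Dg|]; destruct (Rg s Hs); lra.
  - intros s Hs; destruct (Rg s Hs) as [R1 R2].
    assert (M1 : 1 / 2 <= Cmod (g s)).
    { eapply Rle_trans; [exact R1|]; eapply Rle_trans; [apply Rle_abs|apply re_le_Cmod]. }
    assert (Ng : g s <> 0%C) by (apply Re_pos_neq0; lra).
    rewrite Cmod_div, !Cmod_mult by exact Ng.
    assert (P : Cmod (Cpower (g s) b) <= Kexp b * exp (Rabs (Re b))).
    { eapply Rle_trans; [apply Cmod_Cpower_le; lra|].
      apply Rmult_le_compat_l; [left; apply Kexp_pos|].
      unfold Rpower; apply exp_le.
      assert (L1 : Rabs (ln (Cmod (g s))) <= 1).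
      { apply Rabs_le; split.
        - assert (ln (/ Cmod (g s)) <= / Cmod (g s) - 1)
            by (apply ln_le_minus1, Rinv_0_lt_compat; lra).
          rewrite ln_Rinv in H by lra.
          assert (/ Cmod (g s) <= / (1 / 2)) by (apply Rinv_le_contravar; lra). lra.
        - pose proof (ln_le_minus1 (Cmod (g s)) ltac:(lra)); lra. }
      assert (Re b * ln (Cmod (g s)) <= Rabs (Re b) * Rabs (ln (Cmod (g s))))
        by (rewrite <- Rabs_mult; apply Rle_abs).
      pose proof (Rabs_pos (Re b)); nra. }
    assert (I : / Cmod (g s) <= 2).
    { replace 2 with (/ (1 / 2)) by field; apply Rinv_le_contravar; lra. }
    assert (I0 : 0 < / Cmod (g s)) by (apply Rinv_0_lt_compat; lra).
    unfold K, Rdiv.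
    replace (Cmod b * (Kexp b * exp (Rabs (Re b))) * 2 * Cmod (w - 1)) with
      (Cmod b * (Kexp b * exp (Rabs (Re b))) * Cmod (w - 1) * 2) by ring.
    pose proof (Cmod_ge_0 b); pose proof (Cmod_ge_0 (w - 1)); pose proof (Cmod_ge_0 (Cpower (g s) b)).
    apply Rmult_le_compat; [|lra| |exact I].
    + apply Rmult_le_pos; [apply Rmult_le_pos|]; assumption.
    + apply Rmult_le_compat_r; [assumption|]; apply Rmult_le_compat_l; assumption.
Qed.

(** * The function of the second kind off the cut *)

Section SecondKind.
Context (nu : C) (Q : C -> C) (Hnu : -1 < Re nu) (HQ : is_legendreQ nu Q).

Let a : C := (nu + 1)%C.
Let Kq : C := (RtoC (sqrt PI) * (CGamma (nu + 1) / CGamma (nu + 3 / 2)))%C.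
Let H0 := hcoef (nu / 2 + 1) (nu / 2 + 1 / 2) (nu + 3 / 2).
Let f (u : C) : C := CPS H0 u.
Let f1 (u : C) : C := CPS (dcoef H0) u.
Let f2 (u : C) : C := CPS (dcoef (dcoef H0)) u.

Lemma sk_a : 0 < Re a.
Proof. unfold a; autorewrite with reim; lra. Qed.

Lemma sk_c : 0 < Re (nu + 3 / 2).
Proof. rewrite Re_plus, Re_half, Re_RtoC; lra. Qed.

Lemma sk_cdiff u : Cmod u < 1 -> cdiff f u (f1 u) /\ cdiff f1 u (f2 u).
Proof.
  intros U; pose proof (Cmod_ge_0 u).
  assert (B : bnd H0 ((Cmod u + 2) / 3)) by (apply hcoef_bnd; [exact sk_c|lra]).
  split.
  - apply (CPS_cdiff _ ((Cmod u + 2) / 3)); [exact B|lra].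
  - apply (CPS_cdiff _ ((2 * Cmod u + 1) / 3)); [|lra].
    apply (bnd_dcoef _ ((Cmod u + 2) / 3)); [lra|exact B].
Qed.

(** Where the series of [Q] converges and the power in front of it is smooth. *)
Definition sk_dom (z : C) : Prop := 1 < Cmod z /\ 0 < Re z /\ Im z <> 0.

Lemma sk_cut z : sk_dom z -> cut_plane 1 z.
Proof. intros [_ [_ D]] [A _]; exact (D A). Qed.

Lemma sk_u z : sk_dom z -> Cmod (1 / (z * z)) < 1.
Proof.
  intros [A [B _]]; assert (N : z <> 0%C) by (apply Re_pos_neq0, B).
  rewrite Cmod_div, Cmod_1, Cmod_mult by (apply Cmult_neq_0; exact N).
  unfold Rdiv; rewrite Rmult_1_l, <- Rinv_1; apply Rinv_lt_contravar; nra.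
Qed.

(** The formula for [Q] and its first two derivatives. *)
Let q0 (z : C) : C := (Kq * Cpower (2 * z) (- a) * f (1 / (z * z)))%C.
Let q1 (z : C) : C :=
  (Kq * Cpower (2 * z) (- a) * (- a / z * f (1 / (z * z)) - 2 / (z * z * z) * f1 (1 / (z * z))))%C.
Let q2 (z : C) : C :=
  (Kq * Cpower (2 * z) (- a) * ((a * a + a) / (z * z) * f (1 / (z * z))
     + (4 * a + 6) / (z * z * z * z) * f1 (1 / (z * z))
     + 4 / (z * z * z * z * z * z) * f2 (1 / (z * z))))%C.

Lemma sk_Q z : sk_dom z -> Q z = q0 z.
Proof.
  intros D; destruct HQ as [_ F]; rewrite (F z (proj1 D) (sk_cut z D)).
  unfold q0, f, H0, Kq, a; rewrite <- hyp2F1_CPS.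
  replace (- nu - 1)%C with (- (nu + 1))%C by ring; ring.
Qed.

Lemma sk_open z : sk_dom z -> locally 0 (fun s : R => sk_dom (z + RtoC s)).
Proof.
  intros [A [B D]].
  assert (P : 0 < Rmin (Cmod z - 1) (Re z)) by (apply Rmin_glb_lt; lra).
  exists (mkposreal _ P); intros s Hs.
  change (Rabs (s - 0) < Rmin (Cmod z - 1) (Re z)) in Hs; rewrite Rminus_0_r in Hs.
  assert (S1 : Rabs s < Cmod z - 1) by (eapply Rlt_le_trans; [exact Hs|apply Rmin_l]).
  assert (S2 : Rabs s < Re z) by (eapply Rlt_le_trans; [exact Hs|apply Rmin_r]).
  split; [|split].
  - assert (Cmod z <= Cmod (z + RtoC s) + Rabs s); [|lra].
    replace z with ((z + RtoC s) + - RtoC s)%C at 1 by ring.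
    eapply Rle_trans; [apply Cmod_triangle|]; rewrite Cmod_opp, Cmod_R; lra.
  - apply Rabs_def2 in S2; autorewrite with reim; lra.
  - autorewrite with reim; lra.
Qed.

Lemma deriv_ext_dom F G z l : sk_dom z -> (forall w, sk_dom w -> F w = G w) ->
  cderiv (fun s => G (z + RtoC s)%C) 0 l -> deriv F z = l.
Proof.
  intros D E H; unfold deriv; apply CDerive_eq.
  eapply cderiv_ext_loc; [|exact H].
  generalize (sk_open z D); apply filter_imp; intros s Hs; symmetry; apply E, Hs.
Qed.

Lemma sk_line z : cderiv (fun s => z + RtoC s)%C 0 1%C.
Proof.
  eapply cderiv_eq; [apply cderiv_plus; [apply cderiv_const|apply cderiv_id]|ring].
Qed.

Lemma sk_pieces z : sk_dom z ->
  cderiv (fun s => Kq * Cpower (2 * (z + RtoC s)) (- a))%C 0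
    (Kq * Cpower (2 * z) (- a) * (- a / z))%C /\
  cderiv (fun s => 1 / ((z + RtoC s) * (z + RtoC s)))%C 0 (- (2) / (z * z * z))%C.
Proof.
  intros D; assert (N : z <> 0%C) by (apply Re_pos_neq0, D).
  assert (E0 : (z + RtoC 0)%C = z) by ring.
  split; (eapply cderiv_eq; [|]).
  - apply cderiv_scal, (cderiv_Cpower (fun s => 2 * (z + RtoC s))%C).
    + apply cderiv_scal, sk_line.
    + rewrite E0; destruct D as [_ [B _]]; autorewrite with reim; lra.
  - rewrite E0; field; exact N.
  - apply cderiv_div; [apply cderiv_const|apply cderiv_mult; apply sk_line|].
    rewrite E0; apply Cmult_neq_0; exact N.
  - cbn beta; rewrite E0; field; exact N.
Qed.

Lemma sk_Q1 z : sk_dom z -> deriv Q z = q1 z.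
Proof.
  intros D; assert (N : z <> 0%C) by (apply Re_pos_neq0, D).
  assert (E0 : (z + RtoC 0)%C = z) by ring.
  destruct (sk_pieces z D) as [P1 P2]; destruct (sk_cdiff _ (sk_u z D)) as [F1 F2].
  apply (deriv_ext_dom Q q0 z _ D sk_Q); unfold q0.
  eapply cderiv_eq.
  - apply cderiv_mult; [exact P1|].
    apply (cderiv_comp f (fun s => 1 / ((z + RtoC s) * (z + RtoC s)))%C);
      [cbn beta; rewrite E0; exact F1|exact P2].
  - cbn beta; rewrite E0; unfold q1; field; exact N.
Qed.

Lemma sk_Q2 z : sk_dom z -> deriv (deriv Q) z = q2 z.
Proof.
  intros D; assert (N : z <> 0%C) by (apply Re_pos_neq0, D).
  assert (E0 : (z + RtoC 0)%C = z) by ring.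
  destruct (sk_pieces z D) as [P1 P2]; destruct (sk_cdiff _ (sk_u z D)) as [F1 F2].
  apply (deriv_ext_dom (deriv Q) q1 z _ D sk_Q1); unfold q1.
  eapply cderiv_eq.
  - apply cderiv_mult; [exact P1|].
    apply cderiv_minus; apply cderiv_mult.
    + apply cderiv_div; [apply cderiv_const|apply sk_line|rewrite E0; exact N].
    + apply (cderiv_comp f (fun s => 1 / ((z + RtoC s) * (z + RtoC s)))%C);
        [cbn beta; rewrite E0; exact F1|exact P2].
    + apply cderiv_div; [apply cderiv_const| |rewrite E0; repeat apply Cmult_neq_0; exact N].
      apply cderiv_mult; [apply cderiv_mult; apply sk_line|apply sk_line].
    + apply (cderiv_comp f1 (fun s => 1 / ((z + RtoC s) * (z + RtoC s)))%C);
        [cbn beta; rewrite E0; exact F2|exact P2].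
  - cbn beta; rewrite E0; unfold q2; field; exact N.
Qed.

(** The left side of Legendre's equation for [Q]. Gauss's equation makes it vanish near
    infinity, and the identity theorem then carries this along the curves used below. *)
Let res (z : C) : C :=
  ((deriv (deriv Q) z + - (1) * (z * (z * deriv (deriv Q) z)))
   + (- (2) * (z * deriv Q z) + a * (a - 1) * Q z))%C.

Lemma sk_res z : sk_dom z -> res z = 0%C.
Proof.
  intros D; assert (N : z <> 0%C) by (apply Re_pos_neq0, D).
  unfold res; rewrite (sk_Q z D), (sk_Q1 z D), (sk_Q2 z D).
  unfold q0, q1, q2.
  assert (G := gauss_ode (nu / 2 + 1) (nu / 2 + 1 / 2) (nu + 3 / 2) _ sk_c (sk_u z D)).
  fold H0 in G; fold (f (1 / (z * z))) (f1 (1 / (z * z))) (f2 (1 / (z * z))) in G.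
  set (x0 := f (1 / (z * z))) in *; set (x1 := f1 (1 / (z * z))) in *; set (x2 := f2 (1 / (z * z))) in *.
  match type of G with ?g = _ =>
    transitivity (- (4) / (z * z) * (Kq * Cpower (2 * z) (- a)) * g)%C end.
  - unfold a; field; exact N.
  - rewrite G; ring.
Qed.

Lemma res_analytic : analytic_on (cut_plane 1) res.
Proof.
  destruct HQ as [A _]; assert (A1 := analytic_deriv _ _ A); assert (A2 := analytic_deriv _ _ A1).
  apply (analytic_plus _ (fun z => deriv (deriv Q) z + - (1) * (z * (z * deriv (deriv Q) z)))%C
     (fun z => - (2) * (z * deriv Q z) + a * (a - 1) * Q z)%C).
  - apply (analytic_plus _ (deriv (deriv Q)) (fun z => - (1) * (z * (z * deriv (deriv Q) z)))%C);
      [exact A2|].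
    apply (analytic_scal _ (- (1)) (fun z => z * (z * deriv (deriv Q) z))%C).
    apply (analytic_mul_id _ (fun z => z * deriv (deriv Q) z)%C), analytic_mul_id, A2.
  - apply (analytic_plus _ (fun z => - (2) * (z * deriv Q z))%C (fun z => a * (a - 1) * Q z)%C).
    + apply (analytic_scal _ (- (2)) (fun z => z * deriv Q z)%C), analytic_mul_id, A1.
    + apply analytic_scal, A.
Qed.

(** The curve [cosh (h t)] is a quarter of a hyperbola with foci [-1] and [1], which
    leaves the cut at [t = 0] and goes to infinity. *)
Section Curve.
Context (e al : R) (E : e * e = 1) (Al : 0 < al < PI / 2).

Let h (t : R) : C := ((- t)%R, (e * al)%R).

Lemma h_strip t : 0 < t -> strip e (h t) /\ Re (h t) < 0.
Proof.
  intros T; unfold h; split; [|simpl; lra].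
  split; [|simpl; lra]; rewrite Im_pair, <- Rmult_assoc, E, Rmult_1_l; exact Al.
Qed.

Lemma h_cderiv t : cderiv h t (- (1))%C.
Proof.
  split; simpl.
  - auto_derive; [trivial|ring].
  - replace (- 0) with 0 by ring; apply is_derive_cst.
Qed.

Lemma h_dom : exists T, 0 < T /\ forall t, T < t -> sk_dom (Ccosh (h t)).
Proof.
  assert (C0 : 0 < cos al) by (apply cos_gt_0; lra).
  exists (Rmax 1 (ln (2 / cos al))); split; [eapply Rlt_le_trans; [|apply Rmax_l]; lra|].
  intros t Ht.
  assert (T1 : 1 < t) by (eapply Rle_lt_trans; [apply Rmax_l|exact Ht]).
  assert (T2 : ln (2 / cos al) < t) by (eapply Rle_lt_trans; [apply Rmax_r|exact Ht]).
  destruct (h_strip t ltac:(lra)) as [S N].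
  split; [|split; [apply (Ccosh_Re_pos e); assumption|apply (Ccosh_Im_neq0 e); assumption]].
  eapply Rlt_le_trans; [|apply re_le_Cmod]; eapply Rlt_le_trans; [|apply Rle_abs].
  rewrite Re_Ccosh; unfold h; rewrite Re_pair, Im_pair.
  assert (Ce : cos (e * al) = cos al)
    by (destruct (e_cases e E) as [-> | ->]; [f_equal; ring|rewrite <- cos_neg; f_equal; ring]).
  rewrite Ce; unfold cosh; rewrite Ropp_involutive.
  apply exp_increasing in T2; rewrite exp_ln in T2 by (apply Rdiv_lt_0_compat; lra).
  apply (Rmult_lt_compat_r (cos al)) in T2; [|exact C0].
  replace (2 / cos al * cos al) with 2 in T2 by (field; lra).
  pose proof (exp_pos (- t)); nra.
Qed.

Lemma q_leg t : 0 < t ->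
  leg a h (- (1))%C (fun s => Q (Ccosh (h s))) (fun s => deriv Q (Ccosh (h s)) * Csinh (h s))%C t.
Proof.
  intros T; destruct (h_strip t T) as [S N].
  assert (Dc := Ccosh_cut e _ E S N).
  destruct HQ as [A _]; assert (A1 := analytic_deriv _ _ A).
  assert (R0 : res (Ccosh (h t)) = 0%C).
  { destruct h_dom as [T0 [_ HT]].
    apply (identity_curve (cut_plane 1) res (fun s => Ccosh (h s))
      (fun s => Csinh (h s) * - (1))%C T0 res_analytic); [| |exact T].
    - intros s Hs; destruct (h_strip s Hs) as [S' N'].
      split; [apply (Ccosh_cut e); assumption|split].
      + apply cderiv_Ccosh, h_cderiv.
      + apply Cmult_neq_0; [apply (Csinh_neq0 e); assumption|].
        intros Z; apply (f_equal Re) in Z; simpl in Z; lra.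
    - intros s Hs; apply sk_res, HT, Hs. }
  split.
  - eapply cderiv_eq.
    + apply (cderiv_comp Q (fun s => Ccosh (h s)));
        [apply (analytic_cdiff (cut_plane 1)); [exact A|exact Dc]|apply cderiv_Ccosh, h_cderiv].
    + ring.
  - eapply cderiv_eq.
    + apply cderiv_mult; [|apply cderiv_Csinh, h_cderiv].
      apply (cderiv_comp (deriv Q) (fun s => Ccosh (h s)));
        [apply (analytic_cdiff (cut_plane 1)); [exact A1|exact Dc]|apply cderiv_Ccosh, h_cderiv].
    + cbn beta; unfold res in R0; unfold Ccoth.
      assert (X := Ccosh_sqr (h t)).
      assert (Ns := Csinh_neq0 e _ E S).
      set (z := Ccosh (h t)) in *; set (s := Csinh (h t)) in *.
      set (D1 := deriv Q z) in *; set (D2 := deriv (deriv Q) z) in *.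
      replace ((a * (a - 1) * Q z - z / s * (D1 * s)) * - (1))%C with
        (- (a * (a - 1) * Q z - z * D1))%C by (field; exact Ns).
      transitivity (- ((z * z - (z * z - s * s)) * D2 + z * D1))%C; [ring|].
      rewrite X.
      match type of R0 with ?g = _ =>
        transitivity (- (a * (a - 1) * Q z - z * D1) + g)%C; [ring|rewrite R0; ring] end.
Qed.

(** Both functions are [exp (a h)] times a quantity with limit [Kq] at infinity. *)
Let ze (t : R) : C := Cexp (2 * h t).
Let u (t : R) : C := (4 * ze t / ((1 + ze t) * (1 + ze t)))%C.
Let G (t : R) : C := (Kq * Cpower (1 + ze t) (- a))%C.

Lemma u_eq t : 0 < t -> (1 / (Ccosh (h t) * Ccosh (h t)) = u t)%C.
Proof.
  intros T; destruct (h_strip t T) as [S N].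
  assert (E1 := Ccosh_zeta (h t)).
  assert (Nz : Ccosh (h t) <> 0%C) by (apply Re_pos_neq0, (Ccosh_Re_pos e); assumption).
  assert (Np : (1 + ze t <> 0)%C) by (apply Re_pos_neq0, one_plus_zeta, N).
  unfold u; fold (ze t) in E1.
  assert (X : (ze t * Cexp (- h t) * Cexp (- h t) = 1)%C).
  { unfold ze; rewrite <- !Cexp_plus, <- Cexp_0; f_equal; ring. }
  transitivity (4 * (ze t * Cexp (- h t) * Cexp (- h t)) / (2 * Ccosh (h t) * (2 * Ccosh (h t))))%C.
  - rewrite X; field; exact Nz.
  - rewrite E1; field; split; [exact Np|apply Cexp_neq0].
Qed.

Lemma q_form t : 0 < t -> sk_dom (Ccosh (h t)) ->
  Q (Ccosh (h t)) = (Cexp (a * h t) * (G t * f (u t)))%C /\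
  (deriv Q (Ccosh (h t)) * Csinh (h t) = Cexp (a * h t) * (G t * (a * f (u t)
      + ze t * (- (2) * a / (1 + ze t) * f (u t)
        + 8 * (1 - ze t) / ((1 + ze t) * (1 + ze t) * (1 + ze t)) * f1 (u t)))))%C.
Proof.
  intros T D; destruct (h_strip t T) as [S N].
  assert (Nz : Ccosh (h t) <> 0%C) by (apply Re_pos_neq0, (Ccosh_Re_pos e); assumption).
  assert (Np : (1 + ze t <> 0)%C) by (apply Re_pos_neq0, one_plus_zeta, N).
  rewrite (sk_Q _ D), (sk_Q1 _ D); unfold q0, q1.
  rewrite u_eq, (Cpower_Ccosh e) by assumption.
  split; [unfold G, ze; ring|].
  assert (Th : (Csinh (h t) / Ccosh (h t) = (ze t - 1) / (ze t + 1))%C).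
  { unfold ze; rewrite Cexp_double; unfold Csinh, Ccosh; rewrite Cexp_opp.
    assert (N1 := Cexp_neq0 (h t)).
    assert (N2 : (Cexp (h t) * Cexp (h t) + 1 <> 0)%C).
    { intros Z; apply Np; unfold ze; rewrite Cexp_double, Cplus_comm; exact Z. }
    field; repeat split; assumption. }
  transitivity (Kq * (Cexp (a * h t) * Cpower (1 + Cexp (2 * h t)) (- a)) *
     (- a * (Csinh (h t) / Ccosh (h t)) * f (u t)
      - 2 * (Csinh (h t) / Ccosh (h t)) * (1 / (Ccosh (h t) * Ccosh (h t))) * f1 (u t)))%C.
  - field; exact Nz.
  - rewrite Th, u_eq by exact T; fold (ze t); unfold u, G; field.
    repeat split; first [exact Np|rewrite Cplus_comm; exact Np].
Qed.

Let Fi : (R -> Prop) -> Prop := Rbar_locally p_infty.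

Lemma exp_neg_lim k : k < 0 -> filterlim (fun t => exp (k * t)) Fi (locally 0).
Proof.
  intros K; apply (filterlim_comp _ _ _ (fun t => k * t) exp _ (Rbar_locally m_infty));
    [|apply is_lim_exp_m].
  intros P [M HM]; exists (M / k); intros t Ht; apply HM.
  apply (Rmult_lt_gt_compat_neg_l k) in Ht; [|exact K].
  replace (k * (M / k)) with M in Ht by (field; lra); lra.
Qed.

Lemma ze_Cmod t : Cmod (ze t) = exp (- 2 * t).
Proof. unfold ze, h; rewrite Cmod_Cexp; f_equal; autorewrite with reim; ring. Qed.

Lemma ze_tends : tends Fi ze 0%C.
Proof.
  apply (tends_bound Fi ze 0%C (fun t => exp (- 2 * t))); [typeclasses eauto| |apply exp_neg_lim; lra].
  apply filter_forall; intros t; replace (ze t - 0)%C with (ze t) by ring; rewrite ze_Cmod; lra.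
Qed.

Lemma ev_pos : Fi (fun t => 0 < t).
Proof. exists 0; trivial. Qed.

Lemma inv_tends : tends Fi (fun t => / (1 + ze t))%C 1%C.
Proof.
  intros eps He.
  assert (He2 : 0 < eps / 2) by lra. assert (Hh : 0 < 1 / 2) by lra.
  generalize (filter_and (F := Fi) _ _ (ze_tends _ He2) (ze_tends _ Hh)).
  apply filter_imp; intros t [H1 H2].
  replace (ze t - 0)%C with (ze t) in * by ring.
  assert (M : 1 / 2 <= Cmod (1 + ze t)).
  { assert (T := Cmod_triangle (1 + ze t) (- ze t)).
    replace (1 + ze t + - ze t)%C with (RtoC 1) in T by ring.
    rewrite Cmod_1, Cmod_opp in T; lra. }
  assert (N : (1 + ze t <> 0)%C) by (apply Cmod_gt_0; lra).
  replace (/ (1 + ze t) - 1)%C with (- ze t / (1 + ze t))%C by (field; exact N).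
  rewrite Cmod_div, Cmod_opp by exact N.
  apply Rmult_lt_reg_r with (Cmod (1 + ze t)); [lra|].
  unfold Rdiv; rewrite Rmult_assoc, Rinv_l by lra; nra.
Qed.

Lemma u_tends : tends Fi u 0%C.
Proof.
  replace (RtoC 0) with (4 * 0 * (1 * 1))%C by ring.
  apply (tends_ext Fi (fun t => 4 * ze t * (/ (1 + ze t) * / (1 + ze t)))%C); [typeclasses eauto| |].
  - generalize ev_pos; apply filter_imp; intros t T; destruct (h_strip t T) as [S N].
    unfold u; field; apply Re_pos_neq0, one_plus_zeta, N.
  - apply (tends_mult Fi (fun t => 4 * ze t)%C (fun t => / (1 + ze t) * / (1 + ze t))%C);
      [typeclasses eauto| |].
    + apply tends_scal; [typeclasses eauto|exact ze_tends].
    + apply (tends_mult Fi (fun t => / (1 + ze t))%C (fun t => / (1 + ze t))%C);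
        [typeclasses eauto|exact inv_tends|exact inv_tends].
Qed.

Lemma f_tends : tends Fi (fun t => f (u t)) 1%C /\ exists l, tends Fi (fun t => f1 (u t)) l.
Proof.
  assert (U0 : Cmod 0 < 1) by (rewrite Cmod_0; lra).
  destruct (sk_cdiff 0 U0) as [D1 D2]; split.
  - assert (E0 : f 0 = 1%C).
    { unfold f; rewrite CPS_0; unfold H0, hcoef; simpl; field. }
    assert (HF : Filter Fi) by (unfold Fi; typeclasses eauto).
    assert (T := tends_comp Fi f 0%C _ u HF D1 u_tends); rewrite E0 in T; exact T.
  - exists (f1 0%C); apply (tends_comp Fi f1 0%C (f2 0%C) u); [typeclasses eauto|exact D2|exact u_tends].
Qed.

Lemma G_tends : tends Fi G Kq.
Proof.
  replace Kq with (Kq * 1)%C by ring; unfold G.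
  apply (tends_scal Fi Kq (fun t => Cpower (1 + ze t) (- a))); [typeclasses eauto|].
  destruct (Cpower_lip1 (- a)) as [K [K0 HK]].
  apply (tends_bound Fi _ _ (fun t => K * exp (- 2 * t))); [typeclasses eauto| |].
  - assert (Hh : 0 < 1 / 2) by lra.
    generalize (ze_tends _ Hh); apply filter_imp; intros t H1.
    assert (E1 : (1 + ze t - 1 = ze t)%C) by ring.
    assert (E2 : (ze t - 0 = ze t)%C) by ring; rewrite E2 in H1.
    specialize (HK (1 + ze t)%C); rewrite E1, ze_Cmod in HK; rewrite ze_Cmod in H1.
    apply HK; lra.
  - replace 0 with (K * 0) by ring.
    apply (filterlim_comp _ _ _ (fun t => exp (- 2 * t)) (fun y => K * y) _ (locally 0));
      [apply exp_neg_lim; lra|apply (filterlim_scal_r (V := R_NormedModule))].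
Qed.

Lemma Mint_tends m b : INR m < Re b ->
  tends Fi (fun t => Mint e m b (cc e (h t))) (Mint e m b (jj e / 2)).
Proof.
  intros B; destruct (jj_om e E) as [O O1].
  assert (J1 : Cmod (jj e / 2) = 1 / 2).
  { rewrite Cmod_div, Cmod_R, Rabs_pos_eq by (lra || apply C2_neq0).
    rewrite <- (Cmod_opp (jj e)), O1; reflexivity. }
  assert (J2 : Re (jj e / 2) = 0) by (rewrite Re_half; unfold jj; simpl; lra).
  set (K := Cmod b * famK (S m) (b + 1) (1 / 4) (Re b - INR m) / (Re b - INR m)).
  apply (tends_bound Fi _ _ (fun t => K * / 2 * exp (- 2 * t))); [typeclasses eauto| |].
  - assert (Hh : 0 < 1 / 2) by lra.
    generalize (filter_and (F := Fi) _ _ ev_pos (ze_tends _ Hh)).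
    apply filter_imp; intros t [T H1].
    assert (E2 : (ze t - 0 = ze t)%C) by ring; rewrite E2 in H1.
    destruct (h_strip t T) as [S N].
    assert (D : Cmod (cc e (h t) - jj e / 2) = / 2 * exp (- 2 * t)).
    { replace (cc e (h t) - jj e / 2)%C with (- (jj e / 2) * ze t)%C by (unfold cc, ze; field).
      rewrite Cmod_mult, Cmod_opp, J1, ze_Cmod; field. }
    rewrite Rmult_assoc, <- D; unfold Mint, K.
    apply (famint_lip _ _ _ _ _ (1 / 4) (Re b - INR m)); try assumption; try lra.
    + left; apply Re_cc_pos; assumption.
    + rewrite D; rewrite ze_Cmod in H1; lra.
  - replace 0 with (K * / 2 * 0) by ring.
    apply (filterlim_comp _ _ _ (fun t => exp (- 2 * t)) (fun y => K * / 2 * y) _ (locally 0));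
      [apply exp_neg_lim; lra|apply (filterlim_scal_r (V := R_NormedModule))].
Qed.

Lemma sigma_Kq : Mint e 0 a (jj e / 2) = Kq.
Proof.
  unfold Mint; rewrite rotation by (exact E || exact sk_a).
  fold (beta a); rewrite (beta_gamma a sk_a); unfold Kq, a.
  assert (X : (nu + 1 + 1 / 2 = nu + 3 / 2)%C) by field.
  rewrite X; reflexivity.
Qed.

Lemma Kq_neq0 : Kq <> 0%C.
Proof.
  assert (N1 : CGamma (nu + 1) <> 0%C) by (apply gamma_neq0, sk_a).
  assert (N2 : CGamma (nu + 3 / 2) <> 0%C) by (apply gamma_neq0, sk_c).
  unfold Kq; apply Cmult_neq_0.
  - apply Re_pos_neq0; rewrite Re_RtoC; apply sqrt_lt_R0, PI_RGT_0.
  - unfold Cdiv; apply Cmult_neq_0; [exact N1|].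
    intros Z; assert (Y := Cinv_r _ N2); apply (f_equal Re) in Y.
    unfold Cdiv in Y; rewrite Z in Y; autorewrite with reim in Y; lra.
Qed.

Let q (t : R) : C := Q (Ccosh (h t)).
Let qd (t : R) : C := (deriv Q (Ccosh (h t)) * Csinh (h t))%C.
Let y (t : R) : C := Efun e a (h t).
Let yd (t : R) : C := E1fun e a (h t).

Lemma curve_data t : 0 < t ->
  cderiv h t (- (1))%C /\ Csinh (h t) <> 0%C /\ leg a h (- (1))%C q qd t /\ leg a h (- (1))%C y yd t.
Proof.
  intros T; destruct (h_strip t T) as [S N].
  split; [apply h_cderiv|split; [apply (Csinh_neq0 e); assumption|split]].
  - exact (q_leg t T).
  - exact (Efun_leg e a h _ t E sk_a S (h_cderiv t)).
Qed.

Lemma ev_dom : Fi (fun t => 0 < t /\ sk_dom (Ccosh (h t))).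
Proof. destruct h_dom as [T [T0 HT]]; exists T; intros t Ht; split; [lra|apply HT, Ht]. Qed.

Lemma front_tends : tends Fi (fun t => Csinh (h t) * Cexp (2 * a * h t) * ze t)%C 0%C.
Proof.
  pose proof sk_a as A.
  set (K := exp (2 * Rabs (Im a * (e * al)))).
  apply (tends_bound Fi _ _ (fun t => K * exp (- 1 * t))); [typeclasses eauto| |].
  - generalize ev_pos; apply filter_imp; intros t T.
    cbv beta; match goal with |- Cmod (?x - _)%C <= _ => replace (x - 0)%C with x by ring end.
    rewrite !Cmod_mult, ze_Cmod, Cmod_Cexp.
    assert (S1 : Cmod (Csinh (h t)) <= exp t).
    { unfold Csinh; rewrite Cmod_div, Cmod_R, Rabs_pos_eq by (lra || apply C2_neq0).
      assert (Cmod (Cexp (h t) - Cexp (- h t)) <= exp (- t) + exp t).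
      { eapply Rle_trans; [apply Cmod_triangle|]; rewrite Cmod_opp, !Cmod_Cexp; unfold h.
        rewrite Re_opp, Re_pair, Ropp_involutive; lra. }
      assert (exp (- t) <= exp t) by (apply exp_le; lra). lra. }
    apply Rle_trans with (exp t * K * exp (- 2 * t)).
    + apply Rmult_le_compat_r; [left; apply exp_pos|].
      apply Rmult_le_compat; [apply Cmod_ge_0|left; apply exp_pos|exact S1|].
      unfold K; apply exp_le; unfold h; autorewrite with reim.
      pose proof (Rle_abs (- (Im a * (e * al)))) as L; rewrite Rabs_Ropp in L; nra.
    + right; unfold K; rewrite (Rmult_comm (exp t)), Rmult_assoc, <- exp_plus; do 2 f_equal; ring.
  - replace 0 with (K * 0) by ring.
    apply (filterlim_comp _ _ _ (fun t => exp (- 1 * t)) (fun y => K * y) _ (locally 0));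
      [apply exp_neg_lim; lra|apply (filterlim_scal_r (V := R_NormedModule))].
Qed.

(** The Wronskian is constant by Abel's identity. At infinity its two products cancel
    to leading order, and what remains has the factor [sinh h exp (2 a h) exp (2 h)],
    which decays because [Re a > 0]. *)
Lemma wronskian0 t : 0 < t -> (Csinh (h t) * (q t * yd t - qd t * y t) = 0)%C.
Proof.
  intros T.
  set (W := fun s => (Csinh (h s) * (q s * yd s - qd s * y s))%C).
  assert (PF : ProperFilter Fi) by (unfold Fi; typeclasses eauto).
  apply (tends0_const Fi W (W t) PF).
  { exists 0; intros s Hs.
    refine (leg_wronskian a h (- (1))%C q qd y yd 0 (Rmax s t + 1) _ s t _ _).
    - intros v Hv; apply curve_data; lra.
    - pose proof (Rmax_l s t); lra.
    - pose proof (Rmax_r s t); lra. }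
  destruct f_tends as [Ft [l1 F1t]].
  assert (R1 : INR 0 < Re a) by (simpl; apply sk_a).
  assert (R2 : INR 1 < Re (a + 1)) by (rewrite Re_plus, Re_RtoC; pose proof sk_a; change (INR 1) with 1; lra).
  assert (St := Mint_tends 0 a R1); assert (Mt := Mint_tends 1 (a + 1)%C R2).
  assert (L : tends Fi (fun s => (Csinh (h s) * Cexp (2 * a * h s) * ze s)
     * (G s * (f (u s) * (a * jj e * Mint e 1 (a + 1) (cc e (h s)))
        + (2 * a * / (1 + ze s) * f (u s)
           - 8 * (1 - ze s) * (/ (1 + ze s) * (/ (1 + ze s) * / (1 + ze s))) * f1 (u s))
          * Mint e 0 a (cc e (h s)))))%C
     (0 * (Kq * (1 * (a * jj e * Mint e 1 (a + 1) (jj e / 2))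
        + (2 * a * 1 * 1 - 8 * (1 - 0) * (1 * (1 * 1)) * l1) * Mint e 0 a (jj e / 2))))%C).
  { assert (HF : Filter Fi) by (unfold Fi; typeclasses eauto).
    refine (tends_mult Fi _ _ _ _ HF front_tends _).
    refine (tends_mult Fi _ _ _ _ HF G_tends _).
    refine (tends_plus Fi _ _ _ _ HF (tends_mult Fi _ _ _ _ HF Ft (tends_scal Fi _ _ _ HF Mt)) _).
    refine (tends_mult Fi _ _ _ _ HF _ St).
    refine (tends_minus Fi _ _ _ _ HF (tends_mult Fi _ _ _ _ HF (tends_scal Fi _ _ _ HF inv_tends) Ft) _).
    refine (tends_mult Fi _ _ _ _ HF _ F1t).
    refine (tends_mult Fi _ _ _ _ HF _ _).
    - exact (tends_scal Fi _ _ _ HF (tends_minus Fi _ _ _ _ HF (tends_const Fi 1 HF) ze_tends)).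
    - exact (tends_mult Fi _ _ _ _ HF inv_tends (tends_mult Fi _ _ _ _ HF inv_tends inv_tends)). }
  rewrite Cmult_0_l in L.
  assert (L' : tends Fi W 0%C).
  { apply (tends_ext Fi _ W 0%C ltac:(unfold Fi; typeclasses eauto)) with (2 := L).
    generalize ev_dom; apply filter_imp; intros s [Hs D].
    destruct (q_form s Hs D) as [Q0 Q1]; unfold W, q, qd; rewrite Q0, Q1.
    unfold y, yd, Efun, E1fun; fold (ze s).
    replace (2 * a * h s)%C with (a * h s + a * h s)%C by ring; rewrite Cexp_plus.
    destruct (h_strip s Hs) as [S N]; field.
    apply Re_pos_neq0, one_plus_zeta, N. }
  intros eps He; generalize (L' eps He); apply filter_imp; intros s Hs.
  replace (W s - 0)%C with (W s) in Hs by ring; exact Hs.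
Qed.

(** Vanishing of the Wronskian makes the two functions proportional, and the common
    leading coefficient [Kq] makes the factor one. *)
Lemma q_eq_E t : 0 < t -> q t = y t.
Proof.
  intros T.
  assert (PF : ProperFilter Fi) by (unfold Fi; typeclasses eauto).
  assert (R1 : INR 0 < Re a) by (simpl; apply sk_a).
  assert (St := Mint_tends 0 a R1); rewrite sigma_Kq in St.
  assert (Nq := Kq_neq0).
  assert (ev : Fi (fun s => 0 < s /\ Mint e 0 a (cc e (h s)) <> 0%C)).
  { assert (K0 : 0 < Cmod Kq) by (apply Cmod_gt_0, Nq).
    generalize (filter_and (F := Fi) _ _ ev_pos (St _ K0)); apply filter_imp; intros s [H1 H2].
    split; [exact H1|]; intros Z; rewrite Z in H2.
    replace (0 - Kq)%C with (- Kq)%C in H2 by ring; rewrite Cmod_opp in H2; lra. }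
  destruct (filter_ex _ ev) as [t0 [T0 N0]].
  assert (Y0 : y t0 <> 0%C) by (apply Cmult_neq_0; [apply Cexp_neq0|exact N0]).
  set (k := (q t0 / y t0)%C).
  assert (prop : forall s, 0 < s -> q s = (k * y s)%C).
  { intros s Hs; unfold k.
    apply (leg_proportional a h (- (1))%C q qd y yd 0 (Rmax s t0 + 1) t0).
    - intros v Hv; apply curve_data; lra.
    - pose proof (Rmax_r s t0); lra.
    - exact Y0.
    - destruct (h_strip t0 T0) as [S N]; assert (Ns := Csinh_neq0 e _ E S).
      apply (Cmult_eq_reg_l' (Csinh (h t0)) _ _ Ns); rewrite (wronskian0 t0 T0); ring.
    - pose proof (Rmax_l s t0); lra. }
  assert (k1 : k = 1%C).
  { destruct f_tends as [Ft _].
    assert (HF : Filter Fi) by (unfold Fi; typeclasses eauto).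
    assert (A := tends_mult Fi _ _ _ _ HF G_tends Ft).
    assert (B := tends_scal Fi k _ _ HF St).
    assert (C : (k * Kq)%C = (Kq * 1)%C).
    { apply (tends_unique Fi (fun s => G s * f (u s))%C _ _ PF); [|exact A].
      apply (tends_ext Fi _ _ _ HF) with (2 := B).
      generalize ev_dom; apply filter_imp; intros s [Hs D].
      destruct (q_form s Hs D) as [Q0 _]; specialize (prop s Hs); unfold q, y, Efun in prop.
      rewrite Q0 in prop.
      apply (Cmult_eq_reg_l' (Cexp (a * h s)) _ _ (Cexp_neq0 _)); rewrite prop; ring. }
    apply (Cmult_eq_reg_l' Kq _ _ Nq); rewrite <- C; ring. }
  rewrite (prop t T), k1; ring.
Qed.

End Curve.

(** Every interior point of the half-strip lies on one of the curves. *)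
Lemma secondkind_eq e h : e * e = 1 -> strip e h -> Re h < 0 ->
  Q (Ccosh h) = Efun e (nu + 1) h.
Proof.
  intros E S H; destruct S as [S1 S2].
  assert (X := q_eq_E e (e * Im h) E S1 (- Re h) ltac:(lra)); cbv beta in X.
  replace ((- - Re h)%R, (e * (e * Im h))%R) with h in X; [exact X|].
  apply C_eq; simpl; [ring|]; rewrite <- Rmult_assoc, E; ring.
Qed.

End SecondKind.

(** * Boundary values on the cut *)

Lemma Cexp_cdiff z : cdiff Cexp z (Cexp z).
Proof.
  assert (main : forall d, Cmod d <= 1 -> Cmod (Cexp d - 1 - d) <= exp 1 * Cmod d ^ 2).
  { intros d Hd.
    assert (D : forall s, cderiv (fun s => Cexp (RtoC s * d)) s (Cexp (RtoC s * d) * d)%C).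
    { intros s; eapply cderiv_eq.
      - apply cderiv_Cexp, cderiv_mult; [apply cderiv_id|apply cderiv_const].
      - cbn beta; ring. }
    assert (T := cderiv_taylor (fun s => Cexp (RtoC s * d)) (fun s => Cexp (RtoC s * d) * d)%C
      (fun s => Cexp (RtoC s * d) * d * d)%C (exp 1 * Cmod d ^ 2) 0 1 ltac:(lra)).
    cbv beta in T.
    assert (E1 : Cexp (RtoC 1 * d) = Cexp d) by (f_equal; ring).
    assert (E0 : Cexp (RtoC 0 * d) = 1%C) by (rewrite <- Cexp_0; f_equal; ring).
    rewrite E1, E0 in T.
    replace (Cexp d - 1 - RtoC (1 - 0) * (1 * d))%C with (Cexp d - 1 - d)%C in T
      by (rewrite Rminus_0_r; ring).
    replace (exp 1 * Cmod d ^ 2 * (1 - 0) ^ 2) with (exp 1 * Cmod d ^ 2) in T by ring.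
    apply T.
    - intros s _; apply D.
    - intros s _; eapply cderiv_eq;
        [apply cderiv_mult; [apply D|apply cderiv_const]|cbn beta; ring].
    - intros s Hs; rewrite !Cmod_mult, Cmod_Cexp.
      replace (exp 1 * Cmod d ^ 2) with (exp 1 * Cmod d * Cmod d) by ring.
      apply Rmult_le_compat_r; [apply Cmod_ge_0|]; apply Rmult_le_compat_r; [apply Cmod_ge_0|].
      apply exp_le; autorewrite with reim.
      pose proof (re_le_Cmod d) as R; apply Rabs_le_between in R; nra. }
  intros eps He.
  set (K := Cmod (Cexp z) * exp 1).
  assert (K0 : 0 < K) by (apply Rmult_lt_0_compat; [apply Cmod_gt_0, Cexp_neq0|apply exp_pos]).
  exists (Rmin 1 (eps / K)); split; [apply Rmin_glb_lt; [lra|apply Rdiv_lt_0_compat; assumption]|].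
  intros w Hw.
  assert (W1 : Cmod (w - z) < 1) by (eapply Rlt_le_trans; [exact Hw|apply Rmin_l]).
  assert (W2 : Cmod (w - z) < eps / K) by (eapply Rlt_le_trans; [exact Hw|apply Rmin_r]).
  replace (Cexp w) with (Cexp z * Cexp (w - z))%C by (rewrite <- Cexp_plus; f_equal; ring).
  replace (Cexp z * Cexp (w - z) - Cexp z - Cexp z * (w - z))%C with
    (Cexp z * (Cexp (w - z) - 1 - (w - z)))%C by ring.
  rewrite Cmod_mult.
  specialize (main (w - z)%C ltac:(lra)).
  apply (Rmult_lt_compat_l K) in W2; [|exact K0].
  replace (K * (eps / K)) with eps in W2 by (field; lra).
  pose proof (Cmod_ge_0 (w - z)); pose proof (Cmod_ge_0 (Cexp z)).
  apply Rle_trans with (Cmod (Cexp z) * (exp 1 * Cmod (w - z) ^ 2)); [apply Rmult_le_compat_l; assumption|].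
  unfold K in W2; replace (Cmod (Cexp z) * (exp 1 * Cmod (w - z) ^ 2)) with
    (Cmod (Cexp z) * exp 1 * Cmod (w - z) * Cmod (w - z)) by ring.
  apply Rmult_le_compat_r; lra.
Qed.

Lemma tends_Cexp F x l : Filter F -> tends F x l -> tends F (fun t => Cexp (x t)) (Cexp l).
Proof. intros HF A; exact (tends_comp F Cexp l _ x HF (Cexp_cdiff l) A). Qed.

Lemma tends_Efun F e a x l : Filter F -> e * e = 1 -> 0 < Re a -> strip e l -> tends F x l ->
  tends F (fun t => Efun e a (x t)) (Efun e a l).
Proof.
  intros HF E A S X; destruct (jj_om e E) as [O O1].
  refine (tends_mult F _ _ _ _ HF (tends_Cexp F _ _ HF (tends_scal F a _ _ HF X)) _).
  refine (tends_comp F (Mint e 0 a) (cc e l) _ (fun t => cc e (x t)) HF _ _).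
  - apply famint_cdiff; try assumption; apply Re_cc_pos; assumption.
  - unfold cc, Cdiv.
    refine (tends_mult F _ _ _ _ HF (tends_scal F _ _ _ HF _) (tends_const F _ HF)).
    refine (tends_minus F _ _ _ _ HF (tends_const F _ HF) _).
    exact (tends_Cexp F _ _ HF (tends_scal F _ _ _ HF X)).
Qed.

Lemma tends_pair F (p q : R -> R) (x y : R) : Filter F ->
  filterlim p F (locally x) -> filterlim q F (locally y) -> tends F (fun t => (p t, q t)) (x, y).
Proof.
  intros HF A B eps He.
  assert (L1 := proj1 (filterlim_locally _ _) A (mkposreal (eps / 2) ltac:(lra))).
  assert (L2 := proj1 (filterlim_locally _ _) B (mkposreal (eps / 2) ltac:(lra))).
  generalize (filter_and (F := F) _ _ L1 L2); apply filter_imp; intros t [H1 H2].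
  change (Rabs (p t - x) < eps / 2) in H1; change (Rabs (q t - y) < eps / 2) in H2.
  eapply Rle_lt_trans; [apply Cmod_le_ReIm|].
  autorewrite with reim; lra.
Qed.

(** Elliptic coordinates: the point [(x, - e y)] is [cosh h] with
    [cosh (Re h)] and [cos (Im h)] the half sum and half difference of the distances
    to [-1] and [1]. *)
Section Elliptic.
Context (x : R) (X : 0 < x < 1).

Definition dp (y : R) : R := sqrt ((1 + x) ^ 2 + y ^ 2).
Definition dm (y : R) : R := sqrt ((1 - x) ^ 2 + y ^ 2).
Definition eA (y : R) : R := (dp y + dm y) / 2.
Definition eB (y : R) : R := (dp y - dm y) / 2.
Definition et (y : R) : R := ln (eA y + sqrt (eA y ^ 2 - 1)).
Definition eal (y : R) : R := atan (sqrt (1 - eB y ^ 2) / eB y).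

Lemma dpm_sqr y : dp y ^ 2 = (1 + x) ^ 2 + y ^ 2 /\ dm y ^ 2 = (1 - x) ^ 2 + y ^ 2.
Proof.
  unfold dp, dm; split; apply pow2_sqrt; pose proof (pow2_ge_0 y);
    [pose proof (pow2_ge_0 (1 + x))|pose proof (pow2_ge_0 (1 - x))]; lra.
Qed.

Lemma dpm_pos y : 0 < dm y /\ dm y < dp y.
Proof.
  unfold dp, dm; split.
  - apply sqrt_lt_R0; pose proof (pow2_ge_0 y); nra.
  - apply sqrt_lt_1; pose proof (pow2_ge_0 y); nra.
Qed.

Lemma eAB y : eA y * eB y = x /\ eA y ^ 2 + eB y ^ 2 = x ^ 2 + y ^ 2 + 1.
Proof.
  destruct (dpm_sqr y) as [P M]; unfold eA, eB; split.
  - replace ((dp y + dm y) / 2 * ((dp y - dm y) / 2)) with ((dp y ^ 2 - dm y ^ 2) / 4) by field.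
    rewrite P, M; field.
  - replace (((dp y + dm y) / 2) ^ 2 + ((dp y - dm y) / 2) ^ 2) with ((dp y ^ 2 + dm y ^ 2) / 2) by field.
    rewrite P, M; field.
Qed.

Lemma eAB_range y : 0 < y -> 1 < eA y /\ 0 < eB y < 1.
Proof.
  intros Y; destruct (eAB y) as [P S]; destruct (dpm_pos y) as [D1 D2].
  assert (A0 : 0 < eA y) by (unfold eA; lra).
  assert (B0 : 0 < eB y) by (unfold eB; lra).
  assert (Q : (eA y ^ 2 - 1) * (1 - eB y ^ 2) = y ^ 2).
  { transitivity (eA y ^ 2 + eB y ^ 2 - 1 - (eA y * eB y) ^ 2); [ring|rewrite P, S; ring]. }
  assert (y2 : 0 < y ^ 2) by nra.
  assert (AB : eB y < eA y) by (unfold eA, eB; lra).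
  assert (A1 : 1 < eA y ^ 2).
  { destruct (Rlt_dec 1 (eA y ^ 2)) as [H|H]; [exact H|exfalso].
    assert (eB y ^ 2 < 1) by nra. nra. }
  assert (B1 : eB y ^ 2 < 1) by nra.
  split; [nra|split; [exact B0|nra]].
Qed.

Lemma eh_spec e y : e * e = 1 -> 0 < y ->
  let h := (- et y, e * eal y) in
  strip e h /\ Re h < 0 /\ Ccosh h = (x, - e * y).
Proof.
  intros E Y h; destruct (eAB y) as [P S]; destruct (eAB_range y Y) as [A1 [B0 B1]].
  set (sA := sqrt (eA y ^ 2 - 1)); set (sB := sqrt (1 - eB y ^ 2)).
  assert (sA0 : 0 < sA) by (apply sqrt_lt_R0; nra).
  assert (sB0 : 0 < sB) by (apply sqrt_lt_R0; nra).
  assert (sA2 : sA ^ 2 = eA y ^ 2 - 1) by (apply pow2_sqrt; nra).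
  assert (sB2 : sB ^ 2 = 1 - eB y ^ 2) by (apply pow2_sqrt; nra).
  assert (sAB : sA * sB = y).
  { assert ((sA * sB) ^ 2 = y ^ 2).
    { rewrite Rpow_mult_distr, sA2, sB2.
      transitivity (eA y ^ 2 + eB y ^ 2 - 1 - (eA y * eB y) ^ 2); [ring|rewrite P, S; ring]. }
    assert (0 < sA * sB) by (apply Rmult_lt_0_compat; assumption). nra. }
  assert (ex : exp (et y) = eA y + sA) by (unfold et; fold sA; apply exp_ln; lra).
  assert (exn : exp (- et y) = eA y - sA).
  { rewrite exp_Ropp, ex; apply Rmult_eq_reg_r with (eA y + sA); [|lra].
    rewrite Rinv_l by lra; nra. }
  assert (co : cos (eal y) = eB y).
  { unfold eal; fold sB; rewrite cos_atan_div by exact B0.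
    replace (eB y ^ 2 + sB ^ 2) with 1 by lra; rewrite sqrt_1; field. }
  assert (si : sin (eal y) = sB).
  { unfold eal; fold sB; rewrite sin_atan_div by exact B0.
    replace (eB y ^ 2 + sB ^ 2) with 1 by lra; rewrite sqrt_1; field. }
  assert (t0 : 0 < et y).
  { unfold et; fold sA; rewrite <- ln_1; apply ln_increasing; lra. }
  assert (a0 : 0 < eal y < PI / 2).
  { pose proof (atan_bound (sB / eB y)); unfold eal; fold sB; split; [|lra].
    rewrite <- atan_0; apply atan_increasing, Rdiv_lt_0_compat; assumption. }
  split; [|split].
  - split; unfold h; [rewrite Im_pair, <- Rmult_assoc, E, Rmult_1_l; exact a0|rewrite Re_pair; lra].
  - unfold h; rewrite Re_pair; lra.
  - apply C_eq; [rewrite Re_Ccosh|rewrite Im_Ccosh]; unfold h; rewrite Re_pair, Im_pair.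
    + replace (cos (e * eal y)) with (eB y).
      * unfold cosh; rewrite Ropp_involutive, ex, exn; simpl; lra.
      * destruct (e_cases e E) as [-> | ->]; [rewrite Rmult_1_l; auto|].
        replace (-1 * eal y) with (- eal y) by ring; rewrite cos_neg; auto.
    + replace (sin (e * eal y)) with (e * sB).
      * unfold sinh; rewrite Ropp_involutive, ex, exn, <- sAB; simpl; field.
      * destruct (e_cases e E) as [-> | ->]; [rewrite !Rmult_1_l; auto|].
        replace (-1 * eal y) with (- eal y) by ring; rewrite sin_neg, si; ring.
Qed.

Lemma dpm_cont : continuous dp 0 /\ continuous dm 0.
Proof.
  split.
  - apply (ex_derive_continuous dp); unfold dp; auto_derive; nra.
  - apply (ex_derive_continuous dm); unfold dm; auto_derive; nra.
Qed.

Lemma eAB_0 : eA 0 = 1 /\ eB 0 = x.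
Proof.
  unfold eA, eB, dp, dm.
  replace ((1 + x) ^ 2 + 0 ^ 2) with ((1 + x) ^ 2) by ring.
  replace ((1 - x) ^ 2 + 0 ^ 2) with ((1 - x) ^ 2) by ring.
  rewrite !sqrt_pow2 by lra; split; field.
Qed.

Lemma eA_cont : continuous eA 0.
Proof.
  destruct dpm_cont as [A B]; unfold eA.
  apply (continuous_ext (fun y => / 2 * (dp y + dm y)));
    [intros z; change (/ 2 * (dp z + dm z) = (dp z + dm z) / 2); field|].
  apply (continuous_scal_r (V := R_NormedModule) (/ 2) (fun y => dp y + dm y)).
  apply (continuous_plus (V := R_NormedModule) dp dm); assumption.
Qed.

Lemma eB_cont : continuous eB 0.
Proof.
  destruct dpm_cont as [A B]; unfold eB.
  apply (continuous_ext (fun y => / 2 * (dp y - dm y)));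
    [intros z; change (/ 2 * (dp z - dm z) = (dp z - dm z) / 2); field|].
  apply (continuous_scal_r (V := R_NormedModule) (/ 2) (fun y => dp y - dm y)).
  apply (continuous_minus (V := R_NormedModule) dp dm); assumption.
Qed.

Lemma et_lim : filterlim et (at_right 0) (locally 0).
Proof.
  destruct eAB_0 as [A0 _].
  assert (E0 : et 0 = 0).
  { unfold et; rewrite A0; replace (1 ^ 2 - 1) with 0 by ring; rewrite sqrt_0, Rplus_0_r; apply ln_1. }
  rewrite <- E0 at 2; apply (filterlim_at_right_cont et); unfold et.
  apply (continuous_comp (fun y => eA y + sqrt (eA y ^ 2 - 1)) ln).
  - apply (continuous_plus (V := R_NormedModule) eA (fun y => sqrt (eA y ^ 2 - 1))); [exact eA_cont|].
    apply (continuous_comp (fun y => eA y ^ 2 - 1) sqrt); [|apply continuous_sqrt].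
    apply (continuous_comp eA (fun v => v ^ 2 - 1)); [exact eA_cont|].
    apply (ex_derive_continuous (fun v => v ^ 2 - 1)); auto_derive; trivial.
  - rewrite A0; replace (1 ^ 2 - 1) with 0 by ring; rewrite sqrt_0, Rplus_0_r.
    apply (ex_derive_continuous ln); auto_derive; lra.
Qed.

Lemma eal_lim th : 0 < th < PI / 2 -> cos th = x -> filterlim eal (at_right 0) (locally th).
Proof.
  intros T C; destruct eAB_0 as [_ B0].
  assert (E0 : eal 0 = th).
  { unfold eal; rewrite B0, <- C.
    assert (S : 0 < sin th) by (apply sin_gt_0; pose proof PI_RGT_0; lra).
    replace (1 - cos th ^ 2) with (sin th ^ 2)
      by (pose proof (sin2_cos2 th) as Q; unfold Rsqr in Q; lra).
    rewrite sqrt_pow2 by lra; apply atan_tan; lra. }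
  rewrite <- E0; apply (filterlim_at_right_cont eal); unfold eal.
  apply (continuous_comp (fun y => sqrt (1 - eB y ^ 2) / eB y) atan); [|apply continuous_atan].
  apply (continuous_comp eB (fun v => sqrt (1 - v ^ 2) / v)); [exact eB_cont|].
  rewrite B0; apply (ex_derive_continuous (fun v => sqrt (1 - v ^ 2) / v)); auto_derive; nra.
Qed.

End Elliptic.

Definition Ecut (e : R) (a : C) (th : R) : C := Efun e a (jj e * RtoC th).

Lemma jj_th e th : (jj e * RtoC th)%C = (0, e * th).
Proof. apply C_eq; unfold jj; autorewrite with reim; ring. Qed.

Lemma strip_th e th : e * e = 1 -> 0 < th < PI / 2 -> strip e (jj e * RtoC th).
Proof.
  intros E T; rewrite jj_th; split; [|simpl; lra].
  rewrite Im_pair, <- Rmult_assoc, E, Rmult_1_l; exact T.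
Qed.

(** In elliptic coordinates the approach to the cut is the approach of [h] to the side
    of the half-strip, where [Efun] is still continuous. *)
Lemma boundary_value nu Q e th : -1 < Re nu -> is_legendreQ nu Q -> e * e = 1 -> 0 < th < PI / 2 ->
  tends (at_right 0) (fun y => Q (cos th, (- e * y)%R)) (Ecut e (nu + 1) th).
Proof.
  intros Hnu HQ E T.
  assert (HF : Filter (at_right 0)) by typeclasses eauto.
  assert (X : 0 < cos th < 1).
  { split; [apply cos_gt_0; lra|rewrite <- cos_0; apply cos_decreasing_1; lra]. }
  assert (A : 0 < Re (nu + 1)) by (autorewrite with reim; lra).
  apply (tends_ext (at_right 0) (fun y => Efun e (nu + 1) (- et (cos th) y, e * eal (cos th) y)) _ _ HF).
  - exists (mkposreal 1 Rlt_0_1); intros y _ Y.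
    destruct (eh_spec (cos th) X e y E Y) as [S [N C]]; simpl in C.
    rewrite <- (secondkind_eq nu Q Hnu HQ e _ E S N), C; reflexivity.
  - unfold Ecut; apply tends_Efun; [exact HF|exact E|exact A|apply strip_th; assumption|].
    rewrite jj_th; apply (tends_pair _ (fun y => - et (cos th) y) (fun y => e * eal (cos th) y) 0 (e * th) HF).
    + replace 0 with (- 0) at 2 by ring.
      apply (filterlim_comp _ _ _ (et (cos th)) Ropp _ (locally 0));
        [apply et_lim, X|apply (filterlim_opp (V := R_NormedModule))].
    + apply (filterlim_comp _ _ _ (eal (cos th)) (fun y => e * y) _ (locally th));
        [apply eal_lim; trivial|apply (filterlim_scal_r (V := R_NormedModule))].
Qed.

Lemma lim_tends F (x : R -> C) l : ProperFilter F -> tends F x l ->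
  lim (T := C_CompleteNormedModule) (filtermap x F) = l.
Proof.
  intros PF H.
  assert (B : forall eps : posreal, F (fun t => ball l eps (x t))).
  { intros eps; generalize (H eps (cond_pos eps)); apply filter_imp; intros t Ht.
    split; (eapply Rle_lt_trans; [|exact Ht]).
    - exact (re_le_Cmod (x t - l)).
    - exact (Im_le_Cmod (x t - l)). }
  set (G := filtermap x F : (C_CompleteNormedModule -> Prop) -> Prop).
  assert (PG : ProperFilter G) by (apply filtermap_proper_filter, PF).
  assert (L := complete_cauchy (T := C_CompleteNormedModule) G PG
    (fun eps => ex_intro _ l (B eps))).
  set (m := lim (T := C_CompleteNormedModule) G) in *.
  assert (near : forall eps : posreal, Rabs (Re m - Re l) < 2 * eps /\ Rabs (Im m - Im l) < 2 * eps).
  { intros eps; destruct (filter_ex (F := F) _ (filter_and (F := F) _ _ (B eps) (L eps))) as [t [[H1 H2] [H3 H4]]].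
    change (Rabs (Re (x t) - Re l) < eps) in H1; change (Rabs (Im (x t) - Im l) < eps) in H2.
    change (Rabs (Re (x t) - Re m) < eps) in H3; change (Rabs (Im (x t) - Im m) < eps) in H4.
    apply Rabs_def2 in H1; apply Rabs_def2 in H2; apply Rabs_def2 in H3; apply Rabs_def2 in H4.
    split; apply Rabs_def1; lra. }
  apply C_eq.
  - destruct (Req_dec (Re m) (Re l)) as [Z|Z]; [exact Z|exfalso].
    assert (P : 0 < Rabs (Re m - Re l) / 2) by (assert (0 < Rabs (Re m - Re l)) by (apply Rabs_pos_lt; lra); lra).
    destruct (near (mkposreal _ P)) as [K _]; simpl in K; lra.
  - destruct (Req_dec (Im m) (Im l)) as [Z|Z]; [exact Z|exfalso].
    assert (P : 0 < Rabs (Im m - Im l) / 2) by (assert (0 < Rabs (Im m - Im l)) by (apply Rabs_pos_lt; lra); lra).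
    destruct (near (mkposreal _ P)) as [_ K]; simpl in K; lra.
Qed.

Lemma legendreQ_cut_eq nu Q th : -1 < Re nu -> is_legendreQ nu Q -> 0 < th < PI / 2 ->
  legendreQ_cut Q (cos th) = ((Ecut (-1) (nu + 1) th + Ecut 1 (nu + 1) th) / 2)%C.
Proof.
  intros Hnu HQ T; unfold legendreQ_cut; apply lim_tends; [typeclasses eauto|].
  assert (HF : Filter (at_right 0)) by typeclasses eauto.
  assert (B1 := boundary_value nu Q (-1) th Hnu HQ ltac:(ring) T).
  assert (B2 := boundary_value nu Q 1 th Hnu HQ ltac:(ring) T).
  unfold Cdiv.
  refine (tends_mult _ _ _ _ _ HF (tends_plus _ _ _ _ _ HF _ _) (tends_const _ _ HF)).
  - refine (tends_ext _ _ _ _ HF _ B1); apply filter_forall; intros y; do 2 f_equal; ring.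
  - refine (tends_ext _ _ _ _ HF _ B2); apply filter_forall; intros y; do 2 f_equal; ring.
Qed.

(** * Complex conjugation *)

Lemma Cconj_RtoC r : Cconj (RtoC r) = RtoC r.
Proof. apply C_eq; simpl; ring. Qed.

Lemma Re_conj z : Re (Cconj z) = Re z. Proof. reflexivity. Qed.
Lemma Im_conj z : Im (Cconj z) = - Im z. Proof. reflexivity. Qed.

Lemma Cconj_plus z w : Cconj (z + w) = (Cconj z + Cconj w)%C.
Proof. apply C_eq; simpl; ring. Qed.
Lemma Cconj_opp z : Cconj (- z) = (- Cconj z)%C.
Proof. apply C_eq; simpl; ring. Qed.
Lemma Cconj_mult z w : Cconj (z * w) = (Cconj z * Cconj w)%C.
Proof. apply C_eq; simpl; ring. Qed.

Lemma Cexp_conj z : Cexp (Cconj z) = Cconj (Cexp z).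
Proof.
  unfold Cexp; rewrite Re_conj, Im_conj, cos_neg, sin_neg; apply C_eq; simpl; ring.
Qed.

Lemma Clog_conj z : 0 < Re z -> Clog (Cconj z) = Cconj (Clog z).
Proof.
  intros H; unfold Clog; rewrite Cmod_conj, !Carg_atan by (rewrite ?Re_conj; exact H).
  rewrite Re_conj, Im_conj; unfold Rdiv; rewrite Ropp_mult_distr_l_reverse, atan_opp.
  reflexivity.
Qed.

Lemma Cpower_conj z w : 0 < Re z -> Cpower (Cconj z) (Cconj w) = Cconj (Cpower z w).
Proof.
  intros H; unfold Cpower; rewrite Clog_conj, <- Cexp_conj, Cconj_mult by exact H; reflexivity.
Qed.

Lemma kern_conj om x : 0 <= Re om -> 0 < x -> kern (Cconj om) x = Cconj (kern om x).
Proof.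
  intros O X; unfold kern; rewrite <- Cpower_conj by (apply kern_base; assumption).
  rewrite Cconj_plus, !Cconj_mult, !Cconj_RtoC; reflexivity.
Qed.

Lemma fam_conj om m b c x : 0 <= Re om -> 0 <= Re c -> 0 < x ->
  fam (Cconj om) m (Cconj b) (Cconj c) x = Cconj (fam om m b c x).
Proof.
  intros O C X; unfold fam; rewrite kern_conj, !Cconj_mult, Cconj_RtoC by assumption.
  f_equal; rewrite <- Cpower_conj by (pose proof (base_ge1 c x C X); lra).
  rewrite Cconj_plus, Cconj_mult, !Cconj_RtoC, Cconj_opp; reflexivity.
Qed.

Lemma CI_conj g l : CI g l -> CI (fun x => Cconj (g x)) (Cconj l).
Proof.
  rewrite !CI_RI; intros [A B]; split; [exact A|].
  refine (RI_ext _ _ _ _ _); [|replace (Im (Cconj l)) with (-1 * Im l) by (rewrite Im_conj; ring);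
    exact (RI_scal (-1) _ _ B)].
  intros x _; rewrite Im_conj; ring.
Qed.

Lemma famint_conj om m b c : 0 <= Re om -> Cmod om = 1 -> 0 < Re c -> INR m < Re b ->
  famint (Cconj om) m (Cconj b) (Cconj c) = Cconj (famint om m b c).
Proof.
  intros O O1 C B.
  assert (N := Re_pos_neq0 c C).
  assert (I := CI_conj _ _ (fam_CI om m b c O O1 (Rlt_le _ _ C) N B)).
  apply (proj2 (CI_correct _ _ (CI_ext _ _ _ (fun x X =>
    eq_sym (fam_conj om m b c x O (Rlt_le _ _ C) X)) I))).
Qed.

Lemma jj_conj e : Cconj (jj e) = jj (- e).
Proof. reflexivity. Qed.

Lemma jj_opp e : (- jj e)%C = jj (- e).
Proof. apply C_eq; unfold jj; simpl; ring. Qed.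

(** The conjugate of the integrand belongs to the opposite sign of [j] and to the
    conjugate exponent. *)
Lemma Ecut_conj e a th : e * e = 1 -> 0 < Re a -> 0 < th < PI / 2 ->
  Ecut (- e) (Cconj a) th = Cconj (Ecut e a th).
Proof.
  intros E A T; destruct (jj_om e E) as [O O1].
  assert (S := strip_th e th E T).
  unfold Ecut, Efun, Mint; rewrite Cconj_mult, <- Cexp_conj, Cconj_mult.
  assert (Hh : Cconj (jj e * RtoC th) = (jj (- e) * RtoC th)%C)
    by (rewrite Cconj_mult, Cconj_RtoC; reflexivity).
  assert (Hc : cc (- e) (jj (- e) * RtoC th) = Cconj (cc e (jj e * RtoC th))).
  { rewrite <- Hh; unfold cc, Cdiv, Cminus.
    assert (I2 : (/ 2)%C = RtoC (/ 2)) by (rewrite RtoC_inv; [reflexivity|lra]).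
    rewrite I2, !Cconj_mult, Cconj_plus, Cconj_opp, <- Cexp_conj, !Cconj_mult, !Cconj_RtoC, jj_conj.
    reflexivity. }
  rewrite Hh; f_equal.
  rewrite Hc, <- famint_conj; [rewrite Cconj_opp; reflexivity|exact O|exact O1|apply Re_cc_pos; assumption|exact A].
Qed.

(** * Behaviour as the angle tends to zero *)

Lemma tends_filterlim_Re F x l : Filter F -> tends F x l ->
  filterlim (fun t => Re (x t)) F (locally (Re l)).
Proof.
  intros HF A; apply filterlim_locally; intros eps.
  generalize (A eps (cond_pos eps)); apply filter_imp; intros t Ht.
  change (Rabs (Re (x t) - Re l) < eps).
  eapply Rle_lt_trans; [exact (re_le_Cmod (x t - l))|exact Ht].
Qed.

Lemma tends_filterlim_Im F x l : Filter F -> tends F x l ->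
  filterlim (fun t => Im (x t)) F (locally (Im l)).
Proof.
  intros HF A; apply filterlim_locally; intros eps.
  generalize (A eps (cond_pos eps)); apply filter_imp; intros t Ht.
  change (Rabs (Im (x t) - Im l) < eps).
  eapply Rle_lt_trans; [exact (Im_le_Cmod (x t - l))|exact Ht].
Qed.

Lemma CI_FTC G g A B : (forall x, 0 < x -> cderiv G x (g x)) ->
  (forall x, 0 < x -> ccont g x) ->
  tends (at_right 0) G A -> tends (Rbar_locally p_infty) G B -> CI g (B - A)%C.
Proof.
  intros HG Hg HA HB; apply CI_RI; split.
  - apply (RI_FTC (fun x => Re (G x)) (fun x => Re (g x)) (Re A) (Re B)).
    + intros x Hx; apply (HG x Hx).
    + intros x Hx; apply (Hg x Hx).
    + apply tends_filterlim_Re; [typeclasses eauto|exact HA].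
    + apply tends_filterlim_Re; [typeclasses eauto|exact HB].
  - apply (RI_FTC (fun x => Im (G x)) (fun x => Im (g x)) (Im A) (Im B)).
    + intros x Hx; apply (HG x Hx).
    + intros x Hx; apply (Hg x Hx).
    + apply tends_filterlim_Im; [typeclasses eauto|exact HA].
    + apply tends_filterlim_Im; [typeclasses eauto|exact HB].
Qed.

Lemma Rpower_at0 r : 0 < r -> filterlim (fun u => Rpower u r) (at_right 0) (locally 0).
Proof.
  intros P; apply filterlim_locally; intros eps.
  exists (mkposreal (Rpower eps (/ r)) (Rpower_pos _ _)); intros t Ht T.
  change (Rabs (t - 0) < Rpower eps (/ r)) in Ht.
  rewrite Rminus_0_r, Rabs_pos_eq in Ht by lra.
  change (Rabs (Rpower t r - 0) < eps).
  rewrite Rminus_0_r, Rabs_pos_eq by (left; apply Rpower_pos).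
  apply Rlt_le_trans with (Rpower (Rpower eps (/ r)) r).
  - unfold Rpower at 1 2; apply exp_increasing, Rmult_lt_compat_l; [exact P|].
    apply ln_increasing; assumption.
  - rewrite Rpower_mult, Rinv_l, Rpower_1 by (apply cond_pos || lra); lra.
Qed.

Lemma at_right_quarter : at_right 0 (fun th => 0 < th < PI / 2 /\ 0 < sin th < 1 / 4).
Proof.
  exists (mkposreal (1 / 4) ltac:(lra)); intros y Hy Y.
  change (Rabs (y - 0) < 1 / 4) in Hy; rewrite Rminus_0_r, Rabs_pos_eq in Hy by lra.
  pose proof PI2_1 as P1; pose proof PI_4.
  split; [lra|split; [apply sin_gt_0; lra|]].
  pose proof (sin_lt_x y Y); lra.
Qed.

Lemma sin_power_lim k r : 0 < k -> 0 < r ->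
  filterlim (fun th => Rpower (sin th / k) r) (at_right 0) (locally 0).
Proof.
  intros K P; apply (filterlim_comp _ _ _ (fun th => sin th / k) (fun u => Rpower u r) _ (at_right 0));
    [|apply Rpower_at0, P].
  intros Q [d Hd].
  exists (mkposreal (Rmin 3 (d * k)) ltac:(apply Rmin_glb_lt; [lra|apply Rmult_lt_0_compat; [apply cond_pos|exact K]])).
  intros y Hy Y; change (Rabs (y - 0) < Rmin 3 (d * k)) in Hy.
  rewrite Rminus_0_r, Rabs_pos_eq in Hy by lra.
  assert (y < 3) by (eapply Rlt_le_trans; [exact Hy|apply Rmin_l]).
  assert (Y2 : y < d * k) by (eapply Rlt_le_trans; [exact Hy|apply Rmin_r]).
  assert (S0 : 0 < sin y) by (apply sin_gt_0; [exact Y|pose proof PI2_3_2; lra]).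
  assert (S1 : sin y < y) by (apply sin_lt_x, Y).
  apply Hd; [|apply Rdiv_lt_0_compat; assumption].
  change (Rabs (sin y / k - 0) < d); rewrite Rminus_0_r, Rabs_pos_eq by (left; apply Rdiv_lt_0_compat; assumption).
  apply Rmult_lt_reg_r with k; [exact K|]; unfold Rdiv; rewrite Rmult_assoc, Rinv_l; lra.
Qed.

Lemma scaled_lim F (b : R -> R) K : Filter F -> filterlim b F (locally 0) ->
  filterlim (fun t => K * b t) F (locally 0).
Proof.
  intros HF B; assert (L := filterlim_scal_r (V := R_NormedModule) K 0).
  change (filterlim (fun z : R => K * z) (locally 0) (locally (K * 0))) in L.
  rewrite Rmult_0_r in L.
  exact (filterlim_comp _ _ _ b (fun z => K * z) F _ _ B L).
Qed.

(** * The kernel at infinity and its imaginary part *)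

Lemma kern_sqr om x : 0 <= Re om -> 0 < x ->
  (kern om x * kern om x * (RtoC x * RtoC x + 2 * om * RtoC x) = 1)%C.
Proof.
  intros O X; pose proof (kern_base om x O X) as B.
  unfold kern; set (q := (RtoC x * RtoC x + 2 * om * RtoC x)%C) in *.
  rewrite <- Cpower_plus.
  replace (RtoC (- / 2) + RtoC (- / 2))%C with (- (1))%C
    by (apply C_eq; simpl; field).
  rewrite Cpower_opp, Cpower_1 by exact B; apply Cinv_l, Re_pos_neq0, B.
Qed.

Lemma Re_Cpower_pos z r : 0 < Re z -> -1 <= r <= 1 -> 0 < Re (Cpower z (RtoC r)).
Proof.
  intros H R0; unfold Cpower, Cexp; rewrite Re_pair.
  apply Rmult_lt_0_compat; [apply exp_pos|].
  pose proof (Carg_bound z H) as B; unfold Clog; autorewrite with reim.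
  assert (K : Rabs (r * Carg z) < PI / 2).
  { rewrite Rabs_mult; assert (Rabs (Carg z) < PI / 2) by (apply Rabs_def1; lra).
    assert (Rabs r <= 1) by (apply Rabs_le; lra).
    pose proof (Rabs_pos (Carg z)); pose proof (Rabs_pos r); nra. }
  apply Rabs_def2 in K; apply cos_gt_0; lra.
Qed.

(** With [k] the kernel, [(k x - 1) (k x + 1) = 2 j / (x - 2 j)], and the second factor
    has real part at least one. *)
Lemma kern_asym e x : e * e = 1 -> 0 < x -> Cmod (kern (- jj e) x * RtoC x - 1) <= 4 / (x + 2).
Proof.
  intros E X; destruct (jj_om e E) as [O O1].
  set (k := kern (- jj e) x).
  assert (KS := kern_sqr _ x O X); fold k in KS.
  assert (Rk : 0 < Re k) by (apply Re_Cpower_pos; [apply kern_base; assumption|lra]).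
  set (v := (RtoC x - 2 * jj e)%C).
  assert (V : (x + 2) / 2 <= Cmod v).
  { assert (D := Cmod2_alt v); unfold v, jj in D; autorewrite with reim in D.
    assert (D' : Cmod v ^ 2 = x ^ 2 + 4 * (e * e)) by (unfold v, jj; rewrite D; ring).
    rewrite E in D'; apply Rsqr_incr_0_var; [|apply Cmod_ge_0]; unfold Rsqr.
    pose proof (pow2_ge_0 (x - 1)); nra. }
  assert (Nv : v <> 0%C) by (apply Cmod_gt_0; lra).
  assert (Nx : RtoC x <> 0%C) by (apply Re_pos_neq0; exact X).
  assert (Q : ((k * RtoC x - 1) * (k * RtoC x + 1) = 2 * jj e / v)%C).
  { replace (RtoC x * RtoC x + 2 * - jj e * RtoC x)%C with (RtoC x * v)%C in KS by (unfold v; ring).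
    transitivity (k * k * (RtoC x * v) * (RtoC x / v) - 1)%C; [field; exact Nv|].
    rewrite KS; unfold v; field; exact Nv. }
  assert (P : 1 <= Cmod (k * RtoC x + 1)).
  { eapply Rle_trans; [|apply re_le_Cmod]; eapply Rle_trans; [|apply Rle_abs].
    autorewrite with reim; nra. }
  assert (M := f_equal Cmod Q); rewrite Cmod_mult, Cmod_div, Cmod_mult, Cmod_R, Rabs_pos_eq in M by (lra || exact Nv).
  rewrite <- (Cmod_opp (jj e)), O1 in M.
  apply Rle_trans with (2 * 1 / Cmod v).
  - rewrite <- M; pose proof (Cmod_ge_0 (k * RtoC x - 1)); nra.
  - apply Rle_trans with (2 * 1 / ((x + 2) / 2)); [|right; field; lra].
    unfold Rdiv at 1 2; apply Rmult_le_compat_l; [lra|apply Rinv_le_contravar; lra].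
Qed.

(** The kernel has the primitive [log (x + om + sqrt (x^2 + 2 om x))], whose imaginary
    part goes from [- e PI / 2] at zero, where the argument of the logarithm is
    [om = - j], to zero at infinity. *)
Lemma kern_Im_RI e : e * e = 1 -> RI (fun x => Im (kern (- jj e) x)) (e * (PI / 2)).
Proof.
  intros E; destruct (jj_om e E) as [O O1].
  set (om := (- jj e)%C) in *.
  set (q := fun x : R => (RtoC x * RtoC x + 2 * om * RtoC x)%C).
  set (S := fun x : R => Cpower (q x) (RtoC (/ 2))).
  set (w := fun x : R => (RtoC x + om + S x)%C).
  assert (Bq : forall x, 0 < x -> 0 < Re (q x)) by (intros x X; apply kern_base; assumption).
  assert (SS : forall x, 0 < x -> (S x * S x = q x)%C).
  { intros x X; unfold S; rewrite <- Cpower_plus.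
    replace (RtoC (/ 2) + RtoC (/ 2))%C with (RtoC 1) by (rewrite <- RtoC_plus; f_equal; field).
    apply Cpower_1, Bq, X. }
  assert (Sk : forall x, 0 < x -> (S x * kern om x = 1)%C).
  { intros x X; unfold S, kern; fold (q x); rewrite <- Cpower_plus, <- RtoC_plus, Rplus_opp_r.
    apply Cpower_0. }
  assert (RS : forall x, 0 < x -> 0 < Re (S x)) by (intros x X; apply Re_Cpower_pos; [apply Bq, X|lra]).
  assert (Rom : Re om = 0) by (unfold om, jj; simpl; ring).
  assert (Iom : Im om = - e) by (unfold om, jj; simpl; ring).
  assert (Rw : forall x, 0 < x -> x < Re (w x)).
  { intros x X; specialize (RS x X); unfold w; autorewrite with reim; rewrite Rom; lra. }
  assert (Dw : forall x, 0 < x -> cderiv w x (w x * kern om x)%C).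
  { intros x X; assert (Nq : q x <> 0%C) by (apply Re_pos_neq0, Bq, X).
    assert (Dq : cderiv q x (2 * (RtoC x + om))%C).
    { eapply cderiv_eq;
        [apply cderiv_plus; [apply cderiv_mult; apply cderiv_id|apply cderiv_scal, cderiv_id]|ring]. }
    eapply cderiv_eq.
    - apply cderiv_plus; [apply cderiv_plus; [apply cderiv_id|apply cderiv_const]|].
      apply (cderiv_Cpower q); [exact Dq|apply Bq, X].
    - fold (S x); rewrite <- (SS x X) in *.
      assert (NS : S x <> 0%C) by (apply Re_pos_neq0, RS, X).
      assert (Ek : kern om x = (/ S x)%C).
      { apply (Cmult_eq_reg_l' (S x)); [exact NS|]; rewrite (Sk x X), Cinv_r by exact NS; reflexivity. }
      rewrite Ek; unfold w; replace (RtoC (/ 2)) with (/ 2)%C by (rewrite RtoC_inv; [reflexivity|lra]).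
      field; exact NS. }
  assert (e2 := e_cases e E).
  replace (e * (PI / 2)) with (0 - - e * (PI / 2)) by ring.
  apply (RI_FTC (fun x => Im (Clog (w x)))).
  - intros x X.
    assert (D := cderiv_Clog w x _ (Dw x X) ltac:(specialize (Rw x X); lra)).
    replace (w x * kern om x / w x)%C with (kern om x) in D
      by (field; apply Re_pos_neq0; specialize (Rw x X); lra).
    exact (proj2 D).
  - intros x X; exact (proj2 (cderiv_ccont _ _ _ (cderiv_kern om x O X))).
  - set (g := fun x => - e * (Im (w x) / Re (w x))).
    apply (filterlim_ext_loc (fun x => - e * atan (g x))).
    { exists (mkposreal 1 Rlt_0_1); intros x _ X; unfold Clog; rewrite Im_pair.
      rewrite Carg_atan by (specialize (Rw x X); lra); unfold g.
      destruct e2 as [-> | ->].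
      - replace (-(1) * (Im (w x) / Re (w x))) with (- (Im (w x) / Re (w x))) by ring.
        rewrite atan_opp; ring.
      - replace (- -1 * (Im (w x) / Re (w x))) with (Im (w x) / Re (w x)) by ring; ring. }
    apply (filterlim_comp _ _ _ (fun x => atan (g x)) (fun y => - e * y) _ (locally (PI / 2)));
      [|apply (filterlim_scal_r (V := R_NormedModule))].
    apply (filterlim_comp _ _ _ g atan _ (Rbar_locally p_infty)); [|apply filterlim_atan_p].
    intros P [M HM].
    (* For [x < 1/25] one has [sqrt x < 1/5] and hence [- e Im w >= 1/2]; the second bound
       on [x] makes [Re w <= 3 sqrt x] so small that the quotient exceeds [M]. *)
    set (d := Rmin (/ 25) (/ (12 * (Rabs M + 1)) ^ 2)).
    pose proof (Rabs_pos M) as M0.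
    assert (d0 : 0 < d).
    { apply Rmin_glb_lt; [lra|]; apply Rinv_0_lt_compat, pow_lt; lra. }
    exists (mkposreal d d0); intros x Hx X; apply HM.
    change (Rabs (x - 0) < d) in Hx; rewrite Rminus_0_r, Rabs_pos_eq in Hx by lra.
    assert (x1 : x < / 25) by (eapply Rlt_le_trans; [exact Hx|apply Rmin_l]).
    assert (x2 : x < / (12 * (Rabs M + 1)) ^ 2) by (eapply Rlt_le_trans; [exact Hx|apply Rmin_r]).
    pose proof (sqrt_pos_lt x X) as r0; pose proof (sqrt_sqrt x (Rlt_le _ _ X)) as rr.
    set (r := sqrt x) in *.
    assert (S1 : Cmod (S x) <= 2 * r).
    { assert (Cmod (S x) ^ 2 <= (2 * r) ^ 2).
      { replace (Cmod (S x) ^ 2) with (Cmod (S x * S x)) by (rewrite Cmod_mult; ring).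
        rewrite (SS x X); unfold q.
        replace (RtoC x * RtoC x + 2 * om * RtoC x)%C with (RtoC x * (RtoC x + 2 * om))%C by ring.
        rewrite Cmod_mult, Cmod_R, Rabs_pos_eq by lra.
        assert (Cmod (RtoC x + 2 * om) <= x + 2).
        { eapply Rle_trans; [apply Cmod_triangle|].
          rewrite Cmod_mult, O1, !Cmod_R, !Rabs_pos_eq by lra; lra. }
        nra. }
      pose proof (Cmod_ge_0 (S x)); nra. }
    assert (r1 : r < / 5) by nra.
    specialize (Rw x X).
    assert (W1 : Re (w x) <= 3 * r).
    { pose proof (re_le_Cmod (S x)); pose proof (Rle_abs (Re (S x))).
      unfold w; autorewrite with reim; rewrite Rom; nra. }
    assert (W2 : 1 / 2 <= - e * Im (w x)).
    { pose proof (Im_le_Cmod (S x)) as I; apply Rabs_le_between in I.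
      unfold w; autorewrite with reim; rewrite Iom.
      destruct e2 as [-> | ->]; lra. }
    unfold g; replace (- e * (Im (w x) / Re (w x))) with (- e * Im (w x) / Re (w x)) by (field; lra).
    apply Rle_lt_trans with (Rabs M); [apply Rle_abs|].
    apply Rmult_lt_reg_r with (Re (w x)); [lra|].
    unfold Rdiv; rewrite Rmult_assoc, Rinv_l, Rmult_1_r by lra.
    apply Rlt_le_trans with (1 / 2); [|exact W2].
    assert (r2 : r * (12 * (Rabs M + 1)) < 1).
    { assert (x * (12 * (Rabs M + 1)) ^ 2 < 1).
      { apply (Rmult_lt_compat_r ((12 * (Rabs M + 1)) ^ 2)) in x2; [|apply pow_lt; lra].
        rewrite Rinv_l in x2 by (apply pow_nonzero; lra); exact x2. }
      assert ((r * (12 * (Rabs M + 1))) ^ 2 < 1) by (rewrite Rpow_mult_distr; replace (r ^ 2) with x by (simpl; lra); exact H).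
      assert (0 < r * (12 * (Rabs M + 1))) by (apply Rmult_lt_0_compat; lra). nra. }
    nra.
  - apply (filterlim_ext_loc (fun x => atan (Im (w x) / Re (w x)))).
    { exists 0; intros x X; unfold Clog; rewrite Im_pair, Carg_atan by (specialize (Rw x X); lra); reflexivity. }
    rewrite <- atan_0.
    apply (filterlim_comp _ _ _ (fun x => Im (w x) / Re (w x)) atan _ (locally 0)); [|apply continuous_atan].
    apply filterlim_locally; intros eps.
    exists (Rmax 1 (3 / eps)); intros x Hx.
    assert (x1 : 1 < x) by (eapply Rle_lt_trans; [apply Rmax_l|exact Hx]).
    assert (x2 : 3 / eps < x) by (eapply Rle_lt_trans; [apply Rmax_r|exact Hx]).
    assert (X : 0 < x) by lra; specialize (Rw x X).
    assert (Nw : w x <> 0%C) by (apply Re_pos_neq0; lra).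
    assert (oo : (om * om = - (1))%C).
    { unfold om; replace (- jj e * - jj e)%C with (jj e * jj e)%C by ring; apply jj_sqr, E. }
    (* Since [om^2 = -1], [w] is a root of [w^2 - 2 (x + om) w - 1]. *)
    assert (Ew : w x = (2 * (RtoC x + om) + / w x)%C).
    { apply (Cmult_eq_reg_l' (w x)); [exact Nw|].
      rewrite Cmult_plus_distr_l, Cinv_r by exact Nw.
      transitivity (2 * (RtoC x + om) * w x + (S x * S x - RtoC x * RtoC x - 2 * om * RtoC x - om * om))%C;
        [unfold w; ring|rewrite (SS x X), oo; unfold q; ring]. }
    assert (Iw : Rabs (Im (w x)) <= 3).
    { rewrite Ew; autorewrite with reim.
      assert (I1 : Rabs (Im (/ w x)) <= 1).
      { eapply Rle_trans; [apply Im_le_Cmod|]; rewrite Cmod_inv by exact Nw.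
        rewrite <- Rinv_1; apply Rinv_le_contravar; [lra|].
        eapply Rle_trans; [|apply re_le_Cmod]; eapply Rle_trans; [|apply Rle_abs]; lra. }
      rewrite Rom, Iom.
      apply Rabs_le_between in I1; apply Rabs_le.
      destruct e2 as [-> | ->]; lra. }
    change (Rabs (Im (w x) / Re (w x) - 0) < eps); rewrite Rminus_0_r.
    unfold Rdiv; rewrite Rabs_mult, (Rabs_pos_eq (/ Re (w x))) by (left; apply Rinv_0_lt_compat; lra).
    apply Rmult_lt_reg_r with (Re (w x)); [lra|].
    rewrite Rmult_assoc, Rinv_l, Rmult_1_r by lra.
    pose proof (cond_pos eps) as ep.
    apply (Rmult_lt_compat_l eps) in x2; [|exact ep].
    replace (eps * (3 / eps)) with 3 in x2 by (field; lra). nra.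
Qed.

Lemma kern_diff_CI : CI (fun x => kern (- jj 1) x - kern (- jj (-1)) x)%C (Ci * RtoC PI)%C.
Proof.
  assert (R1 := kern_Im_RI 1 ltac:(ring)).
  assert (C1 := CI_scal (2 * Ci) _ _ (CI_RtoC _ _ R1)).
  replace (2 * Ci * RtoC (1 * (PI / 2)))%C with (Ci * RtoC PI)%C in C1
    by (apply C_eq; simpl; field).
  refine (CI_ext _ _ _ _ C1); intros x X.
  assert (K : kern (- jj (-1)) x = Cconj (kern (- jj 1) x)).
  { rewrite <- kern_conj; [|unfold jj; simpl; lra|exact X].
    rewrite Cconj_opp, jj_conj; f_equal; f_equal; unfold jj; f_equal; ring. }
  rewrite K; apply C_eq; simpl; ring.
Qed.

(** * Limits of the integrals *)

Definition cth (e th : R) : C := cc e (jj e * RtoC th).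

Lemma Cexp_jj e th : e * e = 1 -> Cexp (jj e * RtoC th) = (RtoC (cos th) + jj e * RtoC (sin th))%C.
Proof.
  intros E; unfold Cexp, jj; autorewrite with reim.
  replace (0 * th - e * 0) with 0 by ring; replace (0 * 0 + e * th) with (e * th) by ring.
  rewrite exp_0; destruct (e_cases e E) as [-> | ->].
  - replace (1 * th) with th by ring; apply C_eq; unfold Re, Im; simpl; ring.
  - replace (-1 * th) with (- th) by ring; rewrite cos_neg, sin_neg; apply C_eq; unfold Re, Im; simpl; ring.
Qed.

Lemma cth_eq e th : e * e = 1 -> cth e th = (RtoC (sin th) * Cexp (jj e * RtoC th))%C.
Proof.
  intros E; unfold cth, cc; rewrite Cexp_double, Cexp_jj by exact E.
  assert (J := jj_sqr e E); set (j := jj e) in *.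
  assert (SC : (RtoC (sin th) * RtoC (sin th) + RtoC (cos th) * RtoC (cos th) = 1)%C).
  { rewrite <- !RtoC_mult, <- RtoC_plus; f_equal; exact (sin2_cos2 th). }
  set (s := RtoC (sin th)) in *; set (c := RtoC (cos th)) in *.
  transitivity (j * (1 - (s * s + c * c) + s * s * (1 - j * j)) / 2 - (j * j) * s * c)%C; [field|].
  rewrite SC, J.
  transitivity (j * (s * s) + s * c)%C; [field|ring].
Qed.

Lemma cth_data e th : e * e = 1 -> 0 < th < PI / 2 ->
  0 < Re (cth e th) /\ Cmod (cth e th) = sin th.
Proof.
  intros E T; split; [apply Re_cc_pos; [exact E|apply strip_th; assumption]|].
  assert (S0 : 0 < sin th) by (apply sin_gt_0; lra).
  rewrite cth_eq, Cmod_mult, Cmod_Cexp, Cmod_R, Rabs_pos_eq by (exact E || lra).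
  unfold jj; autorewrite with reim; replace (0 * th - e * 0) with 0 by ring; rewrite exp_0; ring.
Qed.

Lemma Csinh_jj e th : e * e = 1 -> Csinh (jj e * RtoC th) = (jj e * RtoC (sin th))%C.
Proof.
  intros E; unfold Csinh.
  replace (- (jj e * RtoC th))%C with (jj e * RtoC (- th))%C by (rewrite RtoC_opp; ring).
  rewrite !Cexp_jj, cos_neg, sin_neg, RtoC_opp by exact E; field.
Qed.

Lemma Ccosh_jj e th : e * e = 1 -> Ccosh (jj e * RtoC th) = RtoC (cos th).
Proof.
  intros E; unfold Ccosh.
  replace (- (jj e * RtoC th))%C with (jj e * RtoC (- th))%C by (rewrite RtoC_opp; ring).
  rewrite !Cexp_jj, cos_neg, sin_neg, RtoC_opp by exact E; field.
Qed.

Lemma fl_th e : filterlim (fun th => e * th) (at_right 0) (locally 0).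
Proof.
  apply scaled_lim; [typeclasses eauto|].
  intros P HP; apply filter_le_within; exact HP.
Qed.

Lemma jth_tends e : tends (at_right 0) (fun th => jj e * RtoC th)%C 0%C.
Proof.
  assert (HF : Filter (at_right 0)) by typeclasses eauto.
  apply (tends_ext _ (fun th => ((fun _ => 0) th, e * th)) _ _ HF).
  - apply filter_forall; intros th; rewrite jj_th; reflexivity.
  - exact (tends_pair (at_right 0) (fun _ => 0) (fun th => e * th) 0 0 HF (filterlim_const 0) (fl_th e)).
Qed.

Lemma Cexp_jth_tends e k : tends (at_right 0) (fun th => Cexp (k * (jj e * RtoC th))) 1%C.
Proof.
  assert (HF : Filter (at_right 0)) by typeclasses eauto.
  assert (T := tends_Cexp _ _ _ HF (tends_scal _ k _ _ HF (jth_tends e))).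
  rewrite Cmult_0_r, Cexp_0 in T; exact T.
Qed.

Lemma sin_tends : tends (at_right 0) (fun th => RtoC (sin th)) 0%C.
Proof.
  apply (tends_bound _ _ _ (fun th => 1 * th)); [typeclasses eauto| |apply fl_th].
  generalize at_right_quarter; apply filter_imp; intros th [T [S0 _]].
  replace (RtoC (sin th) - 0)%C with (RtoC (sin th)) by ring.
  rewrite Cmod_R, Rabs_pos_eq by lra; pose proof (sin_lt_x th (proj1 T)); lra.
Qed.

(** The left side is bounded by a multiple of [Cmod c * x] and by a constant, hence by
    a multiple of the square root. *)
Lemma Cpower_sqrt_near a c x : 0 < Re a -> 0 <= Re c -> 0 < x ->
  Cmod (Cpower (1 + c * RtoC x) (- a) - 1) <= (Cmod a * Kexp a + Kexp a + 1) * sqrt (Cmod c * x).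
Proof.
  intros A C X.
  set (u := Cmod c * x).
  assert (u0 : 0 <= u) by (apply Rmult_le_pos; [apply Cmod_ge_0|lra]).
  assert (K0 := Kexp_pos a); assert (a0 := Cmod_ge_0 a).
  assert (Kb : Kexp (- a) = Kexp a)
    by (unfold Kexp; autorewrite with reim; rewrite Rabs_Ropp; reflexivity).
  assert (P : forall w, 1 <= Re w -> Cmod (Cpower w (- a)) <= Kexp a).
  { intros w W; eapply Rle_trans; [apply Cmod_Cpower_le; lra|]; rewrite Kb, Re_opp.
    assert (1 <= Cmod w) by (eapply Rle_trans; [exact W|]; eapply Rle_trans; [apply Rle_abs|apply re_le_Cmod]).
    pose proof (Rpower_le_1 (Cmod w) (- Re a) H ltac:(lra)); pose proof (Rpower_pos (Cmod w) (- Re a)); nra. }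
  assert (B1 : Cmod (Cpower (1 + c * RtoC x) (- a) - 1) <= Cmod a * Kexp a * u).
  { assert (T := cderiv_mvt (fun t => Cpower (1 + c * RtoC x * RtoC t) (- a))
      (fun t => - a * Cpower (1 + c * RtoC x * RtoC t) (- a) * (c * RtoC x) / (1 + c * RtoC x * RtoC t))%C
      (Cmod a * Kexp a * u) 0 1 ltac:(lra)).
    cbv beta in T.
    replace (1 + c * RtoC x * RtoC 1)%C with (1 + c * RtoC x)%C in T by ring.
    replace (1 + c * RtoC x * RtoC 0)%C with (RtoC 1) in T by ring.
    assert (E1 : Cpower 1 (- a) = 1%C).
    { unfold Cpower; rewrite (Clog_unique 1 0); [rewrite <- Cexp_0; f_equal; ring|simpl; lra|apply Cexp_0|].
      pose proof PI_RGT_0; simpl; lra. }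
    rewrite E1, Rminus_0_r, Rmult_1_r in T.
    assert (Rt : forall t, 0 <= t <= 1 -> 1 <= Re (1 + c * RtoC x * RtoC t)).
    { intros t Ht; autorewrite with reim.
      assert (0 <= Re c * x * t) by (apply Rmult_le_pos; [apply Rmult_le_pos|]; lra). lra. }
    apply T.
    - intros t Ht; apply (cderiv_Cpower (fun t => 1 + c * RtoC x * RtoC t)%C);
        [apply cderiv_base|specialize (Rt t Ht); lra].
    - intros t Ht; specialize (Rt t Ht).
      assert (M : 1 <= Cmod (1 + c * RtoC x * RtoC t))
        by (eapply Rle_trans; [exact Rt|]; eapply Rle_trans; [apply Rle_abs|apply re_le_Cmod]).
      assert (N : (1 + c * RtoC x * RtoC t <> 0)%C) by (apply Re_pos_neq0; lra).
      rewrite Cmod_div, !Cmod_mult, Cmod_opp, Cmod_R, (Rabs_pos_eq x) by (lra || exact N).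
      fold u; specialize (P _ Rt).
      apply Rmult_le_reg_r with (Cmod (1 + c * RtoC x * RtoC t)); [lra|].
      unfold Rdiv; rewrite Rmult_assoc, Rinv_l, Rmult_1_r by lra.
      assert (Q : Cmod a * Cmod (Cpower (1 + c * RtoC x * RtoC t) (- a)) * u <= Cmod a * Kexp a * u)
        by (apply Rmult_le_compat_r; [exact u0|apply Rmult_le_compat_l; assumption]).
      assert (0 <= Cmod a * Kexp a * u) by (apply Rmult_le_pos; [apply Rmult_le_pos; lra|exact u0]).
      nra. }
  assert (B2 : Cmod (Cpower (1 + c * RtoC x) (- a) - 1) <= Kexp a + 1).
  { eapply Rle_trans; [apply Cmod_triangle|]; rewrite Cmod_opp, Cmod_1.
    specialize (P _ (base_ge1 c x C X)); lra. }
  pose proof (sqrt_pos u) as s0; pose proof (sqrt_sqrt u u0) as ss.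
  assert (0 <= Cmod a * Kexp a) by (apply Rmult_le_pos; lra).
  destruct (Rle_dec u 1) as [L|L].
  - assert (sqrt u <= 1) by (rewrite <- sqrt_1; apply sqrt_le_1_alt, L).
    assert (u <= sqrt u) by nra. nra.
  - assert (1 <= sqrt u) by (rewrite <- sqrt_1; apply sqrt_le_1_alt; lra). nra.
Qed.

Section Small.
Context (e : R) (a : C) (E : e * e = 1) (A : 0 < Re a).

Let sg (th : R) : C := Mint e 0 a (cth e th).
Let m1 (th : R) : C := Mint e 1 (a + 1) (cth e th).
Let p : R := Rmin (Re a) (1 / 4).

Lemma p_range : 0 < p /\ p <= Re a /\ p <= 1 / 4.
Proof. unfold p; split; [apply Rmin_glb_lt; lra|split; [apply Rmin_l|apply Rmin_r]]. Qed.

(** The integral is [O(sin^(-p))] for an exponent [p] below one. *)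
Lemma sigma_small : tends (at_right 0) (fun th => RtoC (sin th) * sg th)%C 0%C.
Proof.
  destruct p_range as [p0 [p1 p2]]; destruct (jj_om e E) as [O O1].
  apply (tends_bound _ _ _ (fun th => (8 * Kexp a / p) * Rpower (sin th / 4) (1 - p)));
    [typeclasses eauto| |apply scaled_lim; [typeclasses eauto|apply sin_power_lim; lra]].
  generalize at_right_quarter; apply filter_imp; intros th [T [S0 S1]].
  destruct (cth_data e th E T) as [C C1].
  replace (RtoC (sin th) * sg th - 0)%C with (RtoC (sin th) * sg th)%C by ring.
  rewrite Cmod_mult, Cmod_R, Rabs_pos_eq by lra.
  assert (B := famint_bound (- jj e) 0 a (cth e th) (sin th) p O O1 ltac:(lra) ltac:(lra) ltac:(lra)).
  specialize (B ltac:(simpl; lra)); fold (Mint e 0 a (cth e th)) in B; fold (sg th) in B.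
  eapply Rle_trans; [apply Rmult_le_compat_l; [lra|exact B]|].
  unfold famK; replace (1 - p) with (1 + - p) by ring; rewrite Rpower_plus, Rpower_1 by lra.
  right; simpl pow; field; lra.
Qed.

Lemma linear_CI c : 0 < Re c -> CI (fun x => Cpower (1 + c * RtoC x) (- (a + 1)))%C (1 / (a * c))%C.
Proof.
  intros C; assert (Nc := Re_pos_neq0 c C); assert (Na := Re_pos_neq0 a A).
  replace (1 / (a * c))%C with (- (1 / (a * c)) * 0 - - (1 / (a * c)) * 1)%C by (field; split; assumption).
  apply (CI_FTC (fun x => - (1 / (a * c)) * Cpower (1 + c * RtoC x) (- a))%C).
  - intros x X; pose proof (base_ge1 c x (Rlt_le _ _ C) X) as B.
    eapply cderiv_eq.
    + apply cderiv_scal, (cderiv_Cpower (fun s => 1 + c * RtoC s)%C); [apply cderiv_base|lra].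
    + replace (- (a + 1))%C with (- a + - (1))%C by ring.
      rewrite (Cpower_plus _ (- a)), (Cpower_opp _ 1), Cpower_1 by lra.
      field; repeat split; try assumption; apply Re_pos_neq0; lra.
  - intros x X; pose proof (base_ge1 c x (Rlt_le _ _ C) X) as B.
    eapply cderiv_ccont, (cderiv_Cpower (fun s => 1 + c * RtoC s)%C); [apply cderiv_base|lra].
  - assert (HF : Filter (at_right 0)) by typeclasses eauto.
    apply (tends_scal _ _ _ _ HF).
    destruct (Cpower_lip1 (- a)) as [K [K0 HK]].
    assert (M0 : 0 < Cmod c) by (apply Cmod_gt_0, Nc).
    apply (tends_bound _ _ _ (fun x => (K * Cmod c) * (1 * x))); [exact HF| |apply scaled_lim; [exact HF|apply fl_th]].
    assert (D : 0 < / (2 * Cmod c)) by (apply Rinv_0_lt_compat; lra).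
    exists (mkposreal _ D); intros x Hx X.
    change (Rabs (x - 0) < / (2 * Cmod c)) in Hx; rewrite Rminus_0_r, Rabs_pos_eq in Hx by lra.
    specialize (HK (1 + c * RtoC x)%C); replace (1 + c * RtoC x - 1)%C with (c * RtoC x)%C in HK by ring.
    rewrite Cmod_mult, Cmod_R, Rabs_pos_eq in HK by lra.
    rewrite Rmult_1_l, Rmult_assoc; apply HK.
    apply (Rmult_lt_compat_l (2 * Cmod c)) in Hx; [|lra].
    rewrite Rinv_r in Hx by lra; lra.
  - assert (HF : Filter (Rbar_locally p_infty)) by typeclasses eauto.
    apply (tends_scal _ _ _ _ HF).
    set (r := Rmin 1 (Cmod c)).
    assert (R1 : 0 < r) by (apply Rmin_glb_lt; [lra|apply Cmod_gt_0, Nc]).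
    apply (tends_bound _ _ _ (fun x => (Kexp a * / r ^ 0 * Rpower (r / 4) (- Re a)) * Rpower (1 + sqrt x) (- (2 * Re a))));
      [exact HF| |apply scaled_lim; [exact HF|apply Rpower_1sqrt_infty; lra]].
    exists 0; intros x X.
    assert (P := pow_dom c a 0 r x (Re a) ltac:(lra) (conj R1 (Rmin_l _ _)) (Rmin_r _ _) X ltac:(simpl; lra)).
    rewrite pow_O, Rmult_1_l in P.
    replace (Cpower (1 + c * RtoC x) (- a) - 0)%C with (Cpower (1 + c * RtoC x) (- a)) by ring; exact P.
Qed.

(** Replacing [x k(x)] by its limit one at infinity changes the integral by a less
    singular quantity. *)
Lemma m1_asym th : 0 < th < PI / 2 ->
  Cmod (m1 th - 1 / (a * cth e th)) <= 32 * Kexp (a + 1) * Rpower (sin th / 4) (- (1 / 4)).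
Proof.
  intros T; destruct (cth_data e th E T) as [C C1]; destruct (jj_om e E) as [O O1].
  set (c := cth e th) in *.
  assert (S0 : 0 < sin th) by (apply sin_gt_0; lra).
  assert (S1 : sin th <= 1) by (pose proof (SIN_bound th); lra).
  replace (32 * Kexp (a + 1) * Rpower (sin th / 4) (- (1 / 4))) with
    (8 * Kexp (a + 1) * Rpower (sin th / 4) (- (1 / 4)) * (2 / (1 / 2))) by field.
  apply (CI_le (fun x => fam (- jj e) 1 (a + 1) c x - Cpower (1 + c * RtoC x) (- (a + 1)))%C
    (fun x => 8 * Kexp (a + 1) * Rpower (sin th / 4) (- (1 / 4)) * maj (1 / 2) x)).
  - apply CI_minus; [|apply linear_CI, C].
    apply fam_CI; try assumption; [lra|apply Re_pos_neq0, C|].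
    autorewrite with reim; simpl; lra.
  - apply RI_scal, RI_maj; lra.
  - intros x X; unfold fam.
    replace (kern (- jj e) x * RtoC (x ^ 1) * Cpower (1 + c * RtoC x) (- (a + 1)) - Cpower (1 + c * RtoC x) (- (a + 1)))%C
      with ((kern (- jj e) x * RtoC x - 1) * Cpower (1 + c * RtoC x) (- (a + 1)))%C
      by (rewrite pow_1; ring).
    rewrite Cmod_mult.
    assert (B1 := kern_asym e x E X).
    assert (B2 := pow_dom c (a + 1) 0 (sin th) x (1 / 4) ltac:(lra) ltac:(lra) ltac:(lra) X).
    specialize (B2 ltac:(autorewrite with reim; simpl; lra)).
    rewrite pow_O, Rmult_1_l in B2.
    pose proof (sqrt_pos_lt x X) as r0; pose proof (sqrt_sqrt x (Rlt_le _ _ X)) as rr.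
    assert (B3 : 4 / (x + 2) <= 8 * (/ sqrt x * / (1 + sqrt x))).
    { rewrite <- Rinv_mult.
      apply Rmult_le_reg_r with (sqrt x * (1 + sqrt x)); [apply Rmult_lt_0_compat; lra|].
      rewrite (Rmult_assoc 8), Rinv_l by (apply Rgt_not_eq, Rmult_lt_0_compat; lra).
      apply Rmult_le_reg_r with (x + 2); [lra|].
      replace (4 / (x + 2) * (sqrt x * (1 + sqrt x)) * (x + 2)) with (4 * (sqrt x * (1 + sqrt x))) by (field; lra).
      pose proof (pow2_ge_0 (sqrt x - 1)); nra. }
    eapply Rle_trans.
    { apply Rmult_le_compat; [apply Cmod_ge_0|apply Cmod_ge_0|eapply Rle_trans; [exact B1|exact B3]|exact B2]. }
    right; unfold maj; replace (- 1 - 1 / 2) with (- (2 * (1 / 4)) + - (1)) by field.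
    rewrite (Rpower_plus (- (2 * (1 / 4)))), (Rpower_Ropp _ 1), Rpower_1 by lra.
    simpl pow; field; lra.
Qed.

(** The integral [1 / (a c)] with the kernel replaced by [1 / x] dominates, and [c] is
    [sin] times a factor that tends to one. *)
Lemma m1_tends : tends (at_right 0) (fun th => RtoC (sin th) * m1 th)%C (1 / a)%C.
Proof.
  assert (HF : Filter (at_right 0)) by typeclasses eauto.
  assert (Na := Re_pos_neq0 a A).
  assert (T1 : tends (at_right 0) (fun th => RtoC (sin th) * (m1 th - 1 / (a * cth e th)))%C 0%C).
  { apply (tends_bound _ _ _ (fun th => (128 * Kexp (a + 1)) * Rpower (sin th / 4) (3 / 4)));
      [exact HF| |apply scaled_lim; [exact HF|apply sin_power_lim; lra]].
    generalize at_right_quarter; apply filter_imp; intros th [T [S0 S1]].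
    match goal with |- Cmod (?z - _)%C <= _ => replace (z - 0)%C with z by ring end.
    rewrite Cmod_mult, Cmod_R, Rabs_pos_eq by lra.
    eapply Rle_trans; [apply Rmult_le_compat_l; [lra|apply m1_asym, T]|].
    replace (3 / 4) with (1 + - (1 / 4)) by field; rewrite Rpower_plus, Rpower_1 by lra.
    right; field. }
  assert (T2 := tends_scal _ (1 / a)%C _ _ HF (Cexp_jth_tends e (- (1))%C)).
  assert (T3 := tends_plus _ _ _ _ _ HF T1 T2).
  replace (0 + 1 / a * 1)%C with (1 / a)%C in T3 by ring.
  apply (tends_ext _ _ _ _ HF) with (2 := T3).
  generalize at_right_quarter; apply filter_imp; intros th [T [S0 S1]].
  rewrite cth_eq by exact E.
  replace (- (1) * (jj e * RtoC th))%C with (- (jj e * RtoC th))%C by ring.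
  rewrite Cexp_opp.
  assert (Ns : RtoC (sin th) <> 0%C) by (apply Re_pos_neq0; exact S0).
  assert (Ne := Cexp_neq0 (jj e * RtoC th)).
  field; repeat split; assumption.
Qed.

Lemma E1_tends : tends (at_right 0)
  (fun th => RtoC (sin th) * E1fun e a (jj e * RtoC th))%C (jj e).
Proof.
  assert (HF : Filter (at_right 0)) by typeclasses eauto.
  assert (Na := Re_pos_neq0 a A).
  assert (T := tends_mult _ _ _ _ _ HF (Cexp_jth_tends e a)
    (tends_plus _ _ _ _ _ HF (tends_scal _ a _ _ HF sigma_small)
       (tends_scal _ (a * jj e)%C _ _ HF (tends_mult _ _ _ _ _ HF (Cexp_jth_tends e 2) m1_tends)))).
  replace (1 * (a * 0 + a * jj e * (1 * (1 / a))))%C with (jj e) in T by (field; exact Na).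
  apply (tends_ext _ _ _ _ HF) with (2 := T); apply filter_forall; intros th.
  unfold E1fun; fold (cth e th); fold (sg th) (m1 th); ring.
Qed.

(** The first factor is [O(sin)], so that [sigma_small] applies. *)
Lemma sigma_shift_tends k :
  tends (at_right 0) (fun th => (Cexp (k * (jj e * RtoC th)) - 1) * sg th)%C 0%C.
Proof.
  assert (HF : Filter (at_right 0)) by typeclasses eauto.
  set (K := 4 * (Cmod k + 1)).
  pose proof (Cmod_ge_0 k) as k0.
  apply (tends_bound _ _ _ (fun th => K * Cmod (RtoC (sin th) * sg th))).
  - exact HF.
  - assert (KD := Cexp_cdiff 0 1 Rlt_0_1); destruct KD as [d [D Hd]].
    assert (T := tends_scal _ k _ _ HF (jth_tends e)); rewrite Cmult_0_r in T.
    generalize (filter_and (F := at_right 0) _ _ at_right_quarter (T d D)).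
    apply filter_imp; intros th [[T0 [S0 S1]] H1].
    specialize (Hd _ H1); rewrite Cexp_0 in Hd.
    set (z := (k * (jj e * RtoC th))%C) in *.
    replace (z - 0)%C with z in * by ring.
    assert (Z1 : Cmod (Cexp z - 1) <= 2 * Cmod z).
    { replace (Cexp z - 1)%C with ((Cexp z - 1 - 1 * z) + z)%C by ring.
      eapply Rle_trans; [apply Cmod_triangle|]; lra. }
    assert (Z2 : Cmod z = Cmod k * th).
    { unfold z; rewrite !Cmod_mult, Cmod_R, Rabs_pos_eq by lra.
      rewrite <- (Cmod_opp (jj e)), (proj2 (jj_om e E)); ring. }
    assert (Z3 : th <= 2 * sin th).
    { assert (th < PI / 3).
      { assert (PI2_ge := PI2_3_2).
        destruct (Rlt_dec th (PI / 3)) as [L|L]; [exact L|exfalso].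
        assert (sin (PI / 6) <= sin th) by (apply sin_incr_1; lra).
        rewrite sin_PI6 in H; lra. }
      destruct (MVT_gen sin 0 th cos) as [x [Hx Ex]].
      - intros u _; apply is_derive_sin.
      - intros u _; apply continuity_sin.
      - rewrite Rmin_left, Rmax_right in Hx by lra.
        assert (cos (PI / 3) <= cos x) by (apply cos_decr_1; lra).
        rewrite cos_PI3 in H0; rewrite sin_0 in Ex; nra. }
    match goal with |- Cmod (?z - _)%C <= _ => replace (z - 0)%C with z by ring end.
    rewrite !Cmod_mult, Cmod_R, Rabs_pos_eq by lra.
    rewrite <- Rmult_assoc; apply Rmult_le_compat_r; [apply Cmod_ge_0|].
    unfold K; nra.
  - apply scaled_lim; [exact HF|].
    apply filterlim_locally; intros eps; generalize (sigma_small eps (cond_pos eps)).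
    apply filter_imp; intros th H.
    change (Rabs (Cmod (RtoC (sin th) * sg th) - 0) < eps); rewrite Rminus_0_r, Rabs_pos_eq by apply Cmod_ge_0.
    replace (RtoC (sin th) * sg th - 0)%C with (RtoC (sin th) * sg th)%C in H by ring; exact H.
Qed.

End Small.

(** The difference of the two boundary values stays bounded: the logarithmic
    singularities cancel, and the limit is the integral of the difference of the kernels. *)
Section Difference.
Context (a : C) (A : 0 < Re a).

Let om1 : C := (- jj 1)%C.
Let om2 : C := (- jj (-1))%C.

Lemma om12 : 0 <= Re om1 /\ Cmod om1 = 1 /\ 0 <= Re om2 /\ Cmod om2 = 1.
Proof.
  destruct (jj_om 1 ltac:(ring)) as [O1 O2]; destruct (jj_om (-1) ltac:(ring)) as [O3 O4].
  repeat split; assumption.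
Qed.

(** The difference of the two kernels is [O(x^(-2))] at infinity, so that the power may
    be replaced by its limit one under the integral. *)
Lemma first_tends : tends (at_right 0)
  (fun th => famint om1 0 a (cth 1 th) - famint om2 0 a (cth 1 th))%C (Ci * RtoC PI)%C.
Proof.
  assert (HF : Filter (at_right 0)) by typeclasses eauto.
  destruct om12 as [O1 [O2 [O3 O4]]].
  set (K := Cmod a * Kexp a + Kexp a + 1).
  assert (K0 : 0 < K) by (unfold K; pose proof (Cmod_ge_0 a); pose proof (Kexp_pos a); nra).
  apply (tends_bound _ _ _ (fun th => (32 * K) * Rpower (sin th / 1) (/ 2))); [exact HF| |].
  2:{ apply scaled_lim; [exact HF|apply sin_power_lim; lra]. }
  generalize at_right_quarter; apply filter_imp; intros th [T [S0 S1]].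
  destruct (cth_data 1 th ltac:(ring) T) as [C C1]; set (c := cth 1 th) in *.
  assert (Nc := Re_pos_neq0 c C).
  assert (R1 : INR 0 < Re a) by (simpl; exact A).
  assert (I1 := fam_CI om1 0 a c O1 O2 (Rlt_le _ _ C) Nc R1).
  assert (I2 := fam_CI om2 0 a c O3 O4 (Rlt_le _ _ C) Nc R1).
  replace (32 * K * Rpower (sin th / 1) (/ 2)) with (16 * K * sqrt (sin th) * (2 / 1)).
  2:{ unfold Rdiv at 2; rewrite Rinv_1, Rmult_1_r, Rpower_sqrt by exact S0; field. }
  apply (CI_le (fun x => fam om1 0 a c x - fam om2 0 a c x - (kern om1 x - kern om2 x))%C
    (fun x => 16 * K * sqrt (sin th) * maj 1 x)).
  - exact (CI_minus _ _ _ _ (CI_minus _ _ _ _ I1 I2) kern_diff_CI).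
  - apply RI_scal, RI_maj; lra.
  - intros x X; unfold fam.
    assert (Nx : RtoC x <> 0%C) by (apply Re_pos_neq0; exact X).
    replace (kern om1 x * RtoC (x ^ 0) * Cpower (1 + c * RtoC x) (- a)
       - kern om2 x * RtoC (x ^ 0) * Cpower (1 + c * RtoC x) (- a) - (kern om1 x - kern om2 x))%C with
      (((kern om1 x * RtoC x - 1) - (kern om2 x * RtoC x - 1)) / RtoC x * (Cpower (1 + c * RtoC x) (- a) - 1))%C
      by (rewrite pow_O; field; exact Nx).
    rewrite Cmod_mult, Cmod_div, Cmod_R, (Rabs_pos_eq x) by (exact Nx || lra).
    assert (B1 := kern_asym 1 x ltac:(ring) X); assert (B2 := kern_asym (-1) x ltac:(ring) X).
    assert (B3 := Cpower_sqrt_near a c x A (Rlt_le _ _ C) X); fold K in B3; rewrite C1 in B3.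
    fold om1 in B1; fold om2 in B2.
    pose proof (sqrt_pos_lt x X) as r0; pose proof (sqrt_sqrt x (Rlt_le _ _ X)) as rr.
    assert (B4 : Cmod (kern om1 x * RtoC x - 1 - (kern om2 x * RtoC x - 1)) <= 8 / (x + 2)).
    { eapply Rle_trans; [apply Cmod_triangle|]; rewrite Cmod_opp.
      replace (8 / (x + 2)) with (4 / (x + 2) + 4 / (x + 2)) by (field; lra); lra. }
    rewrite sqrt_mult in B3 by lra.
    apply Rle_trans with (8 / (x + 2) / x * (K * (sqrt (sin th) * sqrt x))).
    { apply Rmult_le_compat; [|apply Cmod_ge_0| |exact B3].
      - apply Rmult_le_pos; [apply Cmod_ge_0|left; apply Rinv_0_lt_compat, X].
      - unfold Rdiv at 1 2; apply Rmult_le_compat_r; [left; apply Rinv_0_lt_compat, X|exact B4]. }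
    unfold maj; replace (- 1 - 1) with (- (1) + - (1)) by ring.
    rewrite Rpower_plus, !Rpower_Ropp, !Rpower_1 by lra.
    pose proof (sqr_1sqrt x X) as Q.
    assert (s0 := sqrt_pos (sin th)).
    replace (8 / (x + 2) / x * (K * (sqrt (sin th) * sqrt x))) with
      (K * sqrt (sin th) * (8 / (x + 2) * / sqrt x)).
    2:{ set (r := sqrt x) in *; rewrite <- rr; field; split; nra. }
    replace (16 * K * sqrt (sin th) * (/ sqrt x * (/ (1 + sqrt x) * / (1 + sqrt x)))) with
      (K * sqrt (sin th) * (16 / (1 + sqrt x) ^ 2 * / sqrt x)) by (field; lra).
    apply Rmult_le_compat_l; [apply Rmult_le_pos; lra|].
    apply Rmult_le_compat_r; [left; apply Rinv_0_lt_compat, r0|].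
    assert (P0 : 0 < (1 + sqrt x) ^ 2) by (apply pow_lt; lra).
    apply Rmult_le_reg_r with ((x + 2) * (1 + sqrt x) ^ 2); [apply Rmult_lt_0_compat; lra|].
    replace (8 / (x + 2) * ((x + 2) * (1 + sqrt x) ^ 2)) with (8 * (1 + sqrt x) ^ 2) by (field; lra).
    replace (16 / (1 + sqrt x) ^ 2 * ((x + 2) * (1 + sqrt x) ^ 2)) with (16 * (x + 2)) by (field; lra).
    lra.
Qed.

Lemma cth_conj_diff th : (cth 1 th - cth (-1) th = 2 * Ci * RtoC (sin th) * RtoC (sin th))%C.
Proof.
  rewrite !cth_eq, !Cexp_jj by ring; apply C_eq; unfold jj; simpl; ring.
Qed.

(** The two parameters differ by [O(sin^2)], and the derivative of the integral is
    [O(sin^(-1 - p))]. *)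
Lemma second_tends : tends (at_right 0)
  (fun th => famint om2 0 a (cth 1 th) - famint om2 0 a (cth (-1) th))%C 0%C.
Proof.
  assert (HF : Filter (at_right 0)) by typeclasses eauto.
  destruct om12 as [_ [_ [O3 O4]]].
  destruct (p_range a A) as [p0 [p1 p2]]; set (p := Rmin (Re a) (1 / 4)) in *.
  apply (tends_bound _ _ _ (fun th => (64 * Cmod a * Kexp (a + 1) / p) * Rpower (sin th / 8) (1 - p)));
    [exact HF| |apply scaled_lim; [exact HF|apply sin_power_lim; lra]].
  generalize at_right_quarter; apply filter_imp; intros th [T [S0 S1]].
  destruct (cth_data 1 th ltac:(ring) T) as [C C1]; destruct (cth_data (-1) th ltac:(ring) T) as [D D1].
  assert (W : Cmod (cth 1 th - cth (-1) th) = 2 * (sin th * sin th)).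
  { rewrite cth_conj_diff, !Cmod_mult, Cmod_Ci, !Cmod_R, (Rabs_pos_eq 2), Rabs_pos_eq by lra; ring. }
  assert (L := famint_lip om2 0 a (cth (-1) th) (cth 1 th) (sin th / 2) p O3 O4 ltac:(lra) ltac:(lra)
    ltac:(lra) ltac:(lra) ltac:(rewrite W; nra) ltac:(simpl; lra)).
  match goal with |- Cmod (?z - _)%C <= _ => replace (z - 0)%C with z by ring end.
  eapply Rle_trans; [exact L|]; rewrite W; unfold famK.
  replace (1 - p) with (1 + - p) by ring; rewrite Rpower_plus, Rpower_1 by lra.
  replace (sin th / 2 / 4) with (sin th / 8) by field.
  right; simpl pow; field; lra.
Qed.

Lemma Ecut_diff_tends : tends (at_right 0) (fun th => Ecut 1 a th - Ecut (-1) a th)%C (Ci * RtoC PI)%C.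
Proof.
  assert (HF : Filter (at_right 0)) by typeclasses eauto.
  assert (T := tends_plus _ _ _ _ _ HF (tends_plus _ _ _ _ _ HF first_tends second_tends)
    (tends_minus _ _ _ _ _ HF (sigma_shift_tends 1 a ltac:(ring) A a)
       (sigma_shift_tends (-1) a ltac:(ring) A a))).
  replace (Ci * RtoC PI + 0 + (0 - 0))%C with (Ci * RtoC PI)%C in T by ring.
  apply (tends_ext _ _ _ _ HF) with (2 := T); apply filter_forall; intros th.
  unfold Ecut, Efun, Mint; fold (cth 1 th) (cth (-1) th) om1 om2; ring.
Qed.

End Difference.

(** * The function of the first kind *)

Definition hth (th : R) : C := (jj 1 * RtoC th)%C.

Lemma hth_data th : 0 < th < PI / 2 ->
  cderiv hth th (jj 1) /\ Csinh (hth th) <> 0%C.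
Proof.
  intros T; split.
  - eapply cderiv_eq; [apply cderiv_scal, cderiv_id|ring].
  - apply (Csinh_neq0 1); [ring|apply strip_th; [ring|exact T]].
Qed.

(** The equation is invariant under [h -> -h], so that both boundary values solve it
    on the same curve. *)
Lemma leg_flip a h d y y1 t : Csinh (h t) <> 0%C -> leg a (fun s => - h s)%C (- d) y y1 t ->
  leg a h d y (fun s => - y1 s)%C t.
Proof.
  intros N [A B]; split; (eapply cderiv_eq; [first [exact A|apply cderiv_opp; exact B]|]).
  - ring.
  - assert (K : Ccoth (- h t) = (- Ccoth (h t))%C).
    { unfold Ccoth.
      assert (S : Csinh (- h t) = (- Csinh (h t))%C)
        by (unfold Csinh; replace (- - h t)%C with (h t) by ring; field).
      assert (K : Ccosh (- h t) = Ccosh (h t)) by (unfold Ccosh; replace (- - h t)%C with (h t) by ring; field).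
      rewrite S, K; field; exact N. }
    rewrite K; ring.
Qed.

Lemma Ecut_leg_pos a th : 0 < Re a -> 0 < th < PI / 2 ->
  leg a hth (jj 1) (Ecut 1 a) (fun s => E1fun 1 a (hth s)) th.
Proof.
  intros A T; apply Efun_leg; [ring|exact A|apply strip_th; [ring|exact T]|apply hth_data, T].
Qed.

Lemma Ecut_leg_neg a th : 0 < Re a -> 0 < th < PI / 2 ->
  leg a hth (jj 1) (Ecut (-1) a) (fun s => - E1fun (-1) a (jj (-1) * RtoC s))%C th.
Proof.
  intros A T; apply leg_flip; [apply hth_data, T|].
  assert (J : (- jj 1)%C = jj (-1)) by (rewrite jj_opp; f_equal; ring).
  rewrite J.
  assert (L : leg a (fun s => jj (-1) * RtoC s)%C (jj (-1)) (Ecut (-1) a)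
    (fun s => E1fun (-1) a (jj (-1) * RtoC s)) th).
  { apply (Efun_leg (-1) a (fun s => jj (-1) * RtoC s)%C); [ring|exact A|apply strip_th; [ring|exact T]|].
    eapply cderiv_eq; [apply cderiv_scal, cderiv_id|ring]. }
  destruct L as [L1 L2]; split; [exact L1|].
  replace (- hth th)%C with (jj (-1) * RtoC th)%C by (rewrite <- J; unfold hth; ring).
  exact L2.
Qed.

Section FirstKind.
Context (nu : C).

Let A := hcoef (- nu) (nu + 1) 1.
Let w (th : R) : C := RtoC ((1 - cos th) / 2).

(** The Gauss series of the function of the first kind; [Pser1] is its derivative with
    respect to [h = i theta]. *)
Definition Pser (th : R) : C := CPS A (w th).
Definition Pser1 (th : R) : C := (- Ci * (CPS (dcoef A) (w th) * RtoC (sin th / 2)))%C.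

Lemma A_bnd r : 0 < r < 1 -> bnd A r.
Proof. intros R0; apply hcoef_bnd; [simpl; lra|exact R0]. Qed.

Lemma w_small th : 0 < th < PI / 2 -> Cmod (w th) < 1 / 2 /\ Cmod (w th) <= sin th.
Proof.
  intros T; unfold w.
  assert (S0 : 0 < sin th) by (apply sin_gt_0; lra).
  assert (C0 : 0 < cos th) by (apply cos_gt_0; lra).
  pose proof (COS_bound th) as [_ C1]; pose proof (SIN_bound th) as [_ S1].
  pose proof (sin2_cos2 th) as Q; unfold Rsqr in Q.
  rewrite Cmod_R, Rabs_pos_eq by lra; split; [lra|nra].
Qed.

Lemma w_cderiv th : cderiv w th (RtoC (sin th / 2)).
Proof.
  apply (cderiv_RtoC (fun s => (1 - cos s) / 2)); auto_derive; [exact I|field].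
Qed.

Lemma Pser_leg th : 0 < th < PI / 2 -> leg (nu + 1) hth (jj 1) Pser Pser1 th.
Proof.
  intros T; destruct (w_small th T) as [W _].
  assert (S0 : 0 < sin th) by (apply sin_gt_0; lra).
  assert (J : (Ci * Ci = - (1))%C) by (apply C_eq; simpl; ring).
  assert (J1 : jj 1 = Ci) by reflexivity.
  split.
  - eapply cderiv_eq.
    + apply (cderiv_comp (CPS A) w); [apply (CPS_cdiff A (1 / 2)); [apply A_bnd; lra|exact W]|apply w_cderiv].
    + unfold Pser1; rewrite J1.
      transitivity (- (Ci * Ci) * (CPS (dcoef A) (w th) * RtoC (sin th / 2)))%C; [rewrite J|]; ring.
  - eapply cderiv_eq.
    + unfold Pser1; apply cderiv_scal, cderiv_mult.
      * apply (cderiv_comp (CPS (dcoef A)) w); [|apply w_cderiv].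
        apply (CPS_cdiff (dcoef A) (1 / 2)); [|exact W].
        apply (bnd_dcoef A (3 / 4)); [lra|apply A_bnd; lra].
      * apply (cderiv_RtoC (fun s => sin s / 2)).
        apply (is_derive_ext (fun s => / 2 * sin s)); [intros s; simpl; unfold Rdiv; ring|].
        apply (is_derive_scal sin th (/ 2)), is_derive_sin.
    + assert (G := gauss_ode (- nu) (nu + 1) 1 (w th) ltac:(simpl; lra) ltac:(lra)).
      fold A in G; unfold hth at 1, Ccoth.
      rewrite Csinh_jj, Ccosh_jj by ring; rewrite J1; unfold Pser, Pser1.
      set (f := CPS A (w th)) in *; set (f1 := CPS (dcoef A) (w th)) in *.
      set (f2 := CPS (dcoef (dcoef A)) (w th)) in *.
      assert (Ns : RtoC (sin th) <> 0%C) by (apply Re_pos_neq0; exact S0).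
      assert (Ni : Ci <> 0%C) by (intros K; apply (f_equal Im) in K; simpl in K; lra).
      assert (Ew : w th = ((1 - RtoC (cos th)) / 2)%C)
        by (unfold w; rewrite RtoC_div, RtoC_minus by lra; reflexivity).
      assert (SC : (RtoC (sin th) * RtoC (sin th) = 1 - RtoC (cos th) * RtoC (cos th))%C).
      { rewrite <- !RtoC_mult, <- RtoC_minus; f_equal; pose proof (sin2_cos2 th) as Q; unfold Rsqr in Q; lra. }
      rewrite Ew in G.
      unfold Rdiv; rewrite !RtoC_mult, RtoC_inv by lra.
      set (s := RtoC (sin th)) in *; set (c := RtoC (cos th)) in *.
      transitivity (- Ci * ((s * s) / 4 * f2 + f1 * c / 2))%C; [field|].
      rewrite SC.
      transitivity (- Ci * (((1 - c) / 2 * (1 - (1 - c) / 2) * f2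
        + (1 - (- nu + (nu + 1) + 1) * ((1 - c) / 2)) * f1 - - nu * (nu + 1) * f)
        - c * f1 / 2 - nu * (nu + 1) * f))%C; [field|].
      rewrite G; field; split; assumption.
Qed.

Lemma w_tends : tends (at_right 0) w 0%C.
Proof.
  apply (tends_bound _ _ _ (fun th => 1 * th)); [typeclasses eauto| |apply fl_th].
  generalize at_right_quarter; apply filter_imp; intros th [T [S0 _]].
  replace (w th - 0)%C with (w th) by ring.
  destruct (w_small th T) as [_ W]; pose proof (sin_lt_x th (proj1 T)); lra.
Qed.

Lemma Pser_tends : tends (at_right 0) Pser 1%C.
Proof.
  assert (HF : Filter (at_right 0)) by typeclasses eauto.
  assert (K : CPS A 0 = 1%C).
  { rewrite CPS_0; unfold A, hcoef; simpl; field; apply Re_pos_neq0; simpl; lra. }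
  rewrite <- K; refine (tends_comp _ (CPS A) 0 _ w HF _ w_tends).
  apply (CPS_cdiff A (1 / 2)); [apply A_bnd; lra|rewrite Cmod_0; lra].
Qed.

Lemma Pser1_tends : tends (at_right 0) Pser1 0%C.
Proof.
  assert (HF : Filter (at_right 0)) by typeclasses eauto.
  assert (D : tends (at_right 0) (fun th => CPS (dcoef A) (w th)) (CPS (dcoef A) 0)).
  { refine (tends_comp _ (CPS (dcoef A)) 0 _ w HF _ w_tends).
    apply (CPS_cdiff (dcoef A) (1 / 2)); [|rewrite Cmod_0; lra].
    apply (bnd_dcoef A (3 / 4)); [lra|apply A_bnd; lra]. }
  assert (T := tends_scal _ (- Ci / 2)%C _ _ HF (tends_mult _ _ _ _ _ HF D sin_tends)).
  rewrite !Cmult_0_r in T.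
  apply (tends_ext _ _ _ _ HF) with (2 := T); apply filter_forall; intros th.
  unfold Pser1, Rdiv; rewrite RtoC_mult, RtoC_inv by lra; field.
Qed.

(** Both sides solve the equation of Legendre; near zero their difference [y] tends to
    zero and [sin y'] tends to zero, so that its Wronskian with [Pser] vanishes. *)
Lemma Pser_Ecut th : -1 < Re nu -> 0 < th < PI / 2 ->
  Pser th = (- (Ci / RtoC PI) * (Ecut 1 (nu + 1) th - Ecut (-1) (nu + 1) th))%C.
Proof.
  intros Hnu.
  assert (HF : ProperFilter (at_right 0)) by typeclasses eauto.
  assert (HF' : Filter (at_right 0)) by typeclasses eauto.
  assert (Ha : 0 < Re (nu + 1)) by (autorewrite with reim; lra).
  assert (J1 : jj 1 = Ci) by reflexivity.
  assert (Jm : jj (-1) = (- Ci)%C) by (apply C_eq; unfold jj; simpl; ring).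
  assert (Np : RtoC PI <> 0%C) by (apply Re_pos_neq0; exact PI_RGT_0).
  assert (J : (Ci * Ci = - (1))%C) by (apply C_eq; simpl; ring).
  set (a := (nu + 1)%C) in *.
  set (y := fun s => (Pser s + Ci / RtoC PI * (Ecut 1 a s - Ecut (-1) a s))%C).
  set (y1 := fun s => (Pser1 s + Ci / RtoC PI
     * (E1fun 1 a (hth s) - - E1fun (-1) a (jj (-1) * RtoC s)))%C).
  assert (L : forall t, 0 < t < PI / 2 -> cderiv hth t (jj 1) /\ Csinh (hth t) <> 0%C /\
     leg a hth (jj 1) y y1 t /\ leg a hth (jj 1) Pser Pser1 t).
  { intros t T; destruct (hth_data t T) as [D S]; split; [exact D|split; [exact S|split]].
    - apply leg_plus; [apply Pser_leg, T|].
      apply leg_scal, leg_minus; [apply Ecut_leg_pos; assumption|apply Ecut_leg_neg; assumption].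
    - apply Pser_leg, T. }
  assert (Y0 : tends (at_right 0) y 0%C).
  { assert (T := tends_plus _ _ _ _ _ HF' Pser_tends
      (tends_scal _ (Ci / RtoC PI)%C _ _ HF' (Ecut_diff_tends a Ha))).
    replace (1 + Ci / RtoC PI * (Ci * RtoC PI))%C with (RtoC 0) in T; [exact T|].
    transitivity (1 + Ci * Ci)%C; [rewrite J; ring|field; exact Np]. }
  assert (V0 := Pser_tends).
  assert (V1 := tends_mult _ _ _ _ _ HF' sin_tends Pser1_tends); rewrite Cmult_0_l in V1.
  assert (Y1 : tends (at_right 0) (fun t => RtoC (sin t) * y1 t)%C 0%C).
  { assert (T := tends_plus _ _ _ _ _ HF' V1
      (tends_scal _ (Ci / RtoC PI)%C _ _ HF' (tends_plus _ _ _ _ _ HF'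
        (E1_tends 1 a ltac:(ring) Ha) (E1_tends (-1) a ltac:(ring) Ha)))).
    rewrite J1, Jm in T.
    replace (0 + Ci / RtoC PI * (Ci + - Ci))%C with (RtoC 0) in T by ring.
    apply (tends_ext _ _ _ _ HF') with (2 := T); apply filter_forall; intros t.
    unfold y1, hth; rewrite J1, Jm; ring. }
  assert (R : at_right 0 (fun t => 0 < t < PI / 2)).
  { generalize at_right_quarter; apply filter_imp; intros t [T _]; exact T. }
  assert (W : forall t, 0 < t < PI / 2 -> (y t * Pser1 t - y1 t * Pser t = 0)%C).
  { intros t T; destruct (L t T) as [_ [S _]].
    apply (Cmult_eq_reg_l' (Csinh (hth t))); [exact S|]; rewrite Cmult_0_r.
    assert (TT := tends_scal _ Ci _ _ HF' (tends_minus _ _ _ _ _ HF'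
       (tends_mult _ _ _ _ _ HF' Y0 V1) (tends_mult _ _ _ _ _ HF' Y1 V0))).
    replace (Ci * (0 * 0 - 0 * 1))%C with (RtoC 0) in TT by ring.
    refine (tends_unique (at_right 0) _ _ _ HF (tends_ext _ _ _ _ HF' _
      (tends_const _ (Csinh (hth t) * (y t * Pser1 t - y1 t * Pser t)) HF')) TT).
    generalize R; apply filter_imp; intros s Hs.
    rewrite <- (leg_wronskian a hth (jj 1) y y1 Pser Pser1 0 (PI / 2) L s t Hs T).
    unfold hth at 1; rewrite Csinh_jj by ring; rewrite J1; ring. }
  assert (N : exists t, 0 < t < PI / 2 /\ Pser t <> 0%C).
  { destruct (filter_ex _ (filter_and _ _ R (V0 1 Rlt_0_1))) as [t [T H]].
    exists t; split; [exact T|]; intros K; rewrite K in H.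
    replace (0 - 1)%C with (- (1))%C in H by ring; rewrite Cmod_opp, Cmod_1 in H; lra. }
  destruct N as [t0 [T0 N0]].
  assert (Pr := leg_proportional a hth (jj 1) y y1 Pser Pser1 0 (PI / 2) t0 L T0 N0 (W t0 T0)).
  set (k := (y t0 / Pser t0)%C) in *.
  assert (K : k = 0%C).
  { assert (TT := tends_scal _ k _ _ HF' V0); rewrite Cmult_1_r in TT.
    apply (tends_unique (at_right 0) _ _ _ HF TT).
    apply (tends_ext _ _ _ _ HF') with (2 := Y0).
    generalize R; apply filter_imp; intros s Hs; apply Pr, Hs. }
  intros T; specialize (Pr th T); rewrite K, Cmult_0_l in Pr; unfold y in Pr.
  set (X := (Ci / RtoC PI * (Ecut 1 a th - Ecut (-1) a th))%C) in *.
  transitivity (Pser th + X - X)%C; [ring|rewrite Pr; unfold X; ring].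
Qed.

End FirstKind.

Lemma legendreP_Pser nu P th : is_legendreP nu P -> 0 < th < PI / 2 ->
  P (RtoC (cos th)) = Pser nu th.
Proof.
  intros [_ H] T; rewrite H.
  - rewrite hyp2F1_CPS; unfold Pser; f_equal.
    rewrite RtoC_div, RtoC_minus by lra; reflexivity.
  - rewrite <- RtoC_minus, Cmod_R.
    assert (C0 : 0 < cos th) by (apply cos_gt_0; lra).
    pose proof (COS_bound th); rewrite Rabs_pos_eq; lra.
Qed.

Lemma psi_Ecut nu P Q th : -1 < Re nu -> is_legendreP nu P -> is_legendreQ nu Q -> 0 < th < PI / 2 ->
  psi_nu P Q th = (- RtoC (2 / PI) * Ci * Ecut 1 (nu + 1) th)%C.
Proof.
  intros Hnu HP HQ T; unfold psi_nu.
  rewrite (legendreP_Pser nu P th HP T), Pser_Ecut, (legendreQ_cut_eq nu Q th) by assumption.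
  assert (Np : RtoC PI <> 0%C) by (apply Re_pos_neq0; exact PI_RGT_0).
  rewrite RtoC_div by (pose proof PI_RGT_0; lra).
  field; exact Np.
Qed.

(** * The logarithmic derivative *)

Lemma jj_1 : jj 1 = Ci.
Proof. reflexivity. Qed.

Lemma kernel_base_cth th x : kernel_base th x = (1 + cth 1 th * RtoC x)%C.
Proof. rewrite cth_eq by ring; rewrite jj_1; reflexivity. Qed.

Lemma kern_Csqrt x : 0 < x ->
  (1 / Csqrt (RtoC x * RtoC x - 2 * Ci * RtoC x))%C = kern (- jj 1) x.
Proof.
  intros X; destruct (jj_om 1 ltac:(ring)) as [O _].
  assert (B : 0 < Re (RtoC x * RtoC x + 2 * - jj 1 * RtoC x)) by (apply kern_base; assumption).
  rewrite jj_1 in *.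
  replace (RtoC x * RtoC x - 2 * Ci * RtoC x)%C with (RtoC x * RtoC x + 2 * - Ci * RtoC x)%C by ring.
  unfold kern; rewrite Csqrt_Cpower by exact B.
  rewrite RtoC_opp, Cpower_opp, <- half_RtoC.
  unfold Cdiv; ring.
Qed.

Section Integrands.
Context (nu : C) (th : R) (Hnu : -1 < Re nu) (T : 0 < th < PI / 2).

Lemma cth_fam_CI m b : INR m < Re b ->
  CI (fam (- jj 1) m b (cth 1 th)) (Mint 1 m b (cth 1 th)).
Proof.
  intros B; destruct (jj_om 1 ltac:(ring)) as [O O1]; destruct (cth_data 1 th ltac:(ring) T) as [C _].
  apply fam_CI; try assumption; [lra|apply Re_pos_neq0, C].
Qed.

Lemma fam_quotient m b x : 0 < x ->
  fam (- jj 1) m b (cth 1 th) x =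
  (RtoC (x ^ m) / (Csqrt (RtoC x * RtoC x - 2 * Ci * RtoC x) * Cpower (kernel_base th x) b))%C.
Proof.
  intros X; destruct (cth_data 1 th ltac:(ring) T) as [C _].
  unfold fam; rewrite <- kern_Csqrt, <- kernel_base_cth, Cpower_opp by exact X.
  assert (N1 : Csqrt (RtoC x * RtoC x - 2 * Ci * RtoC x) <> 0%C).
  { rewrite Csqrt_Cpower; [apply Cpower_neq0|autorewrite with reim; simpl; nra]. }
  assert (N2 := Cpower_neq0 (kernel_base th x) b).
  field; split; assumption.
Qed.

Lemma sigma_CI : CI (sigma_integrand nu th) (Mint 1 0 (nu + 1) (cth 1 th)).
Proof.
  apply (CI_ext (fam (- jj 1) 0 (nu + 1) (cth 1 th))).
  - intros x X; rewrite fam_quotient by exact X; reflexivity.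
  - apply cth_fam_CI; autorewrite with reim; simpl; lra.
Qed.

Lemma tau_CI : CI (tau_integrand nu th) (Mint 1 1 (nu + 1 + 1) (cth 1 th)).
Proof.
  apply (CI_ext (fam (- jj 1) 1 (nu + 1 + 1) (cth 1 th))).
  - intros x X; rewrite fam_quotient by exact X; unfold tau_integrand; rewrite pow_1.
    do 3 f_equal; apply C_eq; autorewrite with reim; ring.
  - apply cth_fam_CI; autorewrite with reim; simpl; lra.
Qed.

Lemma sigma_nu_eq : sigma_nu nu th = Mint 1 0 (nu + 1) (cth 1 th).
Proof. exact (proj2 (CI_correct _ _ sigma_CI)). Qed.

Lemma tau_nu_eq : tau_nu nu th = Mint 1 1 (nu + 1 + 1) (cth 1 th).
Proof. exact (proj2 (CI_correct _ _ tau_CI)). Qed.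

Lemma Ecut_sigma : Ecut 1 (nu + 1) th = (Cexp (Ci * (nu + 1) * RtoC th) * sigma_nu nu th)%C.
Proof.
  rewrite sigma_nu_eq; unfold Ecut, Efun; f_equal; rewrite jj_1; f_equal; ring.
Qed.

End Integrands.

Lemma interval_loc (l r : R) (p : R -> Prop) x : l < x < r -> (forall y, l < y < r -> p y) -> locally x p.
Proof.
  intros X H; apply (filter_imp (fun s => l < s < r)); [exact H|].
  generalize (locally_interval (fun s : R => l < s < r) x l r); simpl; intros K; apply K; tauto.
Qed.

Lemma sigma_cderiv nu th : -1 < Re nu -> 0 < th < PI / 2 ->
  cderiv (sigma_nu nu) th (- (nu + 1) * Cexp (2 * Ci * RtoC th) * tau_nu nu th)%C.
Proof.
  intros Hnu T.
  apply (cderiv_ext_loc (fun s => Mint 1 0 (nu + 1) (cc 1 (hth s)))).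
  - apply (interval_loc 0 (PI / 2)); [exact T|]; intros s S; symmetry; apply sigma_nu_eq; assumption.
  - eapply cderiv_eq.
    + apply (Mint_cderiv 1 0 (nu + 1) hth (jj 1)); [ring|autorewrite with reim; simpl; lra| |apply hth_data, T].
      apply strip_th; [ring|exact T].
    + rewrite tau_nu_eq by assumption; unfold cth, hth; rewrite jj_1.
      replace (2 * (Ci * RtoC th))%C with (2 * Ci * RtoC th)%C by ring.
      assert (J : (Ci * Ci = - (1))%C) by (apply C_eq; simpl; ring).
      transitivity ((Ci * Ci) * ((nu + 1) * Cexp (2 * Ci * RtoC th) *
        Mint 1 1 (nu + 1 + 1) (cc 1 (Ci * RtoC th))))%C; [ring|rewrite J; ring].
Qed.

Section LogDerivative.
Context (nu : C) (P Q : C -> C) (Hnu : -1 < Re nu) (HP : is_legendreP nu P) (HQ : is_legendreQ nu Q).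

Lemma psi_sigma th : 0 < th < PI / 2 -> psi_nu P Q th
  = (- RtoC (2 / PI) * Ci * Cexp (Ci * (nu + 1) * RtoC th) * sigma_nu nu th)%C.
Proof.
  intros T; rewrite (psi_Ecut nu), Ecut_sigma by assumption; ring.
Qed.

Lemma psi_cderiv th : 0 < th < PI / 2 -> cderiv (psi_nu P Q) th
  (- RtoC (2 / PI) * Ci * Cexp (Ci * (nu + 1) * RtoC th) *
    (Ci * (nu + 1) * sigma_nu nu th - (nu + 1) * Cexp (2 * Ci * RtoC th) * tau_nu nu th))%C.
Proof.
  intros T.
  apply (cderiv_ext_loc (fun s => - RtoC (2 / PI) * Ci *
    (Cexp (Ci * (nu + 1) * RtoC s) * sigma_nu nu s))%C).
  - apply (interval_loc 0 (PI / 2)); [exact T|]; intros s S; rewrite psi_sigma by exact S; ring.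
  - eapply cderiv_eq.
    + apply cderiv_scal, cderiv_mult; [apply cderiv_Cexp, cderiv_scal, cderiv_id|].
      apply sigma_cderiv; assumption.
    + cbn beta; ring.
Qed.

Lemma psi_log_derivative th : 0 < th < PI / 2 -> psi_nu P Q th <> RtoC 0 ->
  (CDerive (psi_nu P Q) th / psi_nu P Q th
   = Ci * (nu + 1) - (nu + 1) * Cexp (2 * Ci * RtoC th) * tau_nu nu th * / sigma_nu nu th)%C.
Proof.
  intros T N; rewrite (CDerive_eq _ _ _ (psi_cderiv th T)).
  rewrite psi_sigma in N |- * by exact T.
  assert (N1 : (- RtoC (2 / PI) * Ci)%C <> 0%C)
    by (intros K; apply N; rewrite K; ring).
  assert (N2 : sigma_nu nu th <> 0%C) by (intros K; apply N; rewrite K; ring).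
  assert (N3 := Cexp_neq0 (Ci * (nu + 1) * RtoC th)).
  set (k := (- RtoC (2 / PI) * Ci)%C) in *.
  field; repeat split; assumption.
Qed.

Lemma sigma_log_derivative th : 0 < th < PI / 2 ->
  (CDerive (sigma_nu nu) th / sigma_nu nu th
   = - ((nu + 1) * Cexp (2 * Ci * RtoC th) * tau_nu nu th * / sigma_nu nu th))%C.
Proof.
  intros T; rewrite (CDerive_eq _ _ _ (sigma_cderiv nu th Hnu T)); unfold Cdiv; ring.
Qed.

End LogDerivative.

(** * Smooth functions on an interval *)

Lemma is_derive_eqR (f : R -> R) (x m m' : R) : is_derive f x m -> m = m' -> is_derive f x m'.
Proof. intros H <-; exact H. Qed.

Section Smooth.
Context (l r : R).

(** Existence of [k] derivatives through explicit witnesses, which makes the closure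
    under products and inverses immediate; [Ck_ex_derive_n] passes to iterated [Derive]. *)
Fixpoint Ck (k : nat) (f : R -> R) : Prop :=
  match k with
  | O => True
  | S j => exists g, (forall x, l < x < r -> is_derive f x (g x)) /\ Ck j g
  end.

Lemma Ck_ex_derive_n k f x : l < x < r -> Ck k f -> ex_derive_n f k x.
Proof.
  revert f x; induction k as [|k IH]; intros f x X H; [exact I|].
  destruct H as [g [D G]]; destruct k as [|k].
  - exists (g x); apply D, X.
  - assert (K : forall y, l < y < r -> Derive_n f (S k) y = Derive_n g k y).
    { intros y Y; replace (S k) with (k + 1)%nat by lia; rewrite <- Derive_n_comp.
      apply Derive_n_ext_loc, (interval_loc l r); [exact Y|].
      intros z Z; apply is_derive_unique, D, Z. }
    specialize (IH g x X G).
    apply (ex_derive_ext_loc (Derive_n g k)); [|exact IH].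
    apply (interval_loc l r); [exact X|]; intros y Y; symmetry; apply K, Y.
Qed.

Lemma Ck_ext k f g : (forall x, l < x < r -> f x = g x) -> Ck k f -> Ck k g.
Proof.
  destruct k as [|k]; intros E H; [exact I|]; destruct H as [f1 [D H]].
  exists f1; split; [|exact H]; intros x X.
  apply (is_derive_ext_loc f); [apply (interval_loc l r); assumption|apply D, X].
Qed.

Lemma Ck_pred k f : Ck (S k) f -> Ck k f.
Proof.
  revert f; induction k as [|k IH]; intros f H; [exact I|].
  destruct H as [g [D H]]; exists g; split; [exact D|apply IH, H].
Qed.

Lemma Ck_const k c : Ck k (fun _ => c).
Proof.
  revert c; induction k as [|k IH]; intros c; [exact I|].
  exists (fun _ => 0); split; [intros x _; apply is_derive_cst|apply IH].
Qed.

Lemma Ck_plus k f g : Ck k f -> Ck k g -> Ck k (fun x => f x + g x).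
Proof.
  revert f g; induction k as [|k IH]; intros f g A B; [exact I|].
  destruct A as [f1 [D A]]; destruct B as [g1 [E B]].
  exists (fun x => f1 x + g1 x); split; [|apply IH; assumption].
  intros x X; apply (is_derive_plus f g); auto.
Qed.

Lemma Ck_mult k f g : Ck k f -> Ck k g -> Ck k (fun x => f x * g x).
Proof.
  revert f g; induction k as [|k IH]; intros f g A B; [exact I|].
  assert (A0 := Ck_pred _ _ A); assert (B0 := Ck_pred _ _ B).
  destruct A as [f1 [D A]]; destruct B as [g1 [E B]].
  exists (fun x => f1 x * g x + f x * g1 x); split; [|apply Ck_plus; apply IH; assumption].
  intros x X; apply is_derive_mult'; auto.
Qed.

Lemma Ck_inv k f : (forall x, l < x < r -> f x <> 0) -> Ck k f -> Ck k (fun x => / f x).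
Proof.
  intros N; induction k as [|k IH]; intros A; [exact I|].
  assert (A0 := Ck_pred _ _ A); destruct A as [f1 [D A]].
  exists (fun x => -1 * (f1 x * (/ f x * / f x))); split.
  - intros x X; replace (-1 * (f1 x * (/ f x * / f x))) with (- f1 x / f x ^ 2) by (field; auto).
    apply is_derive_inv; auto.
  - apply Ck_mult; [apply Ck_const|]; apply Ck_mult; [exact A|]; apply Ck_mult; apply IH, A0.
Qed.

Lemma Ck_sin_cos k : Ck k sin /\ Ck k cos.
Proof.
  induction k as [|k [S C]]; [split; exact I|]; split.
  - exists cos; split; [intros x _; apply is_derive_sin|exact C].
  - exists (fun x => -1 * sin x); split; [|apply Ck_mult; [apply Ck_const|exact S]].
    intros x _; replace (-1 * sin x) with (- sin x) by ring; apply is_derive_cos.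
Qed.

(** The equation expresses the second derivative by the two preceding ones, so that
    smoothness increases step by step. *)
Lemma Ck_ode k p q u u1 : Ck k p -> Ck k q ->
  (forall x, l < x < r -> is_derive u x (u1 x) /\ is_derive u1 x (p x * u1 x + q x * u x)) ->
  Ck k u /\ Ck k u1.
Proof.
  intros A B H; induction k as [|k IH]; [split; exact I|].
  destruct (IH (Ck_pred _ _ A) (Ck_pred _ _ B)) as [C D]; split.
  - exists u1; split; [intros x X; apply (H x X)|exact D].
  - exists (fun x => p x * u1 x + q x * u x); split; [intros x X; apply (H x X)|].
    apply Ck_plus; apply Ck_mult; try assumption; apply Ck_pred; assumption.
Qed.

(** * Bases of solutions *)

Definition sol (q y y1 : R -> R) : Prop :=
  forall x, l < x < r -> is_derive y x (y1 x) /\ is_derive y1 x (- (q x * y x)).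

Lemma sol_is_solution q y y1 : sol q y y1 -> is_solution q l r y.
Proof.
  intros H x X; destruct (H x X) as [A B].
  assert (D : locally x (fun s => y1 s = Derive y s)).
  { apply (interval_loc l r); [exact X|]; intros s S; symmetry; apply is_derive_unique, H, S. }
  assert (B' : is_derive (Derive y) x (- (q x * y x)))
    by (apply (is_derive_ext_loc y1); assumption).
  split; [exists (y1 x); exact A|split; [exists (- (q x * y x)); exact B'|]].
  rewrite (is_derive_unique _ _ _ B'); ring.
Qed.

Lemma is_solution_sol q y : is_solution q l r y -> sol q y (Derive y).
Proof.
  intros H x X; destruct (H x X) as [A [B C]]; split; [apply Derive_correct, A|].
  replace (- (q x * y x)) with (Derive (Derive y) x) by lra; apply Derive_correct, B.
Qed.

Lemma sol_lin q y y1 z z1 a b : sol q y y1 -> sol q z z1 ->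
  sol q (fun x => a * y x + b * z x) (fun x => a * y1 x + b * z1 x).
Proof.
  intros H K x X; destruct (H x X) as [A B]; destruct (K x X) as [C D]; split.
  - apply (is_derive_plus (fun s => a * y s) (fun s => b * z s));
      [apply (is_derive_scal y x a), A|apply (is_derive_scal z x b), C].
  - replace (- (q x * (a * y x + b * z x))) with (a * (- (q x * y x)) + b * (- (q x * z x))) by ring.
    apply (is_derive_plus (fun s => a * y1 s) (fun s => b * z1 s));
      [apply (is_derive_scal y1 x a), B|apply (is_derive_scal z1 x b), D].
Qed.

Lemma derive_0_const f : (forall x, l < x < r -> is_derive f x 0) ->
  forall s t, l < s < r -> l < t < r -> f s = f t.
Proof.
  intros H s t S T; apply (f_equal Re (x := RtoC (f s)) (y := RtoC (f t))).
  apply (cderiv_0_const (fun x => RtoC (f x)) l r); [|exact S|exact T].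
  intros x X; apply cderiv_RtoC, H, X.
Qed.

Lemma sol_wronskian q y y1 z z1 : sol q y y1 -> sol q z z1 ->
  forall s t, l < s < r -> l < t < r -> y s * z1 s - y1 s * z s = y t * z1 t - y1 t * z t.
Proof.
  intros H K; apply (derive_0_const (fun x => y x * z1 x - y1 x * z x)).
  intros x X; destruct (H x X) as [A B]; destruct (K x X) as [C D].
  replace 0 with ((y1 x * z1 x + y x * (- (q x * z x))) - (- (q x * y x) * z x + y1 x * z1 x)) by ring.
  apply (is_derive_minus (fun s => y s * z1 s) (fun s => y1 s * z s)); apply is_derive_mult'; assumption.
Qed.

(** Both independence and generation come from the constancy of Wronskians. *)
Lemma basis_of_wronskian q f f1 g g1 : l < r -> sol q f f1 -> sol q g g1 ->
  (forall x, l < x < r -> f x * g1 x - f1 x * g x = 1) -> is_solution_basis q l r f g.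
Proof.
  intros LR F G W; set (m := (l + r) / 2).
  assert (M : l < m < r) by (unfold m; lra).
  split; [exact (sol_is_solution _ _ _ F)|split; [exact (sol_is_solution _ _ _ G)|split]].
  - intros c d H.
    assert (H1 : c * f1 m + d * g1 m = 0).
    { destruct (sol_lin q f f1 g g1 c d F G m M) as [A _].
      rewrite <- (is_derive_unique _ _ _ A).
      apply is_derive_unique, (is_derive_ext_loc (fun _ => 0)); [|apply is_derive_cst].
      apply (interval_loc l r); [exact M|]; intros y Y; symmetry; apply H, Y. }
    specialize (H m M); specialize (W m M).
    split.
    + replace c with (c * (f m * g1 m - f1 m * g m)) by (rewrite W; ring).
      replace (c * (f m * g1 m - f1 m * g m)) with
        ((c * f m + d * g m) * g1 m - (c * f1 m + d * g1 m) * g m) by ring.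
      rewrite H, H1; ring.
    + replace d with (d * (f m * g1 m - f1 m * g m)) by (rewrite W; ring).
      replace (d * (f m * g1 m - f1 m * g m)) with
        ((c * f1 m + d * g1 m) * f m - (c * f m + d * g m) * f1 m) by ring.
      rewrite H, H1; ring.
  - intros y Y; apply is_solution_sol in Y; set (y1 := Derive y) in *.
    exists (y m * g1 m - y1 m * g m), (f m * y1 m - f1 m * y m); intros x X.
    rewrite (sol_wronskian q y y1 g g1 Y G m x M X), (sol_wronskian q f f1 y y1 F Y m x M X).
    transitivity (y x * (f x * g1 x - f1 x * g x)); [rewrite (W x X)|]; ring.
Qed.

Lemma is_solution_basis_ext q f g f' g' :
  (forall x, l < x < r -> f x = f' x /\ g x = g' x) ->
  is_solution_basis q l r f g -> is_solution_basis q l r f' g'.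
Proof.
  intros E [F [G [I S]]].
  assert (K : forall y y', (forall x, l < x < r -> y x = y' x) -> is_solution q l r y ->
    is_solution q l r y').
  { intros y y' Ey H; apply is_solution_sol in H; apply (sol_is_solution q y' (Derive y)).
    intros x X; destruct (H x X) as [A B]; split.
    - apply (is_derive_ext_loc y); [apply (interval_loc l r); assumption|exact A].
    - rewrite <- Ey by exact X; exact B. }
  split; [apply (K f); [intros x X; apply E, X|exact F]|].
  split; [apply (K g); [intros x X; apply E, X|exact G]|split].
  - intros c d H; apply I; intros x X; destruct (E x X) as [-> ->]; apply H, X.
  - intros y Y; destruct (S y Y) as [c [d H]]; exists c, d; intros x X.
    destruct (E x X) as [<- <-]; apply H, X.
Qed.

End Smooth.

(** * Phase functions of the equation of Legendre *)

(** Here [u] and [v] solve Legendre's equation with Wronskian [c / sin], and [A] is the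
    derivative of the argument of [u + i v]. *)
Section Phase.
Context (n c : R) (u u1 v v1 : R -> R).

Let cot (x : R) : R := cos x / sin x.
Let q (x : R) : R := n * (n + 1) - 1 / 4 * (cot x) ^ 2 - 1 / 2 * Derive cot x.

Context (c_pos : 0 < c)
  (Hu : forall x, 0 < x < PI / 2 -> is_derive u x (u1 x) /\
     is_derive u1 x (- cot x * u1 x + - (n * (n + 1)) * u x))
  (Hv : forall x, 0 < x < PI / 2 -> is_derive v x (v1 x) /\
     is_derive v1 x (- cot x * v1 x + - (n * (n + 1)) * v x))
  (HW : forall x, 0 < x < PI / 2 -> sin x * (u x * v1 x - u1 x * v x) = c).

Let D (x : R) : R := u x * u x + v x * v x.
Let A (x : R) : R := c * / (sin x * D x).

Lemma sin_pos x : 0 < x < PI / 2 -> 0 < sin x.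
Proof. intros X; apply sin_gt_0; lra. Qed.

Lemma D_pos x : 0 < x < PI / 2 -> 0 < D x.
Proof.
  intros X; specialize (HW x X); unfold D.
  assert (u x <> 0 \/ v x <> 0).
  { destruct (Req_dec (u x) 0) as [K|K]; [right|left; exact K].
    intros K'; rewrite K, K' in HW; lra. }
  nra.
Qed.

Lemma A_pos x : 0 < x < PI / 2 -> 0 < A x.
Proof.
  intros X; unfold A; apply Rmult_lt_0_compat; [exact c_pos|].
  apply Rinv_0_lt_compat, Rmult_lt_0_compat; [apply sin_pos, X|apply D_pos, X].
Qed.

Lemma A_wronskian x : 0 < x < PI / 2 -> A x = (u x * v1 x - u1 x * v x) / D x.
Proof.
  intros X; pose proof (sin_pos x X); pose proof (D_pos x X).
  unfold A; rewrite <- (HW x X); field; lra.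
Qed.

Lemma cot_derive x : 0 < x < PI / 2 -> is_derive cot x (- / (sin x * sin x)).
Proof.
  intros X; pose proof (sin_pos x X); unfold cot; auto_derive; [lra|].
  pose proof (sin2_cos2 x) as Q; unfold Rsqr in Q.
  field_simplify; [|lra|lra].
  replace (- sin x ^ 2 - cos x ^ 2) with (-1) by lra; field; lra.
Qed.

Lemma q_eq x : 0 < x < PI / 2 ->
  q x = n * (n + 1) - 1 / 4 * (cot x) ^ 2 + 1 / 2 * / (sin x * sin x).
Proof. intros X; unfold q; rewrite (is_derive_unique _ _ _ (cot_derive x X)); ring. Qed.

(** The coefficient is [(n + 1/2)^2 + 1 / (4 sin^2)]. *)
Lemma q_pos x : 0 < x < PI / 2 -> 0 < q x.
Proof.
  intros X; pose proof (sin_pos x X); rewrite q_eq by exact X.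
  pose proof (sin2_cos2 x) as Q; unfold Rsqr in Q.
  replace (n * (n + 1) - 1 / 4 * cot x ^ 2 + 1 / 2 * / (sin x * sin x)) with
    ((n + / 2) * (n + / 2) + / 4 * / (sin x * sin x)).
  - assert (0 < / (sin x * sin x)) by (apply Rinv_0_lt_compat, Rmult_lt_0_compat; assumption).
    pose proof (Rle_0_sqr (n + / 2)) as S; unfold Rsqr in S; lra.
  - unfold cot; replace ((cos x / sin x) ^ 2) with ((1 - sin x * sin x) / (sin x * sin x)).
    + field; lra.
    + replace (1 - sin x * sin x) with (cos x * cos x) by lra; field; lra.
Qed.

Lemma inv_sin_Ck k : Ck 0 (PI / 2) k (fun x => / sin x).
Proof.
  apply Ck_inv; [intros x X; pose proof (sin_pos x X); lra|apply Ck_sin_cos].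
Qed.

Lemma cot_Ck k : Ck 0 (PI / 2) k cot.
Proof. apply Ck_mult; [apply Ck_sin_cos|apply inv_sin_Ck]. Qed.

Lemma q_Ck k : Ck 0 (PI / 2) k q.
Proof.
  apply (Ck_ext _ _ k (fun x => n * (n + 1) + ((- (1 / 4)) * (cot x * cot x) + 1 / 2 * (/ sin x * / sin x)))).
  - intros x X; pose proof (sin_pos x X); rewrite q_eq, Rinv_mult by exact X; ring.
  - apply Ck_plus; [apply Ck_const|]; apply Ck_plus; (apply Ck_mult; [apply Ck_const|]);
      apply Ck_mult; first [apply cot_Ck|apply inv_sin_Ck].
Qed.

Lemma A_Ck k : Ck 0 (PI / 2) k A.
Proof.
  assert (P : Ck 0 (PI / 2) k (fun x => - cot x)).
  { apply (Ck_ext _ _ k (fun x => -1 * cot x)); [intros x _; ring|].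
    apply Ck_mult; [apply Ck_const|apply cot_Ck]. }
  destruct (Ck_ode _ _ k _ _ u u1 P (Ck_const _ _ k _) Hu) as [U _].
  destruct (Ck_ode _ _ k _ _ v v1 P (Ck_const _ _ k _) Hv) as [V _].
  apply Ck_mult; [apply Ck_const|]; apply Ck_inv.
  - intros x X; pose proof (sin_pos x X); pose proof (D_pos x X).
    apply Rmult_integral_contrapositive_currified; lra.
  - apply Ck_mult; [apply Ck_sin_cos|apply Ck_plus; apply Ck_mult; assumption].
Qed.

Definition phase (x : R) : R := RInt A (PI / 4) x.

Lemma A_cont x : 0 < x < PI / 2 -> continuous A x.
Proof.
  intros X; destruct (A_Ck 1) as [g [H _]].
  apply (ex_derive_continuous A); exists (g x); apply H, X.
Qed.

Lemma phase_derive x : 0 < x < PI / 2 -> is_derive phase x (A x).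
Proof.
  intros X; apply (is_derive_RInt A phase (PI / 4)); [|apply A_cont, X].
  apply (interval_loc 0 (PI / 2)); [exact X|]; intros y Y.
  apply (RInt_correct A), (ex_RInt_continuous A); intros z Z; apply A_cont.
  assert (P := PI_RGT_0).
  destruct (Rle_dec (PI / 4) y); [rewrite Rmin_left, Rmax_right in Z by lra|
    rewrite Rmin_right, Rmax_left in Z by lra]; lra.
Qed.

Lemma phase_Ck k : Ck 0 (PI / 2) k phase.
Proof. apply (Ck_pred), (ex_intro _ A); split; [exact phase_derive|apply A_Ck]. Qed.

Let g (x : R) : R := sqrt (sin x / c).

Lemma g_sqr x : 0 < x < PI / 2 -> g x * g x = sin x / c /\ 0 < g x.
Proof.
  intros X; pose proof (sin_pos x X).
  assert (0 < sin x / c) by (apply Rdiv_lt_0_compat; assumption).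
  split; [apply sqrt_sqrt; lra|apply sqrt_lt_R0; assumption].
Qed.

Lemma g_derive x : 0 < x < PI / 2 -> is_derive g x (g x * (cot x / 2)).
Proof.
  intros X; destruct (g_sqr x X) as [G G0]; pose proof (sin_pos x X).
  unfold g; auto_derive.
  - apply Rdiv_lt_0_compat; assumption.
  - change (sqrt (sin x * / c)) with (g x); change (sqrt (sin x / c)) with (g x).
    assert (S : sin x = c * (g x * g x)) by (rewrite G; field; lra).
    unfold cot; rewrite S; field; lra.
Qed.

(** Liouville's substitution: the factor [sqrt (sin)] removes the term of first order,
    and the division by [c] normalizes the Wronskian. *)
Lemma liouville_sol (y y1 : R -> R) :
  (forall x, 0 < x < PI / 2 -> is_derive y x (y1 x) /\
     is_derive y1 x (- cot x * y1 x + - (n * (n + 1)) * y x)) ->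
  sol 0 (PI / 2) q (fun x => g x * y x) (fun x => g x * (y1 x + cot x / 2 * y x)).
Proof.
  intros H x X; destruct (H x X) as [B C]; assert (G := g_derive x X); split.
  - replace (g x * (y1 x + cot x / 2 * y x)) with (g x * (cot x / 2) * y x + g x * y1 x) by ring.
    apply is_derive_mult'; assumption.
  - assert (K : is_derive (fun s => cot s / 2) x (/ 2 * - / (sin x * sin x))).
    { apply (is_derive_ext (fun s => / 2 * cot s)); [intros s; unfold Rdiv; simpl; ring|].
      apply (is_derive_scal cot x (/ 2)), cot_derive, X. }
    replace (- (q x * (g x * y x))) with
      (g x * (cot x / 2) * (y1 x + cot x / 2 * y x)
       + g x * ((- cot x * y1 x + - (n * (n + 1)) * y x)
           + (/ 2 * - / (sin x * sin x) * y x + cot x / 2 * y1 x)))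
      by (rewrite q_eq by exact X; field; pose proof (sin_pos x X); lra).
    apply (is_derive_mult' g (fun s => y1 s + cot s / 2 * y s)); [exact G|].
    apply (is_derive_plus y1 (fun s => cot s / 2 * y s)); [exact C|].
    apply (is_derive_mult' (fun s => cot s / 2) y); assumption.
Qed.

(** The argument of [u + i v] differs from the phase by a constant. *)
Lemma phase_rotation : exists a b, a * a + b * b = 1 /\
  forall x, 0 < x < PI / 2 ->
    sqrt (D x) * cos (phase x) = a * u x + b * v x /\
    sqrt (D x) * sin (phase x) = a * v x - b * u x.
Proof.
  set (f1 := fun x => (u x * cos (phase x) + v x * sin (phase x)) * / sqrt (D x)).
  set (f2 := fun x => (v x * cos (phase x) + - u x * sin (phase x)) * / sqrt (D x)).
  assert (B : forall x, 0 < x < PI / 2 -> is_derive f1 x 0 /\ is_derive f2 x 0).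
  { intros x X; destruct (Hu x X) as [U _]; destruct (Hv x X) as [V _].
    assert (P := phase_derive x X); rewrite A_wronskian in P by exact X.
    pose proof (D_pos x X) as D0.
    assert (R0 := sqrt_lt_R0 _ D0); assert (RR := sqrt_sqrt _ (Rlt_le _ _ D0)).
    assert (S : is_derive (fun s => / sqrt (D s)) x
      (- (u x * u1 x + v x * v1 x) / (D x * sqrt (D x)))).
    { assert (DD : is_derive D x (2 * (u x * u1 x + v x * v1 x))).
      { replace (2 * (u x * u1 x + v x * v1 x)) with
          ((u1 x * u x + u x * u1 x) + (v1 x * v x + v x * v1 x)) by ring.
        apply (is_derive_plus (fun s => u s * u s) (fun s => v s * v s)); apply is_derive_mult'; assumption. }
      assert (SD : is_derive sqrt (D x) (/ (2 * sqrt (D x)))) by (auto_derive; [exact D0|field; lra]).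
      assert (T := is_derive_comp sqrt D x _ _ SD DD).
      assert (T' := is_derive_inv (fun s => sqrt (D s)) x _ T ltac:(lra)).
      eapply is_derive_eqR; [exact T'|].
      change (scal (2 * (u x * u1 x + v x * v1 x)) (/ (2 * sqrt (D x)))) with
        (2 * (u x * u1 x + v x * v1 x) * / (2 * sqrt (D x))).
      rewrite <- RR at 2; field; lra. }
    assert (Cd : is_derive (fun s => cos (phase s)) x ((u x * v1 x - u1 x * v x) / D x * - sin (phase x)))
      by (apply (is_derive_comp cos phase x); [apply is_derive_cos|exact P]).
    assert (Sd : is_derive (fun s => sin (phase s)) x ((u x * v1 x - u1 x * v x) / D x * cos (phase x)))
      by (apply (is_derive_comp sin phase x); [apply is_derive_sin|exact P]).
    assert (U' : is_derive (fun s => - u s) x (- u1 x)) by (apply (is_derive_opp u), U).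
    assert (M := is_derive_mult').
    split.
    - eapply is_derive_eqR.
      + apply (M (fun s => u s * cos (phase s) + v s * sin (phase s)) (fun s => / sqrt (D s))); [|exact S].
        apply (is_derive_plus (fun s => u s * cos (phase s)) (fun s => v s * sin (phase s)));
          apply M; eassumption.
      + unfold plus; simpl; apply Rmult_eq_reg_r with (D x * sqrt (D x)); [|nra].
        field_simplify; [|lra]; unfold D; ring.
    - eapply is_derive_eqR.
      + apply (M (fun s => v s * cos (phase s) + - u s * sin (phase s)) (fun s => / sqrt (D s))); [|exact S].
        apply (is_derive_plus (fun s => v s * cos (phase s)) (fun s => - u s * sin (phase s)));
          apply M; eassumption.
      + unfold plus; simpl; apply Rmult_eq_reg_r with (D x * sqrt (D x)); [|nra].
        field_simplify; [|lra]; unfold D; ring. }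
  set (m := PI / 4).
  assert (M : 0 < m < PI / 2) by (unfold m; pose proof PI_RGT_0; lra).
  exists (f1 m), (f2 m).
  assert (F : forall x, 0 < x < PI / 2 -> sqrt (D x) * cos (phase x) = f1 x * u x + f2 x * v x /\
    sqrt (D x) * sin (phase x) = f1 x * v x - f2 x * u x).
  { intros x X; pose proof (D_pos x X) as D0.
    assert (R0 := sqrt_lt_R0 _ D0); assert (RR := sqrt_sqrt _ (Rlt_le _ _ D0)).
    unfold f1, f2; split; apply Rmult_eq_reg_r with (sqrt (D x)); try lra.
    - transitivity (D x * cos (phase x)); [rewrite <- RR at 3; ring|unfold D at 1; field; lra].
    - transitivity (D x * sin (phase x)); [rewrite <- RR at 3; ring|unfold D at 1; field; lra]. }
  split.
  - pose proof (D_pos m M) as D0; destruct (F m M) as [F1 F2].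
    assert (R0 := sqrt_lt_R0 _ D0); assert (RR := sqrt_sqrt _ (Rlt_le _ _ D0)).
    assert (Q := sin2_cos2 (phase m)); unfold Rsqr in Q.
    apply Rmult_eq_reg_r with (D m); [|lra].
    transitivity ((f1 m * u m + f2 m * v m) * (f1 m * u m + f2 m * v m)
      + (f1 m * v m - f2 m * u m) * (f1 m * v m - f2 m * u m)); [unfold D; ring|].
    rewrite <- F1, <- F2.
    transitivity (sqrt (D m) * sqrt (D m) * (sin (phase m) * sin (phase m) + cos (phase m) * cos (phase m)));
      [ring|rewrite RR, Q; ring].
  - intros x X.
    rewrite (derive_0_const 0 (PI / 2) f1 (fun y Y => proj1 (B y Y)) m x M X),
      (derive_0_const 0 (PI / 2) f2 (fun y Y => proj2 (B y Y)) m x M X).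
    apply F, X.
Qed.

(** By [phase_rotation] the functions in question are obtained from the Liouville
    transforms of [u] and [v] by a rotation, which preserves the Wronskian one. *)
Lemma phase_function : is_phase_function_ode cot (fun _ => n * (n + 1)) 0 (PI / 2) phase.
Proof.
  assert (P2 : 0 < PI / 2) by (pose proof PI_RGT_0; lra).
  split; [intros k x X; apply (Ck_ex_derive_n 0 (PI / 2)); [exact X|apply cot_Ck]|].
  split; [intros k x X; apply (Ck_ex_derive_n 0 (PI / 2)); [exact X|apply Ck_const]|].
  split; [intros k x X; apply (Ck_ex_derive_n 0 (PI / 2)); [exact X|apply q_Ck]|].
  split; [exact q_pos|].
  split; [intros k x X; apply (Ck_ex_derive_n 0 (PI / 2)); [exact X|apply phase_Ck]|].
  assert (DA : forall x, 0 < x < PI / 2 -> Derive phase x = A x)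
    by (intros x X; apply is_derive_unique, phase_derive, X).
  split; [intros x X; rewrite DA by exact X; pose proof (A_pos x X); lra|].
  destruct phase_rotation as [a [b [AB H]]].
  assert (U := liouville_sol u u1 Hu); assert (V := liouville_sol v v1 Hv).
  apply (is_solution_basis_ext _ _ _ (fun x => a * (g x * u x) + b * (g x * v x))
    (fun x => - b * (g x * u x) + a * (g x * v x))).
  - intros x X; rewrite DA by exact X; destruct (H x X) as [H1 H2].
    pose proof (D_pos x X) as D0; pose proof (sin_pos x X) as S0; destruct (g_sqr x X) as [G G0].
    assert (R0 := sqrt_lt_R0 _ D0).
    assert (K : / sqrt (Rabs (A x)) = g x * sqrt (D x)).
    { rewrite Rabs_pos_eq by (left; apply A_pos, X).
      unfold g; rewrite <- sqrt_mult_alt by (left; apply Rdiv_lt_0_compat; assumption).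
      rewrite <- sqrt_inv; f_equal; unfold A; field; lra. }
    unfold Rdiv; rewrite K; split.
    + transitivity (g x * (a * u x + b * v x)); [ring|rewrite <- H1; ring].
    + transitivity (g x * (a * v x - b * u x)); [ring|rewrite <- H2; ring].
  - eapply basis_of_wronskian; [exact P2|exact (sol_lin _ _ _ _ _ _ _ a b U V)|
      exact (sol_lin _ _ _ _ _ _ _ (- b) a U V)|].
    intros x X; cbn beta; destruct (g_sqr x X) as [G G0].
    transitivity ((a * a + b * b) * (g x * g x) * (u x * v1 x - u1 x * v x)); [ring|].
    rewrite AB, G; transitivity (sin x * (u x * v1 x - u1 x * v x) / c); [field; lra|].
    rewrite (HW x X); field; lra.
Qed.

End Phase.

(** * Real degrees *)

(** Abel's identity, with the constant read off as the angle tends to zero. *)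
Lemma Pser_Ecut_wronskian nu th : -1 < Re nu -> 0 < th < PI / 2 ->
  (RtoC (sin th) * (Pser nu th * E1fun 1 (nu + 1) (hth th) - Pser1 nu th * Ecut 1 (nu + 1) th) = Ci)%C.
Proof.
  intros Hnu T.
  assert (HF : ProperFilter (at_right 0)) by typeclasses eauto.
  assert (HF' : Filter (at_right 0)) by typeclasses eauto.
  assert (Ha : 0 < Re (nu + 1)) by (autorewrite with reim; lra).
  set (a := (nu + 1)%C) in *.
  set (W := fun t => (RtoC (sin t) * (Pser nu t * E1fun 1 a (hth t) - Pser1 nu t * Ecut 1 a t))%C).
  change (W th = Ci).
  assert (Ni : Ci <> 0%C) by (intros K; apply (f_equal Im) in K; simpl in K; lra).
  assert (C : forall s, 0 < s < PI / 2 -> W s = W th).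
  { intros s S; apply (Cmult_eq_reg_l' Ci); [exact Ni|].
    assert (L : forall t, 0 < t < PI / 2 -> cderiv hth t (jj 1) /\ Csinh (hth t) <> 0%C /\
      leg a hth (jj 1) (Pser nu) (Pser1 nu) t /\ leg a hth (jj 1) (Ecut 1 a) (fun s => E1fun 1 a (hth s)) t).
    { intros t Ht; destruct (hth_data t Ht) as [H1 H2]; split; [exact H1|split; [exact H2|split]].
      - apply Pser_leg, Ht.
      - apply Ecut_leg_pos; assumption. }
    assert (K := leg_wronskian a hth (jj 1) _ _ _ _ 0 (PI / 2) L s th S T).
    unfold hth at 1 3 in K; rewrite !Csinh_jj, jj_1 in K by ring.
    unfold W; rewrite !Cmult_assoc; exact K. }
  assert (P0 : tends (at_right 0) (Pser1 nu) 0%C) by apply Pser1_tends.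
  assert (SE : tends (at_right 0) (fun t => RtoC (sin t) * Ecut 1 a t)%C 0%C).
  { assert (TT := tends_mult _ _ _ _ _ HF' (Cexp_jth_tends 1 a) (sigma_small 1 a ltac:(ring) Ha)).
    rewrite Cmult_0_r in TT; apply (tends_ext _ _ _ _ HF') with (2 := TT).
    apply filter_forall; intros t; unfold Ecut, Efun, cth; ring. }
  assert (TT := tends_minus _ _ _ _ _ HF'
    (tends_mult _ _ _ _ _ HF' (Pser_tends nu) (E1_tends 1 a ltac:(ring) Ha))
    (tends_mult _ _ _ _ _ HF' P0 SE)).
  rewrite jj_1 in TT; replace (1 * Ci - 0 * 0)%C with Ci in TT by ring.
  refine (tends_unique (at_right 0) _ _ _ HF (tends_ext _ _ _ _ HF' _ (tends_const _ (W th) HF')) TT).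
  generalize at_right_quarter; apply filter_imp; intros t [Ht _].
  rewrite <- (C t Ht); unfold W, hth; rewrite jj_1; ring.
Qed.

Lemma Im_Cdiv (w z : C) : Re z * Re z + Im z * Im z <> 0 ->
  Im (w / z)%C = (Re z * Im w - Re w * Im z) / (Re z * Re z + Im z * Im z).
Proof. destruct w, z; unfold Cdiv, Cinv; simpl; intros H; field; nra. Qed.

Section RealDegree.
Context (n : R) (P Q : C -> C) (Hn : -1 < Re (RtoC n))
  (HP : is_legendreP (RtoC n) P) (HQ : is_legendreQ (RtoC n) Q).

Let a : C := (RtoC n + 1)%C.
Let k : C := (- RtoC (2 / PI) * Ci)%C.
Let psi1 (th : R) : C := (Ci * (k * E1fun 1 a (hth th)))%C.

Lemma Re_a : 0 < Re a.
Proof. unfold a; autorewrite with reim; simpl in Hn; lra. Qed.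

(** The function of the first kind is the real part of [psi_nu], because the two boundary
    values are conjugate. *)
Lemma Re_psi th : 0 < th < PI / 2 -> Pser (RtoC n) th = RtoC (Re (psi_nu P Q th)).
Proof.
  intros T; rewrite (psi_Ecut (RtoC n)), Pser_Ecut by assumption; fold a.
  assert (K := Ecut_conj 1 a th ltac:(ring) Re_a T).
  replace (Cconj a) with a in K by (unfold a; rewrite <- RtoC_plus, Cconj_RtoC; reflexivity).
  replace (- (1)) with (-1) in K by ring; rewrite K.
  replace (Ci / RtoC PI)%C with (0, / PI)
    by (unfold Cdiv; rewrite <- RtoC_inv by (pose proof PI_RGT_0; lra); apply C_eq; simpl; ring).
  apply C_eq; simpl; unfold Rdiv; ring.
Qed.

Lemma psi_leg th : 0 < th < PI / 2 -> cderiv (psi_nu P Q) th (psi1 th) /\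
  cderiv psi1 th (- RtoC (cos th / sin th) * psi1 th + - RtoC (n * (n + 1)) * psi_nu P Q th)%C.
Proof.
  intros T; destruct (leg_scal a hth (jj 1) _ _ k th (Ecut_leg_pos a th Re_a T)) as [A B].
  assert (S0 : 0 < sin th) by (apply sin_gt_0; lra).
  split.
  - apply (cderiv_ext_loc (fun s => k * Ecut 1 a s)%C).
    + apply (interval_loc 0 (PI / 2)); [exact T|]; intros s S; symmetry; apply (psi_Ecut (RtoC n)); assumption.
    + eapply cderiv_eq; [exact A|]; rewrite jj_1; unfold psi1; ring.
  - eapply cderiv_eq; [unfold psi1; apply cderiv_scal; exact B|].
    rewrite (psi_Ecut (RtoC n)) by assumption; fold a; fold k.
    unfold psi1; rewrite jj_1; unfold Ccoth; unfold hth at 1 2.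
    rewrite Csinh_jj, Ccosh_jj, jj_1 by ring.
    assert (Ns : RtoC (sin th) <> 0%C) by (apply Re_pos_neq0; exact S0).
    assert (Ni : Ci <> 0%C) by (intros K; apply (f_equal Im) in K; simpl in K; lra).
    assert (J : (Ci * Ci = - (1))%C) by (apply C_eq; simpl; ring).
    rewrite RtoC_div, RtoC_mult, RtoC_plus by lra; unfold a.
    set (e := Ecut 1 (RtoC n + 1) th); set (f := E1fun 1 (RtoC n + 1) (hth th)).
    transitivity ((Ci * Ci) * ((RtoC n + 1) * (RtoC n + 1 - 1) * (k * e))
      - Ci * (RtoC (cos th) / RtoC (sin th)) * (k * f))%C; [field; split; assumption|].
    rewrite J; field; exact Ns.
Qed.

(** The identity [Pser_Ecut_wronskian], split into real and imaginary parts. *)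
Lemma psi_wronskian th : 0 < th < PI / 2 ->
  sin th * (Re (psi_nu P Q th) * Im (psi1 th) - Re (psi1 th) * Im (psi_nu P Q th)) = 2 / PI.
Proof.
  intros T.
  assert (W := Pser_Ecut_wronskian (RtoC n) th Hn T); fold a in W.
  assert (E : Pser (RtoC n) th = RtoC (Re (psi_nu P Q th))) by apply Re_psi, T.
  assert (E1 : (Pser1 (RtoC n) th * jj 1)%C = RtoC (Re (psi1 th))).
  { destruct (Pser_leg (RtoC n) th T) as [A _].
    apply (cderiv_unique (Pser (RtoC n)) th); [exact A|].
    apply (cderiv_ext_loc (fun s => RtoC (Re (psi_nu P Q s)))).
    - apply (interval_loc 0 (PI / 2)); [exact T|]; intros s S; symmetry; apply Re_psi, S.
    - apply cderiv_RtoC, (proj1 (psi_leg th T)). }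
  assert (J : (Ci * Ci = - (1))%C) by (apply C_eq; simpl; ring).
  assert (K : (RtoC (sin th) * (RtoC (Re (psi_nu P Q th)) * psi1 th - RtoC (Re (psi1 th)) * psi_nu P Q th)
    = RtoC (2 / PI) * Ci)%C).
  { rewrite <- E, <- E1, (psi_Ecut (RtoC n)) by assumption; fold a; fold k; unfold psi1; rewrite jj_1.
    transitivity (Ci * k * (RtoC (sin th) * (Pser (RtoC n) th * E1fun 1 a (hth th)
      - Pser1 (RtoC n) th * Ecut 1 a th)))%C; [ring|].
    rewrite W; unfold k; transitivity (- RtoC (2 / PI) * (Ci * Ci) * Ci)%C; [ring|rewrite J; ring]. }
  revert K; clear E E1; generalize (psi_nu P Q th) (psi1 th); intros [p q] [p1 q1] K.
  apply (f_equal Im) in K; unfold Re, Im in *; simpl in *; ring_simplify in K; rewrite <- (Rmult_1_r (2 / PI)); ring_simplify; lra.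
Qed.

Lemma real_degree : (forall th, 0 < th < PI / 2 -> psi_nu P Q th <> RtoC 0) /\
  exists alpha, is_phase_function_ode (fun th => cos th / sin th) (fun _ => n * (n + 1)) 0 (PI / 2) alpha /\
    forall th, 0 < th < PI / 2 ->
      is_derive alpha th (Im (CDerive (psi_nu P Q) th / psi_nu P Q th)%C).
Proof.
  set (u := fun th => Re (psi_nu P Q th)); set (v := fun th => Im (psi_nu P Q th)).
  set (u1 := fun th => Re (psi1 th)); set (v1 := fun th => Im (psi1 th)).
  assert (c0 : 0 < 2 / PI) by (pose proof PI_RGT_0; apply Rdiv_lt_0_compat; lra).
  assert (Hu : forall x, 0 < x < PI / 2 -> is_derive u x (u1 x) /\
     is_derive u1 x (- (cos x / sin x) * u1 x + - (n * (n + 1)) * u x)).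
  { intros x X; destruct (psi_leg x X) as [[A _] [B _]]; split; [exact A|].
    eapply is_derive_eqR; [exact B|]; autorewrite with reim; unfold u, u1; ring. }
  assert (Hv : forall x, 0 < x < PI / 2 -> is_derive v x (v1 x) /\
     is_derive v1 x (- (cos x / sin x) * v1 x + - (n * (n + 1)) * v x)).
  { intros x X; destruct (psi_leg x X) as [[_ A] [_ B]]; split; [exact A|].
    eapply is_derive_eqR; [exact B|]; autorewrite with reim; unfold v, v1; ring. }
  assert (HW := psi_wronskian : forall x, 0 < x < PI / 2 -> sin x * (u x * v1 x - u1 x * v x) = 2 / PI).
  assert (N : forall th, 0 < th < PI / 2 -> psi_nu P Q th <> RtoC 0).
  { intros th T K; specialize (HW th T); unfold u, v in HW; rewrite K in HW; simpl in HW; lra. }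
  split; [exact N|].
  exists (phase (2 / PI) u v); split.
  - exact (phase_function n (2 / PI) u u1 v v1 c0 Hu Hv HW).
  - intros th T.
    eapply is_derive_eqR; [exact (phase_derive n (2 / PI) u u1 v v1 c0 Hu Hv HW th T)|].
    etransitivity; [exact (A_wronskian (2 / PI) u u1 v v1 c0 HW th T)|].
    rewrite (CDerive_eq _ _ _ (proj1 (psi_leg th T))).
    assert (D := D_pos (2 / PI) u u1 v v1 c0 HW th T).
    symmetry; apply Im_Cdiv; unfold u, v in D; nra.
Qed.

End RealDegree.

Theorem mainTheorem2 (nu : C) (P Q : C -> C)
    (Hnu : -1 < Re nu) (HP : is_legendreP nu P) (HQ : is_legendreQ nu Q) :
  (forall theta : R, 0 < theta < PI / 2 ->
     ex_CRInt_0_infty (sigma_integrand nu theta) /\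
     psi_nu P Q theta
     = (- RtoC (2 / PI) * Ci * Cexp (Ci * (nu + 1) * RtoC theta)
        * sigma_nu nu theta)%C)
  /\
  (forall theta : R, 0 < theta < PI / 2 -> psi_nu P Q theta <> RtoC 0 ->
     ex_CDerive (psi_nu P Q) theta /\
     ex_CDerive (sigma_nu nu) theta /\
     ex_CRInt_0_infty (tau_integrand nu theta) /\
     (CDerive (psi_nu P Q) theta / psi_nu P Q theta)%C
     = (Ci * (nu + 1) + CDerive (sigma_nu nu) theta / sigma_nu nu theta)%C /\
     (CDerive (psi_nu P Q) theta / psi_nu P Q theta)%C
     = (Ci * (nu + 1)
        - (nu + 1) * Cexp (2 * Ci * RtoC theta) * tau_nu nu theta
          * / sigma_nu nu theta)%C)
  /\
  (forall n : R, nu = RtoC n ->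
     (forall theta : R, 0 < theta < PI / 2 -> psi_nu P Q theta <> RtoC 0) /\
     exists alpha : R -> R,
       is_phase_function_ode
         (fun theta => cos theta / sin theta) (fun _ => n * (n + 1))
         0 (PI / 2) alpha /\
       forall theta : R, 0 < theta < PI / 2 ->
         is_derive alpha theta (Im (CDerive (psi_nu P Q) theta / psi_nu P Q theta)%C) /\
         Im (CDerive (psi_nu P Q) theta / psi_nu P Q theta)%C
         = Im (Ci * (nu + 1)
               - (nu + 1) * Cexp (2 * Ci * RtoC theta) * tau_nu nu theta
                 * / sigma_nu nu theta)%C).
Proof.
  split; [|split].
  - intros th T; split; [|apply psi_sigma; assumption].
    apply (CI_correct _ _ (sigma_CI nu th Hnu T)).
  - intros th T N.
    split; [exact (cderiv_ex _ _ _ (psi_cderiv nu P Q Hnu HP HQ th T))|].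
    split; [exact (cderiv_ex _ _ _ (sigma_cderiv nu th Hnu T))|].
    split; [apply (CI_correct _ _ (tau_CI nu th Hnu T))|].
    rewrite (psi_log_derivative nu P Q Hnu HP HQ th T N).
    split; [|reflexivity].
    rewrite (sigma_log_derivative nu Hnu th T); reflexivity.
  - intros n E; subst nu.
    destruct (real_degree n P Q Hnu HP HQ) as [N [alpha [F D]]].
    split; [exact N|]; exists alpha; split; [exact F|]; intros th T; split; [apply D, T|].
    rewrite (psi_log_derivative (RtoC n) P Q Hnu HP HQ th T (N th T)); reflexivity.
Qed.
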